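(* Let $T>0$. Let $\bar a,\bar c,\bar d:(0,T)\times\mathbb{R}\to\mathbb{R}$ be functions of $(t,J)$ such that $\bar a$ is uniformly elliptic (there is $\lambda>1$ with $\lambda^{-1}\le\bar a\le\lambda$) and Lipschitz continuous in $(t,J)$, and $\bar c,\bar d$ are bounded. Let $u=u(t,J,\mathcal{A},\mathcal{V},\mathcal{Q})$ satisfy $$\partial_tu-J\partial_{\mathcal{A}}u-\mathcal{A}\partial_{\mathcal{V}}u-\mathcal{V}\partial_{\mathcal{Q}}u+\partial_J\left(\bar a(t,J)\partial_Ju\right)=\bar c(t,J)u+\bar d(t,J)\partial_Ju$$ in $(0,T)\times\mathbb{R}^4$ in the sense of distributions, where $(J,\mathcal{A},\mathcal{V},\mathcal{Q})\in\mathbb{R}^4$. Assume that $$u(0,\cdot)=0$$ and $$u,\quad\partial_Ju,\quad\left(\partial_t-J\partial_{\mathcal{A}}-\mathcal{A}\partial_{\mathcal{V}}-\mathcal{V}\partial_{\mathcal{Q}}\right)u\ \in L^2((0,T)\times\mathbb{R}^4).$$ Then $u\equiv0$ (a.e. in $(0,T)\times\mathbb{R}^4$).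
   Context: All derivatives of $u$ are distributional. The condition $u(0,\cdot)=0$ is understood as a zero $L^2(\mathbb{R}^4)$-trace at $t=0$: the representative of $u$ that is continuous in time with values in $L^2(\mathbb{R}^4)$ (which exists under the stated regularity) vanishes at $t=0$. *)

(* Defs.v *)
From HB Require Import structures.
From mathcomp Require Import all_boot all_order all_algebra.
From mathcomp Require Import all_classical all_reals all_analysis.

Set Implicit Arguments.
Unset Strict Implicit.
Unset Printing Implicit Defensive.

Import Order.TTheory GRing.Theory Num.Theory.
Import numFieldNormedType.Exports.

Local Open Scope classical_set_scope.
Local Open Scope ring_scope.

(* A point of R^4 is y = (J, A, V, Q); a point of space-time is z = (t, y). *)
Notation phase R := (R * R * R * R)%type.
Notation spacetime R := (R * phase R)%type.

Section Coordinates.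
Context {R : realType}.
Implicit Type z : spacetime R.

Definition coordJ z : R := z.2.1.1.1.
Definition coordA z : R := z.2.1.1.2.
Definition coordV z : R := z.2.1.2.
Definition coordQ z : R := z.2.2.

Definition tJ z : R * R := (z.1, coordJ z).

Definition dir_t : spacetime R := (1, (0, 0, 0, 0)).
Definition dir_J : spacetime R := (0, (1, 0, 0, 0)).
Definition dir_A : spacetime R := (0, (0, 1, 0, 0)).
Definition dir_V : spacetime R := (0, (0, 0, 1, 0)).
Definition dir_Q : spacetime R := (0, (0, 0, 0, 1)).

(* (0, T) x R and (0, T) x R^4 *)
Definition strip (T : R) : set (R * R) := `]0, T[ `*` setT.
Definition cylinder (T : R) : set (spacetime R) := `]0, T[ `*` setT.

End Coordinates.

(* The library proves this, but its instance on [m1 \x m2] is shadowed by the one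
   for products of subprobabilities. *)
Lemma sigma_finite_product d1 d2 (T1 : measurableType d1)
    (T2 : measurableType d2) (R : realType)
    (m1 : {measure set T1 -> \bar R}) (m2 : {sigma_finite_measure set T2 -> \bar R}) :
  sigma_finite setT m1 -> sigma_finite setT (m1 \x m2)%E.
Proof.
move=> /sigma_finiteP[F [TF ndF Foo]].
have /sigma_finiteP[G [TG ndG Goo]] := sigma_finiteT m2.
exists (fun n => F n `*` G n).
  rewrite -setXTT TF TG predeqE => -[x y]; split.
    move=> [/= [n _ Fnx] [k _ Gky]]; exists (maxn n k) => //; split.
    - by move: x Fnx; exact/subsetPset/ndF/leq_maxl.
    - by move: y Gky; exact/subsetPset/ndG/leq_maxr.
  by move=> [n _ []/= ? ?]; split; exists n.
move=> k; have [? ?] := Foo k; have [? ?] := Goo k.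
split; first exact: measurableX.
by rewrite product_measure1E// lte_mul_pinfty// ge0_fin_numE.
Qed.

Section LebesgueMeasures.
Context (R : realType).

Let mu := @lebesgue_measure R.

Definition phase_measure := (mu \x mu \x mu \x mu)%E.
HB.instance Definition _ := Measure.on phase_measure.

Let phase_measure_sigma_finite : sigma_finite setT phase_measure.
Proof. by do 3 apply: sigma_finite_product; exact: sigma_finiteT. Qed.

HB.instance Definition _ := Measure_isSigmaFinite.Build _ _ _ phase_measure
  phase_measure_sigma_finite.

Definition spacetime_measure := (mu \x phase_measure)%E.
HB.instance Definition _ := Measure.on spacetime_measure.

Let spacetime_measure_sigma_finite : sigma_finite setT spacetime_measure.
Proof. by apply: sigma_finite_product; exact: sigma_finiteT. Qed.

HB.instance Definition _ := Measure_isSigmaFinite.Build _ _ _ spacetime_measure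
  spacetime_measure_sigma_finite.

End LebesgueMeasures.

Arguments phase_measure : clear implicits.
Arguments spacetime_measure : clear implicits.

Section FunctionSpaces.
Context {R : realType}.

Definition uniformly_elliptic (D : set (R * R)) (a : R * R -> R) :=
  exists2 lambda : R, 1 < lambda &
    forall p, D p -> lambda^-1 <= a p <= lambda.

(* [Lfun] is about functions on the whole space: L^2(Omega) is membership of
   the extension by zero. *)
Definition square_integrable (Omega : set (spacetime R))
    (f : spacetime R -> R) : Prop :=
  f \_ Omega \in Lfun (spacetime_measure R) 2%:E.

(* C^k: all iterated directional derivatives of order at most k exist
   everywhere and are continuous. *)
Fixpoint class_C (V : normedModType R) (k : nat) (f : V -> R) : Prop :=
  continuous f /\
  if k is k'.+1 then
    forall v : V, (forall x, derivable f x v) /\ class_C k' ('D_v f)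
  else True.

Definition smooth (V : normedModType R) (f : V -> R) : Prop :=
  forall k, class_C k f.

(* C_c^oo(Omega), whose elements are extended by zero outside Omega *)
Definition test_function (Omega : set (spacetime R))
    (phi : spacetime R -> R) : Prop :=
  let supp := closure [set z | phi z != 0] in
  [/\ smooth phi, compact supp & supp `<=` Omega].

End FunctionSpaces.

Section Distributions.
Context {R : realType}.

(* Only the values on test functions of the relevant open set matter, see
   [distr_eq]. *)
Definition distribution := (spacetime R -> R) -> R.
Implicit Types L : distribution.

Definition distr_eq (Omega : set (spacetime R)) L1 L2 : Prop :=
  forall phi, test_function Omega phi -> L1 phi = L2 phi.

Definition distr_of (Omega : set (spacetime R)) (f : spacetime R -> R)
    : distribution :=
  fun phi => \int[spacetime_measure R]_(z in Omega) (f z * phi z).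

Definition distr_derive (v : spacetime R) L : distribution :=
  fun phi => - L ('D_v phi).

(* product with a smooth function *)
Definition distr_mul (h : spacetime R -> R) L : distribution :=
  fun phi => L (h \* phi).

Definition distr_add L1 L2 : distribution := fun phi => L1 phi + L2 phi.
Definition distr_sub L1 L2 : distribution := fun phi => L1 phi - L2 phi.

(* (d_t - J d_A - A d_V - V d_Q) L *)
Definition transport L : distribution :=
  distr_sub (distr_sub (distr_sub
    (distr_derive dir_t L)
    (distr_mul coordJ (distr_derive dir_A L)))
    (distr_mul coordA (distr_derive dir_V L)))
    (distr_mul coordV (distr_derive dir_Q L)).

End Distributions.

(* f is the L^2(R^4)-trace at t = 0 of u: the representative U of u that is
   continuous on [0, T) with values in L^2(R^4) has U 0 = f. *)
Definition is_initial_trace {R : realType} (T : R) (u : spacetime R -> R)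
    (f : phase R -> R) : Prop :=
  exists U : R -> phase R -> R,
  [/\ forall t : R, `[0, T[%classic t -> U t \in Lfun (phase_measure R) 2%:E,
      forall s : R, `[0, T[%classic s ->
        'N[phase_measure R]_2%:E [EFin \o (U t \- U s)%R]%E
          @[t --> within `[0, T[ (nbhs s)] --> 0%E,
      {ae lebesgue_measure, forall t : R, `]0, T[%classic t ->
        U t = (fun y => u (t, y)) %[ae phase_measure R]} &
      U 0 = f %[ae phase_measure R]].

(* Main.v *)
From HB Require Import structures.
From mathcomp Require Import all_boot all_order all_algebra.
From mathcomp Require Import all_classical all_reals all_analysis.
From mathcomp Require Import measurable_realfun zify ring lra.
Require Import Defs.

Set Implicit Arguments.
Unset Strict Implicit.
Unset Printing Implicit Defensive.

Import Order.TTheory GRing.Theory Num.Theory.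
Import numFieldNormedType.Exports.
Local Open Scope classical_set_scope.
Local Open Scope ring_scope.

(** Write Y = d_t - J d_A - A d_V - V d_Q. The equation Yu + d_J(a d_J u) = cu + d d_J u, with data
    at t = 0, is parabolic in the ill-posed direction of time. Uniqueness is therefore sought
    through a Carleman estimate, with a weight exp(k (t - t0 - 2 del)^2) that decreases on a short
    time interval. The obstacle is that Y and d_J do not commute: the commutator is d_A up to sign,
    and d_A u is not controlled by the assumptions.

    The cure is that the coefficients depend on (t, J) only. The fields X_0 = d_A - t d_V + t^2/2
    d_Q, X_1 = d_V - t d_Q and X_2 = d_Q commute with Y, with d_J and with the coefficients, and
    they span d_A, d_V, d_Q over polynomials in t. Averaging u along their flows, at scales e_0,
    e_1, e_2, gives again a solution ([solution_cv]), which now has X_i-derivatives in L^2. The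
    averaging kernel is the Fejer kernel, whose frequencies lie in a bounded set; hence its n-th
    derivative costs only a factor 2^n ([kap_bound], [cv3_nrm]).

    For the averaged function the Carleman estimate ([carleman], resting on [commutator_ge]) reads:
    k times the weighted square norm is at most a cutoff error plus the weighted square norms of the
    X_i-derivatives. Those derivatives are averages of the same type with more derivatives on the
    kernel, so the estimate can be iterated. Geometric growth in the number of derivatives is beaten
    once k is large compared with the sum of the e_i^-2 ([iter_bound]), and only the cutoff error
    survives. Letting k tend to infinity, with the e_i fixed, the averaged solution vanishes on t <
    t0 + del/4 ([cv3_vanish]). The length del does not depend on the e_i, so letting these tend to 0
    ([cv_approx]) gives the same for u itself ([solution_before_vanish]); steps of length del/4 then
    reach every time before T ([solution_eq0]).

    A derivative along a field is throughout a strong L^2 limit of difference quotients along its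
    measure-preserving flow ([sderiv]). Commutators are computed on the flows at finite time, so no
    second derivative of u is ever needed. Distributional derivatives become strong ones by
    [weak_strong], applied in [sderivJ_weak] and [sderivY_weak]. The latter is where the zero trace
    enters: it makes the extension of u by zero satisfy the equation across t = 0 ([trace_lim]). *)

(** * Square-integrable functions, their inner product and norm *)

Section SquareIntegrable.
Context {d : measure_display} {Z : measurableType d} {R : realType}.
Variable mu : {measure set Z -> \bar R}.
Implicit Types f g h : Z -> R.

(** L^2 is handled through everywhere defined functions rather than classes; equality in L^2 is
    expressed by [l2nrm] of a difference being 0. *)
Definition sqint f :=
  measurable_fun setT f /\ mu.-integrable setT (fun z => (f z ^+ 2)%:E).
Definition l2ip f g : R := \int[mu]_z (f z * g z).
Definition l2nrm f : R := Num.sqrt (l2ip f f).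
Notation ip := l2ip.
Notation nrm := l2nrm.

Lemma sqint_meas f : sqint f -> measurable_fun setT f.
Proof. by case. Qed.

Lemma sqint_mul f g : sqint f -> sqint g ->
  mu.-integrable setT (fun z => (f z * g z)%:E).
Proof.
move=> [mf If] [mg Ig].
apply: (@le_integrable _ _ _ mu setT measurableT _
  (fun z => ((f z ^+ 2)%:E + (g z ^+ 2)%:E)%E)).
- by apply/measurable_EFinP; exact: measurable_funM.
- move=> x _; rewrite abse_EFin -EFinD abse_EFin lee_fin.
  rewrite [leRHS]ger0_norm ?addr_ge0 ?sqr_ge0// normrM.
  rewrite -[f x ^+ 2]real_normK ?num_real// -[g x ^+ 2]real_normK ?num_real//.
  have := sqr_ge0 (`|f x| - `|g x|).
  have := normr_ge0 (f x); have := normr_ge0 (g x); nra.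
- exact: integrableD.
Qed.

Lemma sqint_le f g : measurable_fun setT f -> sqint g ->
  (forall z, `|f z| <= `|g z|) -> sqint f.
Proof.
move=> mf [mg Ig] fg; split=> //.
apply: le_integrable Ig => //.
  by apply/measurable_EFinP; exact: measurable_funX.
move=> x _; rewrite !abse_EFin lee_fin !normrX.
by rewrite lerXn2r// nnegrE.
Qed.

Lemma sqintZ k f : sqint f -> sqint (fun z => k * f z).
Proof.
move=> [mf If]; split; first exact: measurable_funM.
have := integrableZl measurableT (k ^+ 2) If.
by apply: eq_integrable => // x _; rewrite -EFinM exprMn.
Qed.

Lemma sqintD f g : sqint f -> sqint g -> sqint (fun z => f z + g z).
Proof.
move=> Lf Lg; split.
  by apply: measurable_funD; [case: Lf|case: Lg].
have := integrableD measurableT (integrableD measurableT Lf.2 Lg.2)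
  (integrableZl measurableT 2 (sqint_mul Lf Lg)).
by apply: eq_integrable => // x _; rewrite -EFinM -!EFinD; congr (_%:E); ring.
Qed.

Lemma sqintN f : sqint f -> sqint (fun z => - f z).
Proof.
move=> /(sqintZ (-1)).
by rewrite (_ : (fun z => -1 * f z) = (fun z => - f z))//; apply/funext=> z; rewrite mulN1r.
Qed.

Lemma sqintB f g : sqint f -> sqint g -> sqint (fun z => f z - g z).
Proof. by move=> Lf Lg; apply: sqintD => //; exact: sqintN. Qed.

Lemma sqint0 : sqint (fun=> 0).
Proof.
split=> //; apply: (eq_integrable measurableT (cst 0%E)) => //.
  by move=> x _; rewrite /= expr0n.
exact: integrable0.
Qed.

Lemma sqint_bounded (m : Z -> R) (M : R) f : measurable_fun setT m ->
  (forall z, `|m z| <= M) -> sqint f -> sqint (fun z => m z * f z).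
Proof.
move=> mm mM Lf; apply: (sqint_le _ (sqintZ M Lf)).
  by apply: measurable_funM => //; case: Lf.
move=> z; rewrite !normrM ler_wpM2r//.
by rewrite (le_trans (mM z))// ler_norm.
Qed.

Lemma sqint_abs f : sqint f -> sqint (fun z => `|f z|).
Proof.
move=> Lf; apply: (sqint_le _ Lf); last by move=> z; rewrite normr_id.
by apply: measurableT_comp => //; case: Lf.
Qed.

Lemma ipC f g : ip f g = ip g f.
Proof. by rewrite /l2ip; under eq_Rintegral do rewrite mulrC. Qed.

Lemma ipDl f g h : sqint f -> sqint g -> sqint h ->
  ip (fun z => f z + g z) h = ip f h + ip g h.
Proof.
move=> Lf Lg Lh; rewrite /l2ip -RintegralD//; try exact: sqint_mul.
by under eq_Rintegral do rewrite mulrDl.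
Qed.

Lemma ipZl k f h : sqint f -> sqint h -> ip (fun z => k * f z) h = k * ip f h.
Proof.
move=> Lf Lh; rewrite /l2ip -RintegralZl//; last exact: sqint_mul.
by under eq_Rintegral do rewrite -mulrA.
Qed.

Lemma ipBl f g h : sqint f -> sqint g -> sqint h ->
  ip (fun z => f z - g z) h = ip f h - ip g h.
Proof.
move=> Lf Lg Lh; rewrite /l2ip -RintegralB//; try exact: sqint_mul.
by under eq_Rintegral do rewrite mulrBl.
Qed.

Lemma ipNl f h : sqint f -> sqint h -> ip (fun z => - f z) h = - ip f h.
Proof.
move=> Lf Lh; rewrite -mulN1r -ipZl//.
by congr l2ip; apply/funext => z; rewrite mulN1r.
Qed.

Lemma ipDr f g h : sqint f -> sqint g -> sqint h ->
  ip h (fun z => f z + g z) = ip h f + ip h g.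
Proof. by move=> *; rewrite ipC ipDl// !(ipC h). Qed.

Lemma ipZr k f h : sqint f -> sqint h -> ip h (fun z => k * f z) = k * ip h f.
Proof. by move=> *; rewrite ipC ipZl// (ipC h). Qed.

Lemma ipBr f g h : sqint f -> sqint g -> sqint h ->
  ip h (fun z => f z - g z) = ip h f - ip h g.
Proof. by move=> *; rewrite ipC ipBl// !(ipC h). Qed.

Lemma ipNr f h : sqint f -> sqint h -> ip h (fun z => - f z) = - ip h f.
Proof. by move=> *; rewrite ipC ipNl// (ipC h). Qed.

Lemma ip0l h : ip (fun=> 0) h = 0.
Proof.
rewrite /l2ip; under eq_Rintegral do rewrite mul0r.
by rewrite Rintegral_cst// mul0r.
Qed.

Lemma ip_mulA (m f g : Z -> R) : ip (fun z => m z * f z) g = ip f (fun z => m z * g z).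
Proof. by rewrite /l2ip; apply: eq_Rintegral => z _; rewrite mulrCA mulrA. Qed.

Lemma ip_ge0 f : 0 <= ip f f.
Proof. by apply: Rintegral_ge0 => z _; rewrite -expr2 sqr_ge0. Qed.

Lemma ip_le f g f' g' : sqint f -> sqint g -> sqint f' -> sqint g' ->
  (forall z, f z * g z <= f' z * g' z) -> ip f g <= ip f' g'.
Proof. by move=> *; apply: le_Rintegral => //; exact: sqint_mul. Qed.

Lemma nrm_ge0 f : 0 <= nrm f.
Proof. exact: sqrtr_ge0. Qed.

Lemma nrm_sqr f : nrm f ^+ 2 = ip f f.
Proof. by rewrite /l2nrm sqr_sqrtr// ip_ge0. Qed.

Lemma nrm_le f g : sqint f -> sqint g -> (forall z, `|f z| <= `|g z|) ->
  nrm f <= nrm g.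
Proof.
move=> Lf Lg fg; rewrite /l2nrm ler_sqrt ?ip_ge0//; apply: ip_le => // z.
rewrite -!expr2 -[f z ^+ 2]real_normK ?num_real// -[g z ^+ 2]real_normK ?num_real//.
by rewrite lerXn2r// nnegrE.
Qed.

(** The quadratic polynomial t -> ||f - t g||^2 is nonnegative; evaluate it at its minimiser, or,
    when ||g|| = 0 makes it affine, far enough to the side where it decreases. *)
Lemma CauchySchwarz f g : sqint f -> sqint g -> `|ip f g| <= nrm f * nrm g.
Proof.
move=> Lf Lg.
have P (t : R) : 0 <= ip f f - 2 * t * ip f g + t ^+ 2 * ip g g.
  have := ip_ge0 (fun z => f z - t * g z).
  have Ltg := sqintZ t Lg.
  rewrite ipBl ?ipBr ?ipZl ?ipZr//; last exact: sqintB.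
  rewrite (ipC g f) => h; apply: (le_trans h); rewrite le_eqVlt; apply/orP; left; apply/eqP; ring.
rewrite -sqrtrM ?ip_ge0// -sqrtr_sqr ler_sqrt ?mulr_ge0 ?ip_ge0//.
have [g0|g0] := eqVneq (ip g g) 0.
  suff -> : ip f g = 0 by rewrite g0 mulr0 expr0n.
  apply/eqP/negPn/negP => fg0.
  (* At this value of t the affine polynomial equals -1. *)
  have := P ((ip f f + 1) / (2 * ip f g)); rewrite g0 mulr0 addr0.
  rewrite (_ : 2 * _ * _ = ip f f + 1); first by lra.
  by field.
have gp : 0 < ip g g by rewrite lt_neqAle eq_sym g0 ip_ge0.
have := P (ip f g / ip g g).
rewrite (_ : _ - _ + _ = ip f f - ip f g ^+ 2 / ip g g); last by field.
by rewrite subr_ge0 ler_pdivrMr.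
Qed.

Lemma nrmZ k f : sqint f -> nrm (fun z => k * f z) = `|k| * nrm f.
Proof.
move=> Lf; rewrite /l2nrm ipZl ?ipZr//; last exact: sqintZ.
by rewrite mulrA -expr2 sqrtrM ?sqr_ge0// sqrtr_sqr.
Qed.

Lemma nrmN f : sqint f -> nrm (fun z => - f z) = nrm f.
Proof. by move=> Lf; rewrite /l2nrm ipNl ?ipNr ?opprK//; exact: sqintN. Qed.

Lemma nrmD f g : sqint f -> sqint g -> nrm (fun z => f z + g z) <= nrm f + nrm g.
Proof.
move=> Lf Lg; rewrite -(@ler_pXn2r _ 2)// ?nnegrE ?addr_ge0 ?nrm_ge0//.
rewrite sqrrD !nrm_sqr ipDl ?ipDr//; last exact: sqintD.
rewrite (ipC g f).
have := CauchySchwarz Lf Lg; rewrite ler_norml => /andP[_]; lra.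
Qed.

Lemma nrmB f g : sqint f -> sqint g -> nrm (fun z => f z - g z) <= nrm f + nrm g.
Proof. by move=> Lf Lg; rewrite -(nrmN Lg); apply: nrmD => //; exact: sqintN. Qed.

Lemma nrmBC f g : nrm (fun z => f z - g z) = nrm (fun z => g z - f z).
Proof.
congr Num.sqrt; rewrite /l2ip; apply: eq_Rintegral => z _; ring.
Qed.

Lemma nrmB_triangle g f h : sqint f -> sqint g -> sqint h ->
  nrm (fun z => f z - h z) <= nrm (fun z => f z - g z) + nrm (fun z => g z - h z).
Proof.
move=> Lf Lg Lh; apply: le_trans (nrmD (sqintB Lf Lg) (sqintB Lg Lh)).
rewrite le_eqVlt; apply/orP; left; apply/eqP; congr nrm; apply/funext => z; ring.
Qed.

Lemma nrm_abs f : nrm (fun z => `|f z|) = nrm f.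
Proof.
congr Num.sqrt; apply: eq_Rintegral => z _.
by rewrite -!expr2 real_normK ?num_real.
Qed.

Lemma ip_ae f f' g : measurable_fun setT f -> measurable_fun setT f' ->
  measurable_fun setT g -> f = f' %[ae mu] -> ip f g = ip f' g.
Proof.
move=> mf mf' mg ff'; rewrite /l2ip /Rintegral; congr fine.
apply: ae_eq_integral => //.
- by apply/measurable_EFinP; exact: measurable_funM.
- by apply/measurable_EFinP; exact: measurable_funM.
- by apply: filterS ff' => z /= /[swap] _ ->.
Qed.

Lemma nrm_ae f f' : measurable_fun setT f -> measurable_fun setT f' ->
  f = f' %[ae mu] -> nrm f = nrm f'.
Proof.
move=> mf mf' ff'; congr Num.sqrt.
by rewrite (ip_ae mf mf' mf ff') ipC (ip_ae mf mf' mf' ff').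
Qed.

Lemma nrm0_ae f : sqint f -> nrm f = 0 -> f = (fun=> 0) %[ae mu].
Proof.
move=> [mf If] f0.
have h : (\int[mu]_z `|(f z ^+ 2)%:E| = 0)%E.
  have := nrm_sqr f; rewrite f0 expr0n/= /l2ip /Rintegral.
  have finf : (\int[mu]_z (f z * f z)%:E)%E \is a fin_num.
    by apply: integrable_fin_num => //; exact: sqint_mul.
  move=> /esym/eqP; rewrite fine_eq0// => /eqP <-.
  by apply: eq_integral => x _; rewrite ger0_norm ?sqr_ge0// expr2.
have mf2 : measurable_fun setT (fun z => (f z ^+ 2)%:E).
  by apply/measurable_EFinP; exact: measurable_funX.
have := (ae_eq_integral_abs mu measurableT mf2).1 h.
apply: filterS => z /= /(_ I) /eqP.
by rewrite eqe sqrf_eq0 => /eqP.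
Qed.

Lemma ae_nrm0 f : measurable_fun setT f -> f = (fun=> 0) %[ae mu] -> nrm f = 0.
Proof. by move=> mf /(nrm_ae mf) ->//; rewrite /l2nrm ip0l sqrtr0. Qed.

Lemma ip_eq0_nrm f : sqint f -> (forall g, sqint g -> ip f g = 0) -> nrm f = 0.
Proof. by move=> Lf /(_ f Lf); rewrite /l2nrm => ->; rewrite sqrtr0. Qed.

Lemma nrm_le_ae f g : sqint f -> sqint g -> {ae mu, forall z, `|f z| <= `|g z|} ->
  nrm f <= nrm g.
Proof.
move=> Lf Lg fg; rewrite -(nrm_abs f) -(nrm_abs g) /l2nrm ler_sqrt ?ip_ge0//.
have L1 := sqint_mul (sqint_abs Lf) (sqint_abs Lf).
have L2 := sqint_mul (sqint_abs Lg) (sqint_abs Lg).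
rewrite /l2ip /Rintegral fine_le//; try exact: integrable_fin_num.
refine (ae_ge0_le_integral measurableT _ _ _ _ _).
- by move=> z _; rewrite lee_fin mulr_ge0.
- exact: measurable_int L1.
- by move=> z _; rewrite lee_fin mulr_ge0.
- exact: measurable_int L2.
- by apply: filterS fg => z h _; rewrite lee_fin; exact: ler_pM.
Qed.

End SquareIntegrable.

(** * Dominated convergence for real integrals and in L^2 *)

Section DominatedConvergence.
Context {d : measure_display} {Z : measurableType d} {R : realType}.
Variable mu : {measure set Z -> \bar R}.

Lemma Rdominated_cvg (f_ : nat -> Z -> R) (f h : Z -> R) :
  (forall n, measurable_fun setT (f_ n)) ->
  mu.-integrable setT (EFin \o h) ->
  (forall n z, `|f_ n z| <= h z) ->
  (forall z, f_ n z @[n --> \oo] --> f z) ->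
  (\int[mu]_z f_ n z) @[n --> \oo] --> \int[mu]_z f z.
Proof.
move=> mf_ Ih fh cf.
have mf : measurable_fun setT f.
  by apply: (measurable_fun_cvg (h := f_)) => // z _; exact: cf.
have [If _ /=] := @dominated_convergence _ _ _ mu setT measurableT
  (fun n => EFin \o f_ n) (EFin \o f) (EFin \o h)
  (fun n => (measurable_EFinP _ _).2 (mf_ n)) ((measurable_EFinP _ _).2 mf)
  ltac:(by apply: aeW => z _; apply: cvg_EFin; [exact: nearW|exact: cf]) Ih
  ltac:(by apply: aeW => z n _; rewrite /= lee_fin).
by move=> c; apply: fine_cvg; rewrite fineK//; exact: integrable_fin_num.
Qed.

Lemma nrm_dominated_cvg (f_ : nat -> Z -> R) (f h : Z -> R) :
  (forall n, measurable_fun setT (f_ n)) ->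
  sqint mu h ->
  (forall n z, `|f_ n z| <= h z) ->
  (forall z, f_ n z @[n --> \oo] --> f z) ->
  sqint mu f /\ l2nrm mu (fun z => f_ n z - f z) @[n --> \oo] --> (0 : R).
Proof.
move=> mf_ Lh fh cf.
have mf : measurable_fun setT f.
  by apply: (measurable_fun_cvg (h := f_)) => // z _; exact: cf.
have fh' z : `|f z| <= h z.
  have /cvg_norm cn := cf z.
  apply: (@closed_cvg _ _ \oo _ (fun n => `|f_ n z|) [set x : R | x <= h z]) cn.
    exact: closed_le.
  by apply: nearW => n /=.
split.
  by apply: (sqint_le mf Lh) => z; exact: le_trans (fh' z) (ler_norm _).
rewrite -[X in _ --> X]sqrtr0; apply: continuous_cvg; first exact: sqrt_continuous.
rewrite (_ : 0 = \int[mu]_z (0 * 0)); last first.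
  by under eq_Rintegral do rewrite mul0r; rewrite Rintegral_cst// mul0r.
apply: (Rdominated_cvg (h := fun z => (2 * h z) * (2 * h z))).
- by move=> n; apply: measurable_funM; exact: measurable_funB.
- by apply: sqint_mul; exact: sqintZ.
- move=> n z; rewrite normrM; have : `|f_ n z - f z| <= 2 * h z.
    apply: (le_trans (ler_normB _ _)); have := fh n z; have := fh' z; lra.
  by move=> ?; exact: ler_pM.
- by move=> z; apply: cvgM; rewrite -(subrr (f z)); apply: cvgB => //; exact: cvg_cst.
Qed.

Lemma nrm_dominated_cvg0 (f_ : nat -> Z -> R) (f h : Z -> R) :
  (forall n, measurable_fun setT (f_ n)) ->
  sqint mu h ->
  (forall n z, `|f_ n z| <= h z) ->
  (forall z, f_ n z @[n --> \oo] --> f z) ->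
  l2nrm mu (fun z => f_ n z - f z) @[n --> \oo] --> (0 : R).
Proof. by move=> a b c e; case: (nrm_dominated_cvg a b c e). Qed.

End DominatedConvergence.

(** * Measure-preserving maps act isometrically on L^2 *)

Section MeasurePreserving.
Context {d : measure_display} {Z : measurableType d} {R : realType}.
Variable mu : {measure set Z -> \bar R}.

Definition mpres (F : Z -> Z) :=
  measurable_fun setT F /\ forall A, measurable A -> mu (F @^-1` A) = mu A.

Lemma mpres_ge0_integral F (f : Z -> \bar R) : mpres F ->
  measurable_fun setT f -> (forall z, 0 <= f z)%E ->
  (\int[mu]_z f (F z) = \int[mu]_z f z)%E.
Proof.
move=> [mF pF] mf f0.
transitivity (\int[pushforward mu F]_z f z)%E.
  by rewrite (ge0_integral_pushforward mF)// => z _.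
by apply: eq_measure_integral => A mA _; exact: pF.
Qed.

Lemma mpres_integral F (f : Z -> \bar R) : mpres F ->
  measurable_fun setT f -> (\int[mu]_z f (F z) = \int[mu]_z f z)%E.
Proof.
move=> pF mf; rewrite integralE [RHS]integralE; congr (_ - _)%E.
  rewrite -(mpres_ge0_integral pF (measurable_funepos mf))//.
  by apply: eq_integral => z _; rewrite !funeposE.
rewrite -(mpres_ge0_integral pF (measurable_funeneg mf))//.
by apply: eq_integral => z _; rewrite !funenegE.
Qed.

Lemma mpres_sqint F f : mpres F -> sqint mu f -> sqint mu (f \o F).
Proof.
move=> [mF pF] [mf If]; split; first exact: measurableT_comp.
apply/integrableP; split.
  by apply/measurable_EFinP; apply: measurable_funX; exact: measurableT_comp.
have := @mpres_ge0_integral F (fun z => `|(f z ^+ 2)%:E|%E) (conj mF pF).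
move=> -> //; first by case/integrableP: If.
by apply/measurable_EFinP; apply: measurableT_comp => //; exact: measurable_funX.
Qed.

Lemma mpres_ip F f g : mpres F -> sqint mu f -> sqint mu g ->
  l2ip mu (f \o F) (g \o F) = l2ip mu f g.
Proof.
move=> pF [mf _] [mg _]; congr fine.
rewrite -[RHS](mpres_integral pF)//.
by apply/measurable_EFinP; exact: measurable_funM.
Qed.

Lemma mpres_nrm F f : mpres F -> sqint mu f -> l2nrm mu (f \o F) = l2nrm mu f.
Proof. by move=> pF Lf; congr Num.sqrt; exact: mpres_ip. Qed.

End MeasurePreserving.


(** * An induction principle over L^2 *)

Section SqintInduction.
Import HBNNSimple.
Context {d : measure_display} {Z : measurableType d} {R : realType}.
Variable mu : {measure set Z -> \bar R}.

Lemma sqint_indic (A : set Z) : measurable A -> (mu A < +oo)%E ->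
  sqint mu (\1_A : Z -> R).
Proof.
move=> mA Aoo; split; first exact: measurable_indic.
apply/integrableP; split.
  by apply/measurable_EFinP; apply: measurable_funX; exact: measurable_indic.
rewrite (_ : (fun x => _) = (fun x => (\1_A x)%:E)) ?integral_indic ?setIT//.
by apply/funext => z; rewrite /= ger0_norm ?sqr_ge0// indicE; case: (_ \in _); rewrite ?expr1n ?expr0n.
Qed.

(* An induction principle: a closed subspace of [L^2] containing the indicators
   of a generating pi-system is everything. *)
Lemma sqint_ind (G : set (set Z)) (B : nat -> set Z) (P : (Z -> R) -> Prop) :
  measurable = <<s G >> -> setI_closed G ->
  (forall n, G (B n)) -> (forall n, (mu (B n) < +oo)%E) ->
  {homo B : m n / (m <= n)%N >-> m `<=` n} -> \bigcup_n B n = setT ->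
  (forall A, G A -> (mu A < +oo)%E -> P \1_A) ->
  (forall k f g, sqint mu f -> sqint mu g -> P f -> P g ->
     P (fun z => k * f z + g z)) ->
  (forall f (f_ : nat -> Z -> R), sqint mu f -> (forall n, sqint mu (f_ n)) ->
     (forall n, P (f_ n)) ->
     l2nrm mu (fun z => f_ n z - f z) @[n --> \oo] --> (0 : R) -> P f) ->
  forall f, sqint mu f -> P f.
Proof.
move=> GE GI GB Boo ndB UB PG Plin Plim.
have mB n : measurable (B n) by rewrite GE; apply: sub_sigma_algebra.
have finI n A : measurable A -> (mu (A `&` B n) < +oo)%E.
  move=> mA; apply: le_lt_trans (Boo n); apply: le_measure; rewrite ?inE//.
  exact: measurableI.
have LI n A : measurable A -> sqint mu (\1_(A `&` B n) : Z -> R).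
  by move=> mA; apply: sqint_indic; [exact: measurableI|exact: finI].
have P0 : P (fun=> 0).
  have L := sqint_indic (mB 0%N) (Boo 0%N).
  have P1 := PG _ (GB 0%N) (Boo 0%N).
  have := Plin (-1) _ _ L L P1 P1.
  by rewrite (_ : (fun z => _) = (fun=> 0))//; apply/funext => z; rewrite mulN1r addNr.
have PI n A : measurable A -> P \1_(A `&` B n).
  move=> mA.
  (* Inside the finite-measure set [B n] a complement becomes a difference of indicators in L^2, and
     a disjoint union becomes a dominated limit of finite sums. *)
  apply: (@dynkin_induction _ _ G (fun A => P \1_(A `&` B n)) GE GI) => //.
  - by rewrite setTI; exact: PG.
  - move=> C GC; apply: PG; first exact: GI.
    by apply: finI; rewrite GE; exact: sub_sigma_algebra.
  - move=> S mS PS.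
    have := Plin (-1) _ _ (LI n _ mS) (sqint_indic (mB n) (Boo n)) PS (PG _ (GB n) (Boo n)).
    congr P; apply/funext => z; rewrite !indicE !in_setI in_setC.
    by case: (z \in S); case: (z \in B n); rewrite /= ?mulr1 ?mulr0 ?addr0 ?add0r ?addNr.
  - move=> F mF tF PF.
    pose H m := \bigcup_(k < m) F k.
    have mH m : measurable (H m) by exact: bigcup_measurable.
    have PH m : P \1_(H m `&` B n).
      elim: m => [|m IH].
        by rewrite /H bigcup_mkord big_ord0 set0I indic0; exact: P0.
      have := Plin 1 _ _ (LI n _ (mF m)) (LI n _ (mH m)) (PF m) IH.
      congr P; apply/funext => z; rewrite mul1r /H !bigcup_mkord big_ord_recr/=.
      rewrite -bigcup_mkord -/(H m) !indicE !in_setI in_setU.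
      case: (boolP (z \in F m)) => zF; case: (boolP (z \in H m)) => zH; case: (z \in B n);
        rewrite /= ?addr0 ?add0r//.
      exfalso; move: zF zH; rewrite !inE => zF [k /= km zk].
      have := tF m k I I (ex_intro _ z (conj zF zk)) => mk.
      by rewrite mk ltnn in km.
    have mU : measurable (\bigcup_k F k) by exact: bigcup_measurable.
    apply: (Plim _ (fun m => \1_(H m `&` B n))) => //; first exact: LI.
      by move=> m; exact: LI.
    apply: (nrm_dominated_cvg0 (h := \1_(B n) : Z -> R)) => //.
    + by move=> m; case: (LI n _ (mH m)).
    + exact: sqint_indic.
    + move=> m z; rewrite !indicE in_setI.
      by case: (z \in H m); case: (z \in B n); rewrite /= ?normr0 ?normr1.
    + move=> z; have [[k _ Fkz]|nU] := pselect ((\bigcup_k F k) z).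
        apply: cvg_near_cst; exists k.+1 => // m /= km.
        rewrite !indicE !in_setI; congr ((_ && _)%:R).
        by transitivity true; [|symmetry]; apply/mem_set; [exists k|exists k].
      apply: cvg_near_cst; apply: nearW => m.
      rewrite !indicE !in_setI; congr ((_ && _)%:R).
      transitivity false; [|symmetry]; apply/memNset => //.
      by move=> [k _ zk]; apply: nU; exists k.
  - by rewrite -GE.
have Psum n (m : nat) (c : 'I_m -> R) (A : 'I_m -> set Z) : (forall i, measurable (A i)) ->
    sqint mu (fun z => \sum_(i < m) c i * \1_(A i `&` B n) z) /\
    P (fun z => \sum_(i < m) c i * \1_(A i `&` B n) z).
  elim: m c A => [|m IH] c A mA.
    split; under eq_fun do rewrite big_ord0; [exact: sqint0|exact: P0].
  have [L1 P1] := IH (fun i => c (lift ord0 i)) (fun i => A (lift ord0 i)) (fun i => mA _).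
  split; under eq_fun do rewrite big_ord_recl.
    by apply: sqintD => //; apply: sqintZ; exact: LI.
  by apply: Plin => //; [exact: LI|exact: PI].
(* Simple functions increase to f; restricting the n-th one to [B n] makes it a combination of
   indicators already treated, with f as majorant. *)
have Ppos f : sqint mu f -> (forall z, 0 <= f z) -> P f.
  move=> Lf f0; have mf : measurable_fun setT (EFin \o f).
    by apply/measurable_EFinP; case: Lf.
  have f0' z : setT z -> (0 <= (EFin \o f) z)%E by rewrite /= lee_fin.
  pose g n := nnsfun_approx measurableT mf n.
  have gf n z : g n z <= f z.
    by rewrite -lee_fin /g nnsfun_approxE; exact: (le_approx n f0').
  have key n : exists (m : nat) (c : 'I_m -> R) (A : 'I_m -> set Z),
      (forall i, measurable (A i)) /\
      (fun z => g n z * \1_(B n) z) = (fun z => \sum_(i < m) c i * \1_(A i `&` B n) z).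
    pose r := finmap.enum_fset (fset_set (range (g n))).
    exists (size r), (fun i => r`_i), (fun i => g n @^-1` [set r`_i]); split.
      by move=> i; exact: measurable_sfunP.
    apply/funext => z; rewrite (fimfunEord (g n)) mulr_suml.
    by apply: eq_bigr => i _; rewrite indicI/= mulrA.
  have Lg n : sqint mu (fun z => g n z * \1_(B n) z).
    by have [m [c [A [mA ->]]]] := key n; case: (Psum n m c A mA).
  apply: (Plim _ (fun n z => g n z * \1_(B n) z)) => //.
    by move=> n; have [m [c [A [mA ->]]]] := key n; case: (Psum n m c A mA).
  apply: (nrm_dominated_cvg0 (h := f)) => //.
  - by move=> n; case: (Lg n).
  - move=> n z; rewrite normrM indicE.
    have gz : 0 <= g n z by [].
    rewrite (ger0_norm gz); have := gf n z; have := f0 z.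
    by case: (_ \in _); rewrite ?normr1 ?normr0 ?mulr1 ?mulr0.
  - move=> z; have : \bigcup_n B n = setT by [].
    move=> /(congr1 (fun X => X z)) /= e; have [k _ Bk] : (\bigcup_n B n) z by rewrite e.
    have cg : g n z @[n --> \oo] --> f z.
      have := cvg_nnsfun_approx measurableT mf f0' (I : setT z).
      by move=> /fine_cvg.
    apply: cvg_trans cg; apply: near_eq_cvg; exists k => // n /= kn.
    by rewrite indicE mem_set ?mulr1//; exact: ndB Bk.
move=> f Lf.
have Lp : sqint mu (fun z => Num.max (f z) 0).
  apply: (sqint_le _ Lf); first by apply: measurable_maxr => //; case: Lf.
  move=> z; rewrite maxEle; case: ifPn => //; rewrite normr0//.
have Ln : sqint mu (fun z => Num.max (- f z) 0).
  apply: (sqint_le _ Lf); first by apply: measurable_maxr => //; apply: measurableT_comp => //; case: Lf.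
  by move=> z; rewrite maxEle; case: ifPn; rewrite ?normrN// normr0.
have := Plin (-1) _ _ Ln Lp (Ppos _ Ln _) (Ppos _ Lp _).
rewrite (_ : (fun z => _) = f).
  by apply; move=> z; rewrite le_max lexx orbT.
apply/funext => z; rewrite !maxEle oppr_le0.
by case: (leP 0 (f z)); case: (leP (f z) 0) => h1 h2; lra.
Qed.

End SqintInduction.

(* [spacetime R] with the sigma-algebra that underlies [spacetime_measure R] *)
Notation spacetimeM R := (measurableTypeR R * (measurableTypeR R * measurableTypeR R *
  measurableTypeR R * measurableTypeR R))%type.

(** * Triangular shears of space-time preserve Lebesgue measure *)

Section Shears.
Context {R : realType}.
Notation leb := (@lebesgue_measure R).

(** The translated measure has the right value on half-open intervals, which determines Lebesgue
    measure. *)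
Lemma lebesgue_shift (c : R) (A : set R) : measurable A ->
  leb ((fun y => y + c) @^-1` A) = leb A.
Proof.
move=> mA; have mf : measurable_fun setT (fun y : R => y + c).
  exact: measurable_funD.
rewrite -[LHS]/(pushforward leb (fun y : measurableTypeR R => (y + c : measurableTypeR R)) A).
apply/esym; move: A mA; apply: lebesgue_measure_unique => X [[a b] _ <-] /=.
rewrite /pushforward (_ : _ @^-1` _ = `]a - c, b - c]%classic); last first.
  by apply/seteqP; split => y /=; rewrite !in_itv/= ltrBlDr lerBrDr.
rewrite !lebesgue_measure_itv/= !lte_fin ltrD2r; case: ifP => // _.
by rewrite -!EFinB; congr (_%:E); ring.
Qed.

(** The fibre over x of the preimage is a translate of the fibre over F x, so integrating fibre
    measures reduces the claim to translation invariance and to the invariance of m under F. *)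
Lemma shear_mpres d (X : measurableType d) (m : {measure set X -> \bar R})
    (F : X -> X) (h : X -> R) :
  mpres m F -> measurable_fun setT h ->
  mpres (m \x leb)%E (fun z : X * R => (F z.1, z.2 + h z.1)).
Proof.
move=> pF mh; have [mF _] := pF.
have mG : measurable_fun setT (fun z : X * R => (F z.1, z.2 + h z.1)).
  apply: measurable_fun_pair; first exact: measurableT_comp.
  by apply: measurable_funD => //; exact: measurableT_comp.
split => // B mB.
rewrite /product_measure1 -[RHS](mpres_ge0_integral pF); last 2 first.
- exact: (measurable_fun_xsection leb mB).
- by move=> x; exact: measure_ge0.
apply: eq_integral => x _ /=.
rewrite -[RHS](lebesgue_shift (h x)); last exact: measurable_xsection.
by congr (leb _); apply/seteqP; split => y /=; rewrite /xsection/= !inE.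
Qed.

Lemma fiber_mpres d (Y : measurableType d) (m : {sigma_finite_measure set Y -> \bar R})
    (s : R) (G : R -> Y -> Y) :
  measurable_fun setT (fun z : R * Y => G z.1 z.2) -> (forall t, mpres m (G t)) ->
  mpres (leb \x m)%E (fun z : R * Y => (z.1 + s, G z.1 z.2)).
Proof.
move=> mG pG.
have mS : measurable_fun setT (fun y : R => y + s) by exact: measurable_funD.
have mF : measurable_fun setT (fun z : R * Y => (z.1 + s, G z.1 z.2)).
  by apply: measurable_fun_pair => //; exact: measurable_funD.
split => // B mB.
have pS : mpres leb (fun y : R => y + s).
  by split => // A mA; exact: lebesgue_shift.
rewrite /product_measure1 -[RHS](mpres_ge0_integral pS); last 2 first.
- exact: (measurable_fun_xsection m mB).
- by move=> x; exact: measure_ge0.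
apply: eq_integral => x _ /=.
rewrite -[RHS](pG x).2; last exact: measurable_xsection.
by congr (m _); apply/seteqP; split => y /=; rewrite /xsection/= !inE.
Qed.

Notation Z := (spacetime R).
Notation mu := (spacetime_measure R).

(* the maps (t, J, A, V, Q) |-> (t + s, J + r, A + al, V + nu, Q + ka) *)
Definition shear (s r : R) (al nu ka : Z -> R) (z : Z) : Z :=
  (z.1 + s, (coordJ z + r, coordA z + al z, coordV z + nu z, coordQ z + ka z)).

Lemma measurable_t : measurable_fun [set: spacetimeM R] (fun z : Z => z.1).
Proof. exact: measurable_fst. Qed.
Lemma measurable_coordJ : measurable_fun [set: spacetimeM R] (@coordJ R).
Proof. by do 3 apply: measurableT_comp => //. Qed.
Lemma measurable_coordA : measurable_fun [set: spacetimeM R] (@coordA R).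
Proof. by do 3 apply: measurableT_comp => //. Qed.
Lemma measurable_coordV : measurable_fun [set: spacetimeM R] (@coordV R).
Proof. by do 2 apply: measurableT_comp => //. Qed.
Lemma measurable_coordQ : measurable_fun [set: spacetimeM R] (@coordQ R).
Proof. by do 1 apply: measurableT_comp => //. Qed.

Lemma measurable_spacetime d (X : measurableType d) (F : X -> spacetimeM R) :
  measurable_fun setT (fun x => (F x).1) ->
  measurable_fun setT (fun x => coordJ (F x)) ->
  measurable_fun setT (fun x => coordA (F x)) ->
  measurable_fun setT (fun x => coordV (F x)) ->
  measurable_fun setT (fun x => coordQ (F x)) ->
  measurable_fun setT F.
Proof.
move=> m0 m1 m2 m3 m4.
rewrite (_ : F = (fun x => ((F x).1, (coordJ (F x), coordA (F x), coordV (F x), coordQ (F x))))).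
  by do 4 apply: measurable_fun_pair => //.
by apply/funext => x; rewrite /coordJ/coordA/coordV/coordQ; case: (F x) => t [[[J A] V] Q].
Qed.

(** The displacement of each coordinate depends only on the preceding ones, so the map is built
    coordinate by coordinate with [shear_mpres], for each fixed t; time, the left factor of the
    product, is added last by [fiber_mpres]. *)
Lemma shear_mpresP (s r : R) (al nu ka : Z -> R) :
  measurable_fun [set: spacetimeM R] al -> measurable_fun [set: spacetimeM R] nu ->
  measurable_fun [set: spacetimeM R] ka ->
  (forall z z', tJ z = tJ z' -> al z = al z') ->
  (forall z z', tJ z = tJ z' -> coordA z = coordA z' -> nu z = nu z') ->
  (forall z z', tJ z = tJ z' -> coordA z = coordA z' -> coordV z = coordV z' ->
     ka z = ka z') ->
  mpres mu (shear s r al nu ka).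
Proof.
move=> mal mnu mka hal hnu hka.
(* The coordinates on which a displacement does not depend are filled with 0. *)
pose G (t : R) (y : phase R) : phase R :=
  (y.1.1.1 + r, y.1.1.2 + al (t, (y.1.1.1, 0, 0, 0)),
    y.1.2 + nu (t, (y.1.1.1, y.1.1.2, 0, 0)), y.2 + ka (t, (y.1.1.1, y.1.1.2, y.1.2, 0))).
have GE : shear s r al nu ka = (fun z : R * phase R => (z.1 + s, G z.1 z.2)).
  apply/funext => -[t [[[J A] V] Q]]; rewrite /shear /G /coordJ /coordA /coordV /coordQ /=.
  by congr (_, (_, _ + _, _ + _, _ + _)); [exact: hal|exact: hnu|exact: hka].
rewrite GE; refine (@fiber_mpres _ _ (phase_measure R) s G _ _).
- have -> : (fun z : R * phase R => G z.1 z.2) = snd \o shear s r al nu ka by rewrite GE.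
  apply: measurableT_comp => //; apply: measurable_spacetime.
  + by apply: measurable_funD => //; exact: measurable_t.
  + by apply: measurable_funD => //; exact: measurable_coordJ.
  + by apply: measurable_funD => //; exact: measurable_coordA.
  + by apply: measurable_funD => //; exact: measurable_coordV.
  + by apply: measurable_funD => //; exact: measurable_coordQ.
- move=> t; rewrite /phase_measure /G.
  have p1 : mpres leb (fun y : R => y + r).
    split; first exact: measurable_funD.
    by move=> A mA; exact: lebesgue_shift.
  have p2 := @shear_mpres _ _ leb _ (fun J => al (t, (J, 0, 0, 0))) p1.
  have {}p2 := p2 ltac:(apply: measurableT_comp => //; apply: measurable_spacetime; rewrite /coordJ/coordA/coordV/coordQ/= => //; by [exact: measurable_fst|exact: measurable_snd]).
  have p3 := @shear_mpres _ _ (leb \x leb)%E _ (fun y => nu (t, (y.1, y.2, 0, 0))) p2.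
  have {}p3 := p3 ltac:(apply: measurableT_comp => //; apply: measurable_spacetime; rewrite /coordJ/coordA/coordV/coordQ/= => //; by [exact: measurable_fst|exact: measurable_snd]).
  have p4 := @shear_mpres _ _ (leb \x leb \x leb)%E _ (fun y => ka (t, (y.1.1, y.1.2, y.2, 0))) p3.
  apply: p4; apply: measurableT_comp => //; apply: measurable_spacetime;
    rewrite /coordJ/coordA/coordV/coordQ/= => //; by [exact: measurable_snd|exact: measurableT_comp].
Qed.

End Shears.

(** * Half-open boxes generate the measurable sets of space-time *)

Section Boxes.
Context {R : realType}.
Notation leb := (@lebesgue_measure R).
Notation Z := (spacetime R).
Notation mu := (spacetime_measure R).

Definition box (I0 I1 I2 I3 I4 : set R) : set Z :=
  [set z | [/\ I0 z.1, I1 (coordJ z), I2 (coordA z), I3 (coordV z) & I4 (coordQ z)]].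

Lemma boxI I0 I1 I2 I3 I4 J0 J1 J2 J3 J4 :
  box I0 I1 I2 I3 I4 `&` box J0 J1 J2 J3 J4 =
  box (I0 `&` J0) (I1 `&` J1) (I2 `&` J2) (I3 `&` J3) (I4 `&` J4).
Proof.
apply/seteqP; split => z /=; first by move=> [[? ? ? ? ?] [? ? ? ? ?]].
by move=> [[? ?] [? ?] [? ?] [? ?] [? ?]].
Qed.

Lemma boxE I0 I1 I2 I3 I4 :
  box I0 I1 I2 I3 I4 = I0 `*` (I1 `*` I2 `*` I3 `*` I4).
Proof. by apply/seteqP; split => z /=; [case|move=> [? [[[? ?] ?] ?]]]. Qed.

Lemma measurable_box I0 I1 I2 I3 I4 : measurable I0 -> measurable I1 ->
  measurable I2 -> measurable I3 -> measurable I4 -> measurable (box I0 I1 I2 I3 I4).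
Proof. by move=> *; rewrite boxE; do 4 apply: measurableX => //. Qed.

Lemma box_lty I0 I1 I2 I3 I4 : measurable I0 -> measurable I1 ->
  measurable I2 -> measurable I3 -> measurable I4 ->
  (leb I0 < +oo)%E -> (leb I1 < +oo)%E -> (leb I2 < +oo)%E ->
  (leb I3 < +oo)%E -> (leb I4 < +oo)%E -> (mu (box I0 I1 I2 I3 I4) < +oo)%E.
Proof.
move=> m0 m1 m2 m3 m4 f0 f1 f2 f3 f4; rewrite boxE.
rewrite /spacetime_measure product_measure1E//=; last first.
  by do 3 apply: measurableX => //.
rewrite /phase_measure product_measure1E//=; last by do 2 apply: measurableX => //.
rewrite product_measure1E//=; last by apply: measurableX.
rewrite product_measure1E//=.
have fin I : (leb I < +oo)%E -> leb I \is a fin_num by move=> ?; rewrite ge0_fin_numE.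
by rewrite ltey_eq !fin_numM// fin.
Qed.

Definition obox : set (set Z) :=
  [set B | exists I0 I1 I2 I3 I4, [/\ [/\ ocitv I0, ocitv I1, ocitv I2, ocitv I3 & ocitv I4]
    & B = box I0 I1 I2 I3 I4]].

Lemma ocitv_measurable (I : set R) : ocitv I -> measurable I.
Proof. by move=> [[a b] _ <-]. Qed.

Lemma ocitv_lty (I : set R) : ocitv I -> (leb I < +oo)%E.
Proof.
move=> [[a b] _ <-]; rewrite lebesgue_measure_itv/=.
by case: ifP => // _; rewrite -EFinB ltry.
Qed.

Lemma ocitvI (I J : set R) : ocitv I -> ocitv J -> ocitv (I `&` J).
Proof. exact: (@measurableI _ (@ocitv_type R)). Qed.

Definition cube (n : nat) : set R := `]- n%:R, n%:R]%classic.

Lemma cube_ocitv n : ocitv (cube n).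
Proof. by exists (- n%:R, n%:R). Qed.

Lemma cube_in (x : R) : \forall n \near \oo, cube n x.
Proof.
near=> n; rewrite /cube/= in_itv/=.
have : `|x| < n%:R by near: n; exact: nbhs_infty_gtr.
by rewrite ltr_norml => /andP[-> /ltW].
Unshelve. all: by end_near. Qed.

(** It suffices that the five coordinates are measurable for the sigma-algebra generated by boxes.
    The preimage of a bounded interval under one coordinate is unbounded in the others, but it is a
    countable union of boxes whose other sides are the cubes [cube n]. *)
Lemma measurable_obox : (measurable : set (set Z)) = <<s obox >>.
Proof.
apply/seteqP; split; last first.
  apply: smallest_sub; first exact: sigma_algebra_measurable.
  move=> B [I0 [I1 [I2 [I3 [I4 [[? ? ? ? ?] ->]]]]]].
  by apply: measurable_box; exact: ocitv_measurable.
pose X := g_sigma_algebraType obox.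
have idm : measurable_fun setT (id : X -> Z).
  have coord (f : Z -> R) (B : set R -> nat -> set Z) :
      (forall I n, ocitv I -> obox (B I n)) ->
      (forall I z, f z \in I <-> exists n, B I n z) ->
      measurable_fun setT (f : X -> R).
    move=> oB fB; apply: (@measurability _ _ X R setT f (@ocitv R)) => //.
    move=> _ [I oI <-]; rewrite setTI.
    have -> : f @^-1` I = \bigcup_n B I n.
      apply/seteqP; split => z /=.
        by move=> Ifz; have /fB[n Bn] := mem_set Ifz; exists n.
      by move=> [n _ Bn]; apply: set_mem; apply/fB; exists n.
    apply: bigcup_measurable => n _; apply: sub_sigma_algebra; exact: oB.
  have all z : \forall n \near \oo, box (cube n) (cube n) (cube n) (cube n) (cube n) z.
    near=> n; split; near: n; exact: cube_in.
  have cb I n : ocitv I -> ocitv (I `&` cube n).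
    by move=> oI; apply: ocitvI => //; exact: cube_ocitv.
  apply: measurable_spacetime.
  - apply: (coord _ (fun I n => box (I `&` cube n) (cube n) (cube n) (cube n) (cube n))).
      by move=> I n oI; do 5 eexists; split; last reflexivity; split; try exact: cube_ocitv; exact: cb.
    move=> I z; split; last by move=> [n [[? _] _ _ _ _]]; exact: mem_set.
    by move=> /set_mem Iz; have [n _ /(_ n (leqnn n)) [? ? ? ? ?]] := all z; exists n.
  - apply: (coord _ (fun I n => box (cube n) (I `&` cube n) (cube n) (cube n) (cube n))).
      by move=> I n oI; do 5 eexists; split; last reflexivity; split; try exact: cube_ocitv; exact: cb.
    move=> I z; split; last by move=> [n [_ [? _] _ _ _]]; exact: mem_set.
    by move=> /set_mem Iz; have [n _ /(_ n (leqnn n)) [? ? ? ? ?]] := all z; exists n.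
  - apply: (coord _ (fun I n => box (cube n) (cube n) (I `&` cube n) (cube n) (cube n))).
      by move=> I n oI; do 5 eexists; split; last reflexivity; split; try exact: cube_ocitv; exact: cb.
    move=> I z; split; last by move=> [n [_ _ [? _] _ _]]; exact: mem_set.
    by move=> /set_mem Iz; have [n _ /(_ n (leqnn n)) [? ? ? ? ?]] := all z; exists n.
  - apply: (coord _ (fun I n => box (cube n) (cube n) (cube n) (I `&` cube n) (cube n))).
      by move=> I n oI; do 5 eexists; split; last reflexivity; split; try exact: cube_ocitv; exact: cb.
    move=> I z; split; last by move=> [n [_ _ _ [? _] _]]; exact: mem_set.
    by move=> /set_mem Iz; have [n _ /(_ n (leqnn n)) [? ? ? ? ?]] := all z; exists n.
  - apply: (coord _ (fun I n => box (cube n) (cube n) (cube n) (cube n) (I `&` cube n))).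
      by move=> I n oI; do 5 eexists; split; last reflexivity; split; try exact: cube_ocitv; exact: cb.
    move=> I z; split; last by move=> [n [_ _ _ _ [? _]]]; exact: mem_set.
    by move=> /set_mem Iz; have [n _ /(_ n (leqnn n)) [? ? ? ? ?]] := all z; exists n.
by move=> E mE; have := idm measurableT E mE; rewrite setTI.
Unshelve. all: by end_near. Qed.

Lemma spacetime_sqint_ind (P : (Z -> R) -> Prop) :
  (forall I0 I1 I2 I3 I4, ocitv I0 -> ocitv I1 -> ocitv I2 -> ocitv I3 -> ocitv I4 ->
     P \1_(box I0 I1 I2 I3 I4)) ->
  (forall k f g, sqint mu f -> sqint mu g -> P f -> P g ->
     P (fun z => k * f z + g z)) ->
  (forall f (f_ : nat -> Z -> R), sqint mu f -> (forall n, sqint mu (f_ n)) ->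
     (forall n, P (f_ n)) ->
     l2nrm mu (fun z => f_ n z - f z) @[n --> \oo] --> (0 : R) -> P f) ->
  forall f, sqint mu f -> P f.
Proof.
move=> Pbox Plin Plim.
refine (@sqint_ind _ _ R mu obox (fun n => box (cube n) (cube n) (cube n) (cube n) (cube n))
  P _ _ _ _ _ _ _ Plin Plim).
- exact: measurable_obox.
- move=> A B [I0 [I1 [I2 [I3 [I4 [[? ? ? ? ?] ->]]]]]] [J0 [J1 [J2 [J3 [J4 [[? ? ? ? ?] ->]]]]]].
  by rewrite boxI; do 5 eexists; split; last reflexivity; split; exact: ocitvI.
- by move=> n; do 5 eexists; split; last reflexivity; split; exact: cube_ocitv.
- move=> n; have o := cube_ocitv n.
  by apply: box_lty; do ?[exact: ocitv_measurable|exact: ocitv_lty].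
- move=> m n mn; have h x : cube m x -> cube n x.
    rewrite /cube/= !in_itv/= => /andP[h1 h2].
    have : (m%:R <= n%:R :> R) by rewrite ler_nat.
    move=> h3; apply/andP; split; lra.
  by move=> z [? ? ? ? ?]; split; exact: h.
- apply/seteqP; split => // z _.
  have all : \forall n \near \oo, box (cube n) (cube n) (cube n) (cube n) (cube n) z.
    near=> n; split; near: n; exact: cube_in.
  by have [n _ /(_ n (leqnn n)) h] := all; exists n.
- move=> A [I0 [I1 [I2 [I3 [I4 [[? ? ? ? ?] ->]]]]]] _; exact: Pbox.
Unshelve. all: by end_near. Qed.

End Boxes.

(** * Smooth functions of one variable and a smooth transition function *)

Section Smooth1.
Context {R : realType}.
Implicit Types f g : R -> R.

(** One-variable counterpart of [class_C]. The derivative is supplied as a witness, which turns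
    closure under sums, products and composition into direct inductions on k. *)
Fixpoint Ck (k : nat) (f : R -> R) : Prop :=
  continuous f /\
  if k is k'.+1 then exists2 f' : R -> R, (forall x : R, is_derive x 1 f (f' x)) & Ck k' f'
  else True.

Definition smooth1 f := forall k, Ck k f.

Lemma Ck_continuous k f : Ck k f -> continuous f.
Proof. by case: k => [|k] []. Qed.

Lemma is_derive_continuous f (f' : R -> R) :
  (forall x : R, is_derive x 1 f (f' x)) -> continuous f.
Proof.
by move=> df x; apply: differentiable_continuous; apply/derivable1_diffP; case: (df x).
Qed.

Lemma CkS k f (f' : R -> R) :
  (forall x : R, is_derive x 1 f (f' x)) -> Ck k f' -> Ck k.+1 f.
Proof. by move=> df cf; split; [exact: is_derive_continuous df|exists f']. Qed.

Lemma CkW k f : Ck k.+1 f -> Ck k f.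
Proof.
elim: k f => [|k IH] f /=; first by case.
by move=> [cf [f' df /IH cf']]; split=> //; exists f'.
Qed.

Lemma is_derive1E f (f' x : R) : is_derive x 1 f f' -> derive1 f x = f'.
Proof. by move=> df; rewrite derive1E derive_val. Qed.

Lemma smooth1_is_derive f : smooth1 f -> forall x : R, is_derive x 1 f (derive1 f x).
Proof.
move=> /(_ 1%N) [_ [f' df _]] x; have := df x.
by rewrite -(is_derive1E (df x)).
Qed.

Lemma smooth1_derive f : smooth1 f -> smooth1 (derive1 f).
Proof.
move=> sf k; have [_ [f' df cf']] := sf k.+1.
by rewrite (_ : derive1 f = f')//; apply/funext => x; exact: is_derive1E.
Qed.

Lemma smooth1_continuous f : smooth1 f -> continuous f.
Proof. by move=> /(_ 0%N); exact: Ck_continuous. Qed.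

Lemma Ck_cst k (c : R) : Ck k (fun=> c).
Proof.
elim: k c => [|k IH] c; first by split => // x; exact: cvg_cst.
by apply: (@CkS _ _ (fun=> 0)) => // x; exact: is_derive_cst.
Qed.

Lemma Ck_id k : Ck k id.
Proof.
case: k => [|k]; first by split => // x.
by apply: (@CkS _ _ (fun=> 1)); exact: Ck_cst.
Qed.

Lemma Ck_add k f g : Ck k f -> Ck k g -> Ck k (fun x => f x + g x).
Proof.
elim: k f g => [|k IH] f g.
  by move=> [cf _] [cg _]; split => // x; exact: cvgD (cf x) (cg x).
move=> [_ [f' df cf]] [_ [g' dg cg]].
by apply: (@CkS _ _ (fun x => f' x + g' x)); exact: IH.
Qed.

Lemma Ck_mul k f g : Ck k f -> Ck k g -> Ck k (fun x => f x * g x).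
Proof.
elim: k f g => [|k IH] f g.
  by move=> [cf _] [cg _]; split => // x; exact: cvgM (cf x) (cg x).
move=> cf cg; have [_ [f' df cf']] := cf; have [_ [g' dg cg']] := cg.
apply: (@CkS _ _ (fun x => f x * g' x + g x * f' x)).
by apply: Ck_add; apply: IH => //; exact: CkW.
Qed.

Lemma Ck_comp k f g : Ck k f -> Ck k g -> Ck k (fun x => f (g x)).
Proof.
elim: k f g => [|k IH] f g.
  by move=> [cf _] [cg _]; split => // x; exact: continuous_comp (cg x) (cf (g x)).
move=> cf cg; have [_ [f' df cf']] := cf; have [_ [g' dg cg']] := cg.
apply: (@CkS _ _ (fun x => f' (g x) * g' x)).
by apply: Ck_mul => //; apply: IH => //; exact: CkW.
Qed.

Lemma Ck_inv k f : (forall x, f x != 0) -> Ck k f -> Ck k (fun x => (f x)^-1).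
Proof.
move=> f0; elim: k f f0 => [|k IH] f f0.
  by move=> [cf _]; split => // x; exact: cvgV (f0 x) (cf x).
move=> cf; have [_ [f' df cf']] := cf.
apply: (@CkS _ _ (fun x => -1 * ((f x)^-1 * (f x)^-1) * f' x)).
  move=> x; apply: (is_derive_eq (is_deriveV (f0 x) (df x))).
  by rewrite /GRing.scale/= mulN1r expr2 invfM.
apply: Ck_mul => //; apply: Ck_mul; first exact: Ck_cst.
by apply: Ck_mul; apply: IH => //; exact: CkW.
Qed.

Lemma Ck_expR k : Ck k (@expR R).
Proof.
elim: k => [|k IH]; first by split => // x; exact: continuous_expR.
by apply: (@CkS _ _ (@expR R)) => // x; exact: is_derive_expR.
Qed.

Lemma smooth1_cst (c : R) : smooth1 (fun=> c). Proof. by move=> k; exact: Ck_cst. Qed.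
Lemma smooth1_id : smooth1 id. Proof. by move=> k; exact: Ck_id. Qed.
Lemma smooth1D f g : smooth1 f -> smooth1 g -> smooth1 (fun x => f x + g x).
Proof. by move=> sf sg k; exact: Ck_add. Qed.
Lemma smooth1M f g : smooth1 f -> smooth1 g -> smooth1 (fun x => f x * g x).
Proof. by move=> sf sg k; exact: Ck_mul. Qed.
Lemma smooth1_comp f g : smooth1 f -> smooth1 g -> smooth1 (fun x => f (g x)).
Proof. by move=> sf sg k; exact: Ck_comp. Qed.
Lemma smooth1_expR : smooth1 (@expR R). Proof. by move=> k; exact: Ck_expR. Qed.

Lemma smooth1_affine (p q : R) : smooth1 (fun x => p * x + q).
Proof.
apply: smooth1D; last exact: smooth1_cst.
by apply: smooth1M; [exact: smooth1_cst|exact: smooth1_id].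
Qed.

(* [flat n x] is [x^-n exp(-1/x)] for [x > 0]; this family is stable under derivation *)
Definition flat (n : nat) (x : R) : R :=
  if 0 < x then x ^- n * expR (- x^-1) else 0.

Lemma flat_ge0 n x : 0 <= flat n x.
Proof.
rewrite /flat; case: ifPn => // x0.
by rewrite mulr_ge0 ?expR_ge0// invr_ge0 exprn_ge0// ltW.
Qed.

(** From exp(y) >= y^(n+2)/(n+2)! at y = 1/x. The two spare powers of x are what differentiability
    at 0 with derivative 0 requires. *)
Lemma flat_le n x : 0 < x -> flat n x <= n.+2`!%:R * x ^+ 2.
Proof.
move=> x0; rewrite /flat x0 expRN.
have y0 : 0 < x^-1 by rewrite invr_gt0.
have := expR_ge1Dxn n.+1 (ltW y0) => h.
have h' : x^-1 ^+ n.+2 / n.+2`!%:R <= expR x^-1.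
  by apply: le_trans h; rewrite lerDr.
rewrite ler_pdivrMr ?expR_gt0//.
have f0 : 0 < n.+2`!%:R :> R by rewrite ltr0n fact_gt0.
apply: le_trans (_ : n.+2`!%:R * x ^+ 2 * (x^-1 ^+ n.+2 / n.+2`!%:R) <= _); last first.
  by rewrite ler_wpM2l// mulr_ge0 ?sqr_ge0// ltW.
rewrite le_eqVlt; apply/orP; left; apply/eqP.
rewrite exprVn -addn2 exprD.
by field; rewrite ?expf_neq0 ?lt0r_neq0.
Qed.

Lemma is_derive_near_eq f g (x df : R) :
  (\forall y \near x, f y = g y) -> is_derive x 1 f df -> is_derive x 1 g df.
Proof.
move=> fg [/cvg_ex[l fl] <-].
have gx : g x = f x by rewrite (nbhs_singleton fg).
have E : \forall h \near 0^', h^-1 *: (f (h *: 1 + x) - f x) = h^-1 *: (g (h *: 1 + x) - g x).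
  have : (fun h : R => h *: (1 : R^o) + x) @ 0^' --> x.
    have -> : (fun h : R => h *: (1 : R^o) + x) = (fun h : R => h + x).
      by apply/funext => h; rewrite /GRing.scale/= mulr1.
    rewrite -[X in _ --> X](add0r x).
    apply: (@cvgD _ R^o _ _ _ (fun h : R => h) (fun=> x) 0 x); last exact: cvg_cst.
    exact: nbhs_dnbhs.
  move=> /(_ _ fg) fgh; near=> h; rewrite gx.
  suff -> : f (h *: 1 + x) = g (h *: 1 + x) by [].
  by near: h; exact: fgh.
have gl : h^-1 *: (g (h *: 1 + x) - g x) @[h --> 0^'] --> l.
  by apply: cvg_trans fl; apply: near_eq_cvg; apply: filterS E => h ->.
apply: DeriveDef; first by apply/cvg_ex; exists l.
by rewrite /derive (cvg_lim _ gl)// (cvg_lim _ fl).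
Unshelve. all: by end_near. Qed.

Lemma is_derive_flat n (x : R) : is_derive x 1 (flat n) (flat n.+2 x - n%:R * flat n.+1 x).
Proof.
have [x0|x0|<-] := ltrgtP 0 x.
- have xn : x != 0 by rewrite gt_eqF.
  apply: (@is_derive_near_eq (fun x => (x ^+ n)^-1 * expR (- x^-1))).
    near=> y; rewrite /flat; suff -> : 0 < y by [].
    by near: y; exact: lt_nbhsr.
  have dx : is_derive x 1 (fun x : R => x^-1) (- x ^- 2).
    have := is_deriveV xn (is_derive_id x (1:R)).
    by move=> h; apply: (is_derive_eq h); rewrite /GRing.scale/= mulr1.
  have de : is_derive x 1 (fun x : R => expR (- x^-1)) (expR (- x^-1) * x ^- 2).
    have := @is_derive1_comp _ expR (fun y => - y^-1) x _ _ (is_derive_expR (- x^-1)) (is_deriveN dx).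
    by rewrite opprK.
  have dn : is_derive x 1 (fun x : R => (x ^+ n)^-1) (- (n%:R * x ^- n.+1)).
    have dX : is_derive x 1 (fun y : R => y ^+ n) (n%:R * x ^+ n.-1).
      apply: DeriveDef; first exact: exprn_derivable.
      by rewrite -derive1E exp_derive1.
    apply: (is_derive_eq (@is_deriveV _ (fun y : R => y ^+ n) x _ _ (expf_neq0 n xn) dX)).
    rewrite /GRing.scale/=; case: n {dX} => [|n]; first by rewrite !mul0r mulr0 oppr0.
    rewrite /= !exprS; field.
    by rewrite ?expf_neq0 ?xn.
  have := is_deriveM dn de => h; apply: (is_derive_eq h).
  rewrite /GRing.scale/= /flat x0.
  rewrite -[in x ^- n.+2]addn2 exprD; field.
  by rewrite ?expf_neq0 ?xn.
- rewrite /flat ltNge (ltW x0)/= mulr0 subr0.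
  apply: (@is_derive_near_eq (fun=> 0)).
  near=> y; rewrite /flat; suff -> : (0 < y) = false by [].
  by apply/negbTE; rewrite -leNgt ltW//; near: y; exact: lt_nbhsl.
- rewrite {2 3}/flat ltxx mulr0 subr0.
  (* At 0 the quotient is at most (n+2)! |h| in absolute value: by [flat_le] on the right, and
     because the function vanishes on the left. *)
  have c0 : h^-1 *: (flat n (h *: 1 + 0) - flat n 0) @[h --> 0^'] --> (0 : R).
    have -> : (fun h => h^-1 *: (flat n (h *: 1 + 0) - flat n 0)) = (fun h => h^-1 * flat n h).
      by apply/funext => h; rewrite /GRing.scale/= mulr1 addr0 [flat n 0]/flat ltxx subr0.
    apply/norm_cvg0P.
    apply: (@squeeze_cvgr _ _ _ _ (fun=> 0) (fun h => n.+2`!%:R * `|h|)); last 2 first.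
    + exact: cvg_cst.
    + rewrite -[X in _ --> X](mulr0 (n.+2`!%:R : R)); apply: cvgM; first exact: cvg_cst.
      by rewrite -[X in _ --> X](@normr0 _ R); apply: cvg_norm; exact: nbhs_dnbhs.
    near=> h; rewrite normr_ge0/= normrM normfV.
    have h0 : h != 0 by near: h; exact: nbhs_dnbhs_neq.
    rewrite mulrC ler_pdivrMr ?normr_gt0// (ger0_norm (flat_ge0 _ _)).
    have [hp|hn] := ltP 0 h.
      by rewrite -mulrA -expr2 real_normK ?num_real// flat_le.
    by rewrite {1}/flat ltNge hn/= !mulr_ge0.
  apply: DeriveDef; first by apply/cvg_ex; exists 0.
  exact: (cvg_lim _ c0).
Unshelve. all: by end_near. Qed.

Lemma smooth1_flat n : smooth1 (flat n).
Proof.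
move=> k; elim: k n => [|k IH] n.
  split => //; exact: is_derive_continuous (is_derive_flat n).
apply: (CkS (is_derive_flat n)).
apply: Ck_add => //.
rewrite (_ : (fun x => _) = (fun x => - n%:R * flat n.+1 x)); last first.
  by apply/funext => x; rewrite mulNr.
by apply: Ck_mul => //; exact: Ck_cst.
Qed.

(* smooth transition from 0 on ]-oo, 0] to 1 on [1, +oo[ *)
Definition step (x : R) : R := flat 0 x / (flat 0 x + flat 0 (1 - x)).

Lemma step_den x : 0 < flat 0 x + flat 0 (1 - x).
Proof.
have [x0|x0] := ltP 0 x.
  by rewrite ltr_wpDr ?flat_ge0// /flat x0 expr0 invr1 mul1r expR_gt0.
rewrite ltr_wpDl ?flat_ge0// /flat subr_gt0 (le_lt_trans x0)//.
by rewrite expr0 invr1 mul1r expR_gt0.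
Qed.

Lemma smooth1_step : smooth1 step.
Proof.
have s1 : smooth1 (fun x => flat 0 (1 - x)).
  apply: (@smooth1_comp (flat 0) (fun x => 1 - x)); first exact: smooth1_flat.
  rewrite (_ : (fun x => 1 - x) = (fun x => -1 * x + 1)); first exact: smooth1_affine.
  by apply/funext => x; rewrite mulN1r addrC.
move=> k; apply: Ck_mul; first exact: smooth1_flat.
apply: Ck_inv; first by move=> x; rewrite gt_eqF ?step_den.
by apply: Ck_add => //; exact: smooth1_flat.
Qed.

Lemma step_ge0 x : 0 <= step x.
Proof. by rewrite /step divr_ge0 ?flat_ge0// ltW ?step_den. Qed.

Lemma step_le1 x : step x <= 1.
Proof. by rewrite /step ler_pdivrMr ?step_den// mul1r lerDl flat_ge0. Qed.

Lemma step0 x : x <= 0 -> step x = 0.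
Proof. by move=> x0; rewrite /step [in X in X / _]/flat ltNge x0/= mul0r. Qed.

Lemma step1 x : 1 <= x -> step x = 1.
Proof.
move=> x1; have := step_den x; rewrite /step.
have -> : flat 0 (1 - x) = 0 by rewrite /flat subr_gt0 ltNge x1.
rewrite addr0 => h.
by rewrite divff// gt_eqF.
Qed.

Lemma near_cst_derive f (c x : R) : (\forall y \near x, f y = c) -> derive1 f x = 0.
Proof.
move=> fc; apply: is_derive1E.
by apply: (@is_derive_near_eq (fun=> c)); apply: filterS fc.
Qed.

Lemma continuous_bounded f (a b : R) : a <= b -> continuous f ->
  exists2 M, 0 <= M & forall x, a <= x <= b -> `|f x| <= M.
Proof.
move=> ab cf.
have [c _ cM] := @EVT_max _ (fun x => `|f x|) a b ab
  (continuous_subspaceT (fun x => continuous_comp (cf x) (@norm_continuous _ R^o _))).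
by exists `|f c| => // x xab; apply: cM; rewrite in_itv.
Qed.

Lemma step'_supp x : ~ (0 <= x <= 1) -> derive1 step x = 0.
Proof.
move=> /negP; rewrite negb_and -!ltNge => /orP[x0|x1].
  apply: (@near_cst_derive _ 0); near=> y; apply: step0; apply: ltW.
  by near: y; exact: lt_nbhsl.
apply: (@near_cst_derive _ 1); near=> y; apply: step1; apply: ltW.
by near: y; exact: lt_nbhsr.
Unshelve. all: by end_near. Qed.

Lemma step'_bounded : exists2 M, 0 <= M & forall x, `|derive1 step x| <= M.
Proof.
have [M M0 hM] := @continuous_bounded _ 0 1 ler01
  (smooth1_continuous (smooth1_derive smooth1_step)).
exists M => // x; have [h|h] := pselect (0 <= x <= 1); first exact: hM.
by rewrite step'_supp// normr0.
Qed.

End Smooth1.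

(** * Tensor products of smooth compactly supported functions are dense in L^2 *)

Section Tensors.
Context {R : realType}.
Notation Z := (spacetime R).
Notation mu := (spacetime_measure R).

Definition tens (f0 f1 f2 f3 f4 : R -> R) (z : Z) : R :=
  f0 z.1 * f1 (coordJ z) * f2 (coordA z) * f3 (coordV z) * f4 (coordQ z).

Definition csmooth (f : R -> R) :=
  smooth1 f /\ exists M : R, forall x, M < `|x| -> f x = 0.

Lemma csmooth_cube f : csmooth f -> exists (K : R) (n : nat),
  0 <= K /\ forall x, `|f x| <= K * \1_(cube n) x.
Proof.
move=> [sf [M fM]]; have [n Mn] : exists n, M < n%:R.
  by have [n _ /(_ n (leqnn n))] := nbhs_infty_gtr M; exists n.
have nn : - n.+1%:R <= n.+1%:R :> R by rewrite -subr_ge0 opprK -natrD ler0n.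
have [K K0 hK] := continuous_bounded nn (smooth1_continuous sf).
exists K, n.+1; split => // x; rewrite indicE.
case: (boolP (_ \in _)) => [|/negP]; rewrite inE /cube/= in_itv/=.
  by move=> /andP[/ltW h1 h2]; rewrite mulr1; apply: hK; rewrite h1 h2.
move=> h; rewrite mulr0 fM ?normr0//; apply: (lt_trans Mn); rewrite ltNge.
apply: contra_notN h; rewrite ler_norml => /andP[h1 h2].
have : (n%:R < n.+1%:R :> R) by rewrite ltr_nat.
by move=> h3; apply/andP; split; lra.
Qed.

Lemma tens_indic I0 I1 I2 I3 I4 :
  tens \1_I0 \1_I1 \1_I2 \1_I3 \1_I4 = \1_(box I0 I1 I2 I3 I4).
Proof.
apply/funext => z; rewrite /tens !indicE.
have -> : (z \in box I0 I1 I2 I3 I4) =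
  [&& z.1 \in I0, coordJ z \in I1, coordA z \in I2, coordV z \in I3 & coordQ z \in I4].
  apply/idP/idP; first by rewrite inE => -[? ? ? ? ?]; rewrite !mem_set.
  move=> /and5P[] /set_mem ? /set_mem ? /set_mem ? /set_mem ? /set_mem ?.
  by apply/mem_set; split.
by do 5 case: (_ \in _); rewrite ?mulr1 ?mulr0 ?mul0r.
Qed.

Lemma measurable_tens f0 f1 f2 f3 f4 : measurable_fun setT f0 ->
  measurable_fun setT f1 -> measurable_fun setT f2 -> measurable_fun setT f3 ->
  measurable_fun setT f4 -> measurable_fun [set: spacetimeM R] (tens f0 f1 f2 f3 f4).
Proof.
move=> m0 m1 m2 m3 m4; rewrite /tens.
have mc (f : R -> R) (c : Z -> R) : measurable_fun [set: spacetimeM R] c ->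
    measurable_fun setT f -> measurable_fun [set: spacetimeM R] (fun z : Z => f (c z)).
  by move=> mc mf; exact: measurableT_comp.
apply: measurable_funM; last by apply: mc m4; exact: measurable_coordQ.
apply: measurable_funM; last by apply: mc m3; exact: measurable_coordV.
apply: measurable_funM; last by apply: mc m2; exact: measurable_coordA.
apply: measurable_funM; last by apply: mc m1; exact: measurable_coordJ.
by apply: mc m0; exact: measurable_t.
Qed.

Lemma smooth1_measurable (f : R -> R) : smooth1 f -> measurable_fun setT f.
Proof. by move=> sf; apply: continuous_measurable_fun; exact: smooth1_continuous. Qed.

Lemma tens_le (f0 f1 f2 f3 f4 g0 g1 g2 g3 g4 : R -> R) z :
  (forall x, `|f0 x| <= g0 x) -> (forall x, `|f1 x| <= g1 x) ->
  (forall x, `|f2 x| <= g2 x) -> (forall x, `|f3 x| <= g3 x) ->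
  (forall x, `|f4 x| <= g4 x) ->
  `|tens f0 f1 f2 f3 f4 z| <= tens g0 g1 g2 g3 g4 z.
Proof.
by move=> h0 h1 h2 h3 h4; rewrite /tens !normrM; do 4 (apply: ler_pM => //; rewrite ?mulr_ge0//).
Qed.

Lemma sqint_box I0 I1 I2 I3 I4 :
  ocitv I0 -> ocitv I1 -> ocitv I2 -> ocitv I3 -> ocitv I4 ->
  sqint mu (\1_(box I0 I1 I2 I3 I4) : Z -> R).
Proof.
move=> *; apply: sqint_indic.
  by apply: measurable_box; exact: ocitv_measurable.
by apply: box_lty; do ?[exact: ocitv_measurable|exact: ocitv_lty].
Qed.

Lemma tens_bound f0 f1 f2 f3 f4 : csmooth f0 -> csmooth f1 -> csmooth f2 ->
  csmooth f3 -> csmooth f4 -> exists (K : R) (h : Z -> R),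
  [/\ 0 <= K, sqint mu h, forall z, h z = 0 \/ h z = 1 &
    forall z, `|tens f0 f1 f2 f3 f4 z| <= K * h z].
Proof.
move=> /csmooth_cube[K0 [n0 [k0 h0]]] /csmooth_cube[K1 [n1 [k1 h1]]]
  /csmooth_cube[K2 [n2 [k2 h2]]] /csmooth_cube[K3 [n3 [k3 h3]]] /csmooth_cube[K4 [n4 [k4 h4]]].
exists (K0 * K1 * K2 * K3 * K4), \1_(box (cube n0) (cube n1) (cube n2) (cube n3) (cube n4)).
split; first by rewrite !mulr_ge0.
- by apply: sqint_box; exact: cube_ocitv.
- by move=> z; rewrite indicE; case: (_ \in _); [right|left].
move=> z; apply: (le_trans (tens_le z h0 h1 h2 h3 h4)).
rewrite -tens_indic /tens le_eqVlt; apply/orP; left; apply/eqP; ring.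
Qed.

Lemma sqint_tens f0 f1 f2 f3 f4 : csmooth f0 -> csmooth f1 -> csmooth f2 ->
  csmooth f3 -> csmooth f4 -> sqint mu (tens f0 f1 f2 f3 f4).
Proof.
move=> c0 c1 c2 c3 c4; have [K [h [K0 Lh h01 Kh]]] := tens_bound c0 c1 c2 c3 c4.
apply: (sqint_le _ (sqintZ K Lh)).
  by apply: measurable_tens; apply: smooth1_measurable; [case: c0|case: c1|case: c2|case: c3|case: c4].
by move=> z; apply: (le_trans (Kh z)); exact: ler_norm.
Qed.

(* smooth approximations of the indicator of ]a, b] *)
Definition cut (a b : R) (n : nat) (x : R) : R :=
  step (n.+1%:R * (x - a)) * step (n.+1%:R * (b - x) + 1).

(** The descent of [cut] takes place on [b, b + 1/(n+1)], so b + 1 serves for all n; since [cut]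
    does not descend before b, the limit keeps the endpoint b of the half-open interval. *)
Lemma cut_le a b n x : `|cut a b n x| <= \1_(`]a, b + 1]%classic) x.
Proof.
have n0 : 0 < n.+1%:R :> R by rewrite ltr0n.
have n1 : 1 <= n.+1%:R :> R by rewrite ler1n.
rewrite /cut normrM !ger0_norm ?step_ge0// indicE.
case: (boolP (_ \in _)) => [_|/negP].
  by rewrite mulr_ile1 ?step_ge0 ?step_le1.
rewrite inE/= in_itv/= => /negP; rewrite negb_and -leNgt -ltNge => /orP[xa|xb].
  by rewrite step0 ?mul0r// pmulr_rle0// subr_le0.
rewrite [X in _ * X]step0 ?mulr0//; nra.
Qed.

Lemma csmooth_cut a b n : csmooth (cut a b n).
Proof.
split.
  apply: smooth1M.
    apply: (@smooth1_comp _ step (fun x => n.+1%:R * (x - a))); first exact: smooth1_step.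
    rewrite (_ : (fun x => _) = (fun x => n.+1%:R * x + - (n.+1%:R * a))); first exact: smooth1_affine.
    by apply/funext => x; rewrite mulrBr.
  apply: (@smooth1_comp _ step (fun x => n.+1%:R * (b - x) + 1)); first exact: smooth1_step.
  rewrite (_ : (fun x => _) = (fun x => - n.+1%:R * x + (n.+1%:R * b + 1))); first exact: smooth1_affine.
  by apply/funext => x; ring.
exists (`|a| + `|b| + 1) => x xM.
have := cut_le a b n x; rewrite indicE memNset ?normr_le0; first by move/eqP.
rewrite /= in_itv/= => /andP[h1 h2].
have [x0|x0] := leP 0 x.
  rewrite (ger0_norm x0) in xM; have := ler_norm b; have := normr_ge0 a; lra.
rewrite (ltr0_norm x0) in xM.
have := ler_norm (- a); rewrite normrN; have := normr_ge0 b; lra.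
Qed.

Lemma cut_cvg a b x : cut a b n x @[n --> \oo] --> (\1_(`]a, b]%classic) x : R).
Proof.
rewrite indicE; case: (boolP (_ \in _)) => [|/negP].
  rewrite inE/= in_itv/= => /andP[ax xb].
  apply: cvg_near_cst; near=> n.
  have nn : 1 / (x - a) < n%:R by near: n; exact: nbhs_infty_gtr.
  rewrite ltr_pdivrMr ?subr_gt0// in nn.
  have n1 : (n%:R + 1 = n.+1%:R :> R) by rewrite -natr1.
  have n0 : (0 <= n%:R :> R) by [].
  rewrite /cut step1 ?mul1r ?step1//; first by rewrite -n1; nra.
  by rewrite -n1; nra.
rewrite inE/= in_itv/= => /negP; rewrite negb_and -leNgt -ltNge => /orP[xa|xb].
  apply: cvg_near_cst; apply: nearW => n.
  by rewrite /cut step0 ?mul0r// pmulr_rle0 ?ltr0n// subr_le0.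
apply: cvg_near_cst; near=> n.
have nn : 1 / (x - b) < n%:R by near: n; exact: nbhs_infty_gtr.
rewrite ltr_pdivrMr ?subr_gt0// in nn.
have n1 : (n%:R + 1 = n.+1%:R :> R) by rewrite -natr1.
have n0 : (0 <= n%:R :> R) by [].
rewrite /cut [X in _ * X]step0 ?mulr0// -n1; nra.
Unshelve. all: by end_near. Qed.

(** Indicators of half-open boxes are dominated limits of tensors of [cut], so the induction over
    L^2 may start from smooth compactly supported tensors. *)
Lemma tens_dense (P : (Z -> R) -> Prop) :
  (forall f0 f1 f2 f3 f4, csmooth f0 -> csmooth f1 -> csmooth f2 ->
    csmooth f3 -> csmooth f4 -> P (tens f0 f1 f2 f3 f4)) ->
  (forall k f g, sqint mu f -> sqint mu g -> P f -> P g ->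
     P (fun z => k * f z + g z)) ->
  (forall f (f_ : nat -> Z -> R), sqint mu f -> (forall n, sqint mu (f_ n)) ->
     (forall n, P (f_ n)) ->
     l2nrm mu (fun z => f_ n z - f z) @[n --> \oo] --> (0 : R) -> P f) ->
  forall f, sqint mu f -> P f.
Proof.
move=> Pt Plin Plim; apply: spacetime_sqint_ind => //.
move=> _ _ _ _ _ [[a0 b0] _ <-] [[a1 b1] _ <-] [[a2 b2] _ <-] [[a3 b3] _ <-] [[a4 b4] _ <-] /=.
have oc a b : ocitv (`]a, b]%classic : set R) by exists (a, b).
apply: (Plim _ (fun n => tens (cut a0 b0 n) (cut a1 b1 n) (cut a2 b2 n) (cut a3 b3 n) (cut a4 b4 n))).
- by apply: sqint_box; exact: oc.
- by move=> n; apply: sqint_tens; exact: csmooth_cut.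
- by move=> n; apply: Pt; exact: csmooth_cut.
refine (@nrm_dominated_cvg0 _ _ R mu
  (fun n => tens (cut a0 b0 n) (cut a1 b1 n) (cut a2 b2 n) (cut a3 b3 n) (cut a4 b4 n)) _
  (\1_(box `]a0, b0 + 1] `]a1, b1 + 1] `]a2, b2 + 1] `]a3, b3 + 1] `]a4, b4 + 1]) : Z -> R) _ _ _ _).
- by move=> n; apply: sqint_meas; apply: sqint_tens; exact: csmooth_cut.
- by apply: sqint_box; exact: oc.
- by move=> n z; rewrite -tens_indic; apply: tens_le => x; exact: cut_le.
- by move=> z; rewrite -tens_indic /tens; do 4 (apply: cvgM; last exact: cut_cvg); exact: cut_cvg.
Qed.

Lemma continuous_t : continuous (fun z : Z => z.1).
Proof. by move=> z; exact: cvg_fst. Qed.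
Lemma continuous_coordJ : continuous (@coordJ R).
Proof.
move=> z; apply: (@continuous_comp _ _ _ (fun z : Z => z.2.1.1) fst); last exact: cvg_fst.
apply: (@continuous_comp _ _ _ (fun z : Z => z.2.1) fst); last exact: cvg_fst.
apply: (@continuous_comp _ _ _ (fun z : Z => z.2) fst); [exact: cvg_snd|exact: cvg_fst].
Qed.
Lemma continuous_coordA : continuous (@coordA R).
Proof.
move=> z; apply: (@continuous_comp _ _ _ (fun z : Z => z.2.1.1) snd); last exact: cvg_snd.
apply: (@continuous_comp _ _ _ (fun z : Z => z.2.1) fst); last exact: cvg_fst.
apply: (@continuous_comp _ _ _ (fun z : Z => z.2) fst); [exact: cvg_snd|exact: cvg_fst].
Qed.
Lemma continuous_coordV : continuous (@coordV R).
Proof.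
move=> z; apply: (@continuous_comp _ _ _ (fun z : Z => z.2.1) snd); last exact: cvg_snd.
apply: (@continuous_comp _ _ _ (fun z : Z => z.2) fst); [exact: cvg_snd|exact: cvg_fst].
Qed.
Lemma continuous_coordQ : continuous (@coordQ R).
Proof.
move=> z; apply: (@continuous_comp _ _ _ (fun z : Z => z.2) snd); exact: cvg_snd.
Qed.

Lemma continuous_tens f0 f1 f2 f3 f4 : continuous f0 -> continuous f1 ->
  continuous f2 -> continuous f3 -> continuous f4 -> continuous (tens f0 f1 f2 f3 f4).
Proof.
move=> c0 c1 c2 c3 c4 z; rewrite /tens.
apply: cvgM; last exact: (continuous_comp (@continuous_coordQ z) (c4 _)).
apply: cvgM; last exact: (continuous_comp (@continuous_coordV z) (c3 _)).
apply: cvgM; last exact: (continuous_comp (@continuous_coordA z) (c2 _)).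
apply: cvgM; last exact: (continuous_comp (@continuous_coordJ z) (c1 _)).
exact: (continuous_comp (@continuous_t z) (c0 _)).
Qed.

End Tensors.

(** * Measure-preserving flows and strong L^2 derivatives along them *)

Section Flows.
Context {R : realType}.
Notation Z := (spacetime R).
Notation mu := (spacetime_measure R).
Notation sq := (sqint mu).
Notation ip := (l2ip mu).
Notation nrm := (l2nrm mu).
Implicit Types (F G : R -> Z -> Z) (f g p q : Z -> R).

(** Group laws, such as [F s (F (- s) z) = z], are separate hypotheses of the lemmas that use
    them. *)
Definition cflow F := (forall s, mpres mu (F s)) /\ forall z, F s z @[s --> 0] --> z.

Lemma cflow_sqint F s f : cflow F -> sq f -> sq (fun z => f (F s z)).
Proof. by move=> [pF _] Lf; exact: (mpres_sqint (pF s) Lf). Qed.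

Lemma cflow_nrm F s f : cflow F -> sq f -> nrm (fun z => f (F s z)) = nrm f.
Proof. by move=> [pF _] Lf; exact: (mpres_nrm (pF s) Lf). Qed.

Lemma cvg0_le (T : Type) (FF : set_system T) {FT : Filter FF} (f g : T -> R) :
  (\forall x \near FF, `|f x| <= g x) -> g @ FF --> (0 : R) -> f @ FF --> (0 : R).
Proof.
move=> fg g0; apply/norm_cvg0P; apply: (@squeeze_cvgr _ _ _ _ (fun=> 0) g) => //.
  by apply: filterS fg => x ->; rewrite normr_ge0.
exact: cvg_cst.
Qed.

(** Strong continuity of the action on L^2. The set of f for which it holds is closed, because
    composition with F s is an isometry, so smooth tensors suffice. *)
Lemma trans_cont F f : cflow F -> sq f ->
  nrm (fun z => f (F s z) - f z) @[s --> 0^'] --> (0 : R).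
Proof.
move=> cF; have [pF Fz] := cF; move: f; apply: tens_dense.
- move=> f0 f1 f2 f3 f4 c0 c1 c2 c3 c4; set f := tens _ _ _ _ _.
  have Lf : sq f by exact: sqint_tens.
  have cf : continuous f by apply: continuous_tens; apply: smooth1_continuous;
    [case: c0|case: c1|case: c2|case: c3|case: c4].
  have [K [h [K0 Lh h01 Kh]]] := tens_bound c0 c1 c2 c3 c4.
  (* Since ||f o F_s|| = ||f||, convergence of the inner products is enough. In these the fixed
     factor f has bounded support, so a majorant exists wherever F_s moves the other factor. *)
  have E s : nrm (fun z => f (F s z) - f z) ^+ 2 = 2 * (ip f f - ip (fun z => f (F s z)) f).
    have LfF := cflow_sqint s cF Lf.
    rewrite nrm_sqr ipBl ?ipBr//; last exact: sqintB.
    have -> : ip (fun z => f (F s z)) (fun z => f (F s z)) = ip f f.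
      exact: (mpres_ip (pF s)).
    by rewrite (ipC mu f (fun z => f (F s z))); ring.
  have c : ip (fun z => f (F s z)) f @[s --> 0^'] --> ip f f.
    apply/cvgr_dnbhsP => t [_ t0].
    apply: (@Rdominated_cvg _ _ R mu (fun n z => f (F (t n) z) * f z) _
      (fun z => (K * h z) * (K * h z))).
    + by move=> n; apply: measurable_funM; [have [] := cflow_sqint (t n) cF Lf|case: Lf].
    + by apply: sqint_mul; exact: sqintZ.
    + move=> n z; rewrite normrM.
      have KK : `|f (F (t n) z)| <= K.
        by apply: (le_trans (Kh _)); case: (h01 (F (t n) z)) => ->; rewrite ?mulr0 ?mulr1.
      by have := Kh z; rewrite -/f; case: (h01 z) => ->; rewrite ?mulr0 ?mulr1; [rewrite normr_le0 => /eqP->; rewrite normr0 mulr0|move=> ?; exact: ler_pM].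
    + move=> z; apply: cvgM; last exact: cvg_cst.
      apply: continuous_cvg; first exact: cf.
      exact: (cvg_comp t (fun s => F s z) t0 (Fz z)).
  have -> : (fun s => nrm (fun z => f (F s z) - f z)) =
      (fun s => Num.sqrt (2 * (ip f f - ip (fun z => f (F s z)) f))).
    by apply/funext => s; rewrite -E sqrtr_sqr ger0_norm ?nrm_ge0.
  rewrite -[X in _ --> X]sqrtr0; apply: continuous_cvg; first exact: sqrt_continuous.
  rewrite [X in _ --> X](_ : 0 = 2 * (ip f f - ip f f)); last by rewrite subrr mulr0.
  by apply: cvgM; [exact: cvg_cst|apply: cvgB => //; exact: cvg_cst].
- move=> k f g Lf Lg cf cg.
  apply: (@cvg0_le _ _ _ _ (fun s => `|k| * nrm (fun z => f (F s z) - f z) +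
     nrm (fun z => g (F s z) - g z))).
    apply: nearW => s; rewrite ger0_norm ?nrm_ge0//.
    have L1 := sqintB (cflow_sqint s cF Lf) Lf.
    have L2 := sqintB (cflow_sqint s cF Lg) Lg.
    rewrite -nrmZ//; apply: le_trans (nrmD (sqintZ k L1) L2).
    rewrite le_eqVlt; apply/orP; left; apply/eqP; congr (l2nrm mu); apply/funext => z; ring.
  rewrite [X in _ --> X](_ : 0 = `|k| * 0 + 0); last by rewrite mulr0 addr0.
  by apply: cvgD => //; apply: cvgM => //; exact: cvg_cst.
- move=> f f_ Lf Lf_ cf_ f0; apply/cvgrPdist_le => e e0.
  have e3 : 0 < e / 3 by rewrite divr_gt0.
  have /(cvgr_lt _)/(_ _ e3) [n _ /(_ n (leqnn n)) /= hn] := f0.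
  have /(cvgr_lt _)/(_ _ e3) := cf_ n; apply: filterS => s /= hs.
  rewrite sub0r normrN ger0_norm ?nrm_ge0//.
  have L1 := cflow_sqint s cF Lf; have L2 := cflow_sqint s cF (Lf_ n).
  apply: (le_trans (nrmB_triangle L1 L2 Lf)).
  have h1 : nrm (fun z => f (F s z) - f_ n (F s z)) <= e / 3.
    by rewrite nrmBC; rewrite (cflow_nrm s cF (sqintB (Lf_ n) Lf)) ltW.
  have := nrmB_triangle L2 (Lf_ n) Lf; move: hn hs; lra.
Qed.

(** This stands for Xf = g in L^2, where X is the vector field generating F. *)
Definition sderiv F f g :=
  nrm (fun z => s^-1 * (f (F s z) - f z) - g z) @[s --> 0^'] --> (0 : R).

Lemma sqint_quot F s f : cflow F -> sq f -> sq (fun z => s^-1 * (f (F s z) - f z)).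
Proof. by move=> cF Lf; apply: sqintZ; exact: (sqintB (cflow_sqint s cF Lf) Lf). Qed.

Lemma sderiv_ip F f g p : cflow F -> sq f -> sq g -> sq p -> sderiv F f g ->
  s^-1 * (ip (fun z => f (F s z)) p - ip f p) @[s --> 0^'] --> ip g p.
Proof.
move=> cF Lf Lg Lp dfg; rewrite -[X in _ --> X]addr0.
have -> : (fun s : R => s^-1 * (ip (fun z => f (F s z)) p - ip f p)) =
    (fun s : R => ip g p + ip (fun z => s^-1 * (f (F s z) - f z) - g z) p).
  apply/funext => s; have L1 := cflow_sqint s cF Lf.
  have L2 := sqint_quot s cF Lf; have L3 := sqintB L1 Lf.
  by rewrite (ipBl L2 Lg Lp) (ipZl _ L3 Lp) (ipBl L1 Lf Lp) [RHS]addrC subrK.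
apply: cvgD; first exact: cvg_cst.
apply: (@cvg0_le _ _ _ _ (fun s => nrm (fun z => s^-1 * (f (F s z) - f z) - g z) * nrm p)).
  by apply: nearW => s; exact: (CauchySchwarz (sqintB (sqint_quot s cF Lf) Lg) Lp).
by rewrite -[X in _ --> X](mul0r (nrm p)); apply: cvgM => //; exact: cvg_cst.
Qed.

Lemma cvg_dnbhs0N (T : topologicalType) (f : R -> T) (l : T) :
  f s @[s --> 0^'] --> l -> f (- s) @[s --> 0^'] --> l.
Proof.
move=> fl; apply: (cvg_comp (fun s : R => - s) f _ fl) => A.
move=> /nbhs_ballP[e /= e0 eA]; apply/nbhs_ballP; exists e => //= x.
rewrite /ball/= sub0r normrN => xe x0; apply: eA; last by rewrite oppr_eq0.
by rewrite /ball/= sub0r opprK.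
Qed.

(* integration by parts *)
Lemma sderiv_ibp F f f' p p' : cflow F -> (forall s z, F s (F (- s) z) = z) ->
  sq f -> sq f' -> sq p -> sq p' -> sderiv F f f' -> sderiv F p p' ->
  ip f' p = - ip f p'.
Proof.
move=> cF FK Lf Lf' Lp Lp' df dp.
have c1 := sderiv_ip cF Lf Lf' Lp df.
have c2 : - ((- s)^-1 * (ip (fun z => p (F (- s) z)) f - ip p f)) @[s --> 0^'] --> - ip p' f.
  apply: cvgN; apply: (cvg_dnbhs0N (f := fun s => s^-1 * (ip (fun z => p (F s z)) f - ip p f))).
  exact: (sderiv_ip cF Lp Lp' Lf dp).
rewrite (ipC mu f p').
have E : (fun s : R => s^-1 * (ip (fun z => f (F s z)) p - ip f p)) =
    (fun s : R => - ((- s)^-1 * (ip (fun z => p (F (- s) z)) f - ip p f))).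
  apply/funext => s.
  have -> : ip (fun z => p (F (- s) z)) f = ip (fun z => f (F s z)) p.
    rewrite -(mpres_ip (cF.1 (- s)) (cflow_sqint s cF Lf) Lp) (ipC mu _ (p \o _)).
    by congr (l2ip mu _ _); apply/funext => z /=; rewrite FK.
  by rewrite invrN mulNr opprK (ipC mu p f).
by rewrite E in c1; exact: (cvg_unique _ c1 c2).
Qed.

Lemma sderiv_ext F f f' g g' : cflow F -> sq f -> sq f' -> sq g -> sq g' ->
  nrm (fun z => f z - f' z) = 0 -> nrm (fun z => g z - g' z) = 0 ->
  sderiv F f g -> sderiv F f' g'.
Proof.
move=> cF Lf Lf' Lg Lg' ff' gg' d.
apply: (@cvg0_le _ _ _ _ (fun s => nrm (fun z => s^-1 * (f (F s z) - f z) - g z))) => //.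
apply: nearW => s; rewrite ger0_norm ?nrm_ge0//.
have L1 := sqint_quot s cF Lf; have L2 := sqint_quot s cF Lf'.
have LB := sqintB Lf Lf'.
have LF : sq (fun z => f (F s z) - f' (F s z)) := cflow_sqint s cF LB.
have n1 : nrm (fun z => f (F s z) - f' (F s z)) = 0 by rewrite (cflow_nrm s cF LB).
have n0 : nrm (fun z => s^-1 * ((f (F s z) - f' (F s z)) - (f z - f' z)) - (g z - g' z)) <= 0.
  have LE := sqintB LF LB.
  apply: (le_trans (nrmB (sqintZ _ LE) (sqintB Lg Lg'))).
  rewrite nrmZ// gg' addr0 -(mulr0 `|s^-1|) ler_wpM2l//.
  by apply: (le_trans (nrmB LF LB)); rewrite n1 ff' addr0.
have := nrmB (sqintB L1 Lg) (sqintB (sqintZ s^-1 (sqintB LF LB)) (sqintB Lg Lg')).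
rewrite (_ : (fun z => _ - _) = (fun z => s^-1 * (f' (F s z) - f' z) - g' z)); last first.
  by apply/funext => z; ring.
by move/le_trans; apply; rewrite gerDl.
Qed.

(** The fields add up: f o F o G - f = (f o F - f) o G + (f o G - f). Composition with G s is an
    isometry, and replacing f1 o G_s by f1 costs nothing in the limit by [trans_cont]. *)
Lemma sderiv_comp F G f f1 f2 : cflow F -> cflow G -> sq f -> sq f1 -> sq f2 ->
  sderiv F f f1 -> sderiv G f f2 ->
  sderiv (fun s z => F s (G s z)) f (fun z => f1 z + f2 z).
Proof.
move=> cF cG Lf L1 L2 d1 d2.
apply: (@cvg0_le _ _ _ _ (fun s => nrm (fun z => s^-1 * (f (F s z) - f z) - f1 z) +
   nrm (fun z => f1 (G s z) - f1 z) + nrm (fun z => s^-1 * (f (G s z) - f z) - f2 z))); last first.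
  rewrite [X in _ --> X](_ : 0 = 0 + 0 + 0); last by rewrite !addr0.
  by apply: cvgD => //; apply: cvgD => //; exact: trans_cont.
apply: nearW => s; rewrite ger0_norm ?nrm_ge0//.
have La := sqintB (sqint_quot s cF Lf) L1.
have Lb := cflow_sqint s cG La.
have Lc := sqintB (cflow_sqint s cG L1) L1.
have Ld := sqintB (sqint_quot s cG Lf) L2.
rewrite -(cflow_nrm s cG La).
have h1 := nrmD Lb Lc.
apply: (@le_trans _ _ (nrm (fun z => (s^-1 * (f (F s (G s z)) - f (G s z)) - f1 (G s z)) +
  (f1 (G s z) - f1 z) + (s^-1 * (f (G s z) - f z) - f2 z)))).
  rewrite le_eqVlt; apply/orP; left; apply/eqP; congr (l2nrm mu); apply/funext => z; ring.
by apply: (le_trans (nrmD (sqintD Lb Lc) Ld)); rewrite lerD2r.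
Qed.

Lemma sderiv_mul F (m : Z -> R) (M : R) f g : cflow F ->
  measurable_fun [set: spacetimeM R] m ->
  (forall z, `|m z| <= M) -> (forall s z, m (F s z) = m z) -> sq f -> sq g ->
  sderiv F f g -> sderiv F (fun z => m z * f z) (fun z => m z * g z).
Proof.
move=> cF mm mM mF Lf Lg d.
apply: (@cvg0_le _ _ _ _ (fun s => M * nrm (fun z => s^-1 * (f (F s z) - f z) - g z))).
  apply: nearW => s; rewrite ger0_norm ?nrm_ge0//.
  have L := sqintB (sqint_quot s cF Lf) Lg.
  have -> : (fun z => s^-1 * (m (F s z) * f (F s z) - m z * f z) - m z * g z) =
     (fun z => m z * (s^-1 * (f (F s z) - f z) - g z)).
    by apply/funext => z; rewrite mF; ring.
  have M0 : 0 <= M by apply: le_trans (mM point); exact: normr_ge0.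
  have E := nrmZ M L; rewrite (ger0_norm M0) in E; rewrite -E.
  refine (nrm_le (sqint_bounded mm mM L) (sqintZ M L) _) => z.
  by rewrite !normrM ler_wpM2r// (ger0_norm M0).
by rewrite -[X in _ --> X](mulr0 M); apply: cvgM => //; exact: cvg_cst.
Qed.

(* The scalar functions [r |-> <f o F_r, phi>] are differentiable for test
   functions [phi], so the mean value theorem bounds the difference quotients
   uniformly, and test functions are dense. *)
Lemma weak_strong F f g : cflow F -> (forall z, F 0 z = z) ->
  sq f -> sq g ->
  (forall f0 f1 f2 f3 f4 : R -> R, csmooth f0 -> csmooth f1 -> csmooth f2 -> csmooth f3 ->
     csmooth f4 -> forall r : R, is_derive r 1
     (fun r => ip (fun z => f (F r z)) (tens f0 f1 f2 f3 f4))
     (ip (fun z => g (F r z)) (tens f0 f1 f2 f3 f4))) ->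
  sderiv F f g.
Proof.
move=> cF F0 Lf Lg H.
have arith (e PP PB N Nq nb x : R) : 0 <= e -> PP + PB <= e * Nq -> - (N * nb) <= PB ->
    Nq <= N + nb -> nb * (N + e + 1) < x -> 0 <= nb -> PP <= x + e * N.
  clear => *; nra.
pose good p := sq p /\ forall r : R, is_derive r 1
  (fun r => ip (fun z => f (F r z)) p) (ip (fun z => g (F r z)) p).
have dense : forall p, sq p -> forall e, 0 < e ->
    exists2 q, good q & nrm (fun z => q z - p z) < e.
  apply: tens_dense.
  - move=> f0 f1 f2 f3 f4 c0 c1 c2 c3 c4 e e0; exists (tens f0 f1 f2 f3 f4).
      by split; [exact: sqint_tens|exact: H].
    rewrite (_ : (fun z => _) = (fun=> 0)); last by apply/funext => z; rewrite subrr.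
    by rewrite /l2nrm ip0l sqrtr0.
  - move=> k p q Lp Lq ap aq e e0.
    have k0 : 0 < `|k| + 1 by rewrite ltr_wpDl.
    have [p' [Lp' gp'] hp] := ap (e / 2 / (`|k| + 1)) ltac:(by rewrite !divr_gt0).
    have [q' [Lq' gq'] hq] := aq (e / 2) ltac:(by rewrite divr_gt0).
    exists (fun z => k * p' z + q' z).
      split; first by apply: sqintD => //; exact: sqintZ.
      move=> r; have LfF s := cflow_sqint s cF Lf; have LgF s := cflow_sqint s cF Lg.
      have Lk := sqintZ k Lp'.
      rewrite (ipDr Lk Lq' (LgF r)) (ipZr _ Lp' (LgF r)).
      rewrite (_ : (fun r => _) = (fun r => k * ip (fun z => f (F r z)) p' + ip (fun z => f (F r z)) q')); last first.
        by apply/funext => s; rewrite (ipDr Lk Lq' (LfF s)) (ipZr _ Lp' (LfF s)).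
      have d1 := gp' r; have d2 := gq' r.
      apply: (is_derive_eq (is_deriveD (is_deriveM (is_derive_cst k r 1) d1) d2)).
      by rewrite scaler0 addr0.
    have L1 := sqintB Lp' Lp; have L2 := sqintB Lq' Lq.
    have -> : (fun z => k * p' z + q' z - (k * p z + q z)) =
      (fun z => k * (p' z - p z) + (q' z - q z)) by apply/funext => z; ring.
    apply: (le_lt_trans (nrmD (sqintZ k L1) L2)); rewrite nrmZ//.
    rewrite ltr_pdivlMr// in hp.
    have := nrm_ge0 mu (fun z => p' z - p z); have := normr_ge0 k; nra.
  - move=> p p_ Lp Lp_ ap p0 e e0.
    have e2 : 0 < e / 2 by rewrite divr_gt0.
    have /(cvgr_lt _)/(_ _ e2) [n _ /(_ n (leqnn n)) /= hn] := p0.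
    have [q gq hq] := ap n _ e2; exists q => //.
    by apply: (le_lt_trans (nrmB_triangle gq.1 (Lp_ n) Lp)); lra.
apply/cvgrPdist_le => e e0.
have /cvgrPdist_lt/(_ _ e0) [d /= d0 hd] := trans_cont cF Lg.
exists d => //= s sd s0; rewrite sub0r normrN ger0_norm ?nrm_ge0//.
set Psi := fun z => _.
have LPsi : sq Psi := sqintB (sqint_quot s cF Lf) Lg.
have hd' r : `|r| <= `|s| -> nrm (fun z => g (F r z) - g z) <= e.
  move=> rs; have [->|r0] := eqVneq r 0.
    rewrite (_ : (fun z => _) = (fun=> 0)); last by apply/funext => z; rewrite F0 subrr.
    by rewrite /l2nrm ip0l sqrtr0 ltW.
  have := hd r; rewrite /= !sub0r !normrN => /(_ (le_lt_trans rs _)).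
  by rewrite (ger0_norm (nrm_ge0 _ _)) => h; apply: ltW; apply: h => //; move: sd; rewrite /= sub0r normrN.
have key q : good q -> `|ip Psi q| <= e * nrm q.
  move=> [Lq dq].
  (* With the linear part removed, the derivative of k at r is <g o F_r - g, q>, at most e ||q|| for
     |r| <= |s|. *)
  pose k r := ip (fun z => f (F r z)) q - r * ip g q.
  have dk (r : R) : is_derive r 1 k (ip (fun z => g (F r z)) q - ip g q).
    have d1 := dq r.
    have := is_deriveB d1 (is_deriveM (is_derive_id r (1 : R)) (is_derive_cst (ip g q) r (1 : R))).
    move=> h; apply: (is_derive_eq h).
    by rewrite scaler0 add0r /GRing.scale/= mulr1.
  have ck : continuous k by exact: is_derive_continuous dk.
  have bk r : `|r| <= `|s| -> `|ip (fun z => g (F r z)) q - ip g q| <= e * nrm q.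
    move=> rs; have LgF := cflow_sqint r cF Lg.
    rewrite -(ipBl LgF Lg Lq); apply: (le_trans (CauchySchwarz (sqintB LgF Lg) Lq)).
    by rewrite ler_wpM2r ?nrm_ge0//; exact: hd'.
  have kE : ip Psi q = s^-1 * (k s - k 0).
    have LfF := cflow_sqint s cF Lf.
    rewrite /Psi (ipBl (sqint_quot s cF Lf) Lg Lq) (ipZl _ (sqintB LfF Lf) Lq) (ipBl LfF Lf Lq).
    rewrite /k mul0r subr0 (_ : (fun z => f (F 0 z)) = f); last by apply/funext => z; rewrite F0.
    by field.
  rewrite kE normrM normfV ler_pdivrMl ?normr_gt0//.
  have [sp|sn|s00] := ltrgtP s 0; last by rewrite s00 eqxx in s0.
    have [c] := MVT sp (fun x _ => dk x) (continuous_subspaceT ck).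
    rewrite in_itv/= => /andP[c1 c2] E.
    rewrite distrC E sub0r normrM normrN mulrC ler_wpM2l//; apply: bk.
    by rewrite !ltr0_norm// lerN2 ltW.
  have [c] := MVT sn (fun x _ => dk x) (continuous_subspaceT ck).
  rewrite in_itv/= => /andP[c1 c2] E.
  rewrite E subr0 normrM mulrC ler_wpM2l//; apply: bk.
  by rewrite !gtr0_norm// ltW.
(* Psi itself need not be an admissible q; an admissible one within x / (||Psi|| + e + 1) of it
   costs at most x, and x is arbitrary. Dividing by ||Psi|| then gives ||Psi|| <= e. *)
have key2 : ip Psi Psi <= e * nrm Psi.
  apply/ler_addgt0Pl => x x0.
  have N0 := nrm_ge0 mu Psi.
  have D0 : 0 < nrm Psi + e + 1 by rewrite ltr_wpDl// addr_ge0// ltW.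
  have [q gq hq] := dense _ LPsi (x / (nrm Psi + e + 1)) ltac:(by rewrite divr_gt0).
  rewrite ltr_pdivlMr// in hq.
  have hn : nrm q <= nrm Psi + nrm (fun z => q z - Psi z).
    rewrite (_ : q = fun z => Psi z + (q z - Psi z)); last by apply/funext => z; rewrite addrC subrK.
    rewrite (_ : (fun z => Psi z + (q z - Psi z) - Psi z) = (fun z => q z - Psi z)); last by apply/funext => z; rewrite addrAC subrr add0r.
    exact: (nrmD LPsi (sqintB gq.1 LPsi)).
  have h1 := key q gq.
  have LB := sqintB gq.1 LPsi.
  have h2 := CauchySchwarz LPsi LB.
  have E : ip Psi q = ip Psi Psi + ip Psi (fun z => q z - Psi z).
    by rewrite (ipBr gq.1 LPsi LPsi) [RHS]addrC subrK.
  move: h1 h2; rewrite E !ler_norml => /andP[_ h1] /andP[h2 _].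
  have h3 := nrm_ge0 mu (fun z => q z - Psi z).
  exact: (arith _ _ _ _ _ _ _ (ltW e0) h1 h2 hn hq h3).
have := nrm_ge0 mu Psi; rewrite le_eqVlt => /predU1P[<-|N0]; first exact: ltW.
by rewrite -(ler_pM2r N0) -expr2 nrm_sqr.
Qed.

End Flows.

(** * The flows of d_J, of Y and of the commuting fields X_i *)

Section ConcreteFlows.
Context {R : realType}.
Notation Z := (spacetime R).
Notation mu := (spacetime_measure R).

Definition flowJ (r : R) (z : Z) : Z :=
  (z.1, (coordJ z + r, coordA z, coordV z, coordQ z)).

(* flow of d_t - J d_A - A d_V - V d_Q *)
Definition flowY (s : R) (z : Z) : Z :=
  (z.1 + s, (coordJ z, coordA z - s * coordJ z,
    coordV z - s * coordA z + s ^+ 2 / 2 * coordJ z,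
    coordQ z - s * coordV z + s ^+ 2 / 2 * coordA z - s ^+ 3 / 6 * coordJ z)).

(* The vector fields d_A - t d_V + t^2/2 d_Q, d_V - t d_Q and d_Q commute with
   d_t - J d_A - A d_V - V d_Q and with d_J, and span d_A, d_V, d_Q over
   functions of t. *)
Definition fieldX (i : 'I_3) (t : R) : R * R * R :=
  if i == 0 :> nat then (1, - t, t ^+ 2 / 2)
  else if i == 1%N :> nat then (0, 1, - t) else (0, 0, 1).

(* translation by [r (al, nu, ka)] in the variables (A, V, Q) *)
Definition transx (w : R * R * R) (r : R) (z : Z) : Z :=
  (z.1, (coordJ z, coordA z + r * w.1.1, coordV z + r * w.1.2, coordQ z + r * w.2)).

Definition flowX (i : 'I_3) (r : R) (z : Z) : Z := transx (fieldX i z.1) r z.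

Lemma coord_eq (z z' : Z) : z.1 = z'.1 -> coordJ z = coordJ z' -> coordA z = coordA z' ->
  coordV z = coordV z' -> coordQ z = coordQ z' -> z = z'.
Proof.
case: z z' => [t [[[J A] V] Q]] [t' [[[J' A'] V'] Q']].
by rewrite /coordJ/coordA/coordV/coordQ/= => -> -> -> -> ->.
Qed.

Lemma coord_cvg (T : Type) (FF : set_system T) {FT : Filter FF} (f : T -> Z) (z : Z) :
  (f x).1 @[x --> FF] --> z.1 -> coordJ (f x) @[x --> FF] --> coordJ z ->
  coordA (f x) @[x --> FF] --> coordA z -> coordV (f x) @[x --> FF] --> coordV z ->
  coordQ (f x) @[x --> FF] --> coordQ z -> f x @[x --> FF] --> z.
Proof.
move=> h0 h1 h2 h3 h4.
rewrite (_ : f = (fun x => ((f x).1, (coordJ (f x), coordA (f x), coordV (f x), coordQ (f x))))); last first.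
  by apply/funext => x; exact: coord_eq.
rewrite [X in _ --> X](_ : z = (z.1, (coordJ z, coordA z, coordV z, coordQ z))); last exact: coord_eq.
exact: (cvg_pair h0 (cvg_pair (cvg_pair (cvg_pair h1 h2) h3) h4)).
Qed.

Lemma cvg0_eq (f : R -> R) (l : R) : continuous f -> f 0 = l -> f x @[x --> 0] --> l.
Proof. by move=> cf <-; exact: cf. Qed.

Lemma poly3_continuous (p0 p1 p2 p3 : R) :
  continuous (fun s : R => p0 + s * p1 + s ^+ 2 * p2 + s ^+ 3 * p3).
Proof.
move=> s; apply: cvgD; last by apply: cvgM; [exact: exprn_continuous|exact: cvg_cst].
apply: cvgD; last by apply: cvgM; [exact: exprn_continuous|exact: cvg_cst].
by apply: cvgD; [exact: cvg_cst|apply: cvgM; [exact: cvg_id|exact: cvg_cst]].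
Qed.

Lemma cvg_poly3 (f : R -> R) (l p1 p2 p3 : R) :
  (forall s, f s = l + s * p1 + s ^+ 2 * p2 + s ^+ 3 * p3) -> f x @[x --> 0] --> l.
Proof.
move=> fE; rewrite (_ : f = fun s => l + s * p1 + s ^+ 2 * p2 + s ^+ 3 * p3); last exact/funext.
by apply: cvg0_eq; [exact: poly3_continuous|ring].
Qed.

Lemma cflow_J : cflow flowJ.
Proof.
split=> [s|z].
  rewrite (_ : flowJ s = shear 0 s (fun=> 0) (fun=> 0) (fun=> 0)).
    exact: shear_mpresP.
  by apply/funext => z; rewrite /flowJ/shear !addr0.
apply: coord_cvg; try exact: cvg_cst.
apply: (@cvg_poly3 _ _ 1 0 0) => s; rewrite /coordJ/=; ring.
Qed.

Lemma cflow_Y : cflow flowY.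
Proof.
split=> [s|z].
  rewrite (_ : flowY s = shear s 0 (fun z => - s * coordJ z)
     (fun z => - s * coordA z + s ^+ 2 / 2 * coordJ z)
     (fun z => - s * coordV z + s ^+ 2 / 2 * coordA z - s ^+ 3 / 6 * coordJ z)); last first.
    apply/funext => z; rewrite /flowY/shear/=; congr (_, (_, _, _, _)); ring.
  apply: shear_mpresP.
  - by apply: measurable_funM => //; exact: measurable_coordJ.
  - apply: measurable_funD; apply: measurable_funM => //; first exact: measurable_coordA.
    exact: measurable_coordJ.
  - apply: measurable_funB; last by apply: measurable_funM => //; exact: measurable_coordJ.
    apply: measurable_funD; apply: measurable_funM => //; first exact: measurable_coordV.
    exact: measurable_coordA.
  - by move=> z z' [_ ->].
  - by move=> z z' [_ ->] ->.
  - by move=> z z' [_ ->] -> ->.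
apply: coord_cvg; rewrite /flowY.
- by apply: (@cvg_poly3 _ _ 1 0 0) => s /=; ring.
- exact: cvg_cst.
- apply: (@cvg_poly3 _ _ (- coordJ z) 0 0) => s; rewrite {1}/coordA/=; ring.
- apply: (@cvg_poly3 _ _ (- coordA z) (coordJ z / 2) 0) => s; rewrite {1}/coordV/=; by field.
- apply: (@cvg_poly3 _ _ (- coordV z) (coordA z / 2) (- coordJ z / 6)) => s; rewrite {1}/coordQ/=; by field.
Qed.

Lemma cflow_transx (w : R -> R * R * R) :
  measurable_fun setT (fun t => (w t).1.1) -> measurable_fun setT (fun t => (w t).1.2) ->
  measurable_fun setT (fun t => (w t).2) ->
  cflow (fun r z => transx (w z.1) r z).
Proof.
move=> m1 m2 m3; split=> [r|z].
  rewrite (_ : (fun z => _) = shear 0 0 (fun z => r * (w z.1).1.1)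
     (fun z => r * (w z.1).1.2) (fun z => r * (w z.1).2)); last first.
    by apply/funext => z; rewrite /transx/shear !addr0.
  have mt : measurable_fun [set: spacetimeM R] (fun z : Z => z.1) by exact: measurable_t.
  apply: shear_mpresP.
  - by apply: measurable_funM => //; exact: (measurableT_comp m1 mt).
  - by apply: measurable_funM => //; exact: (measurableT_comp m2 mt).
  - by apply: measurable_funM => //; exact: (measurableT_comp m3 mt).
  - by move=> z z' [-> _].
  - by move=> z z' [-> _] _.
  - by move=> z z' [-> _] _ _.
apply: coord_cvg; rewrite /transx; try exact: cvg_cst.
- apply: (@cvg_poly3 _ _ (w z.1).1.1 0 0) => s; rewrite {1}/coordA/=; ring.
- apply: (@cvg_poly3 _ _ (w z.1).1.2 0 0) => s; rewrite {1}/coordV/=; ring.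
- apply: (@cvg_poly3 _ _ (w z.1).2 0 0) => s; rewrite {1}/coordQ/=; ring.
Qed.

Lemma measurable_fieldX i : [/\ measurable_fun setT (fun t => (fieldX i t).1.1),
  measurable_fun setT (fun t => (fieldX i t).1.2) &
  measurable_fun setT (fun t => (fieldX i t).2)].
Proof.
rewrite /fieldX; case: (i == 0 :> nat); [|case: (i == 1%N :> nat)]; split => //=;
  by [apply: measurable_funM => //; exact: measurable_funX|exact: measurableT_comp].
Qed.

(* [flowX i] run with a speed depending on time *)
Lemma cflow_Xm i (m : R -> R) : measurable_fun setT m ->
  cflow (fun r z => flowX i (r * m z.1) z).
Proof.
move=> mm; have [m1 m2 m3] := measurable_fieldX i.
have := @cflow_transx (fun t => (m t * (fieldX i t).1.1, m t * (fieldX i t).1.2, m t * (fieldX i t).2)).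
move=> /(_ (measurable_funM mm m1) (measurable_funM mm m2) (measurable_funM mm m3)).
rewrite (_ : (fun r z => _) = (fun r z => flowX i (r * m z.1) z))//.
apply/funext => r; apply/funext => z; rewrite /flowX/transx/=.
by congr (_, (_, _ + _, _ + _, _ + _)); ring.
Qed.

Lemma cflow_X i : cflow (flowX i).
Proof.
have := @cflow_Xm i (fun=> 1) ltac:(by []).
by rewrite (_ : (fun r z => _) = flowX i)//; apply/funext => r; apply/funext => z; rewrite mulr1.
Qed.

Lemma flowX0 i z : flowX i 0 z = z.
Proof. by apply: coord_eq; rewrite /flowX/transx//= ?mul0r ?addr0. Qed.

Lemma flowXD i r s z : flowX i (r + s) z = flowX i r (flowX i s z).
Proof.
by apply: coord_eq; rewrite /flowX/transx/coordA/coordJ/coordV/coordQ//=; ring.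
Qed.

Lemma flowXC i j r s z : flowX i r (flowX j s z) = flowX j s (flowX i r z).
Proof.
by apply: coord_eq; rewrite /flowX/transx/coordA/coordJ/coordV/coordQ//=; ring.
Qed.

Lemma flowXJ i r s z : flowX i r (flowJ s z) = flowJ s (flowX i r z).
Proof.
by apply: coord_eq; rewrite /flowX/flowJ/transx/coordA/coordJ/coordV/coordQ//=; ring.
Qed.

Lemma flowXY i r s z : flowX i r (flowY s z) = flowY s (flowX i r z).
Proof.
apply: coord_eq; rewrite /flowX/flowY/transx/coordA/coordJ/coordV/coordQ/fieldX//=.
- by case: ifP => //= _; [ring|case: ifP => _ /=; ring].
- by case: ifP => //= _; [ring|case: ifP => _ /=; ring].
- by case: ifP => //= _; [field|case: ifP => _ /=; field].
Qed.

Lemma flowYK s z : flowY s (flowY (- s) z) = z.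
Proof.
apply: coord_eq; rewrite /flowY/coordA/coordJ/coordV/coordQ//=; by field.
Qed.

Lemma flowY0 z : flowY 0 z = z.
Proof.
apply: coord_eq; rewrite /flowY/coordA/coordJ/coordV/coordQ//=; by field.
Qed.

Lemma flowJK s z : flowJ s (flowJ (- s) z) = z.
Proof.
apply: coord_eq; rewrite /flowJ/coordA/coordJ/coordV/coordQ//=; ring.
Qed.

Lemma flowJ0 z : flowJ 0 z = z.
Proof.
by apply: coord_eq; rewrite /flowJ/coordA/coordJ/coordV/coordQ//=; ring.
Qed.

(* conjugating a translation in J by [flowY s] produces a translation in (A, V, Q) *)
Lemma flowYJ s r z :
  flowY s (flowJ r z) = flowJ r (transx (- s, s ^+ 2 / 2, - (s ^+ 3 / 6)) r (flowY s z)).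
Proof.
apply: coord_eq; rewrite /flowJ/flowY/transx/coordA/coordJ/coordV/coordQ//=; ring.
Qed.

(** Inverting the triangular system gives d_V = X_1 + t X_2 and d_A = X_0 + t X_1 + (t^2/2) X_2. The
    resulting coefficients are polynomials in s and t, all divisible by s. *)
Lemma transx_flowX s r z : let t := z.1 in
  transx (- s, s ^+ 2 / 2, - (s ^+ 3 / 6)) r z =
  flowX (inord 0) (r * - s) (flowX (inord 1) (r * (s ^+ 2 / 2 - t * s))
    (flowX (inord 2) (r * (- (s ^+ 3 / 6) + t * s ^+ 2 / 2 - t ^+ 2 * s / 2)) z)).
Proof.
move=> t; apply: coord_eq; rewrite /flowX/transx/coordA/coordJ/coordV/coordQ/fieldX !inordK//=; by field.
Qed.

Lemma measurable_flowX i : measurable_fun [set: measurableTypeR R * spacetimeM R]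
  (fun rz : R * Z => flowX i rz.1 rz.2 : spacetimeM R).
Proof.
have [m1 m2 m3] := measurable_fieldX i.
have mr : measurable_fun [set: measurableTypeR R * spacetimeM R] (fun rz : R * Z => rz.1 : measurableTypeR R).
  exact: measurable_fst.
have mz : measurable_fun [set: measurableTypeR R * spacetimeM R] (fun rz : R * Z => rz.2 : spacetimeM R).
  exact: measurable_snd.
have mt := measurableT_comp measurable_t mz.
apply: measurable_spacetime; rewrite /flowX/transx.
- exact: mt.
- exact: (measurableT_comp measurable_coordJ mz).
- apply: measurable_funD; first exact: (measurableT_comp measurable_coordA mz).
  by apply: measurable_funM => //; exact: (measurableT_comp m1 mt).
- apply: measurable_funD; first exact: (measurableT_comp measurable_coordV mz).
  by apply: measurable_funM => //; exact: (measurableT_comp m2 mt).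
- apply: measurable_funD; first exact: (measurableT_comp measurable_coordQ mz).
  by apply: measurable_funM => //; exact: (measurableT_comp m3 mt).
Qed.

End ConcreteFlows.

(** * Averages of L^2 functions over a family of measure-preserving maps *)

Section Averages.
Context {d1 d2 : measure_display} {W : measurableType d1} {Z : measurableType d2}
  {R : realType}.
Variables (nu : {sigma_finite_measure set W -> \bar R})
  (mu : {sigma_finite_measure set Z -> \bar R}) (X : W -> Z -> Z).
Hypothesis mX : measurable_fun setT (fun wz : W * Z => X wz.1 wz.2).
Hypothesis pX : forall w, mpres mu (X w).
Implicit Types (f g p : Z -> R) (k : W -> R).

(** Where the integral diverges, [Rintegral] returns the default value 0; linearity and similar
    identities are therefore stated as the vanishing of an [l2nrm]. *)
Definition conv k f (z : Z) : R := \int[nu]_r (k r * f (X r z)).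

Definition L1 k := measurable_fun setT k /\ nu.-integrable setT (EFin \o k).

Definition l1 k : R := \int[nu]_r `|k r|.

Lemma integral_EFin_fine d (T : measurableType d) (m : {measure set T -> \bar R}) (h : T -> R) :
  m.-integrable setT (EFin \o h) -> (\int[m]_z (h z)%:E = (\int[m]_z h z)%:E)%E.
Proof. by move=> ih; rewrite fineK//; exact: integrable_fin_num. Qed.

Lemma L1_abs k : L1 k -> L1 (fun r => `|k r|).
Proof.
move=> [mk ik]; split; first exact: measurableT_comp.
exact: integrable_norm.
Qed.

Lemma l1_ge0 k : 0 <= l1 k.
Proof. by apply: Rintegral_ge0. Qed.

Lemma measurable_action f : measurable_fun setT f ->
  measurable_fun setT (fun wz : W * Z => f (X wz.1 wz.2)).
Proof. by move=> mf; exact: (measurableT_comp mf mX). Qed.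

Lemma measurable_kernel k f : measurable_fun setT k -> measurable_fun setT f ->
  measurable_fun setT (fun wz : W * Z => k wz.1 * f (X wz.1 wz.2)).
Proof.
move=> mk mf; apply: measurable_funM; last exact: measurable_action.
exact: (measurableT_comp mk measurable_fst).
Qed.

Lemma conv_meas k f : measurable_fun setT k -> measurable_fun setT f ->
  measurable_fun setT (conv k f).
Proof.
move=> mk mf; have mH := measurable_kernel mk mf.
have mH' : measurable_fun setT (fun wz : W * Z => (k wz.1 * f (X wz.1 wz.2))%:E).
  exact/measurable_EFinP.
rewrite /conv /Rintegral.
apply: (measurableT_comp (fine_measurable measurableT)).
under eq_fun do rewrite integralE.
apply: emeasurable_funB.
- have := measurable_fun_fubini_tonelli_G (m1 := nu) _ (measurable_funepos mH') (fun _ => funepos_ge0 _ _).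
  by apply: eq_measurable_fun => z _; apply: eq_integral => r _; rewrite !funeposE.
- have := measurable_fun_fubini_tonelli_G (m1 := nu) _ (measurable_funeneg mH') (fun _ => funeneg_ge0 _ _).
  by apply: eq_measurable_fun => z _; apply: eq_integral => r _; rewrite !funenegE.
Qed.

(** For fixed r the inner integral of |f(X_r y) p(y)| is at most ||f|| ||p|| by Cauchy-Schwarz and
    isometry, and |k| is integrable in r. This is what makes Fubini available. *)
Lemma kernel_integrable k f p : L1 k -> sqint mu f -> sqint mu p ->
  (nu \x mu)%E.-integrable setT
    (fun wz : W * Z => (k wz.1 * f (X wz.1 wz.2) * p wz.2)%:E).
Proof.
move=> [mk ik] Lf Lp.
have mH : measurable_fun setT (fun wz : W * Z => (k wz.1 * f (X wz.1 wz.2) * p wz.2)%:E).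
  apply/measurable_EFinP; apply: measurable_funM.
    by apply: measurable_kernel => //; case: Lf.
  by apply: (measurableT_comp (sqint_meas Lp) measurable_snd).
apply: (@integrable12ltyP _ _ W Z R nu mu _ mH).2.
have h r : (\int[mu]_y `|(k r * f (X r y) * p y)%:E| <= (`|k r| * (l2nrm mu f * l2nrm mu p))%:E)%E.
  have LfX : sqint mu (fun z => `|f (X r z)|).
    by have := sqint_abs (mpres_sqint (pX r) Lf).
  have Lp' := sqint_abs Lp.
  rewrite (_ : (fun y => _) = (fun y => (`|k r|)%:E * (`|f (X r y)| * `|p y|)%:E)%E); last first.
    by apply/funext => y; rewrite abse_EFin !normrM -EFinM mulrA.
  rewrite integralZl//; last exact: sqint_mul.
  rewrite integral_EFin_fine//; last exact: sqint_mul.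
  rewrite -EFinM lee_fin ler_wpM2l//.
  have := CauchySchwarz LfX Lp'; rewrite ger0_norm; last first.
    by apply: Rintegral_ge0 => z _; rewrite mulr_ge0.
  move/le_trans; apply; rewrite !nrm_abs.
  by rewrite (mpres_nrm (pX r) Lf).
apply: (@le_lt_trans _ _ (\int[nu]_r (`|k r| * (l2nrm mu f * l2nrm mu p))%:E)%E).
  apply: ge0_le_integral => //.
  - by move=> r _; exact: integral_ge0.
  - apply: (measurable_fun_fubini_tonelli_F (m2 := mu) (abse \o (fun wz : W * Z => (k wz.1 * f (X wz.1 wz.2) * p wz.2)%:E))).
      exact: measurableT_comp.
    by move=> wz; exact: abse_ge0.
  - by apply/measurable_EFinP; apply: measurable_funM => //; exact: measurableT_comp.
  - by move=> r _; exact: h.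
have ia := integrable_norm ik.
under eq_integral do rewrite EFinM.
rewrite integralZr//; rewrite integral_EFin_fine// -EFinM; exact: ltry.
Qed.

Lemma conv_ae_integrable k f : L1 k -> sqint mu f ->
  forall p, sqint mu p ->
  {ae mu, forall z, p z != 0 -> nu.-integrable setT (fun r => (k r * f (X r z))%:E)}.
Proof.
move=> Lk Lf p Lp; have := ae_integrable2 (kernel_integrable Lk Lf Lp).
apply: filterS => z /= iz pz.
have := integrableZr measurableT (p z)^-1 iz.
apply: eq_integrable => // r _ /=.
by rewrite -EFinM mulfK.
Qed.

Lemma ip_conv_measurable k f p : L1 k -> sqint mu f -> sqint mu p ->
  (\int[mu]_z (conv k f z * p z)%:E = \int[nu]_r (k r * l2ip mu (fun z => f (X r z)) p)%:E)%E.
Proof.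
move=> Lk Lf Lp; have iH := kernel_integrable Lk Lf Lp.
have e1 := integral21_prod_meas1 iH; have e2 := integral12_prod_meas1 iH.
transitivity (\int[mu]_z fubini_G nu (fun wz : W * Z => (k wz.1 * f (X wz.1 wz.2) * p wz.2)%:E) z)%E.
  apply: ae_eq_integral => //.
  - apply/measurable_EFinP; apply: measurable_funM; last by case: Lp.
    by apply: conv_meas; [case: Lk|case: Lf].
  - exact: (measurable_fubini_G iH).
  - have := conv_ae_integrable Lk Lf Lp; apply: filterS => z iz _.
    rewrite /fubini_G/=; have [->|pz] := eqVneq (p z) 0.
      rewrite mulr0; under eq_integral do rewrite mulr0.
      by rewrite integral0.
    have {}iz := iz pz.
    rewrite -RintegralZr// /Rintegral fineK//.
    apply: integrable_fin_num => //; have := integrableZr measurableT (p z) iz.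
    by apply: eq_integrable => // r _; rewrite /= EFinM.
rewrite e1 -e2; apply: eq_integral => r _; rewrite /fubini_F/=.
have LfX : sqint mu (fun z => f (X r z)) := mpres_sqint (pX r) Lf.
rewrite (_ : (fun y => _) = (fun y => (k r)%:E * (f (X r y) * p y)%:E)%E); last first.
  by apply/funext => y; rewrite -EFinM mulrA.
have i1 := sqint_mul LfX Lp.
by rewrite integralZl// integral_EFin_fine// -EFinM.
Qed.

(** The working form of Fubini: testing against p turns identities between averages into identities
    between inner products for each fixed r. *)
Lemma ip_conv k f p : L1 k -> sqint mu f -> sqint mu p ->
  l2ip mu (conv k f) p = \int[nu]_r (k r * l2ip mu (fun z => f (X r z)) p).
Proof. by move=> Lk Lf Lp; rewrite /l2ip {1}/Rintegral ip_conv_measurable. Qed.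

Lemma integrable_ip_conv k f p : L1 k -> sqint mu f -> sqint mu p ->
  nu.-integrable setT (fun r => (k r * l2ip mu (fun z => f (X r z)) p)%:E).
Proof.
move=> Lk Lf Lp; have iH := kernel_integrable Lk Lf Lp.
have := integrable_fubini_F iH.
apply: eq_integrable => // r _; rewrite /fubini_F/=.
have LfX : sqint mu (fun z => f (X r z)) := mpres_sqint (pX r) Lf.
rewrite (_ : (fun y => _) = (fun y => (k r)%:E * (f (X r y) * p y)%:E)%E); last first.
  by apply/funext => y; rewrite -EFinM mulrA.
have i1 := sqint_mul LfX Lp.
by rewrite integralZl// integral_EFin_fine// -EFinM.
Qed.

(* Cauchy-Schwarz in [r] with weight [|k|] *)
Lemma conv_sqr_le k f z : L1 k -> measurable_fun setT f ->
  (((conv k f z) ^+ 2)%:E <= (l1 k + 1)%:E * \int[nu]_r (`|k r| * f (X r z) ^+ 2)%:E)%E.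
Proof.
move=> [mk ik] mf.
have mfz : measurable_fun setT (fun r => f (X r z)).
  exact: (measurableT_comp (measurable_action mf) (measurable_pair2 z)).
have ms : measurable_fun setT (fun r => Num.sqrt `|k r|).
  apply: (measurableT_comp _ (measurableT_comp (@normr_measurable _ setT) mk)).
  by apply: continuous_measurable_fun; exact: sqrt_continuous.
have ge0 r : (0 <= (`|k r| * f (X r z) ^+ 2)%:E)%E by rewrite lee_fin mulr_ge0 ?sqr_ge0.
(* If the integral on the right is infinite, the factor [l1 k + 1], being positive, keeps the right
   side infinite even when [l1 k] is 0. *)
have [a0|] := boolP ((\int[nu]_r (`|k r| * f (X r z) ^+ 2)%:E)%E \is a fin_num); last first.
  rewrite ge0_fin_numE ?integral_ge0// -leNgt leye_eq => /eqP ->.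
  by rewrite gt0_muley ?leey// lte_fin ltr_wpDl// l1_ge0.
have S1 : sqint nu (fun r => Num.sqrt `|k r|).
  split => //; have := integrable_norm ik; apply: eq_integrable => // r _.
  by rewrite /= sqr_sqrtr.
have S2 : sqint nu (fun r => Num.sqrt `|k r| * `|f (X r z)|).
  split; first by apply: measurable_funM => //; exact: measurableT_comp.
  apply/integrableP; split.
    by apply/measurable_EFinP/measurable_funX/measurable_funM => //; exact: measurableT_comp.
  rewrite (_ : (fun r => _) = (fun r => (`|k r| * f (X r z) ^+ 2)%:E)).
    by rewrite -ge0_fin_numE// integral_ge0.
  apply/funext => r; rewrite abse_EFin ger0_norm ?sqr_ge0// exprMn sqr_sqrtr//.
  by rewrite real_normK ?num_real.
have E1 : l2nrm nu (fun r => Num.sqrt `|k r|) ^+ 2 = l1 k.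
  by rewrite nrm_sqr /l2ip; apply: eq_Rintegral => r _; rewrite -expr2 sqr_sqrtr.
have E2 : (l2nrm nu (fun r => Num.sqrt `|k r| * `|f (X r z)|) ^+ 2)%:E =
    (\int[nu]_r (`|k r| * f (X r z) ^+ 2)%:E)%E.
  rewrite nrm_sqr /l2ip -[RHS](fineK a0); congr (_%:E); apply: eq_Rintegral => r _.
  by rewrite -expr2 exprMn sqr_sqrtr// real_normK ?num_real.
rewrite -E2 -EFinM lee_fin.
apply: (@le_trans _ _ (l1 k * l2nrm nu (fun r => Num.sqrt `|k r| * `|f (X r z)|) ^+ 2)); last first.
  by rewrite ler_wpM2r ?sqr_ge0// lerDl.
rewrite -E1 -exprMn -[leLHS]real_normK ?num_real// lerXn2r ?nnegrE ?mulr_ge0 ?nrm_ge0//.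
apply: le_trans (CauchySchwarz S1 S2); apply: le_trans (ler_norm _).
have -> : l2ip nu (fun r => Num.sqrt `|k r|) (fun r => Num.sqrt `|k r| * `|f (X r z)|) =
    \int[nu]_r `|k r * f (X r z)|.
  apply: eq_Rintegral => r _; rewrite mulrA -expr2 sqr_sqrtr// normrM//.
apply: le_normr_Rintegral => //.
apply: (le_integrable measurableT _ _ (sqint_mul S1 S2)).
  by apply/measurable_EFinP; exact: measurable_funM.
move=> r _; rewrite /= lee_fin mulrA -expr2 sqr_sqrtr// normrM [leRHS]ger0_norm ?mulr_ge0//.
Qed.

(** Integrate the pointwise bound [conv_sqr_le] in z and exchange the integrals; each f o X_r has
    the norm of f. *)
Lemma conv_sqint_nrm k f : L1 k -> sqint mu f ->
  sqint mu (conv k f) /\ l2nrm mu (conv k f) <= (l1 k + 1) * l2nrm mu f.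
Proof.
move=> Lk Lf; have [mk ik] := Lk; have mf := sqint_meas Lf.
have mC := conv_meas mk mf.
have mH : measurable_fun setT (fun wz : W * Z => (`|k wz.1| * f (X wz.1 wz.2) ^+ 2)%:E).
  apply/measurable_EFinP.
  apply: (@measurable_kernel (fun r => `|k r|) (fun z => f z ^+ 2)).
    exact: measurableT_comp.
  exact: measurable_funX.
have H0 (wz : W * Z) : (0 <= (`|k wz.1| * f (X wz.1 wz.2) ^+ 2)%:E)%E.
  by rewrite lee_fin mulr_ge0 ?sqr_ge0.
have ia := integrable_norm ik.
have A : (\int[mu]_z \int[nu]_r (`|k r| * f (X r z) ^+ 2)%:E = (l1 k * l2nrm mu f ^+ 2)%:E)%E.
  rewrite -(fubini_tonelli (m1 := nu) (m2 := mu) _ mH H0)/=.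
  transitivity (\int[nu]_r ((`|k r|)%:E * (l2nrm mu f ^+ 2)%:E))%E.
    apply: eq_integral => r _; under eq_integral do rewrite EFinM.
    have LfX : sqint mu (fun z => f (X r z)) := mpres_sqint (pX r) Lf.
    rewrite integralZl//; last by case: LfX.
    congr (_ * _)%E; rewrite integral_EFin_fine; last by case: LfX.
    congr (_%:E); rewrite -(mpres_nrm (pX r) Lf) nrm_sqr.
    by apply: eq_Rintegral => z _; rewrite expr2.
  by rewrite integralZr// integral_EFin_fine// -EFinM.
have B : (\int[mu]_z ((conv k f z) ^+ 2)%:E <= ((l1 k + 1) * (l1 k * l2nrm mu f ^+ 2))%:E)%E.
  apply: (@le_trans _ _ (\int[mu]_z ((l1 k + 1)%:E * \int[nu]_r (`|k r| * f (X r z) ^+ 2)%:E))%E).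
    apply: ge0_le_integral => //.
    - by move=> z _; rewrite lee_fin sqr_ge0.
    - by apply/measurable_EFinP; exact: measurable_funX.
    - apply: emeasurable_funM => //.
      exact: (measurable_fun_fubini_tonelli_G (m1 := nu) _ mH H0).
    - by move=> z _; exact: conv_sqr_le.
  rewrite ge0_integralZl//; last 3 first.
  - exact: (measurable_fun_fubini_tonelli_G (m1 := nu) _ mH H0).
  - by move=> z _; apply: integral_ge0 => r _; exact: (H0 (r, z)).
  - by rewrite lee_fin addr_ge0 ?l1_ge0.
  by rewrite A -EFinM.
have S : sqint mu (conv k f).
  split => //; apply/integrableP; split.
    by apply/measurable_EFinP; exact: measurable_funX.
  apply: le_lt_trans (ltry ((l1 k + 1) * (l1 k * l2nrm mu f ^+ 2))).
  apply: le_trans B; rewrite le_eqVlt; apply/orP; left; apply/eqP.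
  by apply: eq_integral => z _; rewrite abse_EFin ger0_norm ?sqr_ge0.
split => //.
have l0 := l1_ge0 k; have n0 := nrm_ge0 mu f.
rewrite -(@ler_pXn2r _ 2)// ?nnegrE ?mulr_ge0 ?nrm_ge0 ?addr_ge0//.
rewrite nrm_sqr -lee_fin; apply: (@le_trans _ _ ((l1 k + 1) * (l1 k * l2nrm mu f ^+ 2))%:E).
  apply: le_trans B; rewrite le_eqVlt; apply/orP; left; apply/eqP.
  rewrite /l2ip -integral_EFin_fine; last exact: sqint_mul.
  by apply: eq_integral => z _; rewrite expr2.
by rewrite lee_fin exprMn expr2 -mulrA ler_wpM2l ?addr_ge0// ler_wpM2r ?sqr_ge0// lerDl.
Qed.

Lemma conv_sqint k f : L1 k -> sqint mu f -> sqint mu (conv k f).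
Proof. by move=> Lk Lf; case: (conv_sqint_nrm Lk Lf). Qed.

Lemma conv_nrm k f : L1 k -> sqint mu f -> l2nrm mu (conv k f) <= (l1 k + 1) * l2nrm mu f.
Proof. by move=> Lk Lf; case: (conv_sqint_nrm Lk Lf). Qed.

Lemma nrm_eq0_ip f g : sqint mu f -> sqint mu g ->
  (forall p, sqint mu p -> l2ip mu f p = l2ip mu g p) -> l2nrm mu (fun z => f z - g z) = 0.
Proof.
move=> Lf Lg fg; apply: ip_eq0_nrm => [|p Lp]; first exact: sqintB.
by rewrite ipBl// fg// subrr.
Qed.

Lemma convD k f g a : L1 k -> sqint mu f -> sqint mu g ->
  l2nrm mu (fun z => conv k (fun z => a * f z + g z) z - (a * conv k f z + conv k g z)) = 0.
Proof.
move=> Lk Lf Lg.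
have Laf := sqintZ a Lf; have Cf := conv_sqint Lk Lf; have Cg := conv_sqint Lk Lg.
apply: nrm_eq0_ip; [exact: conv_sqint Lk (sqintD Laf Lg)|exact: sqintD (sqintZ a Cf) Cg|].
move=> p Lp; rewrite (ip_conv Lk (sqintD Laf Lg) Lp) (ipDl (sqintZ a Cf) Cg Lp) (ipZl _ Cf Lp).
rewrite (ip_conv Lk Lf Lp) (ip_conv Lk Lg Lp).
have i1 := integrable_ip_conv Lk Lf Lp; have i2 := integrable_ip_conv Lk Lg Lp.
have i3 := integrableZl measurableT a i1.
rewrite -RintegralZl// -RintegralD//.
apply: eq_Rintegral => r _.
have Lfr : sqint mu (fun z => f (X r z)) := mpres_sqint (pX r) Lf.
have Lgr : sqint mu (fun z => g (X r z)) := mpres_sqint (pX r) Lg.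
by rewrite (ipDl (sqintZ a Lfr) Lgr Lp) (ipZl _ Lfr Lp); ring.
Qed.

(* multiplication by an invariant bounded function commutes with averaging *)
Lemma conv_mul k f (m : Z -> R) (M : R) : L1 k -> sqint mu f -> measurable_fun setT m ->
  (forall z, `|m z| <= M) -> (forall r z, m (X r z) = m z) ->
  l2nrm mu (fun z => conv k (fun z => m z * f z) z - m z * conv k f z) = 0.
Proof.
move=> Lk Lf mm mM mX'.
have Lmf := sqint_bounded mm mM Lf; have Cf := conv_sqint Lk Lf.
apply: nrm_eq0_ip; [exact: conv_sqint Lk Lmf|exact: sqint_bounded mm mM Cf|].
move=> p Lp; have Lmp := sqint_bounded mm mM Lp.
rewrite (ip_conv Lk Lmf Lp) ip_mulA (ip_conv Lk Lf Lmp).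
apply: eq_Rintegral => r _; congr (_ * _); rewrite -ip_mulA.
by congr l2ip; apply/funext => z; rewrite mX'.
Qed.

End Averages.

(** * Cosine integrals over the frequencies in [0, 1] *)

Section CosineIntegrals.
Context {R : realType}.
Notation leb := (@lebesgue_measure R).
Implicit Types (P : {poly R}) (th x s : R).

(** The free phase [th] keeps the family stable under the two operations needed: derivation in x
    multiplies P by s and adds pi/2 to the phase, integration by parts replaces P by its derivative
    and subtracts pi/2. *)
Definition cosint P th x : R := \int[leb]_(s in `[0, 1]) (P.[s] * cos (s * x + th)).

Lemma is_derive_cosx P th s x :
  is_derive x 1 (fun x => P.[s] * cos (s * x + th)) (P.[s] * (s * cos (s * x + (th + pi / 2)))).
Proof.
have d1 : is_derive x 1 (fun x : R => s * x + th) s.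
  have := is_deriveD (is_deriveM (is_derive_cst s x (1 : R)) (is_derive_id x (1 : R))) (is_derive_cst th x (1 : R)).
  by move=> h; apply: (is_derive_eq h); rewrite scaler0 !addr0 /GRing.scale/= mulr1.
have d2 := @is_derive1_comp _ cos (fun x => s * x + th) x _ _ (is_derive_cos _) d1.
have := is_deriveM (is_derive_cst P.[s] x (1 : R)) d2.
move=> h; apply: (is_derive_eq h); rewrite scaler0 addr0 /GRing.scale/=.
by rewrite addrA cosDpihalf; congr (_ * _); rewrite mulrC.
Qed.

Lemma is_derive_coss th s x : is_derive s 1 (fun s => cos (s * x + (th - pi / 2))) (x * cos (s * x + th)).
Proof.
have d1 : is_derive s 1 (fun s : R => s * x + (th - pi / 2)) x.
  have := is_deriveD (is_deriveM (is_derive_id s (1 : R)) (is_derive_cst x s (1 : R))) (is_derive_cst (th - pi / 2) s (1 : R)).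
  by move=> h; apply: (is_derive_eq h); rewrite scaler0 addr0 add0r /GRing.scale/= mulr1.
have := @is_derive1_comp _ cos (fun s => s * x + (th - pi / 2)) s _ _ (is_derive_cos _) d1.
move=> h; apply: (is_derive_eq h); rewrite mulrC; congr (_ * _).
by rewrite -cosDpihalf -addrA subrK.
Qed.

Lemma cosint_continuous_arg P th x : continuous (fun s => P.[s] * cos (s * x + th)).
Proof.
move=> s; apply: cvgM.
  by have := is_derive_continuous (is_derive_poly P); apply.
have := is_derive_continuous (fun s => is_derive_coss (th + pi / 2) s x).
by rewrite addrK; apply.
Qed.

Lemma cosint_integrable P th x :
  leb.-integrable `[0, 1] (EFin \o (fun s => P.[s] * cos (s * x + th))).
Proof.
apply: continuous_compact_integrable; first exact: segment_compact.
by apply: continuous_subspaceT; exact: cosint_continuous_arg.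
Qed.

Definition pbound P (B : R) := forall s, 0 <= s <= 1 -> `|P.[s]| <= B.

Lemma pboundX n : pbound 'X^n 1.
Proof.
move=> s /andP[s0 s1]; rewrite hornerXn ger0_norm ?exprn_ge0//.
by rewrite exprn_ile1.
Qed.

Lemma pboundZ P B c : pbound P B -> pbound (c *: P) (`|c| * B).
Proof. by move=> h s hs; rewrite hornerZ normrM ler_wpM2l// h. Qed.

Lemma pboundB P Q B C : pbound P B -> pbound Q C -> pbound (P - Q) (B + C).
Proof.
move=> h h' s hs; rewrite hornerD hornerN; apply: (le_trans (ler_normB _ _)).
by apply: lerD; [exact: h|exact: h'].
Qed.

Lemma cosint_bound P th x B : pbound P B -> `|cosint P th x| <= B.
Proof.
move=> hB; apply: (le_trans (le_normr_Rintegral _ (cosint_integrable P th x))) => //.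
have c1 : leb.-integrable `[0, 1] (EFin \o (fun s => `|P.[s] * cos (s * x + th)|)).
  exact: integrable_norm (cosint_integrable P th x).
have c2 : leb.-integrable `[0, 1] (EFin \o (fun _ : R => B)).
  apply: continuous_compact_integrable; first exact: segment_compact.
  by apply: continuous_subspaceT => s; exact: cvg_cst.
apply: (@le_trans _ _ (\int[leb]_(s in `[0, 1]) B)).
  apply: le_Rintegral => // s; rewrite /= in_itv/= => hs.
  rewrite normrM -[leRHS]mulr1; apply: ler_pM => //; first exact: hB.
  by rewrite ler_norml cos_geN1 cos_le1.
rewrite Rintegral_cst// [fine _](_ : _ = 1) ?mulr1//.
have := lebesgue_measure_itv (`[0, 1] : interval R).
by rewrite /= lte_fin ltr01 -EFinB subr0 => h; rewrite [X in fine X]h.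
Qed.

Lemma is_derive_cosint P th x :
  is_derive x 1 (cosint P th) (cosint ('X * P) (th + pi / 2) x).
Proof.
have [B B0 hB] := @continuous_bounded _ (horner P) 0 1 ler01 (is_derive_continuous (is_derive_poly P)).
pose f (x s : R) := P.[s] * cos (s * x + th).
have dE y s : partial1of2 f y s = P.[s] * (s * cos (s * y + (th + pi / 2))).
  exact: is_derive1E (is_derive_cosx P th s y).
have xI : (`]x - 1, x + 1[%classic : set R) x.
  by rewrite /= in_itv/= ltrDl ltr01 andbT ltrBlDr ltrDl ltr01.
have h1 y : (`]x - 1, x + 1[%classic : set R) y -> leb.-integrable `[0, 1] (EFin \o f y).
  by move=> _; exact: cosint_integrable.
have h2 y s : (`]x - 1, x + 1[%classic : set R) y -> `[0, 1]%classic s -> derivable (f^~ s) y 1.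
  by move=> _ _; case: (is_derive_cosx P th s y).
have h3 : leb.-integrable `[0, 1] (EFin \o (fun _ : R => B)).
  apply: continuous_compact_integrable; first exact: segment_compact.
  by apply: continuous_subspaceT => s; exact: cvg_cst.
have h4 y s : (`]x - 1, x + 1[%classic : set R) y -> `[0, 1]%classic s -> `|partial1of2 f y s| <= B.
  move=> _; rewrite /= in_itv/= => hs; rewrite dE !normrM -[leRHS]mulr1; apply: ler_pM => //.
    exact: hB.
  case/andP: hs => s0 s1; rewrite (ger0_norm s0) -[leRHS]mulr1; apply: ler_pM => //.
  by rewrite ler_norml cos_geN1 cos_le1.
have mI : measurable (`[0, 1]%classic : set R) by [].
have D1 := @derivable_under_integral R _ _ leb f _ mI x (x - 1) (x + 1) xI h1 h2 (fun _ => B) (fun _ => B0) h3 h4.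
apply: DeriveDef; first exact: D1.
rewrite -derive1E (@differentiation_under_integral R _ _ leb f _ mI x (x - 1) (x + 1) xI h1 h2 (fun _ => B) (fun _ => B0) h3 h4).
apply: eq_Rintegral => s _; rewrite dE hornerM hornerX; ring.
Qed.

Lemma cosint_ibp P th x : x * cosint P th x =
  P.[1] * cos (x + (th - pi / 2)) - P.[0] * cos (th - pi / 2) - cosint P^`() (th - pi / 2) x.
Proof.
rewrite /cosint -RintegralZl//; last exact: cosint_integrable.
transitivity (\int[leb]_(s in `[0, 1]) (P.[s] * (x * cos (s * x + th)))).
  by apply: eq_Rintegral => s _; rewrite mulrCA.
have cc th' : continuous (fun s => cos (s * x + th')).
  have := is_derive_continuous (fun s => is_derive_coss (th' + pi / 2) s x).
  by rewrite addrK.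
have cP (Q : {poly R}) : continuous (fun s : R => Q.[s]) := is_derive_continuous (is_derive_poly Q).
rewrite (@Rintegration_by_parts _ (horner P) (fun s => cos (s * x + (th - pi / 2)))
  (horner P^`()) (fun s => x * cos (s * x + th)) 0 1)//.
- by rewrite mul1r mul0r add0r.
- exact: continuous_subspaceT.
- split => //.
  + by apply: cvg_at_right_filter; exact: cP.
  + by apply: cvg_at_left_filter; exact: cP.
- by move=> s _; exact: is_derive1E (is_derive_poly P s).
- by apply: continuous_subspaceT => s; apply: cvgM; [exact: cvg_cst|exact: cc].
- split => //.
  + by apply: cvg_at_right_filter; exact: cc.
  + by apply: cvg_at_left_filter; exact: cc.
- by move=> s _; exact: is_derive1E (is_derive_coss th s x).
Qed.

End CosineIntegrals.

(** * The Fejer kernel and its derivatives *)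

Section Kernel.
Context {R : realType}.
Notation leb := (@lebesgue_measure R).

(* [kap n] is the n-th derivative of the Fejer kernel (1 - cos x) / x^2, written
   as a Fourier integral over a bounded set of frequencies *)
Definition kap (n : nat) : R -> R :=
  cosint (('X^n : {poly R}) - 'X^(n.+1))%R (n%:R * (pi / 2)).

Lemma is_derive_kap n (x : R) : is_derive x 1 (kap n) (kap n.+1 x).
Proof.
have := is_derive_cosint ('X^n - 'X^(n.+1)) (n%:R * (pi / 2)) x.
have E : n.+1%:R * (pi / 2) = n%:R * (pi / 2) + pi / 2 :> R.
  by rewrite -natr1 mulrDl mul1r.
by rewrite /kap mulrBr -!exprS -E.
Qed.

Lemma kap_continuous n : continuous (kap n).
Proof. exact: is_derive_continuous (is_derive_kap n). Qed.

Lemma kap_meas n : measurable_fun setT (kap n).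
Proof. by apply: continuous_measurable_fun; exact: kap_continuous. Qed.

Definition kapc (n : nat) : R := 16 * 2 ^+ n.

Lemma kapc_ge0 n : 0 <= kapc n.
Proof. by rewrite /kapc mulr_ge0 ?exprn_ge0. Qed.

(** Decay comes from two integrations by parts. The first has no boundary term: P vanishes at 1, and
    at 0 either P vanishes (n > 0) or the cosine does (n = 0). The constants are quadratic in n, so
    they are absorbed by 2^n; geometric growth is what the iteration of the Carleman estimate
    tolerates. *)
Lemma kap_bound n x : `|kap n x| <= kapc n / (1 + x ^+ 2).
Proof.
have e0 : `|kap n x| <= 2.
  by rewrite /kap; apply: cosint_bound; apply: pboundB; exact: pboundX.
set P : {poly R} := 'X^n - 'X^(n.+1); set th := n%:R * (pi / 2 : R).
have P1 : P.[1] = 0 by rewrite /P hornerD hornerN !hornerXn !expr1n subrr.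
have P0c : P.[0] * cos (th - pi / 2) = 0.
  rewrite /P hornerD hornerN !hornerXn expr0n/= !expr0n subr0 /th.
  case: n {e0 P th P1} => [|n]; last by rewrite mul0r.
  by rewrite mul0r sub0r cosN cos_pihalf mulr0.
have dP : P^`() = n%:R *: 'X^(n.-1) - n.+1%:R *: 'X^n by rewrite /P derivB !derivXn !scaler_nat.
have ddP : P^`()^`() = (n%:R * n.-1%:R) *: 'X^(n.-2) - (n.+1%:R * n%:R) *: 'X^(n.-1).
  have sc k (q : {poly R}) : q *+ k = k%:R *: q by rewrite scaler_nat.
  by rewrite dP derivB !derivZ !derivXn (sc n.-1 'X^(n.-2)) (sc n 'X^(n.-1)) !scalerA.
have b1 : pbound P^`() (n%:R + n.+1%:R).
  rewrite dP; apply: pboundB.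
    by have := pboundZ n%:R (@pboundX R n.-1); rewrite mulr1 normr_nat.
  by have := pboundZ n.+1%:R (@pboundX R n); rewrite mulr1 normr_nat.
have b2 : pbound P^`()^`() (n%:R * n.-1%:R + n.+1%:R * n%:R).
  rewrite ddP; apply: pboundB.
    by have := pboundZ (n%:R * n.-1%:R) (@pboundX R n.-2); rewrite mulr1 normrM !normr_nat.
  by have := pboundZ (n.+1%:R * n%:R) (@pboundX R n.-1); rewrite mulr1 normrM !normr_nat.
have E : x * (x * kap n x) = - (P^`().[1] * cos (x + (th - pi / 2 - pi / 2)) -
    P^`().[0] * cos (th - pi / 2 - pi / 2) - cosint P^`()^`() (th - pi / 2 - pi / 2) x).
  rewrite {1}/kap -/P -/th cosint_ibp P1 mul0r P0c subr0 sub0r mulrN; congr (- _).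
  by rewrite cosint_ibp.
have c1 (y : R) : `|cos y| <= 1 by rewrite ler_norml cos_geN1 cos_le1.
have B1 s : 0 <= s <= 1 -> forall y, `|P^`().[s] * cos y| <= n%:R + n.+1%:R.
  by move=> hs y; rewrite normrM -[leRHS]mulr1; apply: ler_pM => //; exact: b1.
have e2 : `|x ^+ 2 * kap n x| <= 2 * (n%:R + n.+1%:R) + (n%:R * n.-1%:R + n.+1%:R * n%:R).
  rewrite expr2 -mulrA E normrN.
  apply: (le_trans (ler_normB _ _)); apply: lerD; last exact: cosint_bound.
  apply: (le_trans (ler_normB _ _)); rewrite mulr_natl mulr2n; apply: lerD; apply: B1;
    by rewrite ?lexx ?ler01.
have x0 : 0 < 1 + x ^+ 2 by rewrite ltr_pwDl// sqr_ge0.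
rewrite ler_pdivlMr// mulrDr mulr1 [X in _ + X](_ : _ = `|x ^+ 2 * kap n x|); last first.
  by rewrite normrM (ger0_norm (sqr_ge0 _)) mulrC.
apply: (le_trans (lerD e0 e2)).
have -> : n.+1%:R = n%:R + 1 :> R by rewrite natr1.
have hn1 : n.-1%:R <= n%:R :> R by rewrite ler_nat leq_pred.
have n0 : 0 <= n%:R :> R by [].
(* This is where the polynomial growth in n is traded for 2^n. *)
have key : (n%:R + 1) ^+ 2 <= 4 * 2 ^+ n :> R.
  rewrite natr1 -natrX -(natrX _ 2 n) -natrM ler_nat.
  elim: n {e0 P th P1 P0c dP ddP b1 b2 E B1 e2 hn1 n0} => [//|[//|[//|n]] IH].
  rewrite (expnS 2); nia.
rewrite /kapc; have : n%:R * n.-1%:R <= n%:R * n%:R :> R by rewrite ler_wpM2l.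
nra.
Qed.

(** The two integrations by parts are exact for P = 1 - s. This closed form shows that the kernel is
    nonnegative and vanishes only on a null set. *)
Lemma kap0E x : x ^+ 2 * kap 0 x = 1 - cos x.
Proof.
rewrite /kap mul0r expr0 expr1 expr2 -mulrA cosint_ibp.
rewrite derivB derivC derivX !hornerE subrr mul0r sub0r.
rewrite cosN cos_pihalf mulr0 !oppr0 !sub0r.
have -> : cosint (- 1) (- (pi / 2)) x = - cosint 1 (- (pi / 2)) x.
  rewrite /cosint -[RHS]mulN1r -RintegralZl//; last exact: cosint_integrable.
  by apply: eq_Rintegral => s _; rewrite hornerN mulN1r mulNr.
rewrite opprK cosint_ibp -polyC1 !hornerC derivC !mul1r.
have -> : cosint 0%:P (- (pi / 2) - pi / 2) x = 0.
  rewrite /cosint; under eq_Rintegral do rewrite hornerC mul0r.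
  by rewrite Rintegral_cst// mul0r.
have -> : - (pi / 2) - pi / 2 = - pi :> R by field.
have -> : cos (x - pi) = - cos x by rewrite cosB cospi sinpi mulr0 addr0 mulrN1.
by rewrite subr0 cosN cospi opprK addrC.
Qed.

Lemma kap0_ge0 x : 0 <= kap 0 x.
Proof.
have [->|x0] := eqVneq x 0.
  apply: Rintegral_ge0 => s; rewrite /= in_itv/= => /andP[s0 s1].
  by rewrite mulr0 mul0r addr0 cos0 mulr1 !hornerE subr_ge0.
have x2 : 0 < x ^+ 2 by rewrite exprn_even_gt0.
by rewrite -(pmulr_rge0 _ x2) kap0E subr_ge0 cos_le1.
Qed.

End Kernel.

(** * Integrable majorants, Taylor expansion and mass of the kernel *)

Section KernelBounds.
Context {R : realType}.
Notation leb := (@lebesgue_measure R).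

Definition env (x : R) : R := (1 + x ^+ 2)^-1.

Lemma env_gt0 x : 0 < env x.
Proof. by rewrite /env invr_gt0 ltr_pwDl// sqr_ge0. Qed.

Lemma env_meas : measurable_fun setT env.
Proof.
by apply: continuous_measurable_fun; exact: (@continuous_oneDsqrV R).
Qed.

Lemma env_L1 : L1 leb env.
Proof.
split; first exact: env_meas.
apply/integrableP; split; first by apply/measurable_EFinP; exact: env_meas.
rewrite (_ : (fun x => _) = (fun x => ((oneDsqr x)^-1)%:E)); last first.
  by apply/funext => x; rewrite /= ger0_norm// ltW// env_gt0.
rewrite (@ge0_symfun_integralT R (fun x => (oneDsqr x)^-1)).
- by rewrite -[[set x | 0 <= x]]/[set x | 0 <= x]; rewrite (_ : [set x | _] = `[0, +oo[%classic) ?integral0y_oneDsqr ?ltry//; apply/seteqP; split => x /=; rewrite in_itv/= andbT.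
- by move=> x; exact: ltW (env_gt0 x).
- exact: (@continuous_oneDsqrV R).
- by move=> x; rewrite /= /oneDsqr sqrrN.
Qed.

Lemma L1Z (k : R -> R) c : L1 leb k -> L1 leb (fun r => c * k r).
Proof.
move=> [mk ik]; split; first exact: measurable_funM.
have := integrableZl measurableT c ik.
by apply: eq_integrable.
Qed.

Lemma L1_le (k h : R -> R) : measurable_fun setT k -> (forall x, `|k x| <= h x) ->
  L1 leb h -> L1 leb k.
Proof.
move=> mk kh [mh ih]; split => //.
apply: (le_integrable measurableT _ _ ih); first exact/measurable_EFinP.
by move=> x _; rewrite /= lee_fin; apply: le_trans (kh x) (ler_norm _).
Qed.

Lemma kap_env n x : `|kap n x| <= kapc n * env x.
Proof. exact: kap_bound. Qed.

Lemma kap_L1 n : L1 leb (kap n : R -> R).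
Proof. exact: L1_le (kap_meas n) (kap_env n) (L1Z _ env_L1). Qed.

Lemma kap_l1 n : l1 leb (kap n : R -> R) <= kapc n * l1 leb env.
Proof.
rewrite /l1 -RintegralZl//; last exact: (L1_abs env_L1).2.
apply: le_Rintegral => //.
- exact: (L1_abs (kap_L1 n)).2.
- exact: (L1Z (kapc n) (L1_abs env_L1)).2.
- by move=> x _; rewrite (ger0_norm (ltW (env_gt0 x))); exact: kap_env.
Qed.

Lemma MVT_abs (f df : R -> R) : (forall x : R, is_derive x 1 f (df x)) ->
  forall x y, exists2 c, `|c - x| <= `|y - x| & f y - f x = df c * (y - x).
Proof.
move=> dd x y; have cf := is_derive_continuous dd.
case: (ltP x y) => [xy|yx].
  have [c] := MVT xy (fun z _ => dd z) (continuous_subspaceT cf).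
  rewrite in_itv/= => /andP[c1 c2] E; exists c => //.
  by rewrite ?ger0_norm ?subr_ge0; lra.
have [yx'|xy] := ltP y x; last first.
  have -> : y = x by apply/le_anti/andP; split.
  by exists x; rewrite ?lexx// !subrr mulr0.
have [c] := MVT yx' (fun z _ => dd z) (continuous_subspaceT cf).
rewrite in_itv/= => /andP[c1 c2] E; exists c; last first.
  by rewrite -(opprB (f x)) E -(opprB x y) mulrN.
by rewrite ?ler0_norm ?subr_le0; lra.
Qed.

(** Two applications of the mean value theorem leave the second derivative at a point within 1 of r;
    over such a distance [env] grows at most by a factor 3. *)
Lemma kap_taylor n (r h : R) : `|h| <= 1 ->
  `|kap n (r - h) - kap n r + h * kap n.+1 r| <= h ^+ 2 * (3 * kapc n.+2 * env r).
Proof.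
move=> h1.
have [c hc Ec] := MVT_abs (is_derive_kap n) r (r - h).
have [c' hc' Ec'] := MVT_abs (is_derive_kap n.+1) r c.
have eh : r - h - r = - h by rewrite addrAC subrr add0r.
rewrite eh normrN in hc; rewrite eh in Ec.
have -> : kap n (r - h) - kap n r + h * kap n.+1 r = - h * ((c - r) * kap n.+2 c').
  have -> : (c - r) * kap n.+2 c' = kap n.+1 c - kap n.+1 r by rewrite Ec' mulrC.
  by rewrite Ec; ring.
have q0 (y : R) : 0 < 1 + y ^+ 2 by rewrite ltr_pwDl// sqr_ge0.
have D : env c' <= 3 * env r.
  rewrite /env -[leLHS]mul1r ler_pdivrMr// mulrAC ler_pdivlMr// mul1r.
  have : `|c' - r| <= 1 by apply: (le_trans hc'); apply: (le_trans hc).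
  rewrite ler_norml => /andP[q1 q2].
  have := sqr_ge0 (2 * c' - r); nra.
have B : `|kap n.+2 c'| <= 3 * kapc n.+2 * env r.
  apply: (le_trans (kap_env _ _)); rewrite [leRHS](_ : _ = kapc n.+2 * (3 * env r)); last by ring.
  by rewrite ler_wpM2l ?kapc_ge0.
rewrite normrM normrN normrM -[h ^+ 2]real_normK ?num_real// expr2 -[leRHS]mulrA.
by apply: ler_pM => //; rewrite ?mulr_ge0//; exact: ler_pM.
Qed.

(** A zero integral would make the nonnegative kernel vanish almost everywhere, hence cos x = 1
    almost everywhere on ]0, pi[. *)
Lemma kap0_int_gt0 : 0 < \int[leb]_r (kap 0 r : R).
Proof.
rewrite lt_neqAle Rintegral_ge0 ?andbT; last by move=> x _; exact: kap0_ge0.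
apply/negP => /eqP h0.
have [mk ik] := @kap_L1 0.
have h1 : (\int[leb]_x `|(EFin \o kap 0) x| = 0)%E.
  have : (\int[leb]_x (kap 0 x)%:E = 0)%E by rewrite integral_EFin_fine// -h0.
  by move=> <-; apply: eq_integral => x _; rewrite /= ger0_norm// kap0_ge0.
have [N [mN N0 sN]] := (ae_eq_integral_abs leb measurableT (measurable_int leb ik)).1 h1.
have : (leb `]0%R, pi[%classic <= 0)%E.
  rewrite -N0; apply: le_measure; rewrite ?inE// => x; rewrite /= in_itv/= => /andP[x0 xp].
  apply: sN => /= /(_ I) [] /eqP; apply/negP.
  have /(congr1 (fun z => z == 0)) := kap0E x.
  rewrite mulf_eq0 sqrf_eq0 gt_eqF//= => ->.
  apply/negP; rewrite subr_eq0 => /eqP; rewrite -[LHS](@cos0 R) => /cos_inj.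
  rewrite !in_itv/= lexx pi_ge0 (ltW x0) (ltW xp) => /(_ erefl erefl) x00.
  by rewrite -x00 ltxx in x0.
rewrite (lebesgue_measure_itv (`]0, pi[ : interval R))/= lte_fin pi_gt0 -EFinB subr0 lee_fin.
by rewrite leNgt pi_gt0.
Qed.

End KernelBounds.

Lemma ae_imply3 {R : realType} d (Z : measurableType d)
    (mu : {measure set Z -> \bar R}) (P Q S T : Z -> Prop) :
  {ae mu, forall z, P z} -> {ae mu, forall z, Q z} -> {ae mu, forall z, S z} ->
  (forall z, P z -> Q z -> S z -> T z) -> {ae mu, forall z, T z}.
Proof. by move=> p q r h; apply: filterS3 p q r. Qed.

(** * Averaging along the fields X_i *)

Section Smoothing.
Context {R : realType}.
Notation Z := (spacetime R).
Notation mu := (spacetime_measure R).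
Notation leb := (@lebesgue_measure R).
Notation sq := (sqint mu).
Notation ip := (l2ip mu).
Notation nrm := (l2nrm mu).
Variables (i : 'I_3) (e : R).
Implicit Types (f g : Z -> R) (k : R -> R).

(** The scale e is put into the flow rather than into the kernel, so that the kernel and its L^1
    norm do not depend on e. *)
Definition Xe (r : R) (z : Z) : Z := flowX i (e * r) z.

Definition cv k f : Z -> R := conv leb Xe k f.

Let mXe : measurable_fun [set: measurableTypeR R * spacetimeM R]
  (fun rz => Xe rz.1 rz.2 : spacetimeM R).
Proof.
have m2 : measurable_fun [set: measurableTypeR R * spacetimeM R]
    (fun rz => (e * rz.1, rz.2) : measurableTypeR R * spacetimeM R).
  apply: measurable_fun_pair; last exact: measurable_snd.
  by apply: measurable_funM => //; exact: measurable_fst.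
exact: (measurableT_comp (measurable_flowX i) m2).
Qed.

(* [mXe] at the measurable structures expected by the lemmas about [conv] *)
Let mXe' := ltac:(let t := type of (@conv_sqint _ _ _ _ _ leb mu Xe) in
  match t with ?A -> _ => exact (mXe : A) end).

Let pXe : forall r, mpres mu (Xe r).
Proof. by move=> r; exact: (cflow_X i).1. Qed.

Lemma cv_sqint k f : L1 leb k -> sq f -> sq (cv k f).
Proof. by move=> Lk Lf; exact: (conv_sqint mXe' pXe Lk Lf). Qed.

Lemma cv_nrm k f : L1 leb k -> sq f -> nrm (cv k f) <= (l1 leb k + 1) * nrm f.
Proof. by move=> Lk Lf; exact: (conv_nrm mXe' pXe Lk Lf). Qed.

Lemma ip_cv k f p : L1 leb k -> sq f -> sq p ->
  ip (cv k f) p = \int[leb]_r (k r * ip (fun z => f (Xe r z)) p).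
Proof. by move=> Lk Lf Lp; exact: (ip_conv mXe' pXe Lk Lf Lp). Qed.

Lemma cv_ip_integrable k f p : L1 leb k -> sq f -> sq p ->
  leb.-integrable setT (EFin \o (fun r => k r * ip (fun z => f (Xe r z)) p)).
Proof. by move=> Lk Lf Lp; exact: (integrable_ip_conv mXe' pXe Lk Lf Lp). Qed.

Lemma cv_lin k f g a : L1 leb k -> sq f -> sq g ->
  nrm (fun z => cv k (fun z => a * f z + g z) z - (a * cv k f z + cv k g z)) = 0.
Proof. by move=> Lk Lf Lg; exact: (convD mXe' pXe a Lk Lf Lg). Qed.

Lemma cv_mul k f (m : Z -> R) (M : R) : L1 leb k -> sq f ->
  measurable_fun [set: spacetimeM R] m ->
  (forall z, `|m z| <= M) -> (forall r z, m (Xe r z) = m z) ->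
  nrm (fun z => cv k (fun z => m z * f z) z - m z * cv k f z) = 0.
Proof. by move=> Lk Lf mm mM mX'; exact: (conv_mul mXe' pXe Lk Lf mm mM mX'). Qed.

(** When the flows commute, the difference quotient of the average is the average of the difference
    quotient, and averaging is bounded on L^2. *)
Lemma cv_sderiv F k f g : cflow F -> (forall s r z, F s (Xe r z) = Xe r (F s z)) ->
  L1 leb k -> sq f -> sq g -> sderiv F f g -> sderiv F (cv k f) (cv k g).
Proof.
move=> cF FX Lk Lf Lg d; rewrite /sderiv.
apply: (@cvg0_le _ _ _ _ _ (fun s : R => (l1 leb k + 1) *
  nrm (fun z => s^-1 * (f (F s z) - f z) - g z))); last first.
  rewrite [X in _ --> X](_ : 0 = (l1 leb k + 1) * 0); last by rewrite mulr0.
  by apply: cvgM => //; exact: cvg_cst.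
apply: nearW => s; rewrite ger0_norm ?nrm_ge0//.
have LfF := cflow_sqint s cF Lf.
have LB := sqintB LfF Lf.
have LD := sqintB (sqint_quot s cF Lf) Lg.
have Cf := cv_sqint Lk Lf; have Cg := cv_sqint Lk Lg; have CfF := cv_sqint Lk LfF.
apply: le_trans (cv_nrm Lk LD).
have E : (fun z => cv k f (F s z)) = cv k (fun z => f (F s z)).
  by apply/funext => z; apply: eq_Rintegral => r _; rewrite FX.
rewrite (_ : (fun z => _) = (fun z => s^-1 * (cv k (fun z => f (F s z)) z - cv k f z) - cv k g z)); last first.
  by apply/funext => z; rewrite -E.
have CB := sqintB CfF Cf; have CQ := sqintZ s^-1 CB.
have C1 := sqintB CQ Cg; have C2 := cv_sqint Lk LD.
suff h : nrm (fun z => (s^-1 * (cv k (fun z => f (F s z)) z - cv k f z) - cv k g z) -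
    cv k (fun z => s^-1 * (f (F s z) - f z) - g z) z) = 0.
  have := nrmD (sqintB C1 C2) C2; rewrite h add0r; apply: le_trans.
  rewrite le_eqVlt; apply/orP; left; apply/eqP; congr (l2nrm mu); apply/funext => z.
  by rewrite subrK.
apply: (nrm_eq0_ip C1 C2) => p Lp.
rewrite (ipBl CQ Cg Lp) (ipZl _ CB Lp) (ipBl CfF Cf Lp) !ip_cv//.
have i1 := integrable_ip_conv mXe' pXe Lk Lf Lp.
have i2 := integrable_ip_conv mXe' pXe Lk LfF Lp.
have i3 := integrable_ip_conv mXe' pXe Lk Lg Lp.
rewrite -(RintegralB _ i2 i1)//.
have i4 : leb.-integrable setT (EFin \o (fun r => k r * ip (fun z => f (F s (Xe r z))) p - k r * ip (fun z => f (Xe r z)) p)).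
  by have := integrableB measurableT i2 i1.
rewrite -(RintegralZl s^-1 _ i4)//.
have i5 : leb.-integrable setT (EFin \o (fun r => s^-1 * (k r * ip (fun z => f (F s (Xe r z))) p - k r * ip (fun z => f (Xe r z)) p))).
  by have := integrableZl measurableT s^-1 i4.
rewrite -(RintegralB _ i5 i3)//; apply: eq_Rintegral => r _.
have Lfr : sq (fun z => f (Xe r z)) := mpres_sqint (pXe r) Lf.
have Lgr : sq (fun z => g (Xe r z)) := mpres_sqint (pXe r) Lg.
have LfFr : sq (fun z => f (F s (Xe r z))) := mpres_sqint (pXe r) LfF.
by rewrite (ipBl (sqintZ _ (sqintB LfFr Lfr)) Lgr Lp) (ipZl _ (sqintB LfFr Lfr) Lp) (ipBl LfFr Lfr Lp); ring.
Qed.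

Lemma cv_ae_integrable k f : L1 leb k -> sq f ->
  {ae mu, forall z, leb.-integrable setT (fun r => (k r * f (Xe r z))%:E)}.
Proof.
move=> Lk Lf.
have h n := conv_ae_integrable mXe' pXe Lk Lf
  (sqint_box (cube_ocitv n) (cube_ocitv n) (cube_ocitv n) (cube_ocitv n) (cube_ocitv n)).
have /ae_foralln := h; apply: filterS => z hz.
have all : \forall n \near \oo, box (cube n) (cube n) (cube n) (cube n) (cube n) z.
  near=> n; split; near: n; exact: cube_in.
have [n _ /(_ n (leqnn n)) zn] := all.
by apply: (hz n); rewrite indicE mem_set// oner_neq0.
Unshelve. all: by end_near. Qed.

Lemma Rintegral_shift (h : R -> R) c : measurable_fun [set: measurableTypeR R] h ->
  \int[leb]_r h (r + c) = \int[leb]_r h r.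
Proof.
move=> mh; rewrite /Rintegral; congr fine.
have pS : mpres leb (fun y : R => y + c).
  split; first exact: measurable_funD.
  by move=> A mA; exact: lebesgue_shift.
have mE : measurable_fun [set: measurableTypeR R] (EFin \o h) by exact/measurable_EFinP.
exact: (mpres_integral pS mE).
Qed.

(* Averaging along [flowX i] makes a function differentiable along that flow;
   the second order Taylor expansion of the kernel bounds the error. *)
Lemma cv_sderivX (T M : R) (m : R -> R) n f : e != 0 -> measurable_fun setT m ->
  (forall t, 0 < t < T -> `|m t| <= M) -> sq f ->
  (forall z, ~ (0 < z.1 < T) -> f z = 0) ->
  sderiv (fun s z => flowX i (s * m z.1) z) (cv (kap n) f)
    (fun z => - (m z.1 / e) * cv (kap n.+1) f z).
Proof.
move=> e0 mm mM Lf f0.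
set F := fun s z => _.
have cF : cflow F := cflow_Xm i mm.
have Lk0 := @kap_L1 R n; have Lk1 := @kap_L1 R n.+1.
pose E r : R := 3 * kapc n.+2 * env r.
have LE : L1 leb E := L1Z _ env_L1.
have C0 := cv_sqint Lk0 Lf; have C1 := cv_sqint Lk1 Lf.
have Lfa := sqint_abs Lf; have CE := cv_sqint LE Lfa.
have out k z : ~ (0 < z.1 < T) -> cv k f z = 0.
  move=> hz; rewrite /cv /conv; under eq_Rintegral do rewrite f0 ?mulr0//.
  by rewrite Rintegral_cst// mul0r.
have M0 : 0 <= Num.max M 0 by rewrite le_max lexx orbT.
set K := Num.max M 0 in M0.
have mK t : 0 < t < T -> `|m t| <= K.
  by move=> ht; apply: (le_trans (mM _ ht)); rewrite le_max lexx.
(* The multiplier is bounded only for times in ]0, T[. Cutting it to 0 elsewhere changes nothing,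
   since the averages of f vanish there. *)
pose m' (z : Z) := if (0 < z.1) && (z.1 < T) then m z.1 / e else 0.
have mm' : measurable_fun [set: spacetimeM R] m'.
  rewrite /m'; apply: measurable_fun_ifT => //.
  - apply: measurable_and; apply: measurable_fun_ltr => //; exact: measurable_t.
  - by apply: measurable_funM => //; exact: (measurableT_comp mm measurable_t).
have mM' z : `|m' z| <= K / `|e|.
  rewrite /m'; case: ifP => h; last by rewrite normr0 divr_ge0.
  by rewrite normrM normfV ler_wpM2r ?invr_ge0//; exact: mK.
have L1C := sqint_bounded mm' mM' C1.
have EC : (fun z => - (m z.1 / e) * cv (kap n.+1) f z) = (fun z => - (m' z * cv (kap n.+1) f z)).
  apply/funext => z; rewrite /m'; case: ifP => [_|/negbT h]; first by rewrite mulNr.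
  by rewrite out ?mulr0 ?oppr0//; move/negP: h.
rewrite EC; have LG := sqintN L1C.
have Eout z : ~ (0 < z.1 < T) -> cv E (fun z => `|f z|) z = 0.
  move=> hz; rewrite /cv /conv; under eq_Rintegral do rewrite f0 ?normr0 ?mulr0//.
  by rewrite Rintegral_cst// mul0r.
rewrite /sderiv; apply: (@cvg0_le _ _ _ _ _ (fun s : R => `|s| * ((K / `|e|) ^+ 2 * nrm (cv E (fun z => `|f z|))))); last first.
  rewrite [X in _ --> X](_ : 0 = 0 * ((K / `|e|) ^+ 2 * nrm (cv E (fun z => `|f z|)))); last by rewrite mul0r.
  apply: cvgM; last exact: cvg_cst.
  by rewrite -[X in _ --> X](@normr0 _ R); apply: cvg_norm; exact: nbhs_dnbhs.
have Kp : 0 < K / `|e| + 1 by rewrite ltr_wpDl// divr_ge0.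
near=> s; rewrite ger0_norm ?nrm_ge0//.
have s0 : s != 0 by near: s; exact: nbhs_dnbhs_neq.
have s1 : `|s| * (K / `|e|) <= 1.
  have : `|s| < (K / `|e| + 1)^-1.
    by near: s; apply: dnbhs0_lt; rewrite invr_gt0; exact: Kp.
  rewrite -[X in _ < X]mul1r ltr_pdivlMr// => h; apply: le_trans (ltW h).
  by rewrite ler_wpM2l// lerDl.
have LQ := sqintB (sqint_quot s cF C0) LG.
have LR := sqintZ (`|s| * (K / `|e|) ^+ 2) CE.
apply: (@le_trans _ _ (nrm (fun z => (`|s| * (K / `|e|) ^+ 2) * cv E (fun z => `|f z|) z))); last first.
  rewrite (nrmZ _ CE) ger0_norm ?mulr_ge0 ?sqr_ge0// -[leLHS]mulrA; exact: lexx.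
apply: (nrm_le_ae LQ LR).
have a0 := cv_ae_integrable Lk0 Lf; have a1 := cv_ae_integrable Lk1 Lf.
have aE := cv_ae_integrable LE Lfa.
apply: (ae_imply3 a0 a1 aE) => z i0 i1 iE.
have [hz|hz] := pselect (0 < z.1 < T); last first.
  have o0 : cv (kap n) f (F s z) = 0 by apply: out.
  by rewrite o0 !(out _ z)// (Eout z)// !mulr0 subrr mulr0 oppr0 subr0 normr0.
have m'E : m' z = m z.1 / e by rewrite /m' hz.
pose h := s * m z.1 / e.
have h1 : `|h| <= 1.
  apply: le_trans s1; rewrite /h -mulrA normrM ler_wpM2l// normrM normfV.
  by rewrite ler_wpM2r ?invr_ge0//; exact: mK.
have mfz : measurable_fun [set: measurableTypeR R] (fun r => f (Xe r z)).
  have mXz : measurable_fun [set: measurableTypeR R] (fun r => Xe r z : spacetimeM R).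
    have mp : measurable_fun [set: measurableTypeR R]
        (fun r => (r, z) : measurableTypeR R * spacetimeM R).
      by apply: measurable_fun_pair; [exact: measurable_id|exact: measurable_cst].
    exact: (measurableT_comp mXe mp).
  exact: (measurableT_comp (sqint_meas Lf) mXz).
(* A translation of the variable of integration moves the displacement from f, which is merely in
   L^2, to the kernel, which is smooth. *)
have ES : cv (kap n) f (F s z) = \int[leb]_r (kap n (r - h) * f (Xe r z)).
  have mg : measurable_fun setT (fun r : R => kap n (r - h) * f (Xe r z)).
    apply: measurable_funM => //.
    apply: (measurableT_comp (@kap_meas R n)); exact: measurable_funB.
  rewrite -(Rintegral_shift h mg); apply: eq_Rintegral => r _; rewrite addrK.
  congr (_ * f _); rewrite /Xe /F -flowXD; congr (flowX i _ z).
  by rewrite /h; field.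
pose D r := kap n (r - h) - kap n r + h * kap n.+1 r.
have hD r : `|D r| <= h ^+ 2 * E r by exact: kap_taylor.
have mD : measurable_fun setT D.
  apply: measurable_funD; last by apply: measurable_funM => //; exact: kap_meas.
  apply: measurable_funB; last exact: kap_meas.
  apply: (measurableT_comp (@kap_meas R n)); exact: measurable_funB.
have iEh := integrableZl measurableT (h ^+ 2) iE.
have E0 r : 0 <= E r by apply: mulr_ge0; [apply: mulr_ge0 => //; exact: kapc_ge0|exact: ltW (env_gt0 _)].
have iD : leb.-integrable setT (EFin \o (fun r => D r * f (Xe r z))).
  apply: (le_integrable measurableT _ _ iEh).
    by apply/measurable_EFinP; exact: measurable_funM.
  move=> r _; rewrite /= lee_fin [leRHS]ger0_norm; last first.
    by apply: mulr_ge0; [exact: sqr_ge0|exact: mulr_ge0].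
  by rewrite normrM mulrA ler_wpM2r.
have i1h := integrableZl measurableT (- h) i1.
have ED : cv (kap n) f (F s z) = \int[leb]_r (D r * f (Xe r z)) + (cv (kap n) f z - h * cv (kap n.+1) f z).
  have E1 : \int[leb]_r (- h * (kap n.+1 r * f (Xe r z))) = - h * cv (kap n.+1) f z.
    exact: (RintegralZl (- h) measurableT i1).
  have i1h' : leb.-integrable setT (EFin \o (fun r => - h * (kap n.+1 r * f (Xe r z)))).
    exact: i1h.
  have E2 : \int[leb]_r (kap n r * f (Xe r z) + - h * (kap n.+1 r * f (Xe r z))) =
      cv (kap n) f z + - h * cv (kap n.+1) f z.
    by rewrite -E1; exact: (RintegralD measurableT i0 i1h').
  have i01 : leb.-integrable setT (EFin \o
      (fun r => kap n r * f (Xe r z) + - h * (kap n.+1 r * f (Xe r z)))).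
    exact: (integrableD measurableT i0 i1h').
  rewrite mulNr in E2; rewrite ES -E2 -(RintegralD measurableT iD i01).
  by apply: eq_Rintegral => r _; rewrite /D; ring.
rewrite ED m'E opprK.
have -> : s^-1 * (\int[leb]_r (D r * f (Xe r z)) + (cv (kap n) f z - h * cv (kap n.+1) f z) - cv (kap n) f z)
    + m z.1 / e * cv (kap n.+1) f z = s^-1 * \int[leb]_r (D r * f (Xe r z)).
  by rewrite /h; field; rewrite s0 e0.
have cE0 : 0 <= cv E (fun z => `|f z|) z.
  by apply: Rintegral_ge0 => r _; rewrite mulr_ge0.
rewrite [leRHS]ger0_norm ?mulr_ge0 ?sqr_ge0//.
have B1 : `|\int[leb]_r (D r * f (Xe r z))| <= h ^+ 2 * cv E (fun z => `|f z|) z.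
  apply: (le_trans (le_normr_Rintegral measurableT iD)).
  rewrite -(RintegralZl (h ^+ 2) _ iE)//; apply: le_Rintegral => //.
  - exact: integrable_norm iD.
  - move=> r _; rewrite normrM mulrA ler_wpM2r//.
have B2 : h ^+ 2 <= `|s| ^+ 2 * (K / `|e|) ^+ 2.
  rewrite -[h ^+ 2]real_normK ?num_real// -exprMn lerXn2r ?nnegrE ?mulr_ge0 ?divr_ge0//.
  rewrite /h -mulrA normrM ler_wpM2l// normrM normfV ler_wpM2r ?invr_ge0//; exact: mK.
have sp : 0 < `|s| by rewrite normr_gt0.
rewrite normrM normfV ler_pdivrMl//.
apply: (le_trans B1); apply: (@le_trans _ _ (`|s| ^+ 2 * (K / `|e|) ^+ 2 * cv E (fun z => `|f z|) z)).
  by rewrite ler_wpM2r.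
by rewrite expr2 -!mulrA.
Unshelve. all: by end_near. Qed.

End Smoothing.

(** * Recovering a function from its averages at small scales *)

Section ApproximateIdentity.
Context {R : realType}.
Notation Z := (spacetime R).
Notation mu := (spacetime_measure R).
Notation leb := (@lebesgue_measure R).
Notation sq := (sqint mu).
Notation ip := (l2ip mu).
Notation nrm := (l2nrm mu).
Implicit Types (f g : Z -> R).

Lemma ip_flow_cvg F f (t : R^nat) : cflow F -> (forall z, F 0 z = z) -> sq f ->
  t @ \oo --> 0 -> ip (fun z => f (F (t n) z)) f @[n --> \oo] --> ip f f.
Proof.
move=> cF F0 Lf t0.
have h : nrm (fun z => f (F s z) - f z) @[s --> (0 : R)] --> (0 : R).
  pose N s := nrm (fun z => f (F s z) - f z).
  have N0 : N 0 = 0.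
    rewrite /N (_ : (fun z => _) = (fun=> 0)); last by apply/funext => z; rewrite F0 subrr.
    by rewrite /l2nrm ip0l sqrtr0.
  have cN : N s @[s --> 0^'] --> N 0 by rewrite N0; exact: trans_cont.
  have c := (continuous_withinNx N 0).2 cN; have c2 : N @ 0 --> N 0 := c; move: c2; rewrite N0; exact.
have h' := cvg_comp t (fun s => nrm (fun z => f (F s z) - f z)) t0 h.
rewrite -[X in _ --> X]addr0.
have -> : (fun n => ip (fun z => f (F (t n) z)) f) =
   (fun n => ip f f + ip (fun z => f (F (t n) z) - f z) f).
  by apply/funext => n; rewrite (ipBl (cflow_sqint (t n) cF Lf) Lf Lf) addrC subrK.
apply: cvgD; first exact: cvg_cst.
apply: (@cvg0_le _ _ _ _ _ (fun n => nrm (fun z => f (F (t n) z) - f z) * nrm f)).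
  by apply: nearW => n; exact: (CauchySchwarz (sqintB (cflow_sqint (t n) cF Lf) Lf) Lf).
by rewrite -[X in _ --> X](mul0r (nrm f)); apply: cvgM => //; exact: cvg_cst.
Unshelve. all: by end_near. Qed.

(** Along e = 1/(n+1), the inner product of the average of f with f tends to (integral of [kap 0])
    ||f||^2, by continuity of the flow on L^2 and dominated convergence; the integral is
    positive. *)
Lemma cv_approx i f : sq f -> (forall e, 0 < e -> nrm (cv i e (kap 0) f) = 0) ->
  nrm f = 0.
Proof.
move=> Lf h0; have Lk := @kap_L1 R 0.
pose I n (r : R) : R := kap 0 r * ip (fun z => f (flowX i (n.+1%:R^-1 * r) z)) f.
have I0 n : \int[leb]_r I n r = 0.
  have Lc := cv_sqint i n.+1%:R^-1 Lk Lf.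
  rewrite -(ip_cv i n.+1%:R^-1 Lk Lf Lf); apply/eqP; rewrite -normr_le0.
  by apply: (le_trans (CauchySchwarz Lc Lf)); rewrite h0 ?mul0r// invr_gt0.
have Ic : \int[leb]_r I n r @[n --> \oo] --> \int[leb]_r (kap 0 r * ip f f).
  apply: (@Rdominated_cvg _ _ R leb I _ (fun r => (nrm f * nrm f) * `|kap 0 r|)).
  - move=> n.
    have /integrableP[/measurable_EFinP + _] := cv_ip_integrable i n.+1%:R^-1 Lk Lf Lf.
    exact.
  - exact: (L1Z _ (L1_abs Lk)).2.
  - move=> n r; rewrite normrM mulrC ler_wpM2r//.
    have := CauchySchwarz (cflow_sqint (n.+1%:R^-1 * r) (cflow_X i) Lf) Lf.
    by rewrite (cflow_nrm _ (cflow_X i) Lf).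
  - move=> r; apply: cvgM; first exact: cvg_cst.
    apply: (ip_flow_cvg (t := fun n => n.+1%:R^-1 * r) (cflow_X i) (flowX0 i) Lf).
    rewrite [X in _ --> X](_ : 0 = 0 * r); last by rewrite mul0r.
    by apply: cvgM; [exact: cvg_harmonic|exact: cvg_cst].
have : \int[leb]_r (kap 0 r * ip f f) = 0.
  apply: (cvg_unique _ Ic) => //.
  by rewrite (_ : (fun n => _) = (fun=> 0)); [exact: cvg_cst|apply/funext].
under eq_Rintegral do rewrite mulrC.
rewrite (RintegralZl _ measurableT Lk.2) => /eqP; rewrite mulf_eq0 => /orP[/eqP|/eqP h].
  by rewrite /l2nrm => ->; rewrite sqrtr0.
by have := @kap0_int_gt0 R; rewrite h ltxx.
Qed.

End ApproximateIdentity.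

(** * Functions supported in the time strip and multipliers depending on time *)

Section Strip.
Context {R : realType}.
Notation Z := (spacetime R).
Notation mu := (spacetime_measure R).
Notation sq := (sqint mu).
Notation ip := (l2ip mu).
Notation nrm := (l2nrm mu).
Variable T : R.
Implicit Types (f g : Z -> R) (m : R -> R).

Definition instrip f := forall z : Z, ~ (0 < z.1 < T) -> f z = 0.

Definition bounded_in m := measurable_fun setT m /\
  exists M, forall t, 0 < t < T -> `|m t| <= M.

(** Makes a multiplier that is bounded only on ]0, T[ globally bounded, without changing its product
    with a function supported in the strip. *)
Definition truncate m (t : R) : R := if (0 < t) && (t < T) then m t else 0.

Lemma truncate_mul m f : instrip f ->
  (fun z => m z.1 * f z) = (fun z => truncate m z.1 * f z).
Proof.
move=> f0; apply/funext => z; rewrite /truncate; case: ifP => // /negbT h.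
by rewrite f0 ?mulr0//; exact/negP.
Qed.

Lemma measurable_truncate m : measurable_fun setT m ->
  measurable_fun [set: spacetimeM R] (fun z => truncate m z.1).
Proof.
move=> mm; have h : measurable_fun [set: measurableTypeR R] (truncate m).
  apply: measurable_fun_ifT => //; apply: measurable_and; apply: measurable_fun_ltr => //.
exact: (measurableT_comp h measurable_t).
Qed.

Lemma truncate_le m M t : (forall t, 0 < t < T -> `|m t| <= M) ->
  `|truncate m t| <= Num.max M 0.
Proof.
move=> mM; rewrite /truncate; case: ifP => [/mM h|_]; last by rewrite normr0 le_max lexx orbT.
by rewrite le_max h.
Qed.

Lemma sqint_strip m f : bounded_in m -> instrip f -> sq f -> sq (fun z => m z.1 * f z).
Proof.
move=> [mm [M mM]] f0 Lf; rewrite (truncate_mul m f0).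
exact: (sqint_bounded (measurable_truncate mm) (fun z => truncate_le z.1 mM) Lf).
Qed.

Lemma nrm_strip m M f : measurable_fun setT m -> (forall t, 0 < t < T -> `|m t| <= M) ->
  0 <= M -> instrip f -> sq f -> nrm (fun z => m z.1 * f z) <= M * nrm f.
Proof.
move=> mm mM M0 f0 Lf.
have Lm := sqint_strip (conj mm (ex_intro _ M mM)) f0 Lf.
have E := nrmZ M Lf; rewrite (ger0_norm M0) in E; rewrite -E.
apply: (nrm_le Lm (sqintZ M Lf)) => z; rewrite !normrM (ger0_norm M0).
have [h|h] := pselect (0 < z.1 < T); first by rewrite ler_wpM2r// mM.
by rewrite f0// normr0 !mulr0.
Qed.

Lemma instrip_mul m f : instrip f -> instrip (fun z => m z.1 * f z).
Proof. by move=> f0 z h; rewrite f0// mulr0. Qed.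

Lemma sderiv_mul_strip F m f g : cflow F -> (forall s z, (F s z).1 = z.1) ->
  bounded_in m -> instrip f -> instrip g -> sq f -> sq g ->
  sderiv F f g -> sderiv F (fun z => m z.1 * f z) (fun z => m z.1 * g z).
Proof.
move=> cF F1 [mm [M mM]] f0 g0 Lf Lg d; rewrite (truncate_mul m f0) (truncate_mul m g0).
apply: (sderiv_mul cF (measurable_truncate mm) (fun z => truncate_le z.1 mM) _ Lf Lg d).
by move=> s z; rewrite F1.
Qed.

Lemma bounded_inM m1 m2 : bounded_in m1 -> bounded_in m2 -> bounded_in (fun t => m1 t * m2 t).
Proof.
move=> [mm1 [M1 h1]] [mm2 [M2 h2]]; split; first exact: measurable_funM.
by exists (M1 * M2) => t ht; rewrite normrM ler_pM// ?h1 ?h2.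
Qed.

Lemma bounded_in_smooth m : smooth1 m -> bounded_in m.
Proof.
move=> sm; split; first exact: smooth1_measurable.
have [T0|T0] := lerP 0 T; last first.
  by exists 0 => t /andP[t0 tT]; have := lt_trans t0 (lt_trans tT T0); rewrite ltxx.
have [M _ hM] := continuous_bounded T0 (smooth1_continuous sm).
by exists M => t /andP[t0 tT]; apply: hM; rewrite !ltW.
Qed.

End Strip.

(** * Elementary inequalities for the commutator estimate *)

Section Arithmetic.
Context {R : realFieldType}.
Implicit Types (s t T : R).

Lemma mul1_bound s t T : 0 <= s ^+ 2 <= s -> 0 <= t * s <= T * s -> 0 <= T ^+ 2 * s ->
  - (s * (1 + T + T ^+ 2)) <= s ^+ 2 / 2 - t * s <= s * (1 + T + T ^+ 2).
Proof. lra. Qed.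

Lemma mul2_bound s t T : 0 <= s ^+ 3 <= s -> 0 <= t ^+ 2 * s <= T ^+ 2 * s ->
  0 <= t * s ^+ 2 <= T * s ->
  - (s * (1 + T + T ^+ 2)) <= - (s ^+ 3 / 6) + t * s ^+ 2 / 2 - t ^+ 2 * s / 2
     <= s * (1 + T + T ^+ 2).
Proof. lra. Qed.

Lemma polar_arith (a b c x y : R) : a = b -> b <= c + x -> 2 * y <= a + c ->
  2 * y <= 2 * c + x.
Proof. lra. Qed.

Lemma polar_arith2 (a b c : R) : 0 <= a - b - (b - c) -> 2 * b <= a + c.
Proof. lra. Qed.

Lemma quotient_arith (s x y z w L S N : R) : 2 * x <= 2 * y + L * s * N -> z <= s * S * w ->
  s * (- (L * N) - 2 * (w * S)) <= 2 * (- x - z - - y).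
Proof. lra. Qed.

End Arithmetic.

(** * Lower bound for the inner product of YV with d_J(A d_J V) *)

Section Commutator.
Context {R : realType}.
Notation Z := (spacetime R).
Notation mu := (spacetime_measure R).
Notation sq := (sqint mu).
Notation ip := (l2ip mu).
Notation nrm := (l2nrm mu).
Variables (T L Lam : R) (A : Z -> R).
Hypothesis T0 : 0 < T.
Hypothesis Am : measurable_fun [set: spacetimeM R] A.
Hypothesis A0 : forall z, 0 <= A z.
Hypothesis AL : forall z, A z <= Lam.
(** A one-sided bound, because it survives the extension of A by zero: going back in time from
    inside the strip can only leave it where A drops to 0. It expresses YA >= -L. *)
Hypothesis ALip : forall s z, 0 <= s -> 0 < z.1 < T -> A (flowY (- s) z) <= A z + L * s.

Lemma cflow_XX i j m1 m2 : measurable_fun setT m1 -> measurable_fun setT m2 ->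
  cflow (fun (r : R) (z : Z) => flowX i (r * m1 z.1) (flowX j (r * m2 z.1) z)).
Proof.
move=> mm1 mm2; have [a1 a2 a3] := measurable_fieldX i (R := R).
have [b1 b2 b3] := measurable_fieldX j (R := R).
have := @cflow_transx R (fun t => (m1 t * (fieldX i t).1.1 + m2 t * (fieldX j t).1.1,
  m1 t * (fieldX i t).1.2 + m2 t * (fieldX j t).1.2,
  m1 t * (fieldX i t).2 + m2 t * (fieldX j t).2)).
move=> /(_ (measurable_funD (measurable_funM mm1 a1) (measurable_funM mm2 b1))
           (measurable_funD (measurable_funM mm1 a2) (measurable_funM mm2 b2))
           (measurable_funD (measurable_funM mm1 a3) (measurable_funM mm2 b3))).
rewrite (_ : (fun r z => _) = (fun (r : R) (z : Z) => flowX i (r * m1 z.1) (flowX j (r * m2 z.1) z)))//.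
apply/funext => r; apply/funext => z; apply: coord_eq; rewrite /flowX/transx/coordA/coordJ/coordV/coordQ//=; ring.
Qed.

Variables (V P G H : Z -> R) (DX : 'I_3 -> Z -> R).
Hypotheses (LV : sq V) (LP : sq P) (LG : sq G) (LH : sq H) (LD : forall i, sq (DX i)).
Hypotheses (P0 : instrip T P) (D0 : forall i, instrip T (DX i)).
Hypotheses (dJ : sderiv flowJ V P) (dJ2 : sderiv flowJ (fun z => A z * P z) H).
Hypothesis (dY : sderiv flowY V G).
Hypothesis dX : forall i m, bounded_in T m ->
  sderiv (fun s z => flowX i (s * m z.1) z) V (fun z => m z.1 * DX i z).

(** These are the coefficients of [transx_flowX]. [Xdrift] is the extra term that appears when d_J
    is moved through [flowY s]. *)
Definition mul0 (s t : R) : R := - s.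
Definition mul1 (s t : R) : R := s ^+ 2 / 2 - t * s.
Definition mul2 (s t : R) : R := - (s ^+ 3 / 6) + t * s ^+ 2 / 2 - t ^+ 2 * s / 2.
Definition Xdrift (s : R) (z : Z) : R :=
  mul0 s z.1 * DX (inord 0) z + (mul1 s z.1 * DX (inord 1) z + mul2 s z.1 * DX (inord 2) z).

Let sm0 s : smooth1 (mul0 s).
Proof. exact: smooth1_cst. Qed.
Let sm1 s : smooth1 (mul1 s).
Proof.
have := smooth1_affine (- s) (s ^+ 2 / 2).
by rewrite (_ : (fun t => _) = mul1 s)//; apply/funext => t; rewrite /mul1; ring.
Qed.
Let sm2 s : smooth1 (mul2 s).
Proof.
have h := smooth1M (smooth1_affine (- s / 2) (s ^+ 2 / 2)) (@smooth1_id R).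
have := smooth1D (@smooth1_cst R (- (s ^+ 3 / 6))) h.
by rewrite (_ : (fun t => _) = mul2 s)//; apply/funext => t; rewrite /mul2; field.
Qed.

Let b0 s := bounded_in_smooth T (sm0 s).
Let b1 s := bounded_in_smooth T (sm1 s).
Let b2 s := bounded_in_smooth T (sm2 s).
Let L0 s := sqint_strip (b0 s) (D0 (inord 0)) (LD (inord 0)).
Let L1 s := sqint_strip (b1 s) (D0 (inord 1)) (LD (inord 1)).
Let L2 s := sqint_strip (b2 s) (D0 (inord 2)) (LD (inord 2)).

Lemma sqint_Xdrift s : sq (Xdrift s).
Proof. exact: (sqintD (L0 s) (sqintD (L1 s) (L2 s))). Qed.

Lemma Xdrift_nrm s : 0 <= s <= 1 ->
  nrm (Xdrift s) <= s * ((1 + T + T ^+ 2) * \sum_i nrm (DX i)).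
Proof.
move=> /andP[s0 s1]; have K0 : 0 <= s * (1 + T + T ^+ 2) by rewrite mulr_ge0// !addr_ge0 ?sqr_ge0// ltW.
have T00 := ltW T0.
have s2 : 0 <= s ^+ 2 <= s by rewrite sqr_ge0 expr2 ler_piMl.
have s3 : 0 <= s ^+ 3 <= s.
  by rewrite exprn_ge0//= exprS; apply: le_trans (ler_wpM2l s0 (_ : _ <= 1)) _; rewrite ?mulr1// exprn_ile1.
have le_t t : 0 < t < T -> 0 <= t * s <= T * s /\ 0 <= t ^+ 2 * s <= T ^+ 2 * s.
  move=> /andP[t0 tT]; rewrite !mulr_ge0 ?sqr_ge0 ?(ltW t0)//=; split.
    by rewrite ler_wpM2r// ltW.
  by rewrite ler_wpM2r// lerXn2r ?nnegrE ?ltW.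
have le_t2 t : 0 < t < T -> 0 <= t * s ^+ 2 <= T * s.
  move=> /andP[t0 tT]; rewrite mulr_ge0 ?sqr_ge0 ?(ltW t0)//=.
  by case/andP: s2 => a b; apply: ler_pM => //; exact: ltW.
have h0 : nrm (fun z => mul0 s z.1 * DX (inord 0) z) <= s * (1 + T + T ^+ 2) * nrm (DX (inord 0)).
  apply: (nrm_strip (b0 s).1 _ K0 (D0 _) (LD _)) => t ht; rewrite /mul0 normrN ger0_norm//.
  by rewrite ler_peMr// -addrA lerDl addr_ge0 ?sqr_ge0.
have h1 : nrm (fun z => mul1 s z.1 * DX (inord 1) z) <= s * (1 + T + T ^+ 2) * nrm (DX (inord 1)).
  apply: (nrm_strip (b1 s).1 _ K0 (D0 _) (LD _)) => t ht; rewrite /mul1.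
  have [u1 u2] := le_t _ ht; have T2 : 0 <= T ^+ 2 * s by rewrite mulr_ge0 ?sqr_ge0.
  by rewrite ler_norml; exact: mul1_bound.
have h2 : nrm (fun z => mul2 s z.1 * DX (inord 2) z) <= s * (1 + T + T ^+ 2) * nrm (DX (inord 2)).
  apply: (nrm_strip (b2 s).1 _ K0 (D0 _) (LD _)) => t ht; rewrite /mul2.
  have [u1 u2] := le_t _ ht; have T2 : 0 <= T ^+ 2 * s by rewrite mulr_ge0 ?sqr_ge0.
  by rewrite ler_norml; apply: mul2_bound => //; exact: le_t2.
have -> : \sum_i nrm (DX i) = nrm (DX (inord 0)) + (nrm (DX (inord 1)) + nrm (DX (inord 2))).
  rewrite !big_ord_recl big_ord0 addr0; congr (_ + (_ + _)); congr (l2nrm mu (DX _)); apply/val_inj; by rewrite /= inordK.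
apply: (le_trans (nrmD (L0 s) (sqintD (L1 s) (L2 s)))).
rewrite mulrA (mulrDr (s * _)) (mulrDr (s * _)); apply: lerD; first exact: h0.
exact: (le_trans (nrmD (L1 s) (L2 s)) (lerD h1 h2)).
Qed.

(** Finite-time form of the commutator of d_J with Y. By [flowYJ], a translation of V o Y_s in J is
    a translation of V in J combined with one in (A, V, Q), read at Y_s z; the second is a composite
    of the flows of X_0, X_1, X_2, so [sderiv_comp] applies, and composition with Y_s is an
    isometry. *)
Lemma sderiv_flowYJ s :
  sderiv flowJ (fun z => V (flowY s z)) (fun z => P (flowY s z) + Xdrift s (flowY s z)).
Proof.
pose F r (z : Z) := flowX (inord 1) (r * mul1 s z.1) (flowX (inord 2) (r * mul2 s z.1) z).
have d12 : sderiv F V (fun z => mul1 s z.1 * DX (inord 1) z + mul2 s z.1 * DX (inord 2) z).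
  have := sderiv_comp (cflow_Xm (inord 1) (b1 s).1) (cflow_Xm (inord 2) (b2 s).1) LV
    (L1 s) (L2 s) (dX (inord 1) (b1 s)) (dX (inord 2) (b2 s)).
  by congr (sderiv _ _ _).
have cF : cflow F := cflow_XX _ _ (b1 s).1 (b2 s).1.
have d012 := sderiv_comp (cflow_Xm (inord 0) (b0 s).1) cF LV (L0 s) (sqintD (L1 s) (L2 s)) (dX (inord 0) (b0 s)) d12.
pose W r (z : Z) := transx (- s, s ^+ 2 / 2, - (s ^+ 3 / 6)) r z.
have cW : cflow W by exact: (@cflow_transx R (fun=> _)).
have dW : sderiv W V (Xdrift s).
  rewrite (_ : W = (fun r z => flowX (inord 0) (r * mul0 s (F r z).1) (F r z)))//.
  by apply/funext => r; apply/funext => z; exact: transx_flowX.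
have dJW := sderiv_comp cflow_J cW LV LP (sqint_Xdrift s) dJ dW.
have dJW' : nrm (fun z => r^-1 * (V (flowJ r (W r z)) - V z) - (P z + Xdrift s z))
  @[r --> 0^'] --> (0 : R) := dJW.
refine (cvg0_le _ dJW').
apply: nearW => r; rewrite ger0_norm ?nrm_ge0//.
have LW : sq (fun z => r^-1 * (V (flowJ r (W r z)) - V z) - (P z + Xdrift s z)).
  apply: sqintB (sqintD LP (sqint_Xdrift s)); apply: sqintZ; apply: sqintB LV.
  exact: (cflow_sqint r cW (cflow_sqint r cflow_J LV)).
rewrite -(cflow_nrm s cflow_Y LW) le_eqVlt; apply/orP; left; apply/eqP; congr (l2nrm mu).
by apply/funext => z; rewrite flowYJ.
Qed.

(** Formally, 2 <YV, d_J(AP)> = -2 <YP, AP> + 2 <d_A V, AP>, where the first term equals <(YA) P, P>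
    >= -L ||P||^2 and d_A V is a combination of the X_i-derivatives. As YP need not exist, the
    computation is made on the difference quotient of V along Y, before s tends to 0. *)
Lemma commutator_ge :
  - (L * nrm P ^+ 2) - 2 * (Lam * nrm P * ((1 + T + T ^+ 2) * \sum_i nrm (DX i))) <= 2 * ip G H.
Proof.
set S := (1 + T + T ^+ 2) * _.
have AM z : `|A z| <= Lam by rewrite ger0_norm.
have LAP : sq (fun z => A z * P z) := sqint_bounded Am AM LP.
have Lam0 : 0 <= Lam by apply: le_trans (AL point).
have E s : ip (fun z => V (flowY s z)) H = - ip (fun z => P (flowY s z)) (fun z => A z * P z)
    - ip (fun z => Xdrift s (flowY s z)) (fun z => A z * P z).
  have LY := cflow_sqint s cflow_Y LV; have LPY := cflow_sqint s cflow_Y LP.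
  have LXY := cflow_sqint s cflow_Y (sqint_Xdrift s).
  have := sderiv_ibp cflow_J (@flowJK R) LY (sqintD LPY LXY) LAP LH (sderiv_flowYJ s) dJ2.
  by rewrite (ipDl LPY LXY LAP) => h; rewrite -[LHS]opprK -h opprD.
have E0 : ip V H = - ip P (fun z => A z * P z).
  have := sderiv_ibp cflow_J (@flowJK R) LV LP LAP LH dJ dJ2.
  by move=> ->; rewrite opprK.
(* As A >= 0, the cross term is at most half the sum of the two diagonal ones; in that with P o Y_s,
   invariance of the measure moves the flow onto A, where [ALip] applies. *)
have PAP s : 0 <= s -> 2 * ip (fun z => P (flowY s z)) (fun z => A z * P z) <=
    2 * ip P (fun z => A z * P z) + L * s * nrm P ^+ 2.
  move=> s0; have LPY := cflow_sqint s cflow_Y LP.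
  have LAPY := sqint_bounded Am AM LPY.
  have LAYm : measurable_fun [set: spacetimeM R] (fun z => A (flowY (- s) z)).
    exact: (measurableT_comp Am (cflow_Y.1 (- s)).1).
  have LAYP : sq (fun z => A (flowY (- s) z) * P z) := sqint_bounded LAYm (fun z => AM _) LP.
  have e1 : ip (fun z => P (flowY s z)) (fun z => A z * P (flowY s z)) =
      ip P (fun z => A (flowY (- s) z) * P z).
    rewrite -(mpres_ip (cflow_Y.1 s) LP LAYP); congr (l2ip mu _ _); apply/funext => z /=.
    by rewrite -{1}[z in A z](flowYK (- s)) opprK.
  have e2 : ip P (fun z => A (flowY (- s) z) * P z) <= ip P (fun z => A z * P z) + L * s * nrm P ^+ 2.
    rewrite nrm_sqr -(ipZr _ LP LP) -(ipDr LAP (sqintZ _ LP) LP).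
    apply: (ip_le LP LAYP LP (sqintD LAP (sqintZ _ LP))) => z.
    have [h|h] := pselect (0 < z.1 < T); last by rewrite P0// !mul0r.
    have hL := ALip s0 h; have h2 := sqr_ge0 (P z); rewrite (_ : P z * _ = A (flowY (- s) z) * P z ^+ 2); last by ring.
    rewrite (_ : P z * _ = (A z + L * s) * P z ^+ 2); last by ring.
    by rewrite ler_wpM2r.
  apply: (polar_arith e1 e2); apply: polar_arith2.
  have LB := sqintB LPY LP.
  have : 0 <= ip (fun z => P (flowY s z) - P z) (fun z => A z * (P (flowY s z) - P z)).
    apply: Rintegral_ge0 => z _; rewrite mulrCA mulr_ge0//; exact: sqr_ge0.
  have -> : (fun z => A z * (P (flowY s z) - P z)) = (fun z => A z * P (flowY s z) - A z * P z).
    by apply/funext => z; rewrite mulrBr.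
  rewrite (ipBl LPY LP (sqintB LAPY LAP)) (ipBr LAPY LAP LPY) (ipBr LAPY LAP LP).
  have -> : ip P (fun z => A z * P (flowY s z)) = ip (fun z => P (flowY s z)) (fun z => A z * P z).
    by rewrite -ip_mulA ipC.
  by [].
have c := sderiv_ip cflow_Y LV LG LH dY.
have : 2 * (s^-1 * (ip (fun z => V (flowY s z)) H - ip V H)) @[s --> 0^'] --> 2 * ip G H.
  by apply: cvgM => //; exact: cvg_cst.
(* The estimates hold for s > 0 only; the one-sided limit is enough since the two-sided one
   exists. *)
move=> /cvg_dnbhs_at_right c'.
apply: (@cvgr_to_ge _ _ _ _ _ _ _ c'); near=> s.
have s0 : 0 < s by near: s; exact: nbhs_right_gt.
have s1 : s <= 1 by near: s; apply: nbhs_right_le.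
have X : `|ip (fun z => Xdrift s (flowY s z)) (fun z => A z * P z)| <= s * S * (Lam * nrm P).
  have LXY := cflow_sqint s cflow_Y (sqint_Xdrift s).
  apply: (le_trans (CauchySchwarz LXY LAP)); rewrite (cflow_nrm s cflow_Y (sqint_Xdrift s)).
  apply: ler_pM; rewrite ?nrm_ge0//; first by apply: Xdrift_nrm; rewrite s1 ltW.
  have e := nrmZ Lam LP; rewrite (ger0_norm Lam0) in e; rewrite -e.
  apply: (nrm_le LAP (sqintZ Lam LP)) => z; rewrite !normrM (ger0_norm Lam0) ler_wpM2r//.
rewrite E E0 [leRHS]mulrCA ler_pdivlMl//.
by move: X; rewrite ler_norml => /andP[_ X]; exact: quotient_arith (PAP s (ltW s0)) X.
Unshelve. all: by end_near. Qed.

End Commutator.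

(** * Combining the inequalities behind the Carleman estimate *)

Section CarlemanArithmetic.
Context {R : realFieldType}.

Lemma sqr_sum3 (x y z : R) : (x + y + z) ^+ 2 <= 3 * (x ^+ 2 + y ^+ 2 + z ^+ 2).
Proof.
have := sqr_ge0 (x - y); have := sqr_ge0 (y - z); have := sqr_ge0 (x - z).
rewrite !expr2; lra.
Qed.

Lemma eq_opp_eq0 (x : R) : x = - x -> x = 0.
Proof. lra. Qed.

Lemma ibp_arith (x k n : R) : x = - (x + k * n) -> 2 * x = - k * n.
Proof. lra. Qed.

Lemma parallelogram_arith (gh gv k n f : R) : 4 * (gh - gv) <= f ->
  2 * gv = - (2 * k) * n -> 4 * gh + 4 * k * n <= f.
Proof. lra. Qed.

Lemma commutator_arith (gh k x f L y Lam t S : R) : 4 * gh + 4 * k * x <= f ->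
  - (L * y ^+ 2) - 2 * (Lam * y * (t * S)) <= 2 * gh ->
  4 * k * x <= f + 2 * L * y ^+ 2 + 4 * (Lam * t) * y * S.
Proof. lra. Qed.

Lemma carleman_linear (kx f2 Ly By Kcx Kdy rx cy e2 D y2 bys rfx krd : R) :
  4 * kx <= f2 + 2 * Ly + bys -> cy <= rfx + krd -> rfx <= f2 / 6 + 3 / 2 * rx ->
  krd <= kx / 2 -> 4 * Kcx + 2 * rx <= kx -> bys <= 12 * By + D ->
  cy = 3 * Kdy + 2 * Ly + 12 * By + y2 -> f2 <= 3 * (Kcx + Kdy + e2) ->
  0 <= Ly -> 0 <= By -> 0 <= Kcx -> 0 <= rx -> 0 <= Kdy -> 0 <= e2 -> 0 <= y2 -> 0 <= D ->
  kx <= 4 * e2 + D.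
Proof. lra. Qed.

(** Here x, y, f, e are the norms of V, d_J V, the conjugated right side and the cutoff error, S is
    the sum of the norms of the X_i-derivatives and D the sum of their squares. The constant c is
    large enough for c y^2 to dominate every y^2 produced by the other terms; multiplying the energy
    inequality by r = c / lam pays for it, and 8 r del <= 1 keeps its k-term below half of k x^2. *)
Lemma carleman_arith (k x y f e S D L B Kc Kd lam c r del : R) :
  0 < lam -> 0 <= L -> 0 <= k ->
  c = 3 * Kd ^+ 2 + 2 * L + 12 * B ^+ 2 + 1 -> r = c / lam ->
  8 * r * del <= 1 -> 4 * Kc ^+ 2 + 2 * r ^+ 2 <= k ->
  4 * k * x ^+ 2 <= f ^+ 2 + 2 * L * y ^+ 2 + 4 * B * y * S ->
  lam * y ^+ 2 <= f * x + 4 * k * del * x ^+ 2 ->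
  f ^+ 2 <= 3 * (Kc ^+ 2 * x ^+ 2 + Kd ^+ 2 * y ^+ 2 + e ^+ 2) ->
  S ^+ 2 <= 3 * D ->
  k * x ^+ 2 <= 4 * e ^+ 2 + D.
Proof.
move=> lam0 L0 k0 cE rE hd hk H1 H2 H3 HS.
have c0 : 0 < c by rewrite cE; have := sqr_ge0 Kd; have := sqr_ge0 B; lra.
have r0 : 0 < r by rewrite rE divr_gt0.
have crE : c = r * lam by rewrite rE divfK// gt_eqF.
have h2 : c * y ^+ 2 <= r * (f * x) + 4 * k * r * del * x ^+ 2.
  have := ler_wpM2l (ltW r0) H2; rewrite crE; lra.
have hf : r * (f * x) <= f ^+ 2 / 6 + 3 / 2 * (r ^+ 2 * x ^+ 2).
  have := sqr_ge0 (f - 3 * r * x); rewrite !expr2; lra.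
have hdx : 4 * k * r * del * x ^+ 2 <= k * x ^+ 2 / 2.
  have kx : 0 <= k * x ^+ 2 by rewrite mulr_ge0// sqr_ge0.
  have := ler_wpM2l kx hd; lra.
have hkx : 4 * (Kc ^+ 2 * x ^+ 2) + 2 * (r ^+ 2 * x ^+ 2) <= k * x ^+ 2.
  have := ler_wpM2r (sqr_ge0 x) hk; lra.
have hS : 4 * B * y * S <= 12 * (B ^+ 2 * y ^+ 2) + D.
  have := sqr_ge0 (6 * B * y - S); have := HS; rewrite !expr2; lra.
have hc : c * y ^+ 2 = 3 * (Kd ^+ 2 * y ^+ 2) + 2 * L * y ^+ 2 + 12 * (B ^+ 2 * y ^+ 2) + y ^+ 2.
  by rewrite cE; ring.
have p1 : 0 <= L * y ^+ 2 by rewrite mulr_ge0// sqr_ge0.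
have p2 : 0 <= B ^+ 2 * y ^+ 2 by rewrite mulr_ge0// sqr_ge0.
have p3 := sqr_ge0 y; have p4 := sqr_ge0 e; have p5 := sqr_ge0 f.
have p6 : 0 <= Kc ^+ 2 * x ^+ 2 by rewrite mulr_ge0// sqr_ge0.
have p7 : 0 <= r ^+ 2 * x ^+ 2 by rewrite mulr_ge0// sqr_ge0.
have p8 : 0 <= D by move: HS; have := sqr_ge0 S; lra.
have p9 : 0 <= Kd ^+ 2 * y ^+ 2 by rewrite mulr_ge0// sqr_ge0.
have E1 : 4 * (k * x ^+ 2) <= f ^+ 2 + 2 * (L * y ^+ 2) + 4 * B * y * S by rewrite (mulrA 4) (mulrA 2 L).
rewrite -[2 * L * y ^+ 2]mulrA in hc.
exact: (carleman_linear E1 h2 hf hdx hkx hS hc H3 p1 p2 p6 p7 p9 p4 p3 p8).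
Qed.

End CarlemanArithmetic.

(** * Strong solutions, the weight and the cutoff *)

Section Solution.
Context {R : realType}.
Notation Z := (spacetime R).
Notation mu := (spacetime_measure R).
Notation sq := (sqint mu).
Notation ip := (l2ip mu).
Notation nrm := (l2nrm mu).
Variables (T : R) (A C D : Z -> R).

(** Strong form of the equation for data extended by zero to all times: p = d_J w, g = Yw inside the
    strip and q = d_J(A p). The derivative along Y is asked only after multiplication by functions
    of time vanishing from some T1 < T on, as w may jump at T; such functions need not vanish at t =
    0, so the zero initial value is encoded here. *)
Record solution (w p g q : Z -> R) : Prop := Solution {
  sol_w : sq w; sol_p : sq p; sol_g : sq g; sol_q : sq q;
  sol_w0 : instrip T w; sol_p0 : instrip T p; sol_g0 : instrip T g; sol_q0 : instrip T q;
  sol_J : sderiv flowJ w p;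
  sol_J2 : sderiv flowJ (fun z => A z * p z) q;
  sol_Y : forall m, smooth1 m -> (exists2 T1, T1 < T & forall t, T1 <= t -> m t = 0) ->
    sderiv flowY (fun z => m z.1 * w z) (fun z => m z.1 * g z + derive1 m z.1 * w z);
  sol_eq : nrm (fun z => g z + q z - (C z * w z + D z * p z)) = 0 }.

(** The speed m depends on time because [transx_flowX] expresses the commutator through the X_i with
    coefficients depending on t. *)
Definition has_dX (w : Z -> R) (DX : 'I_3 -> Z -> R) := forall i,
  [/\ sq (DX i), instrip T (DX i) & forall m, bounded_in T m ->
  sderiv (fun s z => flowX i (s * m z.1) z) w (fun z => m z.1 * DX i z)].

(** The parabola is centred at t0 + 2 del, beyond the support of the cutoff, so that the weight
    decreases as long as it acts. The function [eweight] is the part of the derivative of [cweight]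
    that falls on the cutoff, supported in [t0 + del/2, t0 + del]. *)
Definition phase_fun (k t0 del t : R) : R := k * (t - t0 - 2 * del) ^+ 2.
Definition dphase_fun (k t0 del t : R) : R := 2 * k * (t - t0 - 2 * del).
Definition cutoff (t0 del t : R) : R := 1 - step ((t - t0 - del / 2) / (del / 2)).
Definition cweight (k t0 del t : R) : R := expR (phase_fun k t0 del t) * cutoff t0 del t.
Definition eweight (k t0 del t : R) : R :=
  expR (phase_fun k t0 del t) * derive1 (cutoff t0 del) t.

Lemma smooth1_phase k t0 del : smooth1 (phase_fun k t0 del).
Proof.
have s := smooth1_affine 1 (- t0 - 2 * del).
have := smooth1M (@smooth1_cst R k) (smooth1M s s).
by rewrite (_ : (fun t => _) = phase_fun k t0 del)//; apply/funext => t; rewrite /phase_fun; ring.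
Qed.

Lemma smooth1_dphase k t0 del : smooth1 (dphase_fun k t0 del).
Proof.
have := smooth1_affine (2 * k) (2 * k * (- t0 - 2 * del)).
by rewrite (_ : (fun t => _) = dphase_fun k t0 del)//; apply/funext => t; rewrite /dphase_fun; ring.
Qed.

Lemma smooth1_cutoff t0 del : smooth1 (cutoff t0 del).
Proof.
have s := smooth1_comp (@smooth1_step R) (smooth1_affine (del / 2)^-1 ((- t0 - del / 2) / (del / 2))).
have := smooth1D (@smooth1_cst R 1) (smooth1M (@smooth1_cst R (-1)) s).
rewrite (_ : (fun t => _) = cutoff t0 del)//; apply/funext => t; rewrite /cutoff mulN1r.
by congr (_ - step _); ring.
Qed.

Lemma smooth1_expphase k t0 del : smooth1 (fun t => expR (phase_fun k t0 del t)).
Proof. exact: smooth1_comp (@smooth1_expR R) (smooth1_phase k t0 del). Qed.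

Lemma smooth1_cweight k t0 del : smooth1 (cweight k t0 del).
Proof. exact: smooth1M (smooth1_expphase k t0 del) (smooth1_cutoff t0 del). Qed.

Lemma smooth1_eweight k t0 del : smooth1 (eweight k t0 del).
Proof. exact: smooth1M (smooth1_expphase k t0 del) (smooth1_derive (smooth1_cutoff t0 del)). Qed.

Lemma dphase_ge k t0 del t : 0 <= k -> t0 <= t -> - dphase_fun k t0 del t <= 4 * k * del.
Proof.
move=> k0 tt; have : 0 <= k * (t - t0) by rewrite mulr_ge0// subr_ge0.
rewrite /dphase_fun; lra.
Qed.

Lemma derive_cweight k t0 del t : derive1 (cweight k t0 del) t =
  dphase_fun k t0 del t * cweight k t0 del t + eweight k t0 del t.
Proof.
apply: is_derive1E.
have d1 : is_derive t 1 (phase_fun k t0 del) (dphase_fun k t0 del t).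
  rewrite /phase_fun /dphase_fun; apply: is_derive_eq; rewrite /GRing.scale/=; ring.
have d2 := smooth1_is_derive (smooth1_cutoff t0 del) t.
have d3 := is_derive1_comp (is_derive_expR (phase_fun k t0 del t)) d1.
apply: is_derive_eq (is_deriveM d3 d2) _.
by rewrite /eweight /cweight /GRing.scale/=; ring.
Qed.

Lemma derive_dphaseM k t0 del t :
  derive1 (fun t => dphase_fun k t0 del t * cweight k t0 del t) t =
  2 * k * cweight k t0 del t + dphase_fun k t0 del t * derive1 (cweight k t0 del) t.
Proof.
apply: is_derive1E.
have d1 : is_derive t 1 (dphase_fun k t0 del) (2 * k).
  rewrite /dphase_fun; apply: is_derive_eq; rewrite /GRing.scale/=; ring.
have d2 := smooth1_is_derive (smooth1_cweight k t0 del) t.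
apply: is_derive_eq (is_deriveM d1 d2) _.
by rewrite /GRing.scale/=; ring.
Qed.

Lemma cutoff_left t0 del t : 0 < del -> t <= t0 + del / 2 -> cutoff t0 del t = 1.
Proof.
move=> d0 h; rewrite /cutoff step0 ?subr0// mulr_le0_ge0 ?invr_ge0 ?divr_ge0 ?(ltW d0)//; lra.
Qed.

Lemma cutoff_right t0 del t : 0 < del -> t0 + del <= t -> cutoff t0 del t = 0.
Proof.
move=> d0 h; rewrite /cutoff step1 ?subrr// ler_pdivlMr ?divr_gt0//; lra.
Qed.

End Solution.

(** * The Carleman estimate *)

Section CarlemanEstimate.
Context {R : realType}.
Notation Z := (spacetime R).
Notation mu := (spacetime_measure R).
Notation sq := (sqint mu).
Notation ip := (l2ip mu).
Notation nrm := (l2nrm mu).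
Variables (T L Lam lam Kc Kd : R) (A C D : Z -> R).
Hypotheses (T0 : 0 < T) (L0 : 0 <= L) (lam0 : 0 < lam).
Hypothesis Am : measurable_fun [set: spacetimeM R] A.
Hypothesis A0 : forall z, 0 <= A z.
Hypothesis AL : forall z, A z <= Lam.
Hypothesis Al : forall z, 0 < z.1 < T -> lam <= A z.
Hypothesis ALip : forall s z, 0 <= s -> 0 < z.1 < T -> A (flowY (- s) z) <= A z + L * s.
Hypothesis Cm : measurable_fun [set: spacetimeM R] C.
Hypothesis CK : forall z, `|C z| <= Kc.
Hypothesis Dm : measurable_fun [set: spacetimeM R] D.
Hypothesis DK : forall z, `|D z| <= Kd.

(** [cB] comes from [commutator_ge]; [cC] is the multiple of ||d_J V||^2 to be absorbed in
    [carleman_arith], and [cR] converts it through ellipticity. None of them involves k or the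
    averaging scales. *)
Definition cB := Lam * (1 + T + T ^+ 2).
Definition cC := 3 * Kd ^+ 2 + 2 * L + 12 * cB ^+ 2 + 1.
Definition cR := cC / lam.

Lemma ip_psi (psi : R -> R) (K : R) (f : Z -> R) : bounded_in T psi -> instrip T f ->
  sq f -> (forall z, f z != 0 -> - psi z.1 <= K) ->
  - ip (fun z => psi z.1 * f z) f <= K * nrm f ^+ 2.
Proof.
move=> bpsi f0 Lf h; have Lpf := sqint_strip bpsi f0 Lf.
rewrite -(ipNl Lpf Lf) nrm_sqr -(ipZl K Lf Lf).
apply: (ip_le (sqintN Lpf) Lf (sqintZ K Lf) Lf) => z.
have [->|fz] := eqVneq (f z) 0; first by rewrite !mulr0.
have -> : - (psi z.1 * f z) * f z = - psi z.1 * (f z * f z) by ring.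
rewrite -[leRHS]mulrA ler_wpM2r//; [exact: sqr_ge0|exact: h].
Qed.

Lemma four_ip_le (f g : Z -> R) : sq f -> sq g ->
  4 * ip f g <= nrm (fun z => f z + g z) ^+ 2.
Proof.
move=> Lf Lg; rewrite nrm_sqr (ipDl Lf Lg (sqintD Lf Lg)) (ipDr Lf Lg Lf) (ipDr Lf Lg Lg).
have := ip_ge0 mu (fun z => f z - g z).
rewrite (ipBl Lf Lg (sqintB Lf Lg)) (ipBr Lf Lg Lf) (ipBr Lf Lg Lg) (ipC mu g f).
lra.
Qed.

(** V = m w solves YV + d_J(A d_J V) - psi V = F, with F made of lower order terms and the cutoff
    error. From ||F||^2 >= 4 <YV, d_J(AP) - psi V>, the gain k ||V||^2 comes from psi' = 2k and
    antisymmetry of Y, and the other product from [commutator_ge]. The terms in ||P|| are absorbed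
    by the energy identity for V, at the price of a small del. *)
Lemma carleman w p g q DX k t0 del : solution T A C D w p g q -> has_dX T w DX ->
  0 < del -> t0 + del < T -> 8 * cR * del <= 1 -> 4 * Kc ^+ 2 + 2 * cR ^+ 2 <= k ->
  (forall z : Z, z.1 < t0 -> w z = 0) ->
  k * nrm (fun z => cweight k t0 del z.1 * w z) ^+ 2 <=
  4 * nrm (fun z => eweight k t0 del z.1 * w z) ^+ 2 +
  \sum_i nrm (fun z => cweight k t0 del z.1 * DX i z) ^+ 2.
Proof.
move=> sol hDX del0 delT hdel hk wt0.
have [Lw Lp Lg Lq w0 p0 g0 q0 sJ sJ2 sY seq] := sol.
have k0 : 0 <= k by apply: le_trans hk; rewrite addr_ge0// mulr_ge0// sqr_ge0.
set m := cweight k t0 del; set ec := eweight k t0 del.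
pose psi := dphase_fun k t0 del.
have sm : smooth1 m := smooth1_cweight k t0 del.
have sec : smooth1 ec := smooth1_eweight k t0 del.
have spsi : smooth1 psi := smooth1_dphase k t0 del.
have bm := bounded_in_smooth T sm; have be := bounded_in_smooth T sec.
have bpsi := bounded_in_smooth T spsi.
have bdm := bounded_in_smooth T (smooth1_derive sm).
pose V z := m z.1 * w z; pose P z := m z.1 * p z; pose H z := m z.1 * q z.
pose G z := m z.1 * g z + derive1 m z.1 * w z; pose E z := ec z.1 * w z.
have LV : sq V := sqint_strip bm w0 Lw; have LP : sq P := sqint_strip bm p0 Lp.
have LH : sq H := sqint_strip bm q0 Lq; have LE : sq E := sqint_strip be w0 Lw.
have LG : sq G := sqintD (sqint_strip bm g0 Lg) (sqint_strip bdm w0 Lw).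
have V0 : instrip T V by exact: instrip_mul. have P0 : instrip T P by exact: instrip_mul.
have G0 : instrip T G by move=> z h; rewrite /G g0// w0// !mulr0 addr0.
have AM z : `|A z| <= Lam by rewrite ger0_norm.
have LAp : sq (fun z => A z * p z) := sqint_bounded Am AM Lp.
have LAP : sq (fun z => A z * P z) := sqint_bounded Am AM LP.
have Ap0 : instrip T (fun z => A z * p z) by move=> z h; rewrite p0// mulr0.
have dJ : sderiv flowJ V P by exact: (sderiv_mul_strip cflow_J _ bm w0 p0 Lw Lp sJ).
have dJ2 : sderiv flowJ (fun z => A z * P z) H.
  rewrite (_ : (fun z => A z * P z) = (fun z => m z.1 * (A z * p z))); last first.
    by apply/funext => z; rewrite mulrCA.
  exact: (sderiv_mul_strip cflow_J _ bm Ap0 q0 LAp Lq sJ2).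
have mT : forall t, t0 + del <= t -> m t = 0.
  by move=> t ht; rewrite /m /cweight cutoff_right// mulr0.
have dY : sderiv flowY V G by apply: sY => //; exists (t0 + del).
pose G2 z := psi z.1 * G z + 2 * k * V z.
have dY2 : sderiv flowY (fun z => psi z.1 * V z) G2.
  have := sY _ (smooth1M spsi sm); rewrite (_ : (fun z => psi z.1 * V z) = (fun z => psi z.1 * m z.1 * w z)); last first.
    by apply/funext => z; rewrite mulrA.
  rewrite (_ : G2 = (fun z => psi z.1 * m z.1 * g z + derive1 (fun t => psi t * m t) z.1 * w z)); last first.
    by apply/funext => z; rewrite derive_dphaseM -/m -/psi /G2 /G /V; ring.
  by apply; exists (t0 + del) => // t ht; rewrite mT// mulr0.
have LpV : sq (fun z => psi z.1 * V z) := sqint_strip bpsi V0 LV.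
have LpG : sq (fun z => psi z.1 * G z) := sqint_strip bpsi G0 LG.
have LG2 : sq G2 := sqintD LpG (sqintZ _ LV).
(* Y is divergence free, so <YV, V> = - <V, YV>. *)
have iG : ip G V = 0.
  have := sderiv_ibp cflow_Y (@flowYK R) LV LG LV LG dY dY; by rewrite (ipC mu V G) => /eq_opp_eq0.
(* Antisymmetry again; the term 2k V in Y(psi V) is the source of the gain in the estimate. *)
have iGp : 2 * ip G (fun z => psi z.1 * V z) = - (2 * k) * nrm V ^+ 2.
  have := sderiv_ibp cflow_Y (@flowYK R) LV LG LpV LG2 dY dY2.
  rewrite (ipDr LpG (sqintZ _ LV) LV) (ipZr _ LV LV) -nrm_sqr.
  have -> : ip V (fun z => psi z.1 * G z) = ip G (fun z => psi z.1 * V z).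
    by rewrite -(ip_mulA mu (fun z => psi z.1) V G) ipC.
  exact: ibp_arith.
pose DV i z := m z.1 * DX i z.
have LDV i : sq (DV i) by have [Ld d0 _] := hDX i; exact: (sqint_strip bm d0 Ld).
have DV0 i : instrip T (DV i) by have [_ d0 _] := hDX i; exact: (instrip_mul m d0).
have dX i m' : bounded_in T m' ->
    sderiv (fun s z => flowX i (s * m' z.1) z) V (fun z => m' z.1 * DV i z).
  move=> bm'; have [Ld d0 hd] := hDX i.
  rewrite (_ : (fun z => m' z.1 * DV i z) = (fun z => m z.1 * (m' z.1 * DX i z))); last first.
    by apply/funext => z; rewrite /DV mulrCA.
  exact: (sderiv_mul_strip (cflow_Xm i bm'.1) (fun s z => erefl) bm w0 (instrip_mul m' d0) Lw
    (sqint_strip bm' d0 Ld) (hd _ bm')).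
have comm := commutator_ge T0 Am A0 AL ALip LV LP LG LH LDV P0 DV0 dJ dJ2 dY dX.
pose F z := G z + (H z - psi z.1 * V z).
have LHp := sqintB LH LpV; have LF : sq F := sqintD LG LHp.
have F2 : 4 * ip G H + 4 * k * nrm V ^+ 2 <= nrm F ^+ 2.
  have := four_ip_le LG LHp; rewrite (ipBr LH LpV LG) => h.
  exact: parallelogram_arith h iGp.
have eqF : nrm F <= Kc * nrm V + Kd * nrm P + nrm E.
  have LCV : sq (fun z => C z * V z) := sqint_bounded Cm CK LV.
  have LDP : sq (fun z => D z * P z) := sqint_bounded Dm DK LP.
  have LS := sqintD (sqintD LCV LDP) LE.
  have LCw : sq (fun z => C z * w z) := sqint_bounded Cm CK Lw.
  have LDp : sq (fun z => D z * p z) := sqint_bounded Dm DK Lp.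
  pose r z := g z + q z - (C z * w z + D z * p z).
  have Lr : sq r := sqintB (sqintD Lg Lq) (sqintD LCw LDp).
  have r0 : instrip T r by move=> z h; rewrite /r g0// q0// w0// p0// !mulr0 !addr0 subr0.
  have nr : nrm (fun z => m z.1 * r z) = 0.
    have [mm [M mM]] := bm; apply/eqP; rewrite eq_le nrm_ge0 andbT.
    have := nrm_strip (M := Num.max M 0) mm _ _ r0 Lr; rewrite seq mulr0; apply.
      by move=> t /mM h; rewrite le_max h.
    by rewrite le_max lexx orbT.
  have FE : F = (fun z => m z.1 * r z + (C z * V z + D z * P z + E z)).
    by apply/funext => z; rewrite /F /G /H /V /P /E /r derive_cweight -/m -/psi -/ec; ring.
  rewrite FE; apply: (le_trans (nrmD (sqint_strip bm r0 Lr) LS)); rewrite nr add0r.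
  apply: (le_trans (nrmD (sqintD LCV LDP) LE)); rewrite lerD2r.
  have bd (c : Z -> R) K f : (forall z, `|c z| <= K) -> sq f -> sq (fun z => c z * f z) ->
      nrm (fun z => c z * f z) <= K * nrm f.
    move=> cK Lf Lcf; have K0 : 0 <= K by apply: le_trans (cK point).
    have e := nrmZ K Lf; rewrite (ger0_norm K0) in e; rewrite -e.
    apply: (nrm_le Lcf (sqintZ K Lf)) => z; rewrite !normrM (ger0_norm K0) ler_wpM2r//.
  by apply: (le_trans (nrmD LCV LDP)); apply: lerD; exact: bd.
have F3 : nrm F ^+ 2 <= 3 * (Kc ^+ 2 * nrm V ^+ 2 + Kd ^+ 2 * nrm P ^+ 2 + nrm E ^+ 2).
  rewrite -!exprMn; apply: le_trans (sqr_sum3 _ _ _).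
  have S0 : 0 <= Kc * nrm V + Kd * nrm P + nrm E := le_trans (nrm_ge0 _ _) eqF.
  by rewrite lerXn2r ?nnegrE ?nrm_ge0.
(* Energy identity: test the conjugated equation with V, where <YV, V> drops out. The sign of psi is
   unfavourable, but -psi <= 4 k del on the support of V, which lies in t >= t0. *)
have P2 : lam * nrm P ^+ 2 <= nrm F * nrm V + 4 * k * del * nrm V ^+ 2.
  have h1 : lam * nrm P ^+ 2 <= ip P (fun z => A z * P z).
    rewrite nrm_sqr -(ipZr lam LP LP); apply: (ip_le LP (sqintZ lam LP) LP LAP) => z.
    have [h|h] := pselect (0 < z.1 < T); last by rewrite P0// !mul0r.
    rewrite mulrCA [leRHS]mulrCA ler_wpM2r ?Al//; exact: sqr_ge0.
  have h2 : ip P (fun z => A z * P z) = - ip H V.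
    have := sderiv_ibp cflow_J (@flowJK R) LV LP LAP LH dJ dJ2.
    by move=> ->; rewrite (ipC mu V H).
  have h3 : - ip H V = - ip F V - ip (fun z => psi z.1 * V z) V.
    by rewrite (ipDl LG LHp LV) (ipBl LH LpV LV) iG; ring.
  have h4 : - ip F V <= nrm F * nrm V.
    by have := CauchySchwarz LF LV; rewrite ler_norml => /andP[+ _]; rewrite lerNl.
  have h5 : - ip (fun z => psi z.1 * V z) V <= 4 * k * del * nrm V ^+ 2.
    apply: (ip_psi bpsi V0 LV) => z; have [zt|zt _] := ltP z.1 t0.
      by rewrite /V wt0// mulr0 eqxx.
    exact: dphase_ge.
  rewrite h2 h3 in h1; apply: (le_trans h1); exact: lerD.
have sumE : (\sum_i nrm (DV i)) ^+ 2 <= 3 * \sum_i nrm (DV i) ^+ 2.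
  by rewrite !big_ord_recl !big_ord0 !addr0 !addrA; exact: sqr_sum3.
exact: (carleman_arith lam0 L0 k0 erefl erefl hdel hk (commutator_arith F2 comm) P2 F3 sumE).
Qed.

End CarlemanEstimate.

(** * Calculus of functions equal up to a null set *)

Section NullDifference.
Context d (Z : measurableType d) {R : realType} (mu : {measure set Z -> \bar R}).
Notation sq := (sqint mu).
Notation nrm := (l2nrm mu).
Implicit Types f g h : Z -> R.

Lemma nrm0_refl f : nrm (fun z => f z - f z) = 0.
Proof.
rewrite (_ : (fun z => _) = (fun=> 0)); last by apply/funext => z; rewrite subrr.
by rewrite /l2nrm ip0l sqrtr0.
Qed.

Lemma nrm0_trans g f h : sq f -> sq g -> sq h ->
  nrm (fun z => f z - g z) = 0 -> nrm (fun z => g z - h z) = 0 -> nrm (fun z => f z - h z) = 0.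
Proof.
move=> Lf Lg Lh e1 e2; apply/eqP; rewrite eq_le nrm_ge0 andbT.
by apply: (le_trans (nrmB_triangle Lf Lg Lh)); rewrite e1 e2 addr0.
Qed.

Lemma nrm0_sym f g : nrm (fun z => f z - g z) = 0 -> nrm (fun z => g z - f z) = 0.
Proof. by rewrite nrmBC. Qed.

Lemma nrm0_add f f' g g' : sq f -> sq f' -> sq g -> sq g' ->
  nrm (fun z => f z - f' z) = 0 -> nrm (fun z => g z - g' z) = 0 ->
  nrm (fun z => (f z + g z) - (f' z + g' z)) = 0.
Proof.
move=> Lf Lf' Lg Lg' e1 e2; apply/eqP; rewrite eq_le nrm_ge0 andbT.
rewrite (_ : (fun z => _) = (fun z => (f z - f' z) + (g z - g' z))); last first.
  by apply/funext => z; ring.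
by apply: (le_trans (nrmD (sqintB Lf Lf') (sqintB Lg Lg'))); rewrite e1 e2 addr0.
Qed.

Lemma nrm0_mul (c : Z -> R) M f f' : measurable_fun setT c -> (forall z, `|c z| <= M) ->
  sq f -> sq f' ->
  nrm (fun z => f z - f' z) = 0 -> nrm (fun z => c z * f z - c z * f' z) = 0.
Proof.
move=> mc cM Lf Lf' e; apply/eqP; rewrite eq_le nrm_ge0 andbT.
have M0 : 0 <= M by apply: le_trans (cM point).
rewrite (_ : (fun z => _) = (fun z => c z * (f z - f' z))); last first.
  by apply/funext => z; rewrite mulrBr.
have LB := sqintB Lf Lf'.
rewrite -(mulr0 `|M|) -e -(nrmZ M LB).
apply: (nrm_le (sqint_bounded mc cM LB) (sqintZ M LB)) => z.
by rewrite !normrM (ger0_norm M0) ler_wpM2r.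
Qed.

Lemma nrm0_eq0 f g : sq f -> sq g -> nrm (fun z => f z - g z) = 0 -> nrm g = 0 -> nrm f = 0.
Proof.
move=> Lf Lg e g0; apply/eqP; rewrite eq_le nrm_ge0 andbT.
have := nrmD (sqintB Lf Lg) Lg; rewrite e g0 addr0; apply: le_trans.
by rewrite (_ : (fun z => _) = f)//; apply/funext => z; rewrite subrK.
Qed.

Lemma nrm0_countable (f_ : nat -> Z -> R) f : (forall n, sq (f_ n)) -> measurable_fun setT f ->
  (forall n, nrm (f_ n) = 0) -> (forall z, (forall n, f_ n z = 0) -> f z = 0) -> nrm f = 0.
Proof.
move=> Lf_ mf h hf; apply: (ae_nrm0 mf).
have h' n : {ae mu, forall z, setT z -> f_ n z = 0} := nrm0_ae (Lf_ n) (h n).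
have /ae_foralln := h'; apply: filterS => z hz _; apply: hf => n; exact: hz.
Qed.

End NullDifference.

(** * Averages of solutions are solutions *)

Section Closure.
Context {R : realType}.
Notation Z := (spacetime R).
Notation mu := (spacetime_measure R).
Notation leb := (@lebesgue_measure R).
Notation sq := (sqint mu).
Notation ip := (l2ip mu).
Notation nrm := (l2nrm mu).
Variables (T Lam Kc Kd : R) (A C D : Z -> R).
Hypothesis Am : measurable_fun [set: spacetimeM R] A.
Hypothesis AL : forall z, `|A z| <= Lam.
Hypothesis AX : forall i r z, A (flowX i r z) = A z.
Hypothesis Cm : measurable_fun [set: spacetimeM R] C.
Hypothesis CK : forall z, `|C z| <= Kc.
Hypothesis CX : forall i r z, C (flowX i r z) = C z.
Hypothesis Dm : measurable_fun [set: spacetimeM R] D.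
Hypothesis DK : forall z, `|D z| <= Kd.
Hypothesis DX : forall i r z, D (flowX i r z) = D z.

Lemma cv_out i (e : R) k f (z : Z) : (forall z', z'.1 = z.1 -> f z' = 0) -> cv i e k f z = 0.
Proof.
move=> f0; rewrite /cv /conv; under eq_Rintegral do rewrite f0 ?mulr0//.
by rewrite Rintegral_cst// mul0r.
Qed.

Lemma cv_instrip i e k f : instrip T f -> instrip T (cv i e k f).
Proof. by move=> f0 z h; apply: cv_out => z' hz; apply: f0; rewrite hz. Qed.

Lemma cv_mul_strip i e (k : R -> R) (m : R -> R) f : L1 leb k -> bounded_in T m -> instrip T f -> sq f ->
  nrm (fun z => cv i e k (fun z => m z.1 * f z) z - m z.1 * cv i e k f z) = 0.
Proof.
move=> Lk [mm [M mM]] f0 Lf; rewrite (truncate_mul m f0).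
have := cv_mul (i := i) (e := e) Lk Lf (measurable_truncate T mm) (fun z => truncate_le z.1 mM) (fun r z => erefl).
congr (l2nrm mu _ = 0); apply/funext => z; congr (_ - _).
exact: (esym (congr1 (fun h => h z) (truncate_mul m (cv_instrip i e k f0)))).
Qed.

Lemma cvD i e (k : R -> R) f g : L1 leb k -> sq f -> sq g ->
  nrm (fun z => cv i e k (fun z => f z + g z) z - (cv i e k f z + cv i e k g z)) = 0.
Proof.
move=> Lk Lf Lg; have := cv_lin i e 1 Lk Lf Lg.
rewrite (_ : (fun z => 1 * f z + g z) = (fun z => f z + g z)); last first.
  by apply/funext => z; rewrite mul1r.
by congr (l2nrm mu _ = 0); apply/funext => z; rewrite mul1r.
Qed.

Lemma cv_ext i e (k : R -> R) f g : L1 leb k -> sq f -> sq g ->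
  nrm (fun z => f z - g z) = 0 -> nrm (fun z => cv i e k f z - cv i e k g z) = 0.
Proof.
move=> Lk Lf Lg h.
have LB := sqintB Lf Lg; have Lcf := cv_sqint i e Lk Lf; have Lcg := cv_sqint i e Lk Lg.
have Lcb := cv_sqint i e Lk LB.
have hc : nrm (cv i e k (fun z => f z - g z)) = 0.
  apply/eqP; rewrite eq_le nrm_ge0 andbT; apply: (le_trans (cv_nrm i e Lk LB)).
  by rewrite h mulr0.
have := cvD i e Lk LB Lg.
rewrite (_ : (fun z => f z - g z + g z) = f); last by apply/funext => z; rewrite subrK.
move=> h2; apply: (nrm0_eq0 (sqintB Lcf Lcg) Lcb _ hc).
by rewrite -h2; congr (l2nrm mu); apply/funext => z; ring.
Qed.

(** The flow of X_i commutes with those of d_J and Y and leaves A, C, D and time invariant. Products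
    with these commute with averaging only up to null sets, whence the uses of [sderiv_ext]. *)
Lemma solution_cv i e n w p g q : solution T A C D w p g q ->
  solution T A C D (cv i e (kap n) w) (cv i e (kap n) p) (cv i e (kap n) g) (cv i e (kap n) q).
Proof.
move=> [Lw Lp Lg Lq w0 p0 g0 q0 sJ sJ2 sY seq]; have Lk := @kap_L1 R n.
have Cw := cv_sqint i e Lk Lw; have Cp := cv_sqint i e Lk Lp.
have Cg := cv_sqint i e Lk Lg; have Cq := cv_sqint i e Lk Lq.
have LAp : sq (fun z => A z * p z) := sqint_bounded Am AL Lp.
have LAcp : sq (fun z => A z * cv i e (kap n) p z) := sqint_bounded Am AL Cp.
split; [exact: Cw|exact: Cp|exact: Cg|exact: Cq|..]; do ?[exact: cv_instrip].
- apply: (cv_sderiv cflow_J _ Lk Lw Lp sJ) => s r z; exact/esym/flowXJ.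
- apply: (sderiv_ext cflow_J (cv_sqint i e Lk LAp) LAcp Cq Cq _ (nrm0_refl _ _)).
    exact: (cv_mul (i := i) (e := e) Lk Lp Am AL (fun r z => AX i _ z)).
  apply: (cv_sderiv cflow_J _ Lk LAp Lq sJ2) => s r z; exact/esym/flowXJ.
- move=> m sm mT; have bm := bounded_in_smooth T sm.
  have bdm := bounded_in_smooth T (smooth1_derive sm).
  have Lmw := sqint_strip bm w0 Lw; have Lmg := sqint_strip bm g0 Lg.
  have Ldw := sqint_strip bdm w0 Lw.
  have Lmcw := sqint_strip bm (cv_instrip i e (kap n) w0) Cw.
  have Lmcg := sqint_strip bm (cv_instrip i e (kap n) g0) Cg.
  have Ldcw := sqint_strip bdm (cv_instrip i e (kap n) w0) Cw.
  have LS := sqintD Lmg Ldw.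
  apply: (sderiv_ext cflow_Y (cv_sqint i e Lk Lmw) Lmcw (cv_sqint i e Lk LS) (sqintD Lmcg Ldcw)).
  + exact: cv_mul_strip.
  + apply: (nrm0_trans (cv_sqint i e Lk LS) (sqintD (cv_sqint i e Lk Lmg) (cv_sqint i e Lk Ldw))
      (sqintD Lmcg Ldcw) (cvD i e Lk Lmg Ldw)).
    apply: (nrm0_add (cv_sqint i e Lk Lmg) Lmcg (cv_sqint i e Lk Ldw) Ldcw); exact: cv_mul_strip.
  + apply: (cv_sderiv cflow_Y _ Lk Lmw LS (sY _ sm mT)) => s r z; exact/esym/flowXY.
- have LCw : sq (fun z => C z * w z) := sqint_bounded Cm CK Lw.
  have LDp : sq (fun z => D z * p z) := sqint_bounded Dm DK Lp.
  have LCcw : sq (fun z => C z * cv i e (kap n) w z) := sqint_bounded Cm CK Cw.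
  have LDcp : sq (fun z => D z * cv i e (kap n) p z) := sqint_bounded Dm DK Cp.
  have e1 := cvD i e Lk Lg Lq; have e2 := cvD i e Lk LCw LDp.
  have e3 := cv_ext i e Lk (sqintD Lg Lq) (sqintD LCw LDp) seq.
  have e4 := nrm0_add (cv_sqint i e Lk LCw) LCcw (cv_sqint i e Lk LDp) LDcp
    (cv_mul (i := i) (e := e) Lk Lw Cm CK (fun r z => CX i _ z)) (cv_mul (i := i) (e := e) Lk Lp Dm DK (fun r z => DX i _ z)).
  have M1 := cv_sqint i e Lk (sqintD Lg Lq); have M2 := cv_sqint i e Lk (sqintD LCw LDp).
  have M0 := sqintD Cg Cq; have M4 := sqintD LCcw LDcp.
  have M3 := sqintD (cv_sqint i e Lk LCw) (cv_sqint i e Lk LDp).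
  apply: (nrm0_trans M0 M1 M4 (nrm0_sym e1)).
  by apply: (nrm0_trans M1 M2 M4 e3); exact: (nrm0_trans M2 M3 M4 e2 e4).
Qed.

Definition dXs i (c : R) f h := forall m, bounded_in T m ->
  sderiv (fun s z => flowX i (s * m z.1) z) f (fun z => m z.1 * (c * h z)).

Lemma dXs_base i e n f : e != 0 -> sq f -> instrip T f ->
  dXs i (- e^-1) (cv i e (kap n) f) (cv i e (kap n.+1) f).
Proof.
move=> e0 Lf f0 m [mm [M mM]].
rewrite (_ : (fun z => m z.1 * _) = (fun z => - (m z.1 / e) * cv i e (kap n.+1) f z)); last first.
  by apply/funext => z; rewrite mulrA mulrN.
have h := cv_sderivX i n e0 mm mM Lf f0; exact: h.
Qed.

(** Averaging along another X_j preserves derivatives along X_i, as the two flows commute. This lets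
    the three averages be nested. *)
Lemma dXs_cv i j (e : R) (k : R -> R) c f h : L1 leb k -> sq f -> sq h -> instrip T h ->
  dXs i c f h -> dXs i c (cv j e k f) (cv j e k h).
Proof.
move=> Lk Lf Lh h0 d m bm.
have bmc : bounded_in T (fun t => m t * c).
  apply: bounded_inM => //; split => //; by exists `|c|.
have Lmh := sqint_strip bmc h0 Lh.
have Cf := cv_sqint j e Lk Lf; have Ch := cv_sqint j e Lk Lh.
have Lmch := sqint_strip bmc (cv_instrip j e k h0) Ch.
have E (q : Z -> R) : (fun z => m z.1 * (c * q z)) = (fun z => m z.1 * c * q z).
  by apply/funext => z; rewrite mulrA.
rewrite E; have dm := d m bm; rewrite E in dm.
have cF := cflow_Xm i bm.1.
apply: (sderiv_ext cF Cf Cf (cv_sqint j e Lk Lmh) Lmch (nrm0_refl _ _)).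
  exact: (cv_mul_strip j e Lk bmc h0 Lh).
by apply: (cv_sderiv cF _ Lk Lf Lmh dm) => s r z; exact: flowXC.
Qed.

End Closure.

(** * Iterating an estimate that loses derivatives *)

Section Iteration.
Context {R : realType}.

Definition bump (i : 'I_3) (b : nat * nat * nat) : nat * nat * nat :=
  if i == 0 :> nat then (b.1.1.+1, b.1.2, b.2)
  else if i == 1%N :> nat then (b.1.1, b.1.2.+1, b.2) else (b.1.1, b.1.2, b.2.+1).

Definition size3 (b : nat * nat * nat) : nat := (b.1.1 + b.1.2 + b.2)%N.

Lemma size3_bump i b : size3 (bump i b) = (size3 b).+1.
Proof. by rewrite /size3 /bump; case: ifP => [_|_]; [|case: ifP => _] => /=; lia. Qed.

Lemma archi_pow_le (x y a : R) : (forall n : nat, x <= a / 2 ^+ n + y) -> x <= y.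
Proof.
move=> h; rewrite leNgt; apply/negP => yx.
have xy : 0 < x - y by rewrite subr_gt0.
have c : a / 2 ^+ n @[n --> \oo] --> (0 : R).
  rewrite [X in _ --> X](_ : 0 = a * 0); last by rewrite mulr0.
  apply: cvgM; first exact: cvg_cst.
  rewrite (_ : (fun n : nat => _) = geometric 1 2^-1); last first.
    by apply/funext => n; rewrite /geometric /= mul1r exprVn.
  by apply: cvg_geometric; rewrite ger0_norm ?invr_ge0// invf_lt1// ltr1n.
have /(cvgr_lt _)/(_ _ xy) [n _ /(_ n (leqnn n)) /=] := c.
have := h n; lra.
Qed.

Lemma iter_arith (k N Y X Q F S : R) : 1 <= k -> 24 * Q <= k -> 0 <= Y -> 0 <= F -> 0 <= Q ->
  0 <= X -> k * N <= Y * F + Q * S -> S <= 3 * ((X + 2 * Y) * (4 * F)) ->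
  N <= (X / 2 + 2 * Y) * F.
Proof.
move=> k1 kQ Y0 F0 Q0 X0 h1 h2.
have k0 : 0 < k by apply: lt_le_trans k1.
have h3 : k * N <= Y * F + Q * (3 * ((X + 2 * Y) * (4 * F))).
  by apply: (le_trans h1); rewrite lerD2l ler_wpM2l.
have W0 : 0 <= (X + 2 * Y) * F by rewrite mulr_ge0// addr_ge0// mulr_ge0.
have h4 : 24 * Q * ((X + 2 * Y) * F) <= k * ((X + 2 * Y) * F) by rewrite ler_wpM2r.
have h5 : Y * F <= k * (Y * F) by rewrite ler_peMl// mulr_ge0.
rewrite -(ler_pM2l k0); apply: (le_trans h3); move: h4 h5; lra.
Qed.

(** By induction on n, N b <= (X0 / 2^n + 2 Y) 4^|b|. Passing to the three bumped indices costs 3 *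
    4 * Q <= k/2, so each use of the recursion halves the a priori part. Thus X0 disappears from the
    conclusion, which matters because it will depend on k without control. *)
Lemma iter_bound (N : nat * nat * nat -> R) (k Y X0 Q : R) :
  1 <= k -> 24 * Q <= k -> 0 <= Y -> 0 <= Q -> 0 <= X0 ->
  (forall b, k * N b <= Y * 4 ^+ size3 b + Q * \sum_i N (bump i b)) ->
  (forall b, N b <= X0 * 4 ^+ size3 b) -> N (0%N, 0%N, 0%N) <= 2 * Y.
Proof.
move=> k1 kQ Y0 Q0 X00 rec bd.
have h n b : N b <= (X0 / 2 ^+ n + 2 * Y) * 4 ^+ size3 b.
  elim: n b => [|n IH] b.
    rewrite expr0 divr1; apply: (le_trans (bd b)); rewrite ler_wpM2r ?exprn_ge0//.
    by rewrite lerDl mulr_ge0.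
  rewrite exprSr invfM mulrA.
  apply: (iter_arith k1 kQ Y0 _ Q0 _ (rec b)); rewrite ?exprn_ge0 ?divr_ge0 ?exprn_ge0//.
  have -> : 3 * ((X0 / 2 ^+ n + 2 * Y) * (4 * 4 ^+ size3 b)) =
      \sum_(i < 3) (X0 / 2 ^+ n + 2 * Y) * 4 ^+ (size3 b).+1.
    by rewrite sumr_const card_ord exprS mulr_natl.
  by apply: ler_sum => i _; apply: (le_trans (IH _)); rewrite size3_bump.
apply: (@archi_pow_le _ _ X0) => n; have := h n (0%N, 0%N, 0%N).
by rewrite expr0 mulr1.
Qed.

End Iteration.

(** * Averaging in the three commuting directions *)

Section Smooth3.
Context {R : realType}.
Notation Z := (spacetime R).
Notation mu := (spacetime_measure R).
Notation leb := (@lebesgue_measure R).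
Notation sq := (sqint mu).
Notation ip := (l2ip mu).
Notation nrm := (l2nrm mu).
Variable (T : R).
Implicit Types (e : 'I_3 -> R) (f : Z -> R) (b : nat * nat * nat).

(** The multi-index b counts derivatives put on each kernel: up to the factors [- e i], [cv3 e b f]
    is the X^b-derivative of [cv3 e (0, 0, 0) f]. The iteration runs over b. *)
Definition cv3 e b f : Z -> R :=
  cv (inord 0) (e (inord 0)) (kap b.1.1)
    (cv (inord 1) (e (inord 1)) (kap b.1.2) (cv (inord 2) (e (inord 2)) (kap b.2) f)).

Lemma cv3_sqint e b f : sq f -> sq (cv3 e b f).
Proof. by move=> Lf; do 3 apply: cv_sqint (@kap_L1 R _) _. Qed.

Lemma cv3_instrip e b f : instrip T f -> instrip T (cv3 e b f).
Proof. by move=> f0; do 3 apply: cv_instrip. Qed.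

Lemma cv3_left e b f (t0 : R) : (forall z : Z, z.1 < t0 -> f z = 0) ->
  forall z : Z, z.1 < t0 -> cv3 e b f z = 0.
Proof. by move=> h z zt; do 3 (apply: cv_out => ? ?); apply: h; congruence. Qed.

(** A Bernstein-type inequality: the kernels have bounded frequencies, so each derivative costs at
    most a factor 2. *)
Lemma cv3_nrm e b f : sq f ->
  nrm (cv3 e b f) <= (16 * l1 leb (@env R) + 1) ^+ 3 * nrm f * 2 ^+ size3 b.
Proof.
move=> Lf; set K := _ + 1; have l0 : 0 <= l1 leb (@env R) := l1_ge0 _ _.
have K0 : 0 <= K by rewrite addr_ge0// mulr_ge0.
have hk n : l1 leb (kap n : R -> R) + 1 <= K * 2 ^+ n.
  rewrite mulrDl mul1r; apply: lerD; last by rewrite exprn_ege1// ler1n.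
  by apply: (le_trans (kap_l1 n)); rewrite /kapc mulrAC.
have hc i (e' : R) n (g : Z -> R) : sq g -> nrm (cv i e' (kap n) g) <= K * 2 ^+ n * nrm g.
  move=> Lg; apply: (le_trans (cv_nrm i e' (@kap_L1 R n) Lg)).
  by rewrite ler_wpM2r ?nrm_ge0.
have L2 := cv_sqint (inord 2) (e (inord 2)) (@kap_L1 R b.2) Lf.
have L1 := cv_sqint (inord 1) (e (inord 1)) (@kap_L1 R b.1.2) L2.
have P n : 0 <= K * 2 ^+ n by rewrite mulr_ge0// exprn_ge0.
apply: (le_trans (hc _ _ _ _ L1)).
apply: (le_trans (ler_wpM2l (P _) (hc _ _ _ _ L2))).
apply: (le_trans (ler_wpM2l (P _) (ler_wpM2l (P _) (hc _ _ _ _ Lf)))).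
by rewrite le_eqVlt; apply/orP; left; apply/eqP; rewrite /size3 !exprD; ring.
Qed.

Lemma cv3_has_dX e b f : (forall i, e i != 0) -> sq f -> instrip T f ->
  has_dX T (cv3 e b f) (fun i z => - (e i)^-1 * cv3 e (bump i b) f z).
Proof.
move=> e0 Lf f0 i.
split; first exact: (sqintZ _ (cv3_sqint e _ Lf)).
  by move=> z h; rewrite (cv3_instrip e _ f0)// mulr0.
have L2 := cv_sqint (inord 2) (e (inord 2)) (@kap_L1 R b.2) Lf.
have L2' := cv_sqint (inord 2) (e (inord 2)) (@kap_L1 R b.2.+1) Lf.
have L1 := cv_sqint (inord 1) (e (inord 1)) (@kap_L1 R b.1.2) L2.
have L1' := cv_sqint (inord 1) (e (inord 1)) (@kap_L1 R b.1.2) L2'.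
have L1'' := cv_sqint (inord 1) (e (inord 1)) (@kap_L1 R b.1.2.+1) L2.
have s2 := cv_instrip (inord 2) (e (inord 2)) (kap b.2) f0.
have s2' := cv_instrip (inord 2) (e (inord 2)) (kap b.2.+1) f0.
have s1 := cv_instrip (inord 1) (e (inord 1)) (kap b.1.2) s2.
have s1' := cv_instrip (inord 1) (e (inord 1)) (kap b.1.2) s2'.
have s1'' := cv_instrip (inord 1) (e (inord 1)) (kap b.1.2.+1) s2.
have [i0|i0] := eqVneq (i : nat) 0%N.
  have -> : i = inord 0 by apply/val_inj; rewrite /= inordK.
  rewrite /bump inordK//=; exact: (dXs_base (inord 0) b.1.1 (e0 _) L1 s1).
have [i1|i1] := eqVneq (i : nat) 1%N.
  have -> : i = inord 1 by apply/val_inj; rewrite /= inordK.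
  rewrite /bump inordK//=.
  apply: (dXs_cv (inord 0) _ (@kap_L1 R _) L1 L1'' s1'').
  exact: (dXs_base (inord 1) b.1.2 (e0 _) L2 s2).
have -> : i = inord 2 by apply/val_inj; rewrite /= inordK//; move: (ltn_ord i) i0 i1; case: (i : nat) => [|[|[|]]].
rewrite /bump inordK//=.
apply: (dXs_cv (inord 0) _ (@kap_L1 R _) L1 L1' s1').
apply: (dXs_cv (inord 1) _ (@kap_L1 R _) L2 L2' s2').
exact: (dXs_base (inord 2) b.2 (e0 _) Lf f0).
Qed.

End Smooth3.

(** * Numerical bounds on the weight *)

Section WeightArithmetic.
Context {R : realFieldType}.

Lemma phase_upper (t t0 del : R) : t0 + del / 2 <= t -> t <= t0 + del ->
  (t - t0 - 2 * del) ^+ 2 <= 9 / 4 * del ^+ 2.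
Proof.
move=> h1 h2; have -> : 9 / 4 * del ^+ 2 = (3 / 2 * del) ^+ 2 by field.
rewrite -subr_ge0 subr_sqr mulr_ge0//; move: h1 h2; lra.
Qed.

Lemma phase_lower (t t0 del : R) : 0 < del -> t < t0 + del / 4 ->
  49 / 16 * del ^+ 2 <= (t - t0 - 2 * del) ^+ 2.
Proof.
move=> d0 h; have -> : 49 / 16 * del ^+ 2 = (7 / 4 * del) ^+ 2 by field.
rewrite -[leRHS]sqrrN -subr_ge0 subr_sqr mulr_ge0//; move: d0 h; lra.
Qed.

Lemma gain_arith (k d x : R) : 0 <= k * d -> x = k * (13 / 16 * d) ->
  k * (13 / 8 * d) <= 1 + 2 * x.
Proof. lra. Qed.

Lemma exp_arith (M a K b x : R) : (a * b * x) ^+ 2 <= 8 * (M * a * K) ^+ 2 ->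
  a ^+ 2 * (b * x) ^+ 2 <= a ^+ 2 * (8 * (M * K) ^+ 2).
Proof. rewrite !expr2; lra. Qed.

End WeightArithmetic.

(** * Vanishing on a short time interval, then on the whole strip *)

Section Uniqueness.
Context {R : realType}.
Notation Z := (spacetime R).
Notation mu := (spacetime_measure R).
Notation leb := (@lebesgue_measure R).
Notation sq := (sqint mu).
Notation ip := (l2ip mu).
Notation nrm := (l2nrm mu).
Variables (T L Lam lam Kc Kd : R) (A C D : Z -> R).
Hypotheses (T0 : 0 < T) (L0 : 0 <= L) (lam0 : 0 < lam).
Hypothesis Am : measurable_fun [set: spacetimeM R] A.
Hypothesis A0 : forall z, 0 <= A z.
Hypothesis AL : forall z, A z <= Lam.
Hypothesis Al : forall z, 0 < z.1 < T -> lam <= A z.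
Hypothesis ALip : forall s z, 0 <= s -> 0 < z.1 < T -> A (flowY (- s) z) <= A z + L * s.
Hypothesis AX : forall i r z, A (flowX i r z) = A z.
Hypothesis Cm : measurable_fun [set: spacetimeM R] C.
Hypothesis CK : forall z, `|C z| <= Kc.
Hypothesis CX : forall i r z, C (flowX i r z) = C z.
Hypothesis Dm : measurable_fun [set: spacetimeM R] D.
Hypothesis DK : forall z, `|D z| <= Kd.
Hypothesis DX : forall i r z, D (flowX i r z) = D z.

Let AM z : `|A z| <= Lam. Proof. by rewrite ger0_norm. Qed.

Notation r := (cR T L Lam lam Kd).

Lemma cR_gt0 : 0 < r.
Proof.
rewrite divr_gt0// /cC; have := sqr_ge0 Kd; have := sqr_ge0 (cB T Lam); have := L0; lra.
Qed.

Lemma cv3_solution (e : 'I_3 -> R) b w p g q : solution T A C D w p g q ->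
  solution T A C D (cv3 e b w) (cv3 e b p) (cv3 e b g) (cv3 e b q).
Proof. by move=> s; do 3 apply: (solution_cv Am AM AX Cm CK CX Dm DK DX). Qed.

Lemma eweight_bound t0 del : 0 < del -> exists2 M, 0 <= M &
  forall k t, 0 <= k -> 0 < t < T -> `|eweight k t0 del t| <= M * expR (k * (9 / 4 * del ^+ 2)).
Proof.
move=> d0; have [M M0 hM] := continuous_bounded (ltW T0)
  (smooth1_continuous (smooth1_derive (smooth1_cutoff t0 del))).
exists M => // k t k0 /andP[t1 t2]; rewrite /eweight normrM mulrC.
rewrite (ger0_norm (expR_ge0 _)).
have [ht|ht] := pselect (t0 + del / 2 <= t <= t0 + del).
  apply: ler_pM; rewrite ?normr_ge0 ?expR_ge0//; first by apply: hM; rewrite !ltW.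
  rewrite ler_expR /phase_fun ler_wpM2l//.
  by case/andP: ht; exact: phase_upper.
have -> : derive1 (cutoff t0 del) t = 0.
  move/negP: ht; rewrite negb_and -!ltNge => /orP[h|h].
    apply: (@near_cst_derive _ _ 1); near=> y; apply: cutoff_left => //; apply: ltW.
    by near: y; exact: lt_nbhsl.
  apply: (@near_cst_derive _ _ 0); near=> y; apply: cutoff_right => //; apply: ltW.
  by near: y; exact: lt_nbhsr.
by rewrite normr0 mul0r mulr_ge0// expR_ge0.
Unshelve. all: by end_near. Qed.

Definition before (t1 : R) (f : Z -> R) (z : Z) : R := (z.1 < t1)%R%:R * f z.

Lemma before_bounded_in t1 : bounded_in T (fun t => (t < t1)%R%:R).
Proof.
split; last by exists 1 => t _; rewrite normr_nat lern1 leq_b1.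
rewrite (_ : (fun t => _) = (fun t => if t < t1 then 1 else 0)); last first.
  by apply/funext => t; case: (t < t1).
by apply: measurable_fun_ifT => //; exact: measurable_fun_ltr.
Qed.

Lemma nrm0_mul_strip m f f' : bounded_in T m -> instrip T f -> instrip T f' ->
  sq f -> sq f' -> nrm (fun z => f z - f' z) = 0 ->
  nrm (fun z => m z.1 * f z - m z.1 * f' z) = 0.
Proof.
move=> [mm [M hM]] f0 f'0 Lf Lf' e; apply/eqP; rewrite eq_le nrm_ge0 andbT.
rewrite (_ : (fun z => _) = (fun z => m z.1 * (f z - f' z))); last first.
  by apply/funext => z; rewrite mulrBr.
have i0 : instrip T (fun z => f z - f' z) by move=> z h; rewrite f0// f'0// subrr.
have hM' t : 0 < t < T -> `|m t| <= Num.max M 0 by move=> h; rewrite le_max hM.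
have M0 : 0 <= Num.max M 0 by rewrite le_max lexx orbT.
by have := nrm_strip mm hM' M0 i0 (sqintB Lf Lf'); rewrite e mulr0.
Qed.

Lemma before_instrip t1 f : instrip T f -> instrip T (before t1 f).
Proof. by move=> f0 z h; rewrite /before f0// mulr0. Qed.

Lemma before_sqint t1 f : instrip T f -> sq f -> sq (before t1 f).
Proof. by move=> f0 Lf; exact: (sqint_strip (before_bounded_in t1) f0 Lf). Qed.

(* The weight is at least exp(49 k del^2 / 16) before t0 + del/4 and at most
   exp(9 k del^2 / 4) on the support of the derivative of the cutoff. *)
Lemma cv3_vanish (e : 'I_3 -> R) w p g q t0 del : solution T A C D w p g q ->
  (forall i, 0 < e i) -> 0 < del -> t0 + del < T -> 8 * r * del <= 1 ->
  (forall z : Z, z.1 < t0 -> w z = 0) ->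
  nrm (before (t0 + del / 4) (cv3 e (0, 0, 0)%N w)) = 0.
Proof.
move=> sol e0 d0 dT hd wt0; have en i : e i != 0 by rewrite gt_eqF.
have Lw := sol_w sol; have w0 := sol_w0 sol.
have [M M0 hM] := eweight_bound t0 d0.
set K := (16 * l1 leb (@env R) + 1) ^+ 3 * nrm w.
have K0 : 0 <= K by rewrite mulr_ge0 ?nrm_ge0// exprn_ge0// addr_ge0// mulr_ge0// l1_ge0.
have p2 n : 0 <= 2 ^+ n :> R by rewrite exprn_ge0.
pose Q := \sum_i (e i)^-1 ^+ 2.
have Q0 : 0 <= Q by apply: sumr_ge0 => i _; exact: sqr_ge0.
have Qi i : (e i)^-1 ^+ 2 <= Q.
  by rewrite /Q (bigD1 i)//= lerDl; apply: sumr_ge0 => j _; exact: sqr_ge0.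
(* The first two terms are the threshold of [carleman], 24 Q that of [iter_bound]. The dependence on
   the scales e is confined to Q. *)
pose k0 := 4 * Kc ^+ 2 + 2 * r ^+ 2 + 24 * Q + 1.
have k01 : 1 <= k0.
  by rewrite /k0 lerDr !addr_ge0// mulr_ge0// sqr_ge0.
pose N k b := nrm (fun z => cweight k t0 del z.1 * cv3 e b w z) ^+ 2.
have Lb b := cv3_sqint e b Lw; have ob b := cv3_instrip e b w0.
have nb b : nrm (cv3 e b w) <= K * 2 ^+ size3 b := cv3_nrm e b Lw.
(* The a priori constant contains the maximum [Mc] of the weight, which grows too fast in k to be
   useful; [iter_bound] removes it and leaves only the cutoff error. *)
have NB k : k0 <= k -> N k (0, 0, 0)%N <= 2 * (4 * (M * expR (k * (9 / 4 * del ^+ 2)) * K) ^+ 2).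
  move=> kk; have kp : 0 <= k by apply: le_trans kk; apply: le_trans k01.
  have [bm [Mc hMc]] := bounded_in_smooth T (smooth1_cweight k t0 del).
  have Mc0 : 0 <= Num.max Mc 0 by rewrite le_max lexx orbT.
  apply: (@iter_bound R (N k) k _ ((Num.max Mc 0 * K) ^+ 2) Q) => //.
  - exact: le_trans kk.
  - by apply: le_trans kk; rewrite /k0 addrAC lerDr !addr_ge0// mulr_ge0// sqr_ge0.
  - by rewrite mulr_ge0// sqr_ge0.
  - exact: sqr_ge0.
  - move=> b; have kk2 : 4 * Kc ^+ 2 + 2 * r ^+ 2 <= k by apply: le_trans kk; rewrite /k0 -[leRHS]addrA lerDl addr_ge0// mulr_ge0.
    have := carleman T0 L0 lam0 Am A0 AL Al ALip Cm CK Dm DK (cv3_solution e b sol)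
      (cv3_has_dX b en Lw w0) d0 dT hd kk2 (cv3_left e b wt0).
    move/le_trans; apply; apply: lerD.
      rewrite -[leRHS]mulrA ler_wpM2l// (_ : 4 ^+ size3 b = (2 ^+ size3 b) ^+ 2); last first.
        by rewrite -exprM mulnC exprM expr2 -natrM.
      have E0 : 0 <= M * expR (k * (9 / 4 * del ^+ 2)) by rewrite mulr_ge0 ?expR_ge0.
      rewrite -exprMn lerXn2r ?nnegrE ?nrm_ge0//.
        exact: mulr_ge0 (mulr_ge0 E0 K0) (p2 _).
      apply: (le_trans (nrm_strip (smooth1_measurable (smooth1_eweight k t0 del)) _ E0 (ob b) (Lb b))).
        by move=> t ht; exact: hM.
      by rewrite -[leRHS]mulrA ler_wpM2l.
    rewrite mulr_sumr; apply: ler_sum => i _.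
    have -> : (fun z => cweight k t0 del z.1 * (- (e i)^-1 * cv3 e (bump i b) w z)) =
       (fun z => - (e i)^-1 * (cweight k t0 del z.1 * cv3 e (bump i b) w z)).
      by apply/funext => z; rewrite mulrCA.
    rewrite (nrmZ _ (sqint_strip (bounded_in_smooth T (smooth1_cweight k t0 del)) (ob _) (Lb _))).
    by rewrite exprMn normrN real_normK ?num_real// ler_wpM2r// sqr_ge0.
  - move=> b; rewrite (_ : 4 ^+ size3 b = (2 ^+ size3 b) ^+ 2); last first.
      by rewrite -exprM mulnC exprM expr2 -natrM.
    rewrite -exprMn lerXn2r ?nnegrE ?nrm_ge0//.
      exact: mulr_ge0 (mulr_ge0 Mc0 K0) (p2 _).
    have h t : 0 < t < T -> `|cweight k t0 del t| <= Num.max Mc 0.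
      by move=> ht; rewrite le_max hMc.
    apply: (le_trans (nrm_strip bm h Mc0 (ob b) (Lb b))).
    by rewrite -mulrA ler_wpM2l.
set v := cv3 e (0, 0, 0)%N w in N NB *; set X := nrm _.
have vt0 : forall z : Z, z.1 < t0 -> v z = 0 := cv3_left e (0, 0, 0)%N wt0.
have Lv : sq v := Lb _; have v0 : instrip T v := ob _.
have LX : sq (before (t0 + del / 4) v) := before_sqint _ v0 Lv.
have lower k : 0 <= k -> expR (k * (49 / 16 * del ^+ 2)) * X <= nrm (fun z => cweight k t0 del z.1 * v z).
  move=> kp; have Lc := sqint_strip (bounded_in_smooth T (smooth1_cweight k t0 del)) v0 Lv.
  have := nrmZ (expR (k * (49 / 16 * del ^+ 2))) LX; rewrite (ger0_norm (expR_ge0 _)) => <-.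
  apply: (nrm_le (sqintZ _ LX) Lc) => z.
  rewrite /before; case: ltP => h; last by rewrite mul0r mulr0 normr0.
  rewrite mul1r; have [zt|zt] := ltP z.1 t0; first by rewrite vt0// !mulr0.
  have -> : cweight k t0 del z.1 = expR (phase_fun k t0 del z.1).
    rewrite /cweight cutoff_left ?mulr1//; apply: (le_trans (ltW h)).
    by rewrite lerD2l ler_wpM2l ?(ltW d0)// lef_pV2 ?posrE// ler_nat.
  rewrite !normrM !(ger0_norm (expR_ge0 _)) ler_wpM2r// ler_expR /phase_fun ler_wpM2l//.
  exact: phase_lower.
have X0 : 0 <= X := nrm_ge0 _ _.
(* Dividing by the square of exp(9/4 k del^2) leaves the factor exp(13/8 k del^2) on X^2, because
   49/16 - 9/4 = 13/16; the bound exp(x) >= 1 + x reduces this to linear growth in k. *)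
have main k : k0 <= k -> X ^+ 2 * (k * (13 / 8 * del ^+ 2)) <= 8 * (M * K) ^+ 2.
  move=> kk; have kp : 0 <= k by apply: le_trans kk; apply: le_trans k01.
  set a := k * (9 / 4 * del ^+ 2); set b := k * (49 / 16 * del ^+ 2).
  have h : (expR b * X) ^+ 2 <= 8 * (M * expR a * K) ^+ 2.
    have := NB k kk; rewrite mulrA -natrM; apply: le_trans; rewrite /N lerXn2r ?nnegrE ?nrm_ge0//.
      by rewrite mulr_ge0 ?expR_ge0.
    exact: lower.
  have hb : b = a + k * (13 / 16 * del ^+ 2) by rewrite /a /b; field.
  have h1 : (expR (k * (13 / 16 * del ^+ 2)) * X) ^+ 2 <= 8 * (M * K) ^+ 2.
    have ea : 0 < expR a ^+ 2 by rewrite exprn_gt0// expR_gt0.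
    by rewrite -(ler_pM2l ea); apply: exp_arith; move: h; rewrite hb expRD.
  apply: le_trans h1; rewrite exprMn mulrC ler_wpM2r ?sqr_ge0//.
  rewrite -expRM_natl; apply: le_trans (expR_ge1Dx _).
  by apply: gain_arith => //; rewrite mulr_ge0// sqr_ge0.
apply/eqP; rewrite -sqrf_eq0 eq_le sqr_ge0 andbT.
rewrite leNgt; apply/negP => X2.
have d2 : 0 < 13 / 8 * del ^+ 2 by rewrite mulr_gt0// exprn_gt0.
set B := 8 * (M * K) ^+ 2 in main.
have B0 : 0 <= B by rewrite mulr_ge0// sqr_ge0.
have Xd : 0 < X ^+ 2 * (13 / 8 * del ^+ 2) by rewrite mulr_gt0.
(* Chosen so that the linear growth in k exceeds the constant B. *)
pose k := k0 + B / (X ^+ 2 * (13 / 8 * del ^+ 2)).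
have kk : k0 <= k by rewrite lerDl divr_ge0// ltW.
have := main k kk; rewrite mulrCA /k mulrDl divfK ?gt_eqF// gerDr leNgt mulr_gt0//.
exact: lt_le_trans k01.
Qed.

(** The condition on del does not involve the scales e, so [cv3_vanish] holds for all of them on the
    same interval. The restriction [before] depends on time only, hence commutes with the averages,
    and [cv_approx] removes these one direction at a time. *)
Lemma solution_before_vanish w p g q t0 del : solution T A C D w p g q ->
  0 < del -> t0 + del < T -> 8 * r * del <= 1 ->
  (forall z : Z, z.1 < t0 -> w z = 0) -> nrm (before (t0 + del / 4) w) = 0.
Proof.
move=> sol d0 dT hd wt0; have Lw := sol_w sol; have w0 := sol_w0 sol.
set t1 := t0 + del / 4; have bb := before_bounded_in t1.
have LB (f : Z -> R) : instrip T f -> sq f -> sq (before t1 f) by exact: before_sqint.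
have I (f : Z -> R) : instrip T f -> instrip T (before t1 f) by exact: before_instrip.
have Lk := @kap_L1 R 0.
have V i (ei : R) f := cv_sqint i ei (f := f) Lk.
have J i (ei : R) (f : Z -> R) (h : instrip T f) := cv_instrip i ei (kap 0) h.
have comm i (ei : R) f : instrip T f -> sq f ->
    nrm (fun z => cv i ei (kap 0) (before t1 f) z - before t1 (cv i ei (kap 0) f) z) = 0.
  by move=> f0 Lf; exact: (cv_mul_strip i ei Lk bb f0 Lf).
apply: (cv_approx (i := inord 2) (LB _ w0 Lw)) => e2 e20.
apply: (cv_approx (i := inord 1) (V _ _ _ (LB _ w0 Lw))) => e1 e10.
apply: (cv_approx (i := inord 0) (V _ _ _ (V _ _ _ (LB _ w0 Lw)))) => e0 e00.
pose e (i : 'I_3) := if i == 0 :> nat then e0 else if i == 1%N :> nat then e1 else e2.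
have ep i : 0 < e i by rewrite /e; case: ifP => // _; case: ifP.
have := cv3_vanish sol ep d0 dT hd wt0; rewrite -/t1 /cv3 /= /e !inordK//= => h.
have L2 := V (inord 2) e2 _ Lw; have L1 := V (inord 1) e1 _ L2; have L0' := V (inord 0) e0 _ L1.
have o2 := J (inord 2) e2 _ w0; have o1 := J (inord 1) e1 _ o2; have o0 := J (inord 0) e0 _ o1.
have A2 := V (inord 2) e2 _ (LB _ w0 Lw); have A1 := V (inord 1) e1 _ A2; have A0' := V (inord 0) e0 _ A1.
have B1 := V (inord 1) e1 _ (LB _ o2 L2); have B0 := V (inord 0) e0 _ B1.
have C0' := V (inord 0) e0 _ (LB _ o1 L1).
have h1 := comm (inord 0) e0 _ o1 L1.
have h2 := cv_ext (inord 0) e0 Lk B1 (LB _ o1 L1) (comm (inord 1) e1 _ o2 L2).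
have h3 := cv_ext (inord 0) e0 Lk A1 B1 (cv_ext (inord 1) e1 Lk A2 (LB _ o2 L2) (comm (inord 2) e2 _ w0 Lw)).
have Ld := LB _ o0 L0'.
apply: (nrm0_eq0 A0' Ld _ h).
exact: (nrm0_trans A0' B0 Ld h3 (nrm0_trans B0 C0' Ld h2 h1)).
Qed.

(** Vanishing before t0 is obtained almost everywhere but required at every point for the next step
    in time, so w must be changeable on a null set. *)
Lemma solution_ext w w' p g q : solution T A C D w p g q -> sq w' -> instrip T w' ->
  nrm (fun z => w z - w' z) = 0 -> solution T A C D w' p g q.
Proof.
move=> [Lw Lp Lg Lq w0 p0 g0 q0 sJ sJ2 sY seq] Lw' w'0 ww'.
have rf f : nrm (fun z => f z - f z) = 0 := nrm0_refl _ _.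
split; [exact: Lw'|exact: Lp|exact: Lg|exact: Lq|exact: w'0|exact: p0|exact: g0|exact: q0|..].
- exact: (sderiv_ext cflow_J Lw Lw' Lp Lp ww' (rf _) sJ).
- exact: sJ2.
- move=> m sm mT; have bm := bounded_in_smooth T sm.
  have bdm := bounded_in_smooth T (smooth1_derive sm).
  have Lmg := sqint_strip bm g0 Lg.
  have Lmw := sqint_strip bm w0 Lw; have Ldw := sqint_strip bdm w0 Lw.
  have Lmw' := sqint_strip bm w'0 Lw'; have Ldw' := sqint_strip bdm w'0 Lw'.
  have ms m' : bounded_in T m' -> nrm (fun z => m' z.1 * w z - m' z.1 * w' z) = 0.
    by move=> bm'; exact: nrm0_mul_strip.
  apply: (sderiv_ext cflow_Y Lmw Lmw' (sqintD Lmg Ldw) (sqintD Lmg Ldw') (ms _ bm) _ (sY m sm mT)).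
  exact: (nrm0_add Lmg Lmg Ldw Ldw' (rf _) (ms _ bdm)).
- have LC : sq (fun z => C z * w z) := sqint_bounded Cm CK Lw.
  have LC' : sq (fun z => C z * w' z) := sqint_bounded Cm CK Lw'.
  have LD : sq (fun z => D z * p z) := sqint_bounded Dm DK Lp.
  apply: (nrm0_trans (sqintD Lg Lq) (sqintD LC LD) (sqintD LC' LD) seq).
  exact: (nrm0_add LC LC' LD LD (nrm0_mul Cm CK Lw Lw' ww') (rf _)).
Qed.

Theorem solution_eq0 w p g q : solution T A C D w p g q -> nrm w = 0.
Proof.
move=> sol; have Lw := sol_w sol; have w0 := sol_w0 sol; have r0 := cR_gt0.
have Lb t1 : sq (before t1 w) := before_sqint t1 w0 Lw.
have Ib t1 : instrip T (before t1 w) := before_instrip t1 w0.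
suff h tau : tau < T -> nrm (before tau w) = 0.
  have Ln n : sq (before (T - n.+1%:R^-1) w) by exact: Lb.
  apply: (nrm0_countable Ln (sqint_meas Lw)).
    by move=> n; apply: h; rewrite gtrBl invr_gt0.
  move=> z hz; have [/andP[z0 zT]|] := pselect (0 < z.1 < T); last exact: w0.
  pose n := Num.truncn (T - z.1)^-1.
  have := hz n; rewrite /before (_ : z.1 < _); first by rewrite mul1r.
  rewrite ltrBrDr addrC -ltrBrDr invf_plt ?posrE ?subr_gt0//; exact: truncnS_gt.
(* The first bound is the smallness demanded by [carleman]; the second gives t0 + del < T for every
   t0 < tau. The step is thus uniform on [0, tau]. *)
move=> tT; pose del := Num.min (8 * r)^-1 ((T - tau) / 2).
have d0 : 0 < del.
  by rewrite lt_min invr_gt0 mulr_gt0//= divr_gt0// subr_gt0.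
have hd : 8 * r * del <= 1.
  have : del <= (8 * r)^-1 by rewrite ge_min lexx.
  have r8 : 0 < 8 * r by rewrite mulr_gt0.
  by move/(ler_wpM2l (ltW r8)); rewrite mulfV// gt_eqF.
have hT : tau + del < T.
  have : del <= (T - tau) / 2 by rewrite ge_min lexx orbT.
  by move: tT; lra.
have step n : nrm (before (Num.min (n%:R * (del / 4)) tau) w) = 0.
  elim: n => [|n IH].
    rewrite (_ : before _ _ = fun=> 0); first by rewrite /l2nrm ip0l sqrtr0.
    apply/funext => z; rewrite /before lt_min mul0r.
    by case: ltP => zt; rewrite ?mul0r// w0 ?mulr0// => /andP[]; rewrite ltNge (ltW zt).
  set t0 := n%:R * (del / 4) in IH.
  have [tt|tt] := leP tau t0.
    have -> : Num.min (n.+1%:R * (del / 4)) tau = Num.min t0 tau => //.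
    rewrite !min_r// (le_trans tt)// ler_wpM2r ?divr_ge0 ?(ltW d0)// ler_nat; exact: leqnSn.
  rewrite (min_l (ltW tt)) in IH.
  (* The representative that vanishes at every point before t0; it differs from w by a function of
     norm 0. *)
  pose w' z := w z - before t0 w z.
  have Lw' : sq w' := sqintB Lw (Lb _).
  have w'0 : instrip T w' by move=> z h; rewrite /w' w0// Ib// subrr.
  have e1 : nrm (fun z => w z - w' z) = 0.
    by rewrite -IH; congr (l2nrm mu); apply/funext => z; rewrite /w'; ring.
  have sol' := solution_ext sol Lw' w'0 e1.
  have t0T : t0 + del < T by apply: lt_trans hT; rewrite ltrD2r.
  have wl z : z.1 < t0 -> w' z = 0 by move=> zt; rewrite /w' /before zt mul1r subrr.
  have h := solution_before_vanish sol' d0 t0T hd wl.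
  have h' : nrm (before (t0 + del / 4) w) = 0.
    have LB' : sq (before (t0 + del / 4) w') := before_sqint _ w'0 Lw'.
    apply: (nrm0_eq0 (Lb _) LB' _ h).
    exact: (nrm0_mul_strip (before_bounded_in (t0 + del / 4)) w0 w'0 Lw Lw' e1).
  have tE : n.+1%:R * (del / 4) = t0 + del / 4 by rewrite /t0 -natr1 mulrDl mul1r.
  apply/eqP; rewrite eq_le nrm_ge0 andbT -h'; apply: (nrm_le (Lb _) (Lb _)) => z.
  rewrite tE /before lt_min; case: (z.1 < t0 + del / 4); rewrite /= ?mul0r ?normr0//.
  by case: (z.1 < tau); rewrite /= ?mul1r// mul0r normr0.
have d4 : 0 < del / 4 by rewrite divr_gt0.
pose n := (Num.truncn (`|tau| / (del / 4))).+1.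
have hn : tau <= n%:R * (del / 4).
  apply: (le_trans (ler_norm _)); rewrite -ler_pdivrMr//; apply: ltW.
  by have := truncnS_gt (`|tau| / (del / 4)).
by have := step n; rewrite min_r.
Qed.

End Uniqueness.

(** * Closure properties of [class_C] *)

Section ClassC.
Context {R : realType} {V : normedModType R}.
Implicit Types (f g : V -> R) (x v : V).

Lemma is_derive_line f x v (d : R) :
  is_derive (0 : R) 1 (fun s : R => f (s *: v + x)) d -> is_derive x v f d.
Proof.
have E : (fun h : R => h^-1 *: ((f \o shift x) (h *: v) - f x)) =
    (fun h : R => h^-1 *: (((fun s : R => f (s *: v + x)) \o shift 0) (h *: 1) -
       f (0 *: v + x))).
  apply/funext => h /=; rewrite scale0r add0r addr0.
  by rewrite [h *: 1](_ : _ = h)// /GRing.scale /= mulr1.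
by case=> dd de; split; rewrite ?/derivable ?/derive E.
Qed.

Lemma class_CW k f : class_C k.+1 f -> class_C k f.
Proof.
elim: k f => [|k IH] f; first by case.
by move=> [cf h]; split=> // v; have [df /IH] := h v.
Qed.

Lemma class_C_cst k (c : R) : class_C k (fun _ : V => c).
Proof.
elim: k c => [|k IH] c; first by split => //; exact: cst_continuous.
split=> [|v]; first exact: cst_continuous.
split=> [x|]; first exact: derivable_cst.
by rewrite (_ : 'D_v _ = (fun=> 0))//; apply/funext => x; exact: derive_cst.
Qed.

Lemma class_CD k f g : class_C k f -> class_C k g -> class_C k (fun x => f x + g x).
Proof.
elim: k f g => [|k IH] f g.
  by move=> [cf _] [cg _]; split=> // x; apply: cvgD; [exact: cf|exact: cg].
move=> [cf hf] [cg hg]; split=> [x|v]; first by apply: cvgD; [exact: cf|exact: cg].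
have [df cdf] := hf v; have [dg cdg] := hg v.
split=> [x|]; first by apply: derivableD; [exact: df|exact: dg].
rewrite (_ : 'D_v _ = (fun x => 'D_v f x + 'D_v g x)); first exact: IH.
by apply/funext => x; exact: deriveD.
Qed.

Lemma class_CM k f g : class_C k f -> class_C k g -> class_C k (fun x => f x * g x).
Proof.
elim: k f g => [|k IH] f g.
  by move=> [cf _] [cg _]; split=> // x; apply: cvgM; [exact: cf|exact: cg].
move=> Cf Cg; have [cf hf] := Cf; have [cg hg] := Cg.
split=> [x|v]; first by apply: cvgM; [exact: cf|exact: cg].
have [df cdf] := hf v; have [dg cdg] := hg v.
split=> [x|]; first by apply: derivableM; [exact: df|exact: dg].
rewrite (_ : 'D_v _ = (fun x => f x * 'D_v g x + g x * 'D_v f x)).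
  by apply: class_CD; apply: IH => //; exact: class_CW.
by apply/funext => x; exact: deriveM.
Qed.

(* composition with a continuous affine form [l], of linear part [dl] *)
Lemma class_C_affine k (f : R -> R) (l dl : V -> R) : smooth1 f -> continuous l ->
  (forall x v (s : R), l (s *: v + x) = l x + s * dl v) ->
  class_C k (fun x => f (l x)).
Proof.
move=> sf cl hl; have cont h : smooth1 h -> continuous (fun x => h (l x)).
  by move=> sh x; apply: (@continuous_comp _ _ _ l h); [exact: cl|exact: smooth1_continuous].
elim: k f sf => [|k IH] f sf; first by split=> //; exact: cont.
split=> [|v]; first exact: cont.
have D x : is_derive x v (fun x => f (l x)) (dl v * derive1 f (l x)).
  apply: is_derive_line.
  rewrite (_ : (fun s => _) = f \o (fun s : R => l x + s * dl v)); last first.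
    by apply/funext => s /=; rewrite hl.
  have d0 : is_derive (0 : R) 1 (fun s : R => l x + s * dl v) (dl v).
    by apply: is_derive_eq; rewrite /GRing.scale/=; ring.
  have d1 : is_derive (l x + 0 * dl v) 1 f (derive1 f (l x)).
    by rewrite mul0r addr0; exact: smooth1_is_derive.
  have := @is_derive1_comp _ f (fun s : R => l x + s * dl v) 0 _ _ d1 d0; move/is_derive_eq; apply.
  by rewrite /GRing.scale/= mulrC.
split=> [x|]; first by case: (D x).
rewrite (_ : 'D_v _ = (fun x => dl v * derive1 f (l x))); last first.
  by apply/funext => x; case: (D x).
by apply: class_CM; [exact: class_C_cst|apply: IH; exact: smooth1_derive].
Qed.

End ClassC.

(** * Test functions transported by the flow of Y *)

Section TestFunctions.
Context {R : realType}.
Notation Z := (spacetime R).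
Notation mu := (spacetime_measure R).
Implicit Types (f zeta : R -> R) (r : R) (z : Z).

(** For fixed r the coordinates of [flowY r] are affine in z, so a tensor composed with the flow is
    a product of one-variable smooth functions of affine forms. *)
Definition lin (c0 c1 c2 c3 c4 b : R) (z : Z) : R :=
  c0 * z.1 + c1 * coordJ z + c2 * coordA z + c3 * coordV z + c4 * coordQ z + b.

Lemma lin_continuous c0 c1 c2 c3 c4 b : continuous (lin c0 c1 c2 c3 c4 b).
Proof.
have cM c (l : Z -> R) : continuous l -> continuous (fun z => c * l z).
  by move=> cl z; apply: cvgM; [exact: cvg_cst|exact: cl].
have cD (l l' : Z -> R) : continuous l -> continuous l' -> continuous (fun z => l z + l' z).
  by move=> cl cl' z; apply: cvgD; [exact: cl|exact: cl'].
have H0 := cM c0 _ (@continuous_t R); have H1 := cM c1 _ (@continuous_coordJ R).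
have H2 := cM c2 _ (@continuous_coordA R); have H3 := cM c3 _ (@continuous_coordV R).
have H4 := cM c4 _ (@continuous_coordQ R).
exact: cD _ _ (cD _ _ (cD _ _ (cD _ _ (cD _ _ H0 H1) H2) H3) H4) (@cst_continuous _ _ b).
Qed.

Lemma lin_affine c0 c1 c2 c3 c4 b (x v : Z) (s : R) :
  lin c0 c1 c2 c3 c4 b (s *: v + x) = lin c0 c1 c2 c3 c4 b x + s * lin c0 c1 c2 c3 c4 0 v.
Proof. rewrite /lin /coordJ /coordA /coordV /coordQ /= /GRing.scale /=; ring. Qed.

Lemma class_C_lin k f c0 c1 c2 c3 c4 b : smooth1 f ->
  class_C k (fun z : Z => f (lin c0 c1 c2 c3 c4 b z)).
Proof.
move=> sf; apply: (class_C_affine k sf (@lin_continuous _ _ _ _ _ _) (lin_affine _ _ _ _ _ _)).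
Qed.

Lemma flowY_lin r z : [/\ (flowY r z).1 = lin 1 0 0 0 0 r z,
  coordJ (flowY r z) = lin 0 1 0 0 0 0 z, coordA (flowY r z) = lin 0 (- r) 1 0 0 0 z,
  coordV (flowY r z) = lin 0 (r ^+ 2 / 2) (- r) 1 0 0 z &
  coordQ (flowY r z) = lin 0 (- (r ^+ 3 / 6)) (r ^+ 2 / 2) (- r) 1 0 z].
Proof. by rewrite /lin /flowY /coordJ/coordA/coordV/coordQ/=; split; ring. Qed.

(** To differentiate <w o Y_r, phi> at any r, the equation is tested with phi transported by the
    flow. The transport shifts time, so a separate factor [zeta] keeps the support inside the
    strip. *)
Definition tensY zeta r f0 f1 f2 f3 f4 z : R :=
  zeta z.1 * tens f0 f1 f2 f3 f4 (flowY r z).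

Lemma smooth_tensY zeta r f0 f1 f2 f3 f4 : smooth1 zeta -> smooth1 f0 -> smooth1 f1 ->
  smooth1 f2 -> smooth1 f3 -> smooth1 f4 -> smooth (tensY zeta r f0 f1 f2 f3 f4).
Proof.
move=> sz s0 s1 s2 s3 s4 k.
rewrite (_ : tensY _ _ _ _ _ _ _ = (fun z => zeta (lin 1 0 0 0 0 0 z) *
  (f0 (lin 1 0 0 0 0 r z) * f1 (lin 0 1 0 0 0 0 z) * f2 (lin 0 (- r) 1 0 0 0 z) *
   f3 (lin 0 (r ^+ 2 / 2) (- r) 1 0 0 z) *
   f4 (lin 0 (- (r ^+ 3 / 6)) (r ^+ 2 / 2) (- r) 1 0 z)))); last first.
  apply/funext => z; rewrite /tensY /tens; have [-> -> -> -> ->] := flowY_lin r z.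
  by congr (zeta _ * _); rewrite /lin; ring.
by do ?[apply: class_CM]; exact: class_C_lin.
Qed.

(** The linear part of [flowY r] agrees with [flowY r] on the last four coordinates; on time it is
    the identity, because the shift by r drops out, hence [v.1]. *)
Definition dtensY zeta r f0 f1 f2 f3 f4 (v z : Z) : R :=
  let y := flowY r z in
  v.1 * (derive1 zeta z.1 * tens f0 f1 f2 f3 f4 y) +
  zeta z.1 * (v.1 * tens (derive1 f0) f1 f2 f3 f4 y +
    coordJ (flowY r v) * tens f0 (derive1 f1) f2 f3 f4 y +
    coordA (flowY r v) * tens f0 f1 (derive1 f2) f3 f4 y +
    coordV (flowY r v) * tens f0 f1 f2 (derive1 f3) f4 y +
    coordQ (flowY r v) * tens f0 f1 f2 f3 (derive1 f4) y).

Lemma tensY_line zeta r f0 f1 f2 f3 f4 (v z : Z) : smooth1 zeta -> smooth1 f0 -> smooth1 f1 ->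
  smooth1 f2 -> smooth1 f3 -> smooth1 f4 ->
  is_derive (0 : R) 1 (fun s : R => tensY zeta r f0 f1 f2 f3 f4 (s *: v + z))
    (dtensY zeta r f0 f1 f2 f3 f4 v z).
Proof.
move=> sz s0 s1 s2 s3 s4.
have d (f : R -> R) (a b : R) : smooth1 f ->
    is_derive (0 : R) 1 (fun s : R => f (a + s * b)) (b * derive1 f a).
  move=> sf; have d0 : is_derive (0 : R) 1 (fun s : R => a + s * b) b.
    by apply: is_derive_eq; rewrite /GRing.scale/=; ring.
  have d1 : is_derive (a + 0 * b) 1 f (derive1 f a).
    by rewrite mul0r addr0; exact: smooth1_is_derive.
  by have := @is_derive1_comp _ f (fun s : R => a + s * b) 0 _ _ d1 d0; move/is_derive_eq; apply; rewrite /GRing.scale/= mulrC.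
pose y := flowY r z; pose u := flowY r v.
have E : (fun s : R => tensY zeta r f0 f1 f2 f3 f4 (s *: v + z)) =
   (fun s => zeta (z.1 + s * v.1) * (f0 (y.1 + s * v.1) * f1 (coordJ y + s * coordJ u) *
     f2 (coordA y + s * coordA u) * f3 (coordV y + s * coordV u) * f4 (coordQ y + s * coordQ u))).
  apply/funext => s; rewrite /tensY /tens /y /u.
  have [-> -> -> -> ->] := flowY_lin r (s *: v + z).
  have [-> -> -> -> ->] := flowY_lin r z; have [_ -> -> -> ->] := flowY_lin r v.
  rewrite !lin_affine; congr (zeta _ * (f0 _ * _ * _ * _ * _)).
  - by rewrite /= /GRing.scale/= addrC.
  - by congr (_ + s * _); rewrite /lin; ring.
rewrite E.
have D := is_deriveM (d zeta z.1 v.1 sz) (is_deriveM (is_deriveM (is_deriveM (is_deriveM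
  (d f0 y.1 v.1 s0) (d f1 (coordJ y) (coordJ u) s1)) (d f2 (coordA y) (coordA u) s2))
  (d f3 (coordV y) (coordV u) s3)) (d f4 (coordQ y) (coordQ u) s4)).
apply: (is_derive_eq D); rewrite /dtensY /tens /= /GRing.scale /= -/y -/u !mul0r !addr0.
rewrite !fctE !mul0r !addr0; ring.
Qed.

Lemma derive_tensY zeta r f0 f1 f2 f3 f4 (v : Z) : smooth1 zeta -> smooth1 f0 -> smooth1 f1 ->
  smooth1 f2 -> smooth1 f3 -> smooth1 f4 ->
  'D_v (tensY zeta r f0 f1 f2 f3 f4) = dtensY zeta r f0 f1 f2 f3 f4 v.
Proof.
move=> sz s0 s1 s2 s3 s4; apply/funext => z.
by have [] := is_derive_line (tensY_line r v z sz s0 s1 s2 s3 s4).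
Qed.

Lemma derive_coord_tensY (c : Z -> R) zeta r f0 f1 f2 f3 f4 (v : Z) : smooth1 zeta ->
  smooth1 f0 -> smooth1 f1 -> smooth1 f2 -> smooth1 f3 -> smooth1 f4 ->
  (forall (s : R) z, c (s *: v + z) = c z) ->
  'D_v (c \* tensY zeta r f0 f1 f2 f3 f4) =
    (fun z => c z * dtensY zeta r f0 f1 f2 f3 f4 v z).
Proof.
move=> sz s0 s1 s2 s3 s4 hc; apply/funext => z.
have D := tensY_line r v z sz s0 s1 s2 s3 s4.
have D' : is_derive (0 : R) 1 (fun s : R => (c \* tensY zeta r f0 f1 f2 f3 f4) (s *: v + z))
    (c z * dtensY zeta r f0 f1 f2 f3 f4 v z).
  rewrite (_ : (fun s => _) = c z *: (fun s : R => tensY zeta r f0 f1 f2 f3 f4 (s *: v + z))); last first.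
    by apply/funext => s /=; rewrite hc.
  exact: is_deriveZ.
by have [] := is_derive_line D'.
Qed.

Lemma compact_slab (al be N : R) : compact
  [set z : Z | [/\ al <= z.1 <= be, `|coordJ z| <= N, `|coordA z| <= N, `|coordV z| <= N &
     `|coordQ z| <= N]].
Proof.
have c4 := compact_setX (@segment_compact _ al be) (compact_setX (compact_setX (compact_setX
  (@segment_compact _ (- N) N) (@segment_compact _ (- N) N)) (@segment_compact _ (- N) N))
  (@segment_compact _ (- N) N)).
rewrite (_ : [set z : Z | _] = `[al, be] `*` (`[-N, N] `*` `[-N, N] `*` `[-N, N] `*` `[-N, N]))//.
apply/seteqP; split => z /=; rewrite !in_itv /= -!ler_norml.
  by move=> [].
by move=> [? [[[]]]].
Qed.

Lemma test_function_slab (T al be N : R) (phi : Z -> R) : 0 < al -> be < T -> smooth phi ->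
  (forall z, phi z != 0 -> [/\ al <= z.1 <= be, `|coordJ z| <= N, `|coordA z| <= N,
     `|coordV z| <= N & `|coordQ z| <= N]) ->
  test_function (cylinder T) phi.
Proof.
move=> al0 beT sphi h.
set K := [set z : Z | [/\ al <= z.1 <= be, `|coordJ z| <= N, `|coordA z| <= N, `|coordV z| <= N &
     `|coordQ z| <= N]].
have cK : compact K := @compact_slab al be N.
have clK : closed K by apply: compact_closed => //; exact: norm_hausdorff.
have sub : closure [set z | phi z != 0] `<=` K.
  by move/closure_id: clK => ->; apply: closureS => z; exact: h.
split=> //.
  by apply: (subclosed_compact _ cK sub); exact: closed_closure.
move=> z /sub [/andP[h1 h2] _ _ _ _]; split => //=; rewrite in_itv/=.
by rewrite (lt_le_trans al0 h1) (le_lt_trans h2 beT).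
Qed.

End TestFunctions.

(** * Strong derivatives of smooth tensors along the flows *)

Section SmoothFlow.
Context {R : realType}.
Notation Z := (spacetime R).
Notation mu := (spacetime_measure R).
Notation sq := (sqint mu).
Notation ip := (l2ip mu).
Notation nrm := (l2nrm mu).
Implicit Types (f : R -> R) (r M : R) (z : Z).

Definition csupp M f := smooth1 f /\ forall x, M < `|x| -> f x = 0.

Lemma csupp_csmooth M f : csupp M f -> csmooth f.
Proof. by move=> [sf hf]; split=> //; exists M. Qed.

Lemma csmooth_csupp f : csmooth f -> exists M0, forall M, M0 <= M -> csupp M f.
Proof.
move=> [sf [M0 hM]]; exists M0 => M h; split=> // x hx; apply: hM; exact: le_lt_trans hx.
Qed.

Lemma csupp_derive M f : csupp M f -> csupp M (derive1 f).
Proof.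
move=> [sf hf]; split=> [|x hx]; first exact: smooth1_derive.
apply: (@near_cst_derive _ _ 0); near=> y; apply: hf; near: y.
by apply: (cvgr_gt _ (@norm_continuous _ R^o x)).
Unshelve. all: by end_near. Qed.

Lemma csupp_id M f : csupp M f -> csupp M (fun x => x * f x).
Proof.
by move=> [sf hf]; split=> [|x hx]; [apply: smooth1M => //; exact: smooth1_id|rewrite hf// mulr0].
Qed.

Definition in_slab M z := [/\ `|z.1| <= M, `|coordJ z| <= M, `|coordA z| <= M,
  `|coordV z| <= M & `|coordQ z| <= M].

Lemma tens_in_slab M f0 f1 f2 f3 f4 z : csupp M f0 -> csupp M f1 -> csupp M f2 ->
  csupp M f3 -> csupp M f4 -> ~ in_slab M z -> tens f0 f1 f2 f3 f4 z = 0.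
Proof.
move=> [_ c0] [_ c1] [_ c2] [_ c3] [_ c4] h; rewrite /tens.
have [h0|h0] := lerP `|z.1| M; last by rewrite c0// !mul0r.
have [h1|h1] := lerP `|coordJ z| M; last by rewrite c1// mulr0 !mul0r.
have [h2|h2] := lerP `|coordA z| M; last by rewrite c2// mulr0 !mul0r.
have [h3|h3] := lerP `|coordV z| M; last by rewrite c3// mulr0 !mul0r.
have [h4|h4] := lerP `|coordQ z| M; last by rewrite c4// mulr0.
by exfalso; apply: h.
Qed.

Definition spread M r : R := (1 + `|r| + `|r| ^+ 2 + `|r| ^+ 3) * M + `|r|.

Lemma in_slab_flowY M r z : in_slab M (flowY r z) -> in_slab (spread M r) z.
Proof.
rewrite -{2}(flowYK (- r) z) opprK; move: (flowY r z) => y [h0 h1 h2 h3 h4].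
have M0 : 0 <= M by apply: le_trans h0.
have a0 := normr_ge0 r.
have r1 : 0 <= `|r| * M by rewrite mulr_ge0.
have r2 : 0 <= `|r| ^+ 2 * M by rewrite mulr_ge0// sqr_ge0.
have r3 : 0 <= `|r| ^+ 3 * M by rewrite mulr_ge0// exprn_ge0.
have P1 x : `|x| <= M -> - (`|r| * M) <= r * x <= `|r| * M.
  by move=> h; rewrite -ler_norml normrM ler_wpM2l.
have P2 x : `|x| <= M -> - (`|r| ^+ 2 * M) <= r ^+ 2 / 2 * x <= `|r| ^+ 2 * M.
  move=> h; rewrite -ler_norml (normrM _ x) (normrM (r ^+ 2)) normrX (@ger0_norm _ 2^-1) ?invr_ge0//.
  have b0 := sqr_ge0 `|r|; have := ler_wpM2l b0 h; have := mulr_ge0 b0 (normr_ge0 x); lra.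
have P3 x : `|x| <= M -> - (`|r| ^+ 3 * M) <= r ^+ 3 / 6 * x <= `|r| ^+ 3 * M.
  move=> h; rewrite -ler_norml (normrM _ x) (normrM (r ^+ 3)) normrX (@ger0_norm _ 6^-1) ?invr_ge0//.
  have b0 : 0 <= `|r| ^+ 3 by rewrite exprn_ge0.
  have := ler_wpM2l b0 h; have := mulr_ge0 b0 (normr_ge0 x); lra.
have E : spread M r = M + `|r| * M + `|r| ^+ 2 * M + `|r| ^+ 3 * M + `|r|.
  by rewrite /spread; ring.
have hr : - `|r| <= r <= `|r| by rewrite -ler_norml.
have J1 := P1 _ h1; have J2 := P2 _ h1; have J3 := P3 _ h1.
have A1 := P1 _ h2; have A2 := P2 _ h2; have V1 := P1 _ h3.
move: h0 h1 h2 h3 h4; rewrite !ler_norml => h0 h1 h2 h3 h4.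
split; rewrite /flowY /coordJ/coordA/coordV/coordQ/= -/(coordJ y) -/(coordA y) -/(coordV y) -/(coordQ y) E ler_norml.
- move: h0 hr a0 M0 r1 r2 r3; clear; lra.
- move: h1 a0 M0 r1 r2 r3; clear; lra.
- move: h2 J1 a0 M0 r1 r2 r3; clear; lra.
- move: h3 A1 J2 a0 M0 r1 r2 r3; clear; lra.
- move: h4 V1 A2 J3 a0 M0 r1 r2 r3; clear; lra.
Qed.

Lemma csupp_bounded M f : csupp M f -> exists2 K, 0 <= K & forall x, `|f x| <= K.
Proof.
move=> /csupp_csmooth /csmooth_cube [K [n [K0 h]]]; exists K => // x.
by apply: (le_trans (h x)); rewrite ler_piMr// indicE lern1 leq_b1.
Qed.

Definition Jtens f0 f1 f2 f3 f4 z : R := tens f0 (derive1 f1) f2 f3 f4 z.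

(* [d_t - J d_A - A d_V - V d_Q] applied to a tensor *)
Definition Ytens f0 f1 f2 f3 f4 z : R :=
  tens (derive1 f0) f1 f2 f3 f4 z - tens f0 (fun x => x * f1 x) (derive1 f2) f3 f4 z
  - tens f0 f1 (fun x => x * f2 x) (derive1 f3) f4 z
  - tens f0 f1 f2 (fun x => x * f3 x) (derive1 f4) z.

Section Fixed.
Variables (M : R) (f0 f1 f2 f3 f4 : R -> R).
Hypotheses (c0 : csupp M f0) (c1 : csupp M f1) (c2 : csupp M f2) (c3 : csupp M f3)
  (c4 : csupp M f4).

Let t5 g0 g1 g2 g3 g4 : csupp M g0 -> csupp M g1 -> csupp M g2 -> csupp M g3 -> csupp M g4 ->
  [/\ sq (tens g0 g1 g2 g3 g4), exists2 K, 0 <= K & forall z, `|tens g0 g1 g2 g3 g4 z| <= K &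
    forall z, ~ in_slab M z -> tens g0 g1 g2 g3 g4 z = 0].
Proof.
move=> d0 d1 d2 d3 d4; split.
- by apply: sqint_tens; exact: (@csupp_csmooth M).
- have [K [h [K0 _ h01 Kh]]] := tens_bound (csupp_csmooth d0) (csupp_csmooth d1)
    (csupp_csmooth d2) (csupp_csmooth d3) (csupp_csmooth d4).
  by exists K => // z; apply: (le_trans (Kh z)); case: (h01 z) => ->; rewrite ?mulr0 ?mulr1.
- by move=> z; exact: tens_in_slab.
Qed.

Let p0 := csupp_derive c0. Let p1 := csupp_derive c1. Let p2 := csupp_derive c2.
Let p3 := csupp_derive c3. Let p4 := csupp_derive c4.
Let i1 := csupp_id c1. Let i2 := csupp_id c2. Let i3 := csupp_id c3.

Let T := t5 c0 c1 c2 c3 c4.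
Let TJ := t5 c0 p1 c2 c3 c4.
Let T0 := t5 p0 c1 c2 c3 c4.
Let T1 := t5 c0 i1 p2 c3 c4.
Let T2 := t5 c0 c1 i2 p3 c4.
Let T3 := t5 c0 c1 c2 i3 p4.

Lemma sqint_Jtens : sq (Jtens f0 f1 f2 f3 f4). Proof. by case: TJ. Qed.
Lemma Jtens_bounded : exists2 K, 0 <= K & forall z, `|Jtens f0 f1 f2 f3 f4 z| <= K.
Proof. by case: TJ. Qed.
Lemma Jtens_in_slab z : ~ in_slab M z -> Jtens f0 f1 f2 f3 f4 z = 0.
Proof. by case: TJ => _ _; apply. Qed.

Lemma sqint_Ytens : sq (Ytens f0 f1 f2 f3 f4).
Proof.
have [a _ _] := T0; have [b _ _] := T1; have [c _ _] := T2; have [d _ _] := T3.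
exact: (sqintB (sqintB (sqintB a b) c) d).
Qed.
Lemma Ytens_bounded : exists2 K, 0 <= K & forall z, `|Ytens f0 f1 f2 f3 f4 z| <= K.
Proof.
have [_ [K0 k0 h0] _] := T0; have [_ [K1 k1 h1] _] := T1.
have [_ [K2 k2 h2] _] := T2; have [_ [K3 k3 h3] _] := T3.
exists (K0 + K1 + K2 + K3) => [|z]; first by rewrite !addr_ge0.
rewrite /Ytens; do 3 (apply: (le_trans (ler_normB _ _)); apply: lerD => //).
Qed.
Lemma Ytens_in_slab z : ~ in_slab M z -> Ytens f0 f1 f2 f3 f4 z = 0.
Proof.
move=> h; have [_ _ /(_ z h) a] := T0; have [_ _ /(_ z h) b] := T1.
have [_ _ /(_ z h) c] := T2; have [_ _ /(_ z h) d] := T3.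
by rewrite /Ytens a b c d !subr0.
Qed.

Let der f (a b : R -> R) (s : R) : csupp M f -> (forall s : R, is_derive s 1 a (b s)) ->
  is_derive s 1 (fun s => f (a s)) (b s * derive1 f (a s)).
Proof.
move=> [sf _] da; have := @is_derive1_comp _ f a s _ _ (smooth1_is_derive sf (a s)) (da s).
by move/is_derive_eq; apply; rewrite /GRing.scale/= mulrC.
Qed.

Lemma is_derive_flowY z (s : R) :
  is_derive s 1 (fun s : R => tens f0 f1 f2 f3 f4 (flowY s z)) (Ytens f0 f1 f2 f3 f4 (flowY s z)).
Proof.
pose a0 (s : R) : R := z.1 + s. pose a2 (s : R) : R := coordA z - s * coordJ z.
pose a3 (s : R) : R := coordV z - s * coordA z + s ^+ 2 / 2 * coordJ z.
pose a4 (s : R) : R := coordQ z - s * coordV z + s ^+ 2 / 2 * coordA z - s ^+ 3 / 6 * coordJ z.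
have d0 (s' : R) : is_derive s' (1 : R) a0 (1 : R) by rewrite /a0; apply: is_derive_eq; rewrite /GRing.scale/=; ring.
have d2 (s' : R) : is_derive s' (1 : R) a2 (- coordJ z).
  by rewrite /a2; apply: is_derive_eq; rewrite /GRing.scale/=; ring.
have d3 (s' : R) : is_derive s' (1 : R) a3 (- a2 s').
  by rewrite /a3; apply: is_derive_eq; rewrite /a2 /GRing.scale/=; field.
have d4 (s' : R) : is_derive s' (1 : R) a4 (- a3 s').
  by rewrite /a4; apply: is_derive_eq; rewrite /a3 /GRing.scale/=; field.
have D := is_deriveM (is_deriveM (is_deriveM (is_deriveM (der s c0 d0)
  (is_derive_cst (f1 (coordJ z)) s 1)) (der s c2 d2)) (der s c3 d3)) (der s c4 d4).
apply: (is_derive_eq D); rewrite /Ytens /tens /= /GRing.scale /= !fctE.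
rewrite /flowY /coordJ/coordA/coordV/coordQ/= -/(coordJ z) -/(coordA z) -/(coordV z) -/(coordQ z).
rewrite /a0 /a2 /a3 /a4; ring.
Qed.

Lemma is_derive_flowJ z (s : R) :
  is_derive s 1 (fun s : R => tens f0 f1 f2 f3 f4 (flowJ s z)) (Jtens f0 f1 f2 f3 f4 (flowJ s z)).
Proof.
pose a1 (s : R) : R := coordJ z + s.
have d1 (s' : R) : is_derive s' (1 : R) a1 (1 : R) by rewrite /a1; apply: is_derive_eq; rewrite /GRing.scale/=; ring.
have D := is_deriveM (is_deriveM (is_deriveM (is_deriveM (is_derive_cst (f0 z.1) s 1)
  (der s c1 d1)) (is_derive_cst (f2 (coordA z)) s 1)) (is_derive_cst (f3 (coordV z)) s 1))
  (is_derive_cst (f4 (coordQ z)) s 1).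
apply: (is_derive_eq D); rewrite /Jtens /tens /= /GRing.scale /= !fctE.
rewrite /flowJ /coordJ/coordA/coordV/coordQ/= -/(coordJ z) -/(coordA z) -/(coordV z) -/(coordQ z).
rewrite /a1; ring.
Qed.

End Fixed.

(* A slab-shaped majorant: the indicator of a large cube. *)
Lemma in_slab_majorant N : exists h : Z -> R, [/\ sq h, forall z, 0 <= h z &
  forall z, in_slab N z -> h z = 1].
Proof.
have [n Mn] : exists n, N < n%:R.
  by have [n _ /(_ n (leqnn n))] := nbhs_infty_gtr N; exists n.
exists (\1_(box (cube n) (cube n) (cube n) (cube n) (cube n))); split.
- by apply: sqint_box; exact: cube_ocitv.
- by move=> z; rewrite indicE.
- move=> z [h0 h1 h2 h3 h4].
  have c x : `|x| <= N -> cube n x.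
    move=> h; have : `|x| < n%:R by apply: le_lt_trans Mn.
    by rewrite ltr_norml /cube /= in_itv /= => /andP[-> /ltW ->].
  by rewrite indicE mem_set//; split; apply: c.
Qed.

(** By the mean value theorem each difference quotient is a value of the derivative along the orbit
    at a time in [-1, 1]; the majorant h then gives L^2 convergence by domination. *)
Lemma smooth_sderiv F (phi phi' : Z -> R) (h : Z -> R) : cflow F -> (forall z, F 0 z = z) ->
  sq phi -> sq phi' -> (forall z (s : R), is_derive s 1 (fun s => phi (F s z)) (phi' (F s z))) ->
  sq h -> (forall s z, `|s| <= 1 -> `|phi' (F s z)| <= h z) -> sderiv F phi phi'.
Proof.
move=> cF F0 Lp Lp' d Lh hh; rewrite /sderiv; apply/cvgr_dnbhsP => t [tn t0].
have [N _ hN] : \forall n \near \oo, `|t n| < 1.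
  have /cvgr0Pnorm_lt/(_ _ ltr01) := t0; exact.
rewrite -(cvg_shiftn N); set u := fun n => t (n + N)%N.
have u1 n : `|u n| <= 1 by apply: ltW; apply: hN; rewrite /= leq_addl.
have u0 : u @ \oo --> 0 by rewrite cvg_shiftn.
have Q n z : exists2 c, `|c| <= 1 & phi (F (u n) z) - phi z = phi' (F c z) * u n.
  have [c cu] := MVT_abs (d z) 0 (u n); rewrite F0 subr0 => e.
  by exists c => //; move: cu; rewrite !subr0 => /le_trans; apply.
apply: (@nrm_dominated_cvg0 _ _ R mu (fun n z => (u n)^-1 * (phi (F (u n) z) - phi z)) phi' h) => //.
- by move=> n; exact: (sqint_meas (sqint_quot (u n) cF Lp)).
- move=> n z; have [c c1 ->] := Q n z; rewrite mulrC -mulrA mulfV ?mulr1; first exact: hh.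
  exact: tn.
- move=> z; have [D1 D2] := d z 0; rewrite F0 in D2.
  have D3 : (fun s : R => s^-1 * (phi (F s z) - phi z)) @ 0^' --> phi' z.
    rewrite -D2; have := D1; rewrite /derivable /derive.
    rewrite (_ : (fun s : R => s^-1 *: _) = (fun s : R => s^-1 * (phi (F s z) - phi z))); first by [].
    apply/funext => s /=; rewrite /GRing.scale /= mulr1 addr0 F0; by [].
  have /cvgr_dnbhsP/(_ u) := D3; apply; split=> // n; exact: tn.
Qed.

Lemma csmooth_common f0 f1 f2 f3 f4 : csmooth f0 -> csmooth f1 -> csmooth f2 -> csmooth f3 ->
  csmooth f4 -> exists M, [/\ csupp M f0, csupp M f1, csupp M f2, csupp M f3 & csupp M f4].
Proof.
move=> /csmooth_csupp[M0 h0] /csmooth_csupp[M1 h1] /csmooth_csupp[M2 h2] /csmooth_csupp[M3 h3].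
move=> /csmooth_csupp[M4 h4].
exists (Num.max (Num.max (Num.max (Num.max M0 M1) M2) M3) M4).
by split; [apply: h0|apply: h1|apply: h2|apply: h3|apply: h4]; rewrite !le_max lexx ?orbT.
Qed.

Lemma tens_sderiv_Y f0 f1 f2 f3 f4 : csmooth f0 -> csmooth f1 -> csmooth f2 -> csmooth f3 ->
  csmooth f4 -> sderiv flowY (tens f0 f1 f2 f3 f4) (Ytens f0 f1 f2 f3 f4).
Proof.
move=> s0 s1 s2 s3 s4.
have [M [c0 c1 c2 c3 c4]] := csmooth_common s0 s1 s2 s3 s4.
have [K K0 hK] := Ytens_bounded c0 c1 c2 c3 c4.
(* For |s| <= 1 the flow stays in this slab: [spread M s] is at most 4 |M| + 1. *)
have [h [Lh h0 h1]] := in_slab_majorant (4 * `|M| + 1).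
apply: (smooth_sderiv cflow_Y (@flowY0 R) (sqint_tens s0 s1 s2 s3 s4)
  (sqint_Ytens c0 c1 c2 c3 c4) _ (sqintZ K Lh)).
  by move=> z s; exact: (is_derive_flowY f1 c0 c2 c3 c4).
move=> s z s1'; have [hs|hs] := pselect (in_slab M (flowY s z)); last first.
  by rewrite (Ytens_in_slab c0 c1 c2 c3 c4 hs) normr0 mulr_ge0.
rewrite h1 ?mulr1//; have := in_slab_flowY hs.
have : spread M s <= 4 * `|M| + 1.
  have M0 := normr_ge0 M; have MM := ler_norm M.
  have b2 : `|s| ^+ 2 <= 1 by rewrite exprn_ile1.
  have b3 : `|s| ^+ 3 <= 1 by rewrite exprn_ile1.
  rewrite /spread lerD//; apply: (@le_trans _ _ ((1 + `|s| + `|s| ^+ 2 + `|s| ^+ 3) * `|M|)).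
    by rewrite ler_wpM2l// !addr_ge0// exprn_ge0.
  by rewrite ler_wpM2r//; move: b2 b3 s1'; clear; lra.
by move=> le [a b c d e]; split; exact: (le_trans _ le).
Qed.

Lemma tens_sderiv_J f0 f1 f2 f3 f4 : csmooth f0 -> csmooth f1 -> csmooth f2 -> csmooth f3 ->
  csmooth f4 -> sderiv flowJ (tens f0 f1 f2 f3 f4) (Jtens f0 f1 f2 f3 f4).
Proof.
move=> s0 s1 s2 s3 s4.
have [M [c0 c1 c2 c3 c4]] := csmooth_common s0 s1 s2 s3 s4.
have [K K0 hK] := Jtens_bounded c0 c1 c2 c3 c4.
have [h [Lh h0 h1]] := in_slab_majorant (`|M| + 1).
apply: (smooth_sderiv cflow_J (@flowJ0 R) (sqint_tens s0 s1 s2 s3 s4)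
  (sqint_Jtens c0 c1 c2 c3 c4) _ (sqintZ K Lh)).
  by move=> z s; exact: (is_derive_flowJ f0 f2 f3 f4 c1).
move=> s z s1'; have [hs|hs] := pselect (in_slab M (flowJ s z)); last first.
  by rewrite (Jtens_in_slab c0 c1 c2 c3 c4 hs) normr0 mulr_ge0.
rewrite h1 ?mulr1//; have MM := ler_norm M; have [a b c d e] := hs.
have M1 : M <= `|M| + 1 by rewrite (le_trans MM)// lerDl.
split; try by [exact: (le_trans a)|exact: (le_trans c)|exact: (le_trans d)|exact: (le_trans e)].
have -> : coordJ z = coordJ (flowJ s z) - s by rewrite /flowJ /coordJ/= addrK.
by apply: (le_trans (ler_normB _ _)); apply: lerD => //; exact: le_trans MM.
Qed.

End SmoothFlow.

(** * From weak to strong derivatives along flows *)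

Section WeakDerivatives.
Context {R : realType}.
Notation Z := (spacetime R).
Notation mu := (spacetime_measure R).
Notation sq := (sqint mu).
Notation ip := (l2ip mu).
Notation nrm := (l2nrm mu).
Implicit Types (f : R -> R) (r M : R) (z : Z).

(** The flow is moved onto the smooth tensor, where the derivative is strong; by the group law the
    tested identity at -r gives the derivative of <w o F_r, phi> at r, and [weak_strong]
    concludes. *)
Lemma weak_sderiv F (w g : Z -> R) : cflow F -> (forall z, F 0 z = z) ->
  (forall r s z, F (r + s) z = F r (F s z)) -> sq w -> sq g ->
  (forall f0 f1 f2 f3 f4, csmooth f0 -> csmooth f1 -> csmooth f2 -> csmooth f3 -> csmooth f4 ->
    exists phi', [/\ sq phi', sderiv F (tens f0 f1 f2 f3 f4) phi' &
      forall r, - ip w (fun z => phi' (F (- r) z)) = ip g (fun z => tens f0 f1 f2 f3 f4 (F (- r) z))]) ->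
  sderiv F w g.
Proof.
move=> cF F0 FD Lw Lg H; apply: weak_strong => // f0 f1 f2 f3 f4 c0 c1 c2 c3 c4 r.
have [phi' [Lp' dphi star]] := H _ _ _ _ _ c0 c1 c2 c3 c4.
set phi := tens f0 f1 f2 f3 f4 in dphi star *.
have Lp : sq phi := sqint_tens c0 c1 c2 c3 c4.
have move_ip (v : Z -> R) s p : sq v -> sq p ->
    ip (fun z => v (F s z)) p = ip v (fun z => p (F (- s) z)).
  move=> Lv Lpp; rewrite -[RHS](mpres_ip (cF.1 s) Lv (cflow_sqint (- s) cF Lpp)).
  by congr (l2ip mu _ _); apply/funext => z /=; rewrite -FD addNr F0.
have Lwr : sq (fun z => w (F r z)) := cflow_sqint r cF Lw.
have c : (fun s : R => s^-1 * (ip (fun z => w (F (s + r) z)) phi - ip (fun z => w (F r z)) phi))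
    @ 0^' --> ip (fun z => g (F r z)) phi.
  have lim : - ((- s)^-1 * (ip (fun z => phi (F (- s) z)) (fun z => w (F r z)) -
      ip phi (fun z => w (F r z)))) @[s --> 0^'] --> - ip phi' (fun z => w (F r z)).
    apply: cvgN; apply: (cvg_dnbhs0N (f := fun s => s^-1 * (ip (fun z => phi (F s z)) (fun z => w (F r z)) -
      ip phi (fun z => w (F r z))))).
    exact: (sderiv_ip cF Lp Lp' Lwr dphi).
  have e : - ip phi' (fun z => w (F r z)) = ip (fun z => g (F r z)) phi.
    by rewrite ipC (move_ip w r phi' Lw Lp') star -(move_ip g r phi Lg Lp).
  rewrite -e; move: lim.
  have -> : (fun s : R => - ((- s)^-1 * (ip (fun z => phi (F (- s) z)) (fun z => w (F r z)) -
      ip phi (fun z => w (F r z))))) = (fun s : R => s^-1 * (ip (fun z => w (F (s + r) z)) phi -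
      ip (fun z => w (F r z)) phi)); last by [].
  apply/funext => s; rewrite invrN mulNr opprK; congr (_ * (_ - _)); last exact: ipC.
  rewrite ipC -(move_ip (fun z => w (F r z)) s phi Lwr Lp); congr (l2ip mu _ _).
  by apply/funext => z; rewrite addrC FD.
have E : (fun h : R => h^-1 *: (((fun r0 : R => ip (fun z => w (F r0 z)) phi) \o shift r) (h *: 1)
     - ip (fun z => w (F r z)) phi)) =
   (fun s : R => s^-1 * (ip (fun z => w (F (s + r) z)) phi - ip (fun z => w (F r z)) phi)).
  by apply/funext => h /=; rewrite [h *: 1](_ : _ = h)// /GRing.scale /= mulr1.
split; first by rewrite /derivable E; apply/cvg_ex; exists (ip (fun z => g (F r z)) phi).
by rewrite /derive E; exact: (cvg_lim _ c).
Qed.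

Definition timecut (T : R) (zeta : R -> R) := smooth1 zeta /\
  exists al be, [/\ 0 < al, be < T & forall t, ~ (al <= t <= be) -> zeta t = 0].

Lemma timecut_csmooth T zeta : timecut T zeta -> csmooth zeta.
Proof.
move=> [sz [al [be [al0 beT h]]]]; split=> //; exists `|be| => t ht; apply: h => /andP[h1 h2].
have t0 : 0 < t by apply: lt_le_trans h1.
by move: ht; rewrite (gtr0_norm t0) ltNge (le_trans h2)// ler_norm.
Qed.

Lemma tensY_test T zeta r f0 f1 f2 f3 f4 : timecut T zeta -> csmooth f0 -> csmooth f1 ->
  csmooth f2 -> csmooth f3 -> csmooth f4 ->
  test_function (cylinder T) (tensY zeta r f0 f1 f2 f3 f4).
Proof.
move=> [sz [al [be [al0 beT h]]]] c0 c1 c2 c3 c4.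
have [M [d0 d1 d2 d3 d4]] := csmooth_common c0 c1 c2 c3 c4.
apply: (@test_function_slab R T al be (spread M r) _ al0 beT).
  by apply: smooth_tensY => //; [case: c0|case: c1|case: c2|case: c3|case: c4].
move=> z; rewrite /tensY mulf_eq0 negb_or => /andP[z1 z2].
have t1 : al <= z.1 <= be by apply: contrapT => /h e; rewrite e eqxx in z1.
have : in_slab M (flowY r z).
  by apply: contrapT => n; rewrite (tens_in_slab d0 d1 d2 d3 d4 n) eqxx in z2.
by move/in_slab_flowY => [].
Qed.

Lemma distr_of_ip (Om : set Z) (f phi : Z -> R) : distr_of Om f phi = ip (f \_ Om) phi.
Proof.
rewrite /distr_of Rintegral_mkcond; congr (Rintegral _ _ _); apply/funext => z.
by rewrite !patchE; case: ifP; rewrite ?mul0r.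
Qed.

Section Tensor.
Variables (T : R) (zeta : R -> R) (r : R) (f0 f1 f2 f3 f4 : R -> R).
Hypotheses (tz : timecut T zeta) (c0 : csmooth f0) (c1 : csmooth f1) (c2 : csmooth f2)
  (c3 : csmooth f3) (c4 : csmooth f4).

Let s0 := c0.1. Let s1 := c1.1. Let s2 := c2.1. Let s3 := c3.1. Let s4 := c4.1. Let sz := tz.1.

Lemma sqint_zeta (ze : R -> R) (p : Z -> R) : csmooth ze -> sq p -> sq (fun z => ze z.1 * p z).
Proof.
move=> cz Lp; have [M0 hM] := csmooth_csupp cz.
have [K K0 hK] := csupp_bounded (hM M0 (lexx _)).
have mz : measurable_fun [set: spacetimeM R] (fun z : Z => ze z.1).
  exact: (measurableT_comp (smooth1_measurable cz.1) measurable_t).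
exact: (sqint_bounded mz (fun z => hK z.1) Lp).
Qed.

Lemma csmooth_derive f : csmooth f -> csmooth (derive1 f).
Proof.
by move=> /csmooth_csupp[M h]; exact: (csupp_csmooth (csupp_derive (h M (lexx _)))).
Qed.

Let cz := timecut_csmooth tz.

Lemma dtensY_spec v : exists N, [/\ sq (dtensY zeta r f0 f1 f2 f3 f4 v) &
  forall z, ~ in_slab N z -> dtensY zeta r f0 f1 f2 f3 f4 v z = 0].
Proof.
have [M [d0 d1 d2 d3 d4]] := csmooth_common c0 c1 c2 c3 c4.
exists (spread M r); split.
  have LF g0 g1 g2 g3 g4 : csmooth g0 -> csmooth g1 -> csmooth g2 -> csmooth g3 -> csmooth g4 ->
      sq (fun z => tens g0 g1 g2 g3 g4 (flowY r z)).
    by move=> e0 e1 e2 e3 e4; exact: (cflow_sqint r cflow_Y (sqint_tens e0 e1 e2 e3 e4)).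
  have L := LF _ _ _ _ _ c0 c1 c2 c3 c4.
  have L0 := LF _ _ _ _ _ (csmooth_derive c0) c1 c2 c3 c4.
  have L1 := LF _ _ _ _ _ c0 (csmooth_derive c1) c2 c3 c4.
  have L2 := LF _ _ _ _ _ c0 c1 (csmooth_derive c2) c3 c4.
  have L3 := LF _ _ _ _ _ c0 c1 c2 (csmooth_derive c3) c4.
  have L4 := LF _ _ _ _ _ c0 c1 c2 c3 (csmooth_derive c4).
  exact: (sqintD (sqintZ v.1 (sqint_zeta (csmooth_derive cz) L)) (sqint_zeta cz
    (sqintD (sqintD (sqintD (sqintD (sqintZ v.1 L0) (sqintZ (coordJ (flowY r v)) L1))
    (sqintZ (coordA (flowY r v)) L2)) (sqintZ (coordV (flowY r v)) L3))
    (sqintZ (coordQ (flowY r v)) L4)))).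
move=> z hz; have hy : ~ in_slab M (flowY r z) by move/in_slab_flowY.
rewrite /dtensY (tens_in_slab d0 d1 d2 d3 d4 hy).
rewrite (tens_in_slab (csupp_derive d0) d1 d2 d3 d4 hy).
rewrite (tens_in_slab d0 (csupp_derive d1) d2 d3 d4 hy).
rewrite (tens_in_slab d0 d1 (csupp_derive d2) d3 d4 hy).
rewrite (tens_in_slab d0 d1 d2 (csupp_derive d3) d4 hy).
rewrite (tens_in_slab d0 d1 d2 d3 (csupp_derive d4) hy).
by rewrite !(mulr0, addr0).
Qed.

Lemma sqint_coord_dtensY (c : Z -> R) v : measurable_fun [set: spacetimeM R] c ->
  (forall N z, in_slab N z -> `|c z| <= N) ->
  sq (fun z => c z * dtensY zeta r f0 f1 f2 f3 f4 v z).
Proof.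
move=> mc hc; have [N [L h]] := dtensY_spec v.
have mL : measurable_fun [set: spacetimeM R] (dtensY zeta r f0 f1 f2 f3 f4 v) := sqint_meas L.
have mcL : measurable_fun [set: spacetimeM R] (fun z => c z * dtensY zeta r f0 f1 f2 f3 f4 v z).
  exact: (measurable_funM mc mL).
apply: (sqint_le mcL (sqintZ N L)) => z.
have [hz|hz] := pselect (in_slab N z); last by rewrite h// !mulr0.
by rewrite !normrM ler_wpM2r// (le_trans (hc _ _ hz))// ler_norm.
Qed.

(** The coordinate multiplying each directional derivative is constant in that direction, so it
    passes through the derivative. It is unbounded, but bounded on the support of the test
    function. *)
Lemma transport_tensY (Om : set Z) (u : Z -> R) : sq (u \_ Om) ->
  transport (distr_of Om u) (tensY zeta r f0 f1 f2 f3 f4) =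
  - ip (u \_ Om) (fun z => derive1 zeta z.1 * tens f0 f1 f2 f3 f4 (flowY r z) +
     zeta z.1 * Ytens f0 f1 f2 f3 f4 (flowY r z)).
Proof.
move=> Lu; rewrite /transport /distr_sub /distr_mul /distr_derive.
have invJ (s : R) z : coordJ (s *: dir_A + z) = coordJ z.
  by rewrite /coordJ /= /GRing.scale/= mulr0 add0r.
have invA (s : R) z : coordA (s *: dir_V + z) = coordA z.
  by rewrite /coordA /= /GRing.scale/= mulr0 add0r.
have invV (s : R) z : coordV (s *: dir_Q + z) = coordV z.
  by rewrite /coordV /= /GRing.scale/= mulr0 add0r.
rewrite (derive_tensY r dir_t sz s0 s1 s2 s3 s4).
rewrite (derive_coord_tensY r sz s0 s1 s2 s3 s4 invJ).
rewrite (derive_coord_tensY r sz s0 s1 s2 s3 s4 invA).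
rewrite (derive_coord_tensY r sz s0 s1 s2 s3 s4 invV).
have [_ [Lt _]] := dtensY_spec dir_t.
have LJ := sqint_coord_dtensY dir_A (@measurable_coordJ R) (fun N z h => let: And5 _ b _ _ _ := h in b).
have LA := sqint_coord_dtensY dir_V (@measurable_coordA R) (fun N z h => let: And5 _ _ b _ _ := h in b).
have LV := sqint_coord_dtensY dir_Q (@measurable_coordV R) (fun N z h => let: And5 _ _ _ b _ := h in b).
rewrite !distr_of_ip !opprK.
transitivity (- ip (u \_ Om) (fun z => dtensY zeta r f0 f1 f2 f3 f4 dir_t z
   - coordJ z * dtensY zeta r f0 f1 f2 f3 f4 dir_A z - coordA z * dtensY zeta r f0 f1 f2 f3 f4 dir_V z
   - coordV z * dtensY zeta r f0 f1 f2 f3 f4 dir_Q z)).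
  rewrite (ipBr (sqintB (sqintB Lt LJ) LA) LV Lu) (ipBr (sqintB Lt LJ) LA Lu) (ipBr Lt LJ Lu).
  by rewrite !opprB; ring.
congr (- l2ip mu _ _); apply/funext => z.
rewrite /dtensY /Ytens /tens /dir_t /dir_A /dir_V /dir_Q /flowY /coordJ /coordA /coordV /coordQ /=.
by field.
Qed.

Lemma derive_J_tensY (Om : set Z) (u : Z -> R) : r = 0 ->
  distr_derive dir_J (distr_of Om u) (tensY zeta r f0 f1 f2 f3 f4) =
  - ip (u \_ Om) (fun z => zeta z.1 * Jtens f0 f1 f2 f3 f4 z).
Proof.
move=> r0; rewrite /distr_derive (derive_tensY r dir_J sz s0 s1 s2 s3 s4) distr_of_ip.
congr (- l2ip mu _ _); apply/funext => z.
rewrite r0 /dtensY flowY0 /Jtens /dir_J /flowY /coordJ /coordA /coordV /coordQ /=.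
by field.
Qed.

End Tensor.

End WeakDerivatives.

Lemma ae_imply {R : realType} d (Z : measurableType d)
    (mu : {measure set Z -> \bar R}) (P Q : Z -> Prop) :
  {ae mu, forall z, P z} -> (forall z, P z -> Q z) -> {ae mu, forall z, Q z}.
Proof. by move=> p h; apply: filterS p. Qed.

Lemma ae_imply2 {R : realType} d (Z : measurableType d)
    (mu : {measure set Z -> \bar R}) (P Q S : Z -> Prop) :
  {ae mu, forall z, P z} -> {ae mu, forall z, Q z} -> (forall z, P z -> Q z -> S z) ->
  {ae mu, forall z, S z}.
Proof. by move=> p q h; apply: filterS2 p q. Qed.

(** * Time slices, cutoffs near the ends of the interval, and the zero trace *)

Section Slices.
Context {R : realType}.
Notation Z := (spacetime R).
Notation mu := (spacetime_measure R).
Notation leb := (@lebesgue_measure R).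
Notation ph := (phase_measure R).
Notation sq := (sqint mu).
Notation ip := (l2ip mu).
Notation nrm := (l2nrm mu).
Implicit Types (f : Z -> R) (S : set R).

Lemma measurable_slice f t : measurable_fun [set: spacetimeM R] f ->
  measurable_fun setT (fun y : phase R => f (t, y)).
Proof. by move=> mf; exact: (measurableT_comp mf (measurable_pair1 t)). Qed.

Lemma sqint_indic_time S f : measurable S -> sq f -> sq (fun z => \1_S z.1 * f z).
Proof.
move=> mS Lf.
have m1 : measurable_fun [set: spacetimeM R] (fun z : Z => \1_S z.1 : R).
  exact: (measurableT_comp (measurable_indic mS) measurable_t).
apply: (sqint_bounded (M := 1) m1 _ Lf) => z.
by rewrite ger0_norm indicE// lern1 leq_b1.
Qed.

Lemma slice_nrm f S s B : sq f -> measurable S -> leb S = s%:E -> 0 <= B ->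
  {ae leb, forall t, S t -> (\int[ph]_y (f (t, y) ^+ 2)%:E <= B%:E)%E} ->
  nrm (fun z => \1_S z.1 * f z) ^+ 2 <= B * s.
Proof.
move=> Lf mS Ss B0 ae; have Lh := sqint_indic_time mS Lf.
set h := (fun z => _) in Lh *.
have mh : measurable_fun [set: spacetimeM R] (fun z => (h z * h z)%:E).
  by apply/measurable_EFinP; apply: measurable_funM; exact: (sqint_meas Lh).
rewrite nrm_sqr -lee_fin /l2ip -(integral_EFin_fine (sqint_mul Lh Lh)).
have h0 z : (0 <= (h z * h z)%:E)%E by rewrite lee_fin -expr2 sqr_ge0.
rewrite (@fubini_tonelli1 _ _ _ _ _ leb ph _ mh h0).
have i1 : (\int[leb]_t (B * \1_S t)%:E = (B * s)%:E)%E.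
  under eq_integral do rewrite EFinM.
  rewrite ge0_integralZl//; last by apply/measurable_EFinP; exact: measurable_indic.
  by rewrite EFinM -Ss; congr (_ * _)%E; rewrite integral_indic// setIT.
rewrite -i1; refine (ae_ge0_le_integral measurableT _ _ _ _ _).
- by move=> t _; apply: integral_ge0 => y _; exact: h0.
- exact: (@measurable_fun_fubini_tonelli_F _ _ _ _ _ ph _ mh h0).
- by move=> t _; rewrite lee_fin mulr_ge0// indicE.
- apply/measurable_EFinP; apply: measurable_funM => //; exact: measurable_indic.
- apply: (ae_imply ae) => t St _; rewrite /fubini_F /h /=.
  have [tS|tS] := pselect (S t).
    rewrite !indicE (mem_set tS) mulr1.
    by under eq_integral do rewrite !mul1r -expr2; exact: St.
  rewrite !indicE (memNset tS) mulr0.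
  by under eq_integral do rewrite !mul0r; rewrite integral0.
Qed.

Lemma slab_slice f K N : measurable_fun [set: spacetimeM R] f -> (forall z, `|f z| <= K) ->
  (forall z, ~ in_slab N z -> f z = 0) ->
  exists2 B, 0 <= B & forall t, (\int[ph]_y (f (t, y) ^+ 2)%:E <= B%:E)%E.
Proof.
move=> mf fK f0; have [n Mn] : exists n, N < n%:R.
  by have [n _ /(_ n (leqnn n))] := nbhs_infty_gtr N; exists n.
pose Q : set (phase R) := cube n `*` cube n `*` cube n `*` cube n.
have mc := ocitv_measurable (cube_ocitv n (R := R)).
have fin : leb (cube n) \is a fin_num.
  by rewrite ge0_fin_numE//; exact: ocitv_lty (cube_ocitv n).
have mQ : measurable Q by do 3 apply: measurableX => //.
have Qfin : ph Q \is a fin_num.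
  rewrite /phase_measure /Q product_measure1E//=; last by do 2 apply: measurableX => //.
  rewrite product_measure1E//=; last by apply: measurableX.
  by rewrite product_measure1E//= !fin_numM.
exists (K ^+ 2 * fine (ph Q)); first by rewrite mulr_ge0 ?sqr_ge0// fine_ge0.
move=> t; rewrite EFinM fineK//.
have <- : (\int[ph]_y ((K ^+ 2)%:E * (\1_Q y)%:E) = (K ^+ 2)%:E * ph Q)%E.
  rewrite ge0_integralZl//; last by rewrite lee_fin sqr_ge0.
    by congr (_ * _)%E; rewrite integral_indic// setIT.
  by apply/measurable_EFinP; exact: measurable_indic.
apply: ge0_le_integral => //.
- by move=> y _; rewrite lee_fin sqr_ge0.
- by apply/measurable_EFinP; apply: measurable_funX; exact: measurable_slice.
- apply/measurable_EFinP; apply: measurable_funM => //; exact: measurable_indic.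
- move=> y _; rewrite -EFinM lee_fin indicE; case: (boolP (y \in Q)) => [_|].
    rewrite mulr1 -[leLHS]real_normK ?num_real// lerXn2r ?nnegrE//.
    exact: le_trans (normr_ge0 _) (fK (t, y)).
  move=> /negP yQ; rewrite f0 ?expr0n/= ?mulr0// => -[_ h1 h2 h3 h4].
  apply: yQ; apply/mem_set; have c x : `|x| <= N -> cube n x.
    move=> h; have : `|x| < n%:R by apply: le_lt_trans Mn.
    by rewrite ltr_norml /cube /= in_itv /= => /andP[-> /ltW ->].
  by split; [split; [split|]|]; exact: c.
Qed.

Lemma cut_lim T (ze : nat -> R -> R) w h : sq w -> instrip T w -> sq h ->
  (forall n, measurable_fun setT (ze n)) -> (forall n t, `|ze n t| <= 1) ->
  (forall t, 0 < t < T -> ze n t @[n --> \oo] --> (1 : R)) ->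
  ip w (fun z => ze n z.1 * h z) @[n --> \oo] --> ip w h.
Proof.
move=> Lw w0 Lh mz z1 zc.
apply: (@Rdominated_cvg _ _ R mu (fun n z => w z * (ze n z.1 * h z)) _ (fun z => `|w z| * `|h z|)).
- move=> n; apply: measurable_funM; first exact: (sqint_meas Lw).
  apply: measurable_funM; last exact: (sqint_meas Lh).
  exact: (measurableT_comp (mz n) measurable_t).
- exact: (sqint_mul (sqint_abs Lw) (sqint_abs Lh)).
- by move=> n z; rewrite !normrM ler_wpM2l// ler_piMl.
- move=> z; have [ht|ht] := pselect (0 < z.1 < T); last first.
    by rewrite w0// mul0r; under eq_fun do rewrite mul0r; exact: cvg_cst.
  apply: cvgM; first exact: cvg_cst.
  rewrite [X in _ --> X](_ : h z = 1 * h z); last by rewrite mul1r.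
  by apply: cvgM; [exact: zc|exact: cvg_cst].
Qed.

(** It is 0 up to 1/(n+1) and 1 from 2/(n+1) on, so that test functions stay away from t = 0; [late]
    also cuts near T. *)
Definition early (n : nat) (t : R) : R := step (n.+1%:R * t - 1).
Definition late (T : R) (n : nat) (t : R) : R := early n t * early n (T - t).

Lemma smooth1_early n : smooth1 (early n).
Proof. exact: (smooth1_comp (@smooth1_step R) (smooth1_affine n.+1%:R (- 1))). Qed.

Lemma smooth1_late T n : smooth1 (late T n).
Proof.
apply: smooth1M; first exact: smooth1_early.
have := smooth1_comp (smooth1_early n) (smooth1_affine (- 1) T).
by rewrite (_ : (fun x => _) = (fun t => early n (T - t)))//; apply/funext => t; rewrite mulN1r addrC.
Qed.

Lemma early_bound n t : 0 <= early n t <= 1.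
Proof. by rewrite step_ge0 step_le1. Qed.

Lemma early0 n t : t <= n.+1%:R^-1 -> early n t = 0.
Proof.
by move=> h; rewrite /early step0// subr_le0 -[leRHS](@mulfV _ n.+1%:R)// ler_wpM2l.
Qed.

Lemma early_cvg t : 0 < t -> early n t @[n --> \oo] --> (1 : R).
Proof.
move=> t0; apply: cvg_near_cst; near=> n; apply: step1.
rewrite lerBrDr -ler_pdivrMr//; have : (1 + 1) / t < n%:R by near: n; exact: nbhs_infty_gtr.
by move=> /ltW /le_trans; apply; rewrite ler_nat.
Unshelve. all: by end_near. Qed.

Lemma early_derive n t : derive1 (early n) t = n.+1%:R * derive1 (@step R) (n.+1%:R * t - 1).
Proof.
apply: is_derive1E.
have d0 : is_derive t 1 (fun t : R => n.+1%:R * t - 1) n.+1%:R.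
  by apply: is_derive_eq; rewrite /GRing.scale/=; ring.
have := @is_derive1_comp _ step (fun t : R => n.+1%:R * t - 1) t _ _
  (smooth1_is_derive (@smooth1_step R) _) d0.
by move/is_derive_eq; apply; rewrite /GRing.scale/= mulrC.
Qed.

Lemma late_bound T n t : 0 <= late T n t <= 1.
Proof.
have /andP[a b] := early_bound n t; have /andP[c d] := early_bound n (T - t).
by rewrite mulr_ge0//= mulr_ile1.
Qed.

Lemma late_cvg T t : 0 < t < T -> late T n t @[n --> \oo] --> (1 : R).
Proof.
move=> /andP[t0 tT]; rewrite -[X in _ --> X]mulr1.
by apply: cvgM; apply: early_cvg => //; rewrite subr_gt0.
Qed.

Lemma timecut_late T n : timecut T (late T n).
Proof.
split; first exact: smooth1_late.
have n0 : 0 < n.+1%:R^-1 :> R by rewrite invr_gt0.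
exists n.+1%:R^-1, (T - n.+1%:R^-1); split => //; first by rewrite gtrBl.
move=> t /negP; rewrite negb_and -!ltNge => /orP[h|h]; rewrite /late.
  by rewrite (early0 (ltW h)) mul0r.
by rewrite [X in _ * X]early0 ?mulr0// lerBlDr addrC -lerBlDr ltW.
Qed.

Lemma timecut_early T T1 n (m : R -> R) : smooth1 m -> T1 < T -> (forall t, T1 <= t -> m t = 0) ->
  timecut T (fun t => early n t * m t).
Proof.
move=> sm T1T hm; split; first by apply: smooth1M => //; exact: smooth1_early.
exists n.+1%:R^-1, T1; split => //.
move=> t /negP; rewrite negb_and -!ltNge => /orP[h|h]; first by rewrite early0 ?mul0r// ltW.
by rewrite hm ?mulr0// ltW.
Qed.

Lemma leb_early_supp n : leb `[n.+1%:R^-1, 2 * n.+1%:R^-1]%classic = (n.+1%:R^-1)%:E.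
Proof.
rewrite lebesgue_measure_itv/= lte_fin ltr_pMl ?invr_gt0// ltr1n -EFinB; congr (_%:E); ring.
Qed.

(** The zero initial value in the form used by [trace_lim]: almost every slice at a small positive
    time has small L^2 norm. *)
Definition zero_trace (w : Z -> R) := forall e : R, 0 < e -> exists2 del, 0 < del &
  {ae leb, forall t, 0 < t < del -> (\int[ph]_y (w (t, y) ^+ 2)%:E <= e%:E)%E}.

(* On the support of the derivative of [early n], an interval of length 1/(n+1),
   Cauchy-Schwarz gains a factor 1/(n+1) against the size n+1 of the derivative. *)
Lemma trace_lim T w h K N m : sq w -> instrip T w -> zero_trace w -> sq h ->
  (forall z, `|h z| <= K) -> (forall z, ~ in_slab N z -> h z = 0) -> bounded_in T m ->
  ip (fun z => m z.1 * w z) (fun z => derive1 (early n) z.1 * h z) @[n --> \oo] --> (0 : R).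
Proof.
move=> Lw w0 tr Lh hK h0 [mm [M hM]].
have [B B0 hB] := slab_slice (sqint_meas Lh) hK h0.
have [Ms Ms0 hMs] := @step'_bounded R.
pose M' := Num.max M 0; have M'0 : 0 <= M' by rewrite le_max lexx orbT.
have hM' t : 0 < t < T -> `|m t| <= M' by move=> ht; rewrite le_max hM.
have bound e : 0 <= e -> forall n, {ae leb, forall t : R, `[n.+1%:R^-1, 2 * n.+1%:R^-1]%classic t ->
     (\int[ph]_y (w (t, y) ^+ 2)%:E <= (e ^+ 2)%:E)%E} ->
    `|ip (fun z => m z.1 * w z) (fun z => derive1 (early n) z.1 * h z)| <= M' * Ms * (e * Num.sqrt B).
  move=> e0 n ae; pose S := `[n.+1%:R^-1, 2 * n.+1%:R^-1]%classic : set R.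
  set s := n.+1%:R^-1 : R; have s0 : 0 < s by rewrite invr_gt0.
  have mS : measurable S by exact: measurable_itv.
  have LSw := sqint_indic_time mS Lw; have LSh := sqint_indic_time mS Lh.
  have nw := slice_nrm Lw mS (leb_early_supp n) (sqr_ge0 e) ae.
  have nh : nrm (fun z => \1_S z.1 * h z) ^+ 2 <= B * s.
    by apply: (slice_nrm Lh mS (leb_early_supp n) B0); apply: aeW => t _; exact: hB.
  have Sw0 : instrip T (fun z => \1_S z.1 * w z) by move=> z hz; rewrite w0// mulr0.
  have LmSw := sqint_strip (conj mm (ex_intro _ M hM)) Sw0 LSw.
  have Ld : sq (fun z => n.+1%:R * (derive1 step (n.+1%:R * z.1 - 1) * (\1_S z.1 * h z))).
    apply: sqintZ; apply: (sqint_bounded (M := Ms) _ _ LSh) => [|z]; last exact: hMs.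
    have m1 : measurable_fun setT (fun t : R => derive1 (@step R) (n.+1%:R * t - 1)).
      exact: (smooth1_measurable (smooth1_comp (smooth1_derive (@smooth1_step R)) (smooth1_affine n.+1%:R (- 1)))).
    exact: (measurableT_comp m1 measurable_t).
  have -> : ip (fun z => m z.1 * w z) (fun z => derive1 (early n) z.1 * h z) =
     ip (fun z => m z.1 * (\1_S z.1 * w z))
        (fun z => n.+1%:R * (derive1 step (n.+1%:R * z.1 - 1) * (\1_S z.1 * h z))).
    apply: eq_Rintegral => z _; rewrite early_derive.
    rewrite indicE; case: (boolP (z.1 \in S)) => [_|/negP zS]; first by rewrite !mul1r mulrA.
    rewrite step'_supp ?mulr0 ?mul0r ?mulr0// => /andP[h1 h2]; apply: zS; apply/mem_set.
    have np : 0 < n.+1%:R :> R by [].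
    rewrite /S /= in_itv /=; apply/andP; split.
      by rewrite -[_^-1]mulr1 ler_pdivrMl// -subr_ge0.
    by rewrite mulrC ler_pdivlMl// -lerBlDr (le_trans h2)//; lra.
  apply: (le_trans (CauchySchwarz LmSw Ld)).
  have b1 : nrm (fun z => m z.1 * (\1_S z.1 * w z)) <= M' * (e * Num.sqrt s).
    apply: (le_trans (nrm_strip mm hM' M'0 Sw0 LSw)); rewrite ler_wpM2l//.
    rewrite -[leLHS]ger0_norm ?nrm_ge0// -sqrtr_sqr -[e in leRHS]ger0_norm// -sqrtr_sqr -sqrtrM ?sqr_ge0//.
    by rewrite ler_wsqrtr.
  have b2 : nrm (fun z => n.+1%:R * (derive1 step (n.+1%:R * z.1 - 1) * (\1_S z.1 * h z))) <=
      n.+1%:R * (Ms * (Num.sqrt B * Num.sqrt s)).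
    have L' : sq (fun z => (n.+1%:R * Ms) * (\1_S z.1 * h z)) := sqintZ _ LSh.
    apply: (@le_trans _ _ (nrm (fun z => (n.+1%:R * Ms) * (\1_S z.1 * h z)))).
      apply: (nrm_le Ld L') => z; rewrite mulrA !normrM [leLHS]mulrA [leRHS]mulrA.
      by rewrite ler_wpM2r// ler_wpM2r// ler_wpM2l// (ger0_norm Ms0).
    rewrite (nrmZ _ LSh) ger0_norm ?mulr_ge0// -mulrA ler_wpM2l// ler_wpM2l//.
    by rewrite -[leLHS]ger0_norm ?nrm_ge0// -sqrtr_sqr -sqrtrM// ler_wsqrtr.
  apply: (le_trans (ler_pM (nrm_ge0 _ _) (nrm_ge0 _ _) b1 b2)).
  have ss : Num.sqrt s * Num.sqrt s = s by rewrite -expr2 sqr_sqrtr// ltW.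
  rewrite le_eqVlt; apply/orP; left; apply/eqP.
  rewrite (_ : M' * (e * Num.sqrt s) * (n.+1%:R * (Ms * (Num.sqrt B * Num.sqrt s))) =
    M' * Ms * (e * Num.sqrt B) * ((Num.sqrt s * Num.sqrt s) * n.+1%:R)); last by ring.
  by rewrite ss /s mulVf ?mulr1.
apply/cvgr0Pnorm_le => e e0.
pose c := M' * Ms * Num.sqrt B + 1.
have c0 : 0 < c by rewrite ltr_wpDl// !mulr_ge0// sqrtr_ge0.
have ec : 0 < e / c by rewrite divr_gt0.
have [del d0 aed] := tr ((e / c) ^+ 2) (exprn_gt0 2 ec).
near=> n.
apply: (@le_trans _ _ (M' * Ms * (e / c * Num.sqrt B))).
  apply: bound; first exact: ltW.
  apply: (ae_imply aed) => t ht /=; rewrite in_itv/= => /andP[t1 t2]; apply: ht.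
  rewrite (lt_le_trans _ t1) ?invr_gt0//= (le_lt_trans t2)//.
  rewrite -ltr_pdivlMr ?invr_gt0// invrK -ltr_pdivrMl//.
  have : del^-1 * 2 < n%:R by near: n; exact: nbhs_infty_gtr.
  by move=> /lt_trans; apply; rewrite ltr_nat.
rewrite (_ : M' * Ms * (e / c * Num.sqrt B) = e * (M' * Ms * Num.sqrt B / c)); last by ring.
rewrite ger_pMr// ler_pdivrMr// mul1r /c lerDl//.
Unshelve. all: by end_near. Qed.

End Slices.

(** * Strong derivatives along d_J and Y from the distributional equation *)

Section WeakToStrong.
Context {R : realType}.
Notation Z := (spacetime R).
Notation mu := (spacetime_measure R).
Notation sq := (sqint mu).
Notation ip := (l2ip mu).
Notation nrm := (l2nrm mu).

Lemma flowJD (r s : R) (z : Z) : flowJ (r + s) z = flowJ r (flowJ s z).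
Proof. by apply: coord_eq; rewrite /flowJ/coordA/coordJ/coordV/coordQ//=; ring. Qed.

Lemma flowYD (r s : R) (z : Z) : flowY (r + s) z = flowY r (flowY s z).
Proof. by apply: coord_eq; rewrite /flowY/coordA/coordJ/coordV/coordQ//=; by field. Qed.

Lemma csmooth_shift (f : R -> R) r : csmooth f -> csmooth (fun x => f (x - r)).
Proof.
move=> [sf [M hM]]; split.
  have := smooth1_comp sf (smooth1_affine 1 (- r)).
  by rewrite (_ : (fun x => _) = (fun x => f (x - r)))//; apply/funext => x; rewrite mul1r.
exists (M + `|r|) => x hx; apply: hM.
have := ler_normD (x - r) r; rewrite subrK; move: hx; lra.
Qed.

Lemma derive_shift (f : R -> R) r x : smooth1 f ->
  derive1 (fun x => f (x - r)) x = derive1 f (x - r).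
Proof.
move=> sf; apply: is_derive1E.
have d0 : is_derive x 1 (fun x : R => x - r) 1 by apply: is_derive_eq; rewrite subr0.
have := @is_derive1_comp _ f (fun x : R => x - r) x _ _ (smooth1_is_derive sf (x - r)) d0.
by move/is_derive_eq; apply; rewrite /GRing.scale/= mulr1.
Qed.

Variable T : R.

Lemma late_abs n (t : R) : `|late T n t| <= 1.
Proof. by have /andP[a b] := late_bound T n t; rewrite ger0_norm. Qed.

Lemma early_abs n (t : R) : `|early n t| <= 1.
Proof. by have /andP[a b] := early_bound n t; rewrite ger0_norm. Qed.

(** The flow of d_J keeps time fixed, so the cutoffs [late] are never differentiated and converge to
    1 with no boundary term; a translate of a tensor in J is again a tensor. *)
Lemma sderivJ_weak (v v' : Z -> R) : sq v -> sq v' -> instrip T v -> instrip T v' ->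
  (forall zeta f0 f1 f2 f3 f4, timecut T zeta -> csmooth f0 -> csmooth f1 -> csmooth f2 ->
    csmooth f3 -> csmooth f4 ->
    - ip v (fun z => zeta z.1 * Jtens f0 f1 f2 f3 f4 z) =
    ip v' (fun z => zeta z.1 * tens f0 f1 f2 f3 f4 z)) -> sderiv flowJ v v'.
Proof.
move=> Lv Lv' v0 v'0 H.
have base f0 f1 f2 f3 f4 : csmooth f0 -> csmooth f1 -> csmooth f2 -> csmooth f3 -> csmooth f4 ->
    - ip v (Jtens f0 f1 f2 f3 f4) = ip v' (tens f0 f1 f2 f3 f4).
  move=> c0 c1 c2 c3 c4; have [M [d0 d1 d2 d3 d4]] := csmooth_common c0 c1 c2 c3 c4.
  have LJ := sqint_Jtens d0 d1 d2 d3 d4; have Lt := sqint_tens c0 c1 c2 c3 c4.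
  have ml n := smooth1_measurable (smooth1_late T n).
  have l1 : - (fun n => ip v (fun z => late T n z.1 * Jtens f0 f1 f2 f3 f4 z)) @ \oo -->
      - ip v (Jtens f0 f1 f2 f3 f4).
    by apply: cvgN; exact: (cut_lim Lv v0 LJ ml late_abs (@late_cvg R T)).
  have l2 := cut_lim Lv' v'0 Lt ml late_abs (@late_cvg R T).
  have E : - (fun n => ip v (fun z => late T n z.1 * Jtens f0 f1 f2 f3 f4 z)) =
      (fun n => ip v' (fun z => late T n z.1 * tens f0 f1 f2 f3 f4 z)).
    by apply/funext => n; exact: (H _ _ _ _ _ _ (timecut_late T n) c0 c1 c2 c3 c4).
  rewrite E in l1; exact: (cvg_unique (@Rhausdorff R) l1 l2).
apply: (weak_sderiv cflow_J (@flowJ0 R) flowJD Lv Lv') => f0 f1 f2 f3 f4 c0 c1 c2 c3 c4.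
have [M [d0 d1 d2 d3 d4]] := csmooth_common c0 c1 c2 c3 c4.
exists (Jtens f0 f1 f2 f3 f4); split; first exact: (sqint_Jtens d0 d1 d2 d3 d4).
  exact: tens_sderiv_J.
move=> r; have := base f0 (fun x => f1 (x - r)) f2 f3 f4 c0 (csmooth_shift r c1) c2 c3 c4.
rewrite (_ : Jtens f0 (fun x => f1 (x - r)) f2 f3 f4 = (fun z => Jtens f0 f1 f2 f3 f4 (flowJ (- r) z))); last first.
  by apply/funext => z; rewrite /Jtens /tens derive_shift//; case: c1.
by rewrite (_ : tens f0 (fun x => f1 (x - r)) f2 f3 f4 = (fun z => tens f0 f1 f2 f3 f4 (flowJ (- r) z))).
Qed.

(** Test with the time factor [early n t * m t]: m takes care of T and [early n] of 0. As n grows,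
    the term with the derivative of [early n] disappears by [trace_lim], so the extension by zero
    satisfies the product rule across t = 0. *)
Lemma sderivY_weak (w g : Z -> R) m T1 : sq w -> sq g -> instrip T w -> instrip T g ->
  zero_trace w -> smooth1 m -> T1 < T -> (forall t, T1 <= t -> m t = 0) ->
  (forall zeta r f0 f1 f2 f3 f4, timecut T zeta -> csmooth f0 -> csmooth f1 -> csmooth f2 ->
    csmooth f3 -> csmooth f4 ->
    - ip w (fun z => derive1 zeta z.1 * tens f0 f1 f2 f3 f4 (flowY r z) +
       zeta z.1 * Ytens f0 f1 f2 f3 f4 (flowY r z)) =
    ip g (fun z => zeta z.1 * tens f0 f1 f2 f3 f4 (flowY r z))) ->
  sderiv flowY (fun z => m z.1 * w z) (fun z => m z.1 * g z + derive1 m z.1 * w z).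
Proof.
move=> Lw Lg w0 g0 tr sm T1T hm H.
have bm := bounded_in_smooth T sm; have bdm := bounded_in_smooth T (smooth1_derive sm).
have Lmw := sqint_strip bm w0 Lw; have Ldw := sqint_strip bdm w0 Lw.
have Lmg := sqint_strip bm g0 Lg.
apply: (weak_sderiv cflow_Y (@flowY0 R) flowYD Lmw (sqintD Lmg Ldw)) => f0 f1 f2 f3 f4 c0 c1 c2 c3 c4.
have [M [d0 d1 d2 d3 d4]] := csmooth_common c0 c1 c2 c3 c4.
exists (Ytens f0 f1 f2 f3 f4); split; first exact: (sqint_Ytens d0 d1 d2 d3 d4).
  exact: tens_sderiv_Y.
move=> r; set phi := fun z => tens f0 f1 f2 f3 f4 _; set psi := fun z => Ytens f0 f1 f2 f3 f4 _.
have Lphi : sq phi := cflow_sqint (- r) cflow_Y (sqint_tens c0 c1 c2 c3 c4).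
have Lpsi : sq psi := cflow_sqint (- r) cflow_Y (sqint_Ytens d0 d1 d2 d3 d4).
have [K [h [K0 _ h01 Kh]]] := tens_bound c0 c1 c2 c3 c4.
have phiK z : `|phi z| <= K.
  by apply: (le_trans (Kh _)); case: (h01 (flowY (- r) z)) => ->; rewrite ?mulr0 ?mulr1.
have phi0 z : ~ in_slab (spread M (- r)) z -> phi z = 0.
  by move=> hz; apply: (tens_in_slab d0 d1 d2 d3 d4) => /in_slab_flowY.
have mw0 := instrip_mul m w0; have dw0 := instrip_mul (derive1 m) w0.
have mg0 := instrip_mul m g0.
have me n := smooth1_measurable (smooth1_early (R := R) n).
have ec t : 0 < t < T -> early n t @[n --> \oo] --> (1 : R) by move=> /andP[t0 _]; exact: early_cvg.
have l0 := trace_lim Lw w0 tr Lphi phiK phi0 bm.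
have l1 := cut_lim Ldw dw0 Lphi me early_abs ec.
have l2 := cut_lim Lmw mw0 Lpsi me early_abs ec.
have l3 := cut_lim Lmg mg0 Lphi me early_abs ec.
have E n : - (ip (fun z => m z.1 * w z) (fun z => derive1 (early n) z.1 * phi z) +
    ip (fun z => derive1 m z.1 * w z) (fun z => early n z.1 * phi z) +
    ip (fun z => m z.1 * w z) (fun z => early n z.1 * psi z)) =
    ip (fun z => m z.1 * g z) (fun z => early n z.1 * phi z).
  have tc := timecut_early n sm T1T hm.
  have := H _ (- r) _ _ _ _ _ tc c0 c1 c2 c3 c4; rewrite -/phi -/psi => h1.
  have -> : ip (fun z => m z.1 * g z) (fun z => early n z.1 * phi z) =
      ip g (fun z => early n z.1 * m z.1 * phi z).
    by apply: eq_Rintegral => z _; ring.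
  rewrite -h1; congr (- _).
  have tcd : csmooth (derive1 (fun t => early n t * m t)) := csmooth_derive (timecut_csmooth tc).
  have Ldn : sq (fun z => derive1 (early n) z.1 * phi z).
    have [Ms Ms0 hMs] := @step'_bounded R.
    have md : measurable_fun [set: spacetimeM R] (fun z : Z => derive1 (early n) z.1).
      exact: (measurableT_comp (smooth1_measurable (smooth1_derive (smooth1_early n))) (@measurable_t R)).
    apply: (sqint_bounded (M := n.+1%:R * Ms) md _ Lphi) => z.
    by rewrite early_derive normrM ger0_norm// ler_wpM2l.
  have Len p : sq p -> sq (fun z => early n z.1 * p z).
    move=> Lp; have me' : measurable_fun [set: spacetimeM R] (fun z : Z => early n z.1).
      exact: (measurableT_comp (me n) (@measurable_t R)).
    exact: (sqint_bounded me' (fun z => early_abs n z.1) Lp).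
  have i1 := sqint_mul Lmw Ldn; have i2 := sqint_mul Ldw (Len _ Lphi).
  have i3 := sqint_mul Lmw (Len _ Lpsi).
  have i12 := integrableD measurableT i1 i2.
  rewrite /l2ip -(RintegralD measurableT i1 i2) -(RintegralD measurableT i12 i3).
  apply: eq_Rintegral => z _.
  have -> : derive1 (fun t => early n t * m t) z.1 =
      early n z.1 * derive1 m z.1 + m z.1 * derive1 (early n) z.1.
    apply: is_derive1E.
    have := is_deriveM (smooth1_is_derive (smooth1_early n) z.1) (smooth1_is_derive sm z.1).
    by rewrite /GRing.scale/=.
  rewrite /phi /psi; ring.
have lim : (fun n => - (ip (fun z => m z.1 * w z) (fun z => derive1 (early n) z.1 * phi z) +
    ip (fun z => derive1 m z.1 * w z) (fun z => early n z.1 * phi z) +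
    ip (fun z => m z.1 * w z) (fun z => early n z.1 * psi z))) @ \oo -->
    - (0 + ip (fun z => derive1 m z.1 * w z) phi + ip (fun z => m z.1 * w z) psi).
  by apply: cvgN; apply: cvgD l2; exact: cvgD l0 l1.
have : - (0 + ip (fun z => derive1 m z.1 * w z) phi + ip (fun z => m z.1 * w z) psi) =
    ip (fun z => m z.1 * g z) phi.
  rewrite (funext E) in lim; exact: (cvg_unique (@Rhausdorff R) lim l3).
rewrite (ipDl Lmg Ldw Lphi) => <-; ring.
Qed.

End WeakToStrong.

(** * Extended coefficients and the translation of the hypotheses *)

Section Coefficients.
Context {R : realType}.
Notation Z := (spacetime R).
Notation mu := (spacetime_measure R).
Notation leb := (@lebesgue_measure R).
Notation ph := (phase_measure R).
Notation sq := (sqint mu).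

Lemma measurable_strip (T : R) : measurable (strip T : set (measurableTypeR R * measurableTypeR R)).
Proof. by apply: measurableX => //; exact: measurable_itv. Qed.

Lemma same_ball (x y q s : R) : q - s < x < q + s -> q - s < y < q + s -> `|x - y| <= 2 * s.
Proof. rewrite ler_norml; lra. Qed.

(** A superlevel set is the union of S intersected with those squares, of rational centre and size
    1/(n+1), on which a exceeds the level; there are countably many. *)
Lemma lipschitz_measurable (S : set (R * R)) (a : R * R -> R) (L : R) :
  measurable (S : set (measurableTypeR R * measurableTypeR R)) -> 0 < L ->
  (forall p p', S p -> S p' -> `|a p - a p'| <= L * Num.max `|p.1 - p'.1| `|p.2 - p'.2|) ->
  measurable_fun (S : set (measurableTypeR R * measurableTypeR R)) a.
Proof.
move=> mS L0 lip _; apply: (measurability _ (RGenOInfty.measurableE R)) => //.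
move=> /= _ [_ [y ->] <-]; rewrite preimage_itvoy.
pose B (q : rat * rat * nat) : set (measurableTypeR R * measurableTypeR R) :=
  `]ratr q.1.1 - q.2.+1%:R^-1, ratr q.1.1 + q.2.+1%:R^-1[%classic `*`
  `]ratr q.1.2 - q.2.+1%:R^-1, ratr q.1.2 + q.2.+1%:R^-1[%classic.
pose good q := forall p, S p -> B q p -> y < a p.
pose F q := if `[< good q >] then S `&` B q else set0.
rewrite (_ : _ `&` _ = \bigcup_q F q).
  apply: countable_bigcupT_measurable => // q; rewrite /F; case: ifP => // _.
  by apply: measurableI => //; apply: measurableX; exact: measurable_itv.
apply/seteqP; split => [p [Sp yp]|p [q _]]; last first.
  by rewrite /F; case: asboolP => // g [Sp Bp]; split=> //; exact: g.
have e0 : 0 < a p - y by rewrite subr_gt0.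
(* Two points of one square differ by at most 2/(n+1) in each coordinate, so a varies by less than
   its excess a p - y over the level. *)
pose n := Num.truncn (2 * L / (a p - y)).
have hn : L * (2 * n.+1%:R^-1) < a p - y.
  have : 2 * L / (a p - y) < n.+1%:R by exact: truncnS_gt.
  rewrite ltr_pdivrMr// => h; rewrite mulrA ltr_pdivrMr// mulrC mulrC [L * 2]mulrC.
  by rewrite [X in _ < X]mulrC.
have near (x : R) : exists q : rat, ratr q - n.+1%:R^-1 < x < ratr q + n.+1%:R^-1.
  have : x - n.+1%:R^-1 < x + n.+1%:R^-1 by rewrite ltrBlDr -addrA ltrDl addr_gt0// invr_gt0.
  move=> h; have [q] := rat_in_itvoo h; rewrite in_itv /= => /andP[h1 h2]; exists q.
  by rewrite ltrBlDr h2 -ltrBlDr h1.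
have [q1 h1] := near p.1; have [q2 h2] := near p.2.
exists (q1, q2, n) => //; rewrite /F; have Bp : B (q1, q2, n) p by split; rewrite /= in_itv.
have g : good (q1, q2, n).
  move=> p' Sp' [/= b1 b2]; move: b1 b2; rewrite !in_itv /= => b1 b2.
  have m0 : Num.max `|p.1 - p'.1| `|p.2 - p'.2| <= 2 * n.+1%:R^-1.
    by rewrite ge_max (same_ball h1 b1) (same_ball h2 b2).
  have := le_trans (lip _ _ Sp Sp') (ler_wpM2l (ltW L0) m0).
  rewrite ler_norml => /andP[_ h]; have := le_lt_trans h hn.
  by rewrite ltrD2l ltrN2.
by case: asboolP.
Qed.

Definition on_strip (T : R) (c : R * R -> R) (z : Z) : R := (c \_ (strip T)) (tJ z).

Lemma cylinderE (T : R) (z : Z) : (z \in cylinder T) = (0 < z.1 < T).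
Proof.
apply/idP/idP; first by rewrite inE => -[]; rewrite /= in_itv.
by move=> h; rewrite inE; split=> //=; rewrite in_itv.
Qed.

Lemma on_stripE T c z : on_strip T c z = if 0 < z.1 < T then c (tJ z) else 0.
Proof.
rewrite /on_strip patchE (_ : (_ \in _) = (0 < z.1 < T))//.
apply/idP/idP; first by rewrite inE => -[]; rewrite /= in_itv.
by move=> h; rewrite inE; split=> //=; rewrite in_itv.
Qed.

Lemma measurable_on_strip T c :
  measurable_fun (strip T : set (measurableTypeR R * measurableTypeR R)) c ->
  measurable_fun [set: spacetimeM R] (on_strip T c).
Proof.
move=> mc; have m1 := (measurable_restrictT c (measurable_strip T)).1 mc.
have m2 : measurable_fun [set: spacetimeM R] (fun z => tJ z : measurableTypeR R * measurableTypeR R).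
  by apply: measurable_fun_pair; [exact: measurable_t|exact: measurable_coordJ].
exact: (measurableT_comp m1 m2).
Qed.

Lemma on_strip_X T c i r z : on_strip T c (flowX i r z) = on_strip T c z.
Proof. by []. Qed.

Lemma on_strip_bounded T c : [bounded c p | p in strip T] ->
  exists K, forall z, `|on_strip T c z| <= K.
Proof.
move=> /pinfty_ex_gt0[M M0 h]; exists M => z; rewrite on_stripE; case: ifP => hz.
  by apply: h; split => //=; rewrite in_itv.
by rewrite normr0 ltW.
Qed.

Lemma cylinder_instrip T (f : Z -> R) : instrip T (f \_ (cylinder T)).
Proof. by move=> z h; rewrite patchE cylinderE; case: ifP. Qed.

Lemma square_integrable_sqint (Om : set Z) (f : Z -> R) : square_integrable Om f ->
  sq (f \_ Om).
Proof.
rewrite /square_integrable => Lf; split; last exact: Lfun2_integrable_sqr Lf.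
by move: Lf; rewrite inE => /andP[mf _]; move: mf; rewrite inE.
Qed.

Lemma abse_poweR2 (x : R) : (`|x%:E| `^ 2 = (x ^+ 2)%:E)%E.
Proof. by rewrite abse_EFin poweR_EFin powR_mulrn// real_normK// num_real. Qed.

(** Continuity of U at 0 in norm, together with U 0 = 0, makes ||U t|| small for small t, and almost
    every slice of u is U t. The norm bound is taken at sqrt e, as the conclusion is about the
    square. *)
Lemma initial_zero_trace (T : R) (u : Z -> R) : 0 < T -> square_integrable (cylinder T) u ->
  is_initial_trace T u (fun=> 0) -> zero_trace (u \_ (cylinder T)).
Proof.
move=> T0 Lu [U [LU cU aU U0]] e e0.
have z0 : `[0, T[%classic (0 : R) by rewrite /= in_itv /= lexx.
have Lw := square_integrable_sqint Lu.
have mU t : `[0, T[%classic t -> measurable_fun setT (U t).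
  by move=> /LU; rewrite inE => /andP[mf _]; move: mf; rewrite inE.
have se0 : 0 < Num.sqrt e by rewrite sqrtr_gt0.
have nb : nbhs 0%E [set x : \bar R | (x < (Num.sqrt e)%:E)%E].
  by apply: open_nbhs_nbhs; split; [exact: open_ereal_lt_ereal|rewrite /= lte_fin].
have := cU 0 z0 _ nb; rewrite /= /within /= => /nbhs_ballP[del /= d0 hd].
exists (Num.min del T); first by rewrite lt_min d0.
apply: (ae_imply aU) => t ht /andP[t0]; rewrite lt_min => /andP[td tT].
have tin : `]0, T[%classic t by rewrite /= in_itv /= t0.
have tin' : `[0, T[%classic t by rewrite /= in_itv /= (ltW t0).
have Nt : ('N[ph]_2%:E [EFin \o (U t \- U 0)%R] < (Num.sqrt e)%:E)%E.
  by apply: hd => //; rewrite /ball /= sub0r normrN gtr0_norm.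
have -> : (\int[ph]_y (((u \_ (cylinder T)) (t, y)) ^+ 2)%:E =
    \int[ph]_y (`|(EFin \o (U t \- U 0)%R) y| `^ 2))%E.
  apply: ge0_ae_eq_integral => //.
  - apply/measurable_EFinP; apply: measurable_funX; exact: (measurable_slice t (sqint_meas Lw)).
  - rewrite (_ : (fun y => _) = (fun y => ((U t y - U 0 y) ^+ 2)%:E)).
      apply/measurable_EFinP; apply: measurable_funX; apply: measurable_funB; exact: mU.
    by apply/funext => y; exact: abse_poweR2.
  - by move=> y _; rewrite lee_fin sqr_ge0.
  - by move=> y _; exact: poweR_ge0.
  - move: (ht tin) U0 => h1 h2; apply: (ae_imply2 h1 h2) => y e1 e2 _.
    apply/esym/(eq_trans (abse_poweR2 (U t y - U 0 y))).
    by rewrite (e1 I) (e2 I) subr0 patchE cylinderE /= t0 tT.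
rewrite -powR_Lnorm//.
have -> : e%:E = ((Num.sqrt e)%:E `^ 2)%E by rewrite poweR_EFin powR_mulrn ?sqrtr_ge0// sqr_sqrtr// ltW.
apply: gt0_ler_poweR => //; last exact: ltW.
- by rewrite in_itv /= Lnorm_ge0 leey.
- by rewrite in_itv /= lee_fin sqrtr_ge0 leey.
Qed.

End Coefficients.

(** * The extended data form a strong solution, which vanishes *)

Theorem corollary2p1 (R : realType) (T : R) (a c d : R * R -> R)
    (u dJu Yu : spacetime R -> R)
    (T_gt0 : 0 < T)
    (a_elliptic : uniformly_elliptic (strip T) a)
    (a_lipschitz : [lipschitz a p | p in strip T])
    (c_measurable : measurable_fun (strip T) c)
    (c_bounded : [bounded c p | p in strip T])
    (d_measurable : measurable_fun (strip T) d)
    (d_bounded : [bounded d p | p in strip T])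
    (u_L2 : square_integrable (cylinder T) u)
    (dJu_L2 : square_integrable (cylinder T) dJu)
    (dJuE : distr_eq (cylinder T)
       (distr_derive dir_J (distr_of (cylinder T) u))
       (distr_of (cylinder T) dJu))
    (Yu_L2 : square_integrable (cylinder T) Yu)
    (YuE : distr_eq (cylinder T)
       (transport (distr_of (cylinder T) u))
       (distr_of (cylinder T) Yu))
    (u_equation : distr_eq (cylinder T)
       (distr_add
          (transport (distr_of (cylinder T) u))
          (distr_derive dir_J
             (distr_of (cylinder T) (fun z => a (tJ z) * dJu z))))
       (distr_of (cylinder T)
          (fun z => c (tJ z) * u z + d (tJ z) * dJu z)))
    (u_initial : is_initial_trace T u (fun=> 0)) :
  u = (fun=> 0) %[ae spacetime_measure R in cylinder T].
Proof.
pose mu := spacetime_measure R.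
have [lam lam1 ell] := a_elliptic; have lam0 : 0 < lam by apply: lt_trans lam1.
have [L L0 lip] : exists2 L, 0 < L & forall p p', strip T p -> strip T p' ->
    `|a p - a p'| <= L * Num.max `|p.1 - p'.1| `|p.2 - p'.2|.
  have [L L0 h] := pinfty_ex_gt0 a_lipschitz; exists L => // p p' Sp Sp'.
  by have := h (p, p') (conj Sp Sp'); rewrite /= prod_normE.
have inS (z : spacetime R) : 0 < z.1 < T -> strip T (tJ z) by move=> h; split => //=; rewrite in_itv.
pose A := on_strip T a; pose C := on_strip T c; pose D := on_strip T d.
have Am : measurable_fun [set: spacetimeM R] A.
  by apply: measurable_on_strip; exact: (lipschitz_measurable (measurable_strip T) L0 lip).
have Cm : measurable_fun [set: spacetimeM R] C := measurable_on_strip c_measurable.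
have Dm : measurable_fun [set: spacetimeM R] D := measurable_on_strip d_measurable.
have [Kc CK] := on_strip_bounded c_bounded; have [Kd DK] := on_strip_bounded d_bounded.
have Al z : 0 < z.1 < T -> lam^-1 <= A z.
  by move=> h; rewrite /A on_stripE h; have /andP[] := ell _ (inS z h).
have lv0 : 0 < lam^-1 by rewrite invr_gt0.
have A0 z : 0 <= A z.
  have [h|/negP h] := pselect (0 < z.1 < T); first by rewrite (le_trans (ltW lv0))// Al.
  by rewrite /A on_stripE (negbTE h).
have AL z : A z <= lam.
  rewrite /A on_stripE; case: ifP => h; last exact: ltW.
  by have /andP[] := ell _ (inS z h).
have AM z : `|A z| <= lam by rewrite ger0_norm.
(* The flow of Y keeps J, so only the times differ, by s. If the earlier time lies outside the
   strip, the extended coefficient is 0 there. *)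
have ALip (s : R) z : 0 <= s -> 0 < z.1 < T -> A (flowY (- s) z) <= A z + L * s.
  move=> s0 hz; have Ls : 0 <= L * s by rewrite mulr_ge0// ltW.
  rewrite [A (flowY _ _)]on_stripE; case: ifP => h; last by rewrite addr_ge0.
  have := lip _ _ (inS _ h) (inS _ hz); rewrite /A on_stripE hz ler_norml => /andP[_].
  rewrite /= (_ : coordJ (flowY (- s) z) = coordJ z)// subrr normr0.
  rewrite (_ : z.1 - s - z.1 = - s); last by ring.
  rewrite normrN ger0_norm// max_l// => h2; rewrite -lerBlDl; exact: h2.
pose w := u \_ (cylinder T); pose p := dJu \_ (cylinder T); pose g := Yu \_ (cylinder T).
have Lw : sqint mu w := square_integrable_sqint u_L2.
have Lp : sqint mu p := square_integrable_sqint dJu_L2.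
have Lg : sqint mu g := square_integrable_sqint Yu_L2.
have w0 : instrip T w by exact: cylinder_instrip.
have p0 : instrip T p by exact: cylinder_instrip.
have g0 : instrip T g by exact: cylinder_instrip.
have tr : zero_trace w := initial_zero_trace T_gt0 u_L2 u_initial.
have LAp : sqint mu (fun z => A z * p z) := sqint_bounded Am AM Lp.
have LCw : sqint mu (fun z => C z * w z) := sqint_bounded Cm CK Lw.
have LDp : sqint mu (fun z => D z * p z) := sqint_bounded Dm DK Lp.
(* q is read off from the equation; the content is then that it is the J-derivative of A p, shown as
   [sJ2]. *)
pose q z := C z * w z + D z * p z - g z.
have LCD := sqintD LCw LDp.
have Lq : sqint mu q := sqintB LCD Lg.
have q0 : instrip T q by move=> z h; rewrite /q w0// p0// g0// !mulr0 addr0 subr0.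
have Ap0 : instrip T (fun z => A z * p z) by move=> z h; rewrite p0// mulr0.
have ApE : (fun z => a (tJ z) * dJu z) \_ (cylinder T) = (fun z => A z * p z).
  apply/funext => z; rewrite /A on_stripE /p !patchE cylinderE.
  by case: ifP; rewrite ?mulr0.
have CDE : (fun z => c (tJ z) * u z + d (tJ z) * dJu z) \_ (cylinder T) =
    (fun z => C z * w z + D z * p z).
  apply/funext => z; rewrite /C /D !on_stripE /p /w !patchE cylinderE.
  by case: ifP; rewrite ?mulr0 ?addr0.
have sJ : sderiv flowJ w p.
  apply: (sderivJ_weak Lw Lp w0 p0) => zeta f0 f1 f2 f3 f4 tz c0 c1 c2 c3 c4.
  have := dJuE _ (tensY_test 0 tz c0 c1 c2 c3 c4).
  rewrite (derive_J_tensY tz c0 c1 c2 c3 c4)// distr_of_ip => ->.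
  by congr (l2ip mu _ _); apply/funext => z; rewrite /tensY flowY0.
have HY zeta r f0 f1 f2 f3 f4 : timecut T zeta -> csmooth f0 -> csmooth f1 -> csmooth f2 ->
    csmooth f3 -> csmooth f4 -> transport (distr_of (cylinder T) u) (tensY zeta r f0 f1 f2 f3 f4) =
    l2ip mu g (tensY zeta r f0 f1 f2 f3 f4).
  move=> tz c0 c1 c2 c3 c4; rewrite -distr_of_ip.
  exact: (YuE _ (tensY_test r tz c0 c1 c2 c3 c4)).
(* Subtracting the weak identity for Yu from the equation isolates d_J(a d_J u). *)
have sJ2 : sderiv flowJ (fun z => A z * p z) q.
  apply: (sderivJ_weak LAp Lq Ap0 q0) => zeta f0 f1 f2 f3 f4 tz c0 c1 c2 c3 c4.
  have := u_equation _ (tensY_test 0 tz c0 c1 c2 c3 c4).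
  rewrite /distr_add (HY _ _ _ _ _ _ _ tz c0 c1 c2 c3 c4).
  rewrite (derive_J_tensY tz c0 c1 c2 c3 c4)// distr_of_ip ApE CDE => h.
  have E : (fun z => zeta z.1 * tens f0 f1 f2 f3 f4 z) = tensY zeta 0 f0 f1 f2 f3 f4.
    by apply/funext => z; rewrite /tensY flowY0.
  have Lt : sqint mu (tensY zeta 0 f0 f1 f2 f3 f4).
    by rewrite -E; exact: (sqint_zeta (timecut_csmooth tz) (sqint_tens c0 c1 c2 c3 c4)).
  by rewrite E /q (ipBl LCD Lg Lt) -h; ring.
have sY m : smooth1 m -> (exists2 T1, T1 < T & forall t, T1 <= t -> m t = 0) ->
    sderiv flowY (fun z => m z.1 * w z) (fun z => m z.1 * g z + derive1 m z.1 * w z).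
  move=> sm [T1 T1T hm]; apply: (sderivY_weak Lw Lg w0 g0 tr sm T1T hm).
  move=> zeta r f0 f1 f2 f3 f4 tz c0 c1 c2 c3 c4.
  by rewrite -(transport_tensY r tz c0 c1 c2 c3 c4 Lw); exact: HY.
have sol : solution T A C D w p g q.
  split; [exact: Lw|exact: Lp|exact: Lg|exact: Lq|exact: w0|exact: p0|exact: g0|exact: q0|
    exact: sJ|exact: sJ2|exact: sY|].
  rewrite (_ : (fun z => _) = (fun=> 0)); last by apply/funext => z; rewrite /q; ring.
  by rewrite /l2nrm ip0l sqrtr0.
have nw : l2nrm mu w = 0.
  exact: (solution_eq0 T_gt0 (ltW L0) lv0 Am A0 AL Al ALip (@on_strip_X R T a) Cm CK
    (@on_strip_X R T c) Dm DK (@on_strip_X R T d) sol).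
have := nrm0_ae Lw nw; rewrite /w => h.
apply: (ae_imply h) => z hz zc; have := hz I; rewrite patchE mem_set//.
Qed.
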